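(* Let $\theta>1$ and let $V$ be twice continuously differentiable on $[0,+\infty)$ with $\lim_{x\to+\infty}V(x)/\log x=+\infty$. Suppose that (i) $V''(x)x+V'(x)>0$ for all $x>0$, and (ii) $V''(x)\ge0$ for all $x>0$. Then the equilibrium measure $\mu_{V,\theta}$ is supported on a single interval $[0,b]$, where $$b=c\,\frac{(1+\theta)^{1+1/\theta}}{\theta}$$ and $c$ is the unique solution $c\in(0,+\infty)$ of $$\frac{1}{2\pi i}\oint_\gamma\frac{V'(J_c(s))J_c(s)}{s}\,ds=1+\theta.$$ Moreover $\mu_{V,\theta}$ has density $$\psi(x)=\frac{1}{2\pi^2x}\int_0^b\big(V''(y)y+V'(y)\big)\log\left|\frac{I_+(y)-I_-(x)}{I_+(y)-I_+(x)}\right|dy,\qquad x\in(0,b).$$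
   Context: The equilibrium measure $\mu_{V,\theta}$ is the unique probability measure on $[0,+\infty)$ minimizing $$I_{V,\theta}(\mu)=\frac12\iint\log\frac{1}{|x-y|}d\mu(x)d\mu(y)+\frac12\iint\log\frac{1}{|x^\theta-y^\theta|}d\mu(x)d\mu(y)+\int V\,d\mu$$ among all probability measures on $[0,+\infty)$. For $c>0$, $J_c(s)=c(s+1)\left(\frac{s+1}{s}\right)^{1/\theta}$, with the branch analytic in $\mathbb C\setminus[-1,0]$ and such that $J_c(s)\sim cs$ as $s\to\infty$. Its real critical points are $-1$ and $s_b=1/\theta$, with $J_c(-1)=0$ and $J_c(1/\theta)=b$. There are two complex conjugate arcs $\gamma_1$ (in the upper half-plane) and $\gamma_2$ (in the lower half-plane) joining $-1$ and $1/\theta$ on which $J_c$ is real; each is mapped bijectively onto $[0,b]$ by $J_c$ (the arcs do not depend on $c$). $\gamma=\gamma_1\cup\gamma_2$ is oriented counterclockwise. For $x\in[0,b]$, $I_+(x)\in\gamma_1$ and $I_-(x)\in\gamma_2$ denote the preimages of $x$ under $J_c$. *)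

(* Defs.v *)
From HB Require Import structures.
From mathcomp Require Import all_boot all_order all_algebra.
From mathcomp Require Import all_classical all_reals all_analysis.
From mathcomp Require Import complex.
Set Implicit Arguments.
Unset Strict Implicit.
Unset Printing Implicit Defensive.
Import Order.TTheory GRing.Theory Num.Theory.
Import numFieldNormedType.Exports.
Local Open Scope classical_set_scope.
Local Open Scope ring_scope.
Local Open Scope complex_scope.

Section Defs.
Variable R : realType.

Definition cmod (w : R[i]) : R := Num.sqrt (complex.Re w ^+ 2 + complex.Im w ^+ 2).

(* principal argument, in (-pi, pi] *)
Definition carg (w : R[i]) : R :=
  if (complex.Im w == 0) && (complex.Re w < 0) then pi
  else 2 * atan (complex.Im w / (cmod w + complex.Re w)).

Definition cpow (w : R[i]) (a : R) : R[i] :=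
  if w == 0 then 0
  else Complex (cmod w `^ a * cos (a * carg w)) (cmod w `^ a * sin (a * carg w)).

(* J_c(s) = c (s+1) ((s+1)/s)^(1/theta), principal branch of the power:
   analytic in C \ [-1,0] and ~ c s at infinity *)
Definition Jc (theta c : R) (s : R[i]) : R[i] :=
  c%:C * (s + 1) * cpow ((s + 1) / s) theta^-1.

(* b = J_c(1/theta) = c (1+theta)^(1+1/theta) / theta *)
Definition bc (theta c : R) : R := c * (1 + theta) `^ (1 + theta^-1) / theta.

(* I_+(x) : the preimage of x in [0,b] on the upper arc gamma_1
   (the arc of points of the upper half plane where J_c is real),
   I_-(x) : the preimage on the lower arc gamma_2. *)
Definition Iplus (theta c : R) (x : R) : R[i] :=
  if x == 0 then -1
  else if x == bc theta c then (theta^-1)%:C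
  else xget 0 [set s : R[i] | 0 < complex.Im s /\ Jc theta c s = x%:C].

Definition Iminus (theta c : R) (x : R) : R[i] :=
  if x == 0 then -1
  else if x == bc theta c then (theta^-1)%:C
  else xget 0 [set s : R[i] | complex.Im s < 0 /\ Jc theta c s = x%:C].

Definition cderiv (f : R -> R[i]) (x : R) : R[i] :=
  Complex (derive1 (fun t => complex.Re (f t)) x) (derive1 (fun t => complex.Im (f t)) x).

Definition cintegral (f : R -> R[i]) (a b : R) : R[i] :=
  Complex (Rintegral lebesgue_measure `[a, b] (fun t => complex.Re (f t)))
          (Rintegral lebesgue_measure `[a, b] (fun t => complex.Im (f t))).

(* contour integral over gamma = gamma_1 U gamma_2, counterclockwise,
   using the parametrisations x |-> I_-(x) (lower arc, from -1 to 1/theta)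
   and x |-> I_+(x) (upper arc, traversed backwards from 1/theta to -1). *)
Definition contour_gamma (theta c : R) (F : R[i] -> R[i]) : R[i] :=
  cintegral (fun x => F (Iminus theta c x) * cderiv (Iminus theta c) x) 0 (bc theta c)
  - cintegral (fun x => F (Iplus theta c x) * cderiv (Iplus theta c) x) 0 (bc theta c).

(* (1 / 2 pi i) \oint_gamma V'(J_c(s)) J_c(s) / s ds ;
   on gamma, J_c(s) is real, and V' is evaluated at it *)
Definition Econtour (theta : R) (V1 : R -> R) (c : R) : R[i] :=
  (2%:R * pi%:C * 'i)^-1 *
  contour_gamma theta c (fun s => (V1 (complex.Re (Jc theta c s)))%:C * Jc theta c s / s).

(* symmetric integrand: I(mu) = iint k(x,y) dmu(x) dmu(y), using
   int V dmu = iint (V x + V y)/2 dmu dmu for a probability mu *)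
Definition energy_kernel (theta : R) (V : R -> R) (x y : R) : \bar R :=
  if x == y then +oo%E
  else ((ln (`|x - y|^-1) / 2 + ln (`|x `^ theta - y `^ theta|^-1) / 2
         + V x / 2 + V y / 2)%:E).

Definition halfline : set R := `[0, +oo[.

Definition energy (theta : R) (V : R -> R) (mu : probability R R) : \bar R :=
  (\int[mu]_(x in halfline) \int[mu]_(y in halfline) energy_kernel theta V x y)%E.

Definition on_halfline (mu : probability R R) : Prop :=
  mu halfline = 1%E.

Definition is_equilibrium_measure (theta : R) (V : R -> R) (mu : probability R R) : Prop :=
  on_halfline mu /\
  forall nu : probability R R, on_halfline nu -> (energy theta V mu <= energy theta V nu)%E.

Definition measure_support (mu : probability R R) : set R :=
  [set x | forall e : R, 0 < e -> (0 < mu (ball x e))%E].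

Definition psi (theta c : R) (V1 V2 : R -> R) (x : R) : R :=
  (2%:R * pi ^+ 2 * x)^-1 *
  Rintegral lebesgue_measure `[0, bc theta c]
    (fun y => (V2 y * y + V1 y) *
       ln (cmod ((Iplus theta c y - Iminus theta c x) /
                 (Iplus theta c y - Iplus theta c x)))).

End Defs.

(* Main.v *)
(** The arc [gamma_1] is parametrised by the angle [f] in [(0, pi/(1+theta))] as
    [s = sin f / sin(theta f) e^(i(1+theta)f)], on which [J_c(s) = c X(f)] with [X]
    decreasing from [b/c] to [0]. A contour deformation gives
    [int (ln|X(f) - x| + ln|X(f)^theta - x^theta|) df = 0] for [0 < x < X(0)], so the
    law of [k X] for uniform [f] has constant logarithmic potential on its support.
    Let [w = (x V')'] and let [nu] be the mixture of these laws over [0 < k < c] with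
    weight [wt(k) = int X w(k X) df]. Its mass is the contour integral divided by
    [1 + theta], which increases strictly with [c] from [0] to infinity; this
    determines [c]. Changing variables twice turns the density of [nu] into the
    integral of [w] against [int D(x/k) D(y/k) dk/k], with [D] the logarithmic
    derivative of the angle, and this is the logarithm of
    [|(I_+(y) - I_-(x))/(I_+(y) - I_+(x))|] up to a constant. The identity
    [V(x) - V(0) = int_0^x w(y) ln(x/y) dy] yields the Euler-Lagrange conditions
    for [nu]. Finally the logarithmic energy is positive definite with an explicit
    [L^2] remainder in the distribution functions, so a minimiser equals [nu]. *)
Require Import Defs.
From HB Require Import structures.
From mathcomp Require Import all_boot all_order all_algebra.
From mathcomp Require Import all_classical all_reals all_analysis.
From mathcomp Require Import complex.
From mathcomp Require Import ring lra measurable_realfun.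
Import Order.TTheory GRing.Theory Num.Theory.
Import numFieldNormedType.Exports.
Local Open Scope classical_set_scope.
Local Open Scope ring_scope.
Local Open Scope complex_scope.
Set Implicit Arguments.
Unset Strict Implicit.
Unset Printing Implicit Defensive.

(** * Densities and changes of variables *)

(** Cauchy's theorem is replaced by Fubini's theorem for a bounded real function on the region swept
    by the points [k Q(f)], with the real point [x] first moved to [x + i e]; the limit [e -> 0] is
    taken afterwards. This is done for every [th > 0], because exchanging [th] with [1 / th]
    exchanges [ln |X - x|] with [ln |X^th - x^th|], and the two integrals are opposite. A mixture of
    scales solves the problem for the following reason. At a point beyond the support of [X] the
    potential falls short of its constant value by an amount [Pf >= 0], and the average of [Pf] over
    a dilated copy [u X] is a multiple of [ln u]. Now [V - V 0] is itself a superposition of the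
    functions [ln (x / y)], [y < x], with density [w], so the weight of the mixture can be read off,
    and positivity of [w] makes it a measure. The kernels change sign and the energies may be
    infinite. Kernels are therefore made nonnegative, identities are written with sums only, and
    finite terms are cancelled at the end. *)

Section transfer.
Import HBNNSimple.

(** [m2] is the image under [F] of the measure with density [f] against [m1]. The one statement
    serves densities ([F] the identity), changes of variables ([m2] a restriction of Lebesgue
    measure) and the passage between the two copies of Lebesgue measure. *)
Lemma ge0_integral_transfer (R : realType) d1 d2 (T1 : measurableType d1) (T2 : measurableType d2)
    (m1 : {measure set T1 -> \bar R}) (m2 : {measure set T2 -> \bar R})
    (F : T1 -> T2) (f : T1 -> R) :
  (forall x, 0 <= f x) -> measurable_fun setT f -> measurable_fun setT F ->
  (forall A, measurable A -> m2 A = (\int[m1]_(x in F @^-1` A) (f x)%:E)%E) ->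
  forall h : T2 -> \bar R, (forall x, (0 <= h x)%E) -> measurable_fun setT h ->
  (\int[m2]_x h x = \int[m1]_x (h (F x) * (f x)%:E))%E.
Proof.
move=> f0 mf mF m2E h h0 mh.
pose h_ := nnsfun_approx measurableT mh.
have nd x n m : (n <= m)%N -> h_ n x <= h_ m x.
  by move=> nm; exact/lefP/(nd_nnsfun_approx measurableT mh).
have mfE : measurable_fun setT (EFin \o f) by exact/measurable_EFinP.
have mh_ n : measurable_fun setT (EFin \o h_ n) by exact/measurable_EFinP.
have mhF_ n : measurable_fun setT (EFin \o h_ n \o F) by exact: measurableT_comp.
have -> : (\int[m2]_x h x =
    lim (\int[m2]_x (EFin \o h_ n) x @[n --> \oo]))%E.
  have fE x : h x = lim ((EFin \o h_ n) x @[n --> \oo]).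
    by apply/esym/cvg_lim => //; exact: cvg_nnsfun_approx.
  under eq_integral do rewrite fE.
  apply: monotone_convergence => //.
  - by move=> n x _ //=; rewrite lee_fin.
  - by move=> x _ a b ab; rewrite lee_fin; exact: nd.
have -> : (\int[m1]_x (h (F x) * (f x)%:E) =
    lim (\int[m1]_x ((EFin \o h_ n \o F) \* (EFin \o f)) x @[n --> \oo]))%E.
  have fg x : (h (F x) * (f x)%:E)%E = lim (((EFin \o h_ n \o F) \* (EFin \o f))%E x @[n --> \oo]).
    by apply/esym/cvg_lim => //; apply: cvgeZr => //; exact: cvg_nnsfun_approx.
  under eq_integral do rewrite fg.
  apply: monotone_convergence => [//| | |].
  - by move=> n; exact: emeasurable_funM.
  - by move=> n x _ /=; rewrite mule_ge0 ?lee_fin.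
  - by move=> x _ a b ab/=; rewrite lee_wpmul2r ?lee_fin//; exact: nd.
suff suf n : (\int[m1]_x ((EFin \o h_ n \o F) \* (EFin \o f)) x = \int[m2]_x (EFin \o h_ n) x)%E.
  by under [in RHS]eq_fun do rewrite suf.
transitivity (\int[m2]_x
   (\sum_(y \in range (h_ n)) (y * \1_(h_ n @^-1` [set y]) x)%:E))%E; last first.
  by apply: eq_integral => t tE; rewrite /= fimfunE -fsumEFin.
have indich r : measurable_fun setT (fun x => (r * \1_(h_ n @^-1` [set r]) x)%:E).
  by apply: (measurable_comp measurableT) => //; exact: measurable_funM.
have indichF r : measurable_fun setT (fun x => (r * \1_(h_ n @^-1` [set r]) (F x))%:E).
  by have /= := @measurableT_comp _ _ _ _ _ _ _ setT F (indich r) mF.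
rewrite ge0_integral_fsum//; last by move=> m y Ey; exact: nnfun_muleindic_ge0.
transitivity (\int[m1]_x (\sum_(y \in range (h_ n))
    (y * \1_(h_ n @^-1` [set y]) (F x))%:E * (f x)%:E))%E.
  under [RHS]eq_integral => x xE.
    rewrite -(@ge0_mule_fsuml _ _ _ (fun y => (y * \1_(h_ n @^-1` [set y]) (F x))%:E)) => [|y]; last exact: nnfun_muleindic_ge0.
    rewrite fsumEFin // -(fimfunE (h_ n)).
    over.
  by [].
rewrite ge0_integral_fsum//; last 2 first.
- by move=> y; apply: (@emeasurable_funM _ _ _ _ (fun x => (y * \1_(h_ n @^-1` [set y]) (F x))%:E) (EFin \o f)).
- by move=> y x _; apply: mule_ge0; [exact: nnfun_muleindic_ge0|rewrite lee_fin].
apply: eq_fsbigr => r rfh.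
under eq_integral do rewrite EFinM -muleA.
under [RHS]eq_integral do rewrite EFinM.
have r0 : 0 <= r by move: rfh; rewrite inE => -[x _ <-].
have mI : measurable_fun setT (fun x => (\1_(h_ n @^-1` [set r]) (F x))%:E : \bar R).
  have mi : measurable_fun setT (fun x => (\1_(h_ n @^-1` [set r]) x)%:E : \bar R).
    by apply/measurable_EFinP; exact: measurable_indic.
  by have /= := @measurableT_comp _ _ _ _ _ _ _ setT F mi mF.
rewrite !ge0_integralZl_EFin//; last 3 first.
- by apply/measurable_EFinP; exact: measurable_indic.
- by move=> x _; rewrite mule_ge0 ?lee_fin.
- exact: (@emeasurable_funM _ _ _ _ _ (EFin \o f)).
congr (_ * _)%E.
rewrite integral_indic// setIT m2E// [RHS]integral_mkcond.
apply: eq_integral => x _; rewrite patchE indicE.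
have -> : (x \in F @^-1` (h_ n @^-1` [set r])) = (F x \in h_ n @^-1` [set r]).
  by apply/idP/idP; rewrite !inE.
by case: ifPn => _; rewrite ?mul1e ?mul0e.
Qed.

End transfer.

Section lebesgue_on_R.
Context {R : realType}.

(* [lebesgue_measure] lives on an alias of [R] with another display; this copy
   lives on [R] itself, where the probability measures of interest live. *)
Definition lebR (A : set R) : \bar R := lebesgue_measure A.

Let lebR0 : lebR set0 = 0%E. Proof. exact: measure0. Qed.
Let lebR_ge0 A : (0 <= lebR A)%E. Proof. exact: measure_ge0. Qed.
Let lebR_sigma_additive : semi_sigma_additive lebR.
Proof. exact: (@measure_semi_sigma_additive _ _ _ (@lebesgue_measure R)). Qed.

HB.instance Definition _ := isMeasure.Build _ R R lebR lebR0 lebR_ge0 lebR_sigma_additive.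

Let lebR_sigma_finite : sigma_finite setT lebR.
Proof. exact: (@sigma_finiteT _ _ _ (@lebesgue_measure R)). Qed.

HB.instance Definition _ := Measure_isSigmaFinite.Build _ R R lebR lebR_sigma_finite.

Lemma ge0_integral_lebRT (h : R -> \bar R) : (forall x, (0 <= h x)%E) ->
  measurable_fun setT h ->
  (\int[lebesgue_measure]_x h x = \int[lebR]_x h x)%E.
Proof.
move=> h0 mh.
rewrite (@ge0_integral_transfer R _ _ R (measurableTypeR R) lebR lebesgue_measure id (cst 1))//.
- by apply: eq_integral => x _; rewrite mule1.
- move=> A mA; transitivity (\int[lebR]_(x in A) (cst 1%E) x)%E; last by [].
  by rewrite integral_cst// mul1e.
Qed.

Lemma integral_lebR (D : set R) (h : R -> \bar R) : measurable D ->
  measurable_fun D h ->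
  (\int[lebesgue_measure]_(x in D) h x = \int[lebR]_(x in D) h x)%E.
Proof.
move=> mD mh.
have mh' : measurable_fun setT (h \_ D) by apply/(measurable_restrictT h).
rewrite [LHS]integral_mkcond [RHS]integral_mkcond [LHS]integralE [RHS]integralE.
by rewrite !ge0_integral_lebRT//; [exact: measurable_funeneg|exact: measurable_funepos].
Qed.

Lemma integrable_lebR (D : set R) (h : R -> \bar R) : measurable D ->
  lebesgue_measure.-integrable D h -> lebR.-integrable D h.
Proof.
move=> mD /integrableP[mh fh]; apply/integrableP; split=> //.
by rewrite -integral_lebR//; exact: measurableT_comp.
Qed.

End lebesgue_on_R.

Section general_measure.
Context {R : realType}.
Local Notation mu := (@lebesgue_measure R).
Implicit Types (f g F : R -> R) (a b c x y : R).

Lemma measurable_funV : measurable_fun [set: R] (@GRing.inv R).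
Proof.
have -> : @GRing.inv R = fun x => if x == 0 then 0 else x^-1.
  by apply/funext => x; case: eqP => // ->; rewrite invr0.
apply: measurable_fun_if => //.
- exact: measurable_fun_eqr.
- rewrite setTI (_ : _ @^-1` _ = [set x : R | x != 0]); last first.
    by apply/seteqP; split=> x /=; case: eqP.
  apply: open_continuous_measurable_fun.
    exact: open_neq.
  by move=> x; rewrite inE/= => x0; exact: inv_continuous.
Qed.

Lemma measurable_preimage F (A : set R) :
  measurable_fun setT F -> measurable A -> measurable (F @^-1` A).
Proof. by move=> mF mA; rewrite -[X in measurable X]setTI; exact: mF. Qed.

Lemma measurable_patch_oo f a b :
  (forall x, a < x < b -> {for x, continuous f}) ->
  measurable_fun setT (f \_ `]a, b[).
Proof.
move=> cf; apply/(measurable_restrictT f) => //.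
apply: open_continuous_measurable_fun; first exact: itv_open.
by move=> x; rewrite inE/= in_itv/= => /cf.
Qed.

Lemma measurable_fun_oo f a b :
  (forall x, a < x < b -> {for x, continuous f}) ->
  measurable_fun `]a, b[ f.
Proof.
move=> cf; apply: open_continuous_measurable_fun; first exact: itv_open.
by move=> x; rewrite inE/= in_itv/= => /cf.
Qed.

Lemma cvg_harmonic_scale a : (a * n.+3%:R^-1) @[n --> \oo] --> (0 : R).
Proof.
rewrite -[X in _ --> X](mulr0 a); apply: cvgM; first exact: cvg_cst.
have : (@harmonic R) n @[n --> \oo] --> 0 by exact: cvg_harmonic.
rewrite -(cvg_shiftn 2 (@harmonic R)) /=.
by apply: cvg_trans; apply: near_eq_cvg; near=> n; rewrite /harmonic /= addn2.
Unshelve. all: by end_near. Qed.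

(** Only one-sided limits of [F] are required at the ends, so that [f] may blow up there, as
    [ln (c / k)] does at 0. The interval is exhausted by closed ones and monotone convergence
    applies. *)
Lemma ge0_FTC_oo f F a b (la lb : R) : a < b ->
  (forall x, a < x < b -> 0 <= f x) ->
  (forall x, a < x < b -> {for x, continuous f}) ->
  (forall x, a < x < b -> is_derive x 1 F (f x)) ->
  F x @[x --> a^'+] --> la -> F x @[x --> b^'-] --> lb ->
  (\int[mu]_(x in `]a, b[) (f x)%:E = (lb - la)%:E)%E.
Proof.
move=> ab f0 cf dF Fa Fb.
(* The offset 3 gives [3 * d n <= b - a], so that even the interval [A 0] is nondegenerate. *)
pose d n : R := (b - a) * n.+3%:R^-1.
have ba0 : 0 < b - a by rewrite subr_gt0.
have d0 n : 0 < d n by rewrite /d mulr_gt0// invr_gt0.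
have d3 n : d n * 3 <= b - a.
  rewrite /d -[leRHS]mulr1 -mulrA ler_pM2l// mulrC ler_pdivrMr ?ltr0n//.
  by rewrite mul1r ler_nat.
have dle n m : (n <= m)%N -> d m <= d n.
  move=> nm; rewrite /d ler_pM2l// lef_pV2 ?posrE ?ltr0n// ler_nat.
  by rewrite !ltnS.
have dcvg : d n @[n --> \oo] --> (0 : R) by exact: cvg_harmonic_scale.
pose A n : set R := `[a + d n, b - d n]%classic.
have inA n x : A n x -> a < x < b.
  rewrite /A/= in_itv/= => /andP[h1 h2]; have := d0 n; lra.
have UA : \bigcup_n A n = `]a, b[%classic.
  apply/seteqP; split => x /=.
    by move=> [n _ /inA]; rewrite in_itv.
  rewrite in_itv/= => /andP[ax xb].
  have : \forall n \near \oo, d n < Num.min (x - a) (b - x).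
    apply: (cvgr_lt 0 dcvg); rewrite lt_min; apply/andP; split; lra.
  move=> [N _ /(_ N (leqnn N))]/=; rewrite lt_min => /andP[h1 h2].
  by exists N => //; rewrite /A/= in_itv/=; apply/andP; split; lra.
have mfoo : measurable_fun `]a, b[ (EFin \o f).
  by apply/measurable_EFinP; exact: measurable_fun_oo.
have H : (\int[mu]_(x in A n) (f x)%:E)%E @[n --> \oo] -->
    (\int[mu]_(x in `]a, b[) (f x)%:E)%E.
  rewrite -UA; apply: ge0_nondecreasing_set_cvg_integral.
  - move=> n m nm; apply/subsetPset => x; rewrite /A/= !in_itv/= => /andP[h1 h2].
    by have := dle _ _ nm => h; apply/andP; split; lra.
  - by move=> n; exact: measurable_itv.
  - move=> n; apply: (measurable_funS _ _ mfoo); first exact: measurable_itv.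
    by move=> x /inA; rewrite /= in_itv.
  - by move=> n x /inA h; rewrite lee_fin f0.
have H2 n : (\int[mu]_(x in A n) (f x)%:E)%E = (F (b - d n) - F (a + d n))%:E.
  rewrite EFinB; apply: continuous_FTC2.
  - have := d3 n; have := d0 n; lra.
  - apply: continuous_in_subspaceT => x; rewrite inE => /inA; exact: cf.
  - have cF x : a < x < b -> {for x, continuous F}.
      by move=> xab; apply: differentiable_continuous; apply/derivable1_diffP; have [] := dF _ xab.
    split.
    + move=> x; rewrite in_itv/= => /andP[h1 h2].
      have xab : a < x < b by have := d0 n; lra.
      by have [] := dF _ xab.
    + apply: cvg_at_right_filter; apply: cF; have := d3 n; have := d0 n; lra.
    + apply: cvg_at_left_filter; apply: cF; have := d3 n; have := d0 n; lra.
  - move=> x; rewrite in_itv/= => /andP[h1 h2].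
    have xab : a < x < b by have := d0 n; lra.
    by rewrite derive1E; have [_ ->] := dF _ xab.
have H3 : (F (b - d n) - F (a + d n)) @[n --> \oo] --> lb - la.
  apply: cvgB.
  - move/cvg_at_leftP : Fb => /(_ (fun n => b - d n)); apply; split.
      by move=> n; have := d0 n; lra.
    by rewrite -[X in _ --> X]subr0; apply: cvgB => //; exact: cvg_cst.
  - move/cvg_at_rightP : Fa => /(_ (fun n => a + d n)); apply; split.
      by move=> n; have := d0 n; lra.
    by rewrite -[X in _ --> X]addr0; apply: cvgD => //; exact: cvg_cst.
have H4 : (\int[mu]_(x in A n) (f x)%:E)%E @[n --> \oo] --> (lb - la)%:E.
  under eq_fun do rewrite H2.
  by apply: cvg_EFin H3; exact: nearW.
exact: (cvg_unique _ H H4).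
Qed.

Lemma integral_cst_oo a b (M : R) : a <= b ->
  (\int[mu]_(x in `]a, b[) M%:E = (M * (b - a))%:E)%E.
Proof.
move=> ab; rewrite integral_cst//= lebesgue_measure_itv/= lte_fin.
move: ab; rewrite le_eqVlt => /orP[/eqP ->|ab]; last by rewrite ab -EFinB -EFinM.
by rewrite ltxx mule0 subrr mulr0.
Qed.

Lemma bounded_integrable_oo f a b (M : R) : measurable_fun `]a, b[ f ->
  (forall x, a < x < b -> `|f x| <= M) ->
  mu.-integrable `]a, b[ (EFin \o f).
Proof.
move=> mf fM; apply: measurable_bounded_integrable => //.
  have := @lebesgue_measure_itv R `]a, b[ => /= ->; case: ifP => _ //.
  by rewrite -EFinB ltry.
exists M; split; first exact: num_real.
by move=> m Mm x /=; rewrite in_itv/= => /fM h; apply: (le_trans h); exact: ltW.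
Qed.

Lemma bounded_FTC_oo f F a b (la lb M : R) : a < b ->
  (forall x, a < x < b -> `|f x| <= M) ->
  (forall x, a < x < b -> {for x, continuous f}) ->
  (forall x, a < x < b -> is_derive x 1 F (f x)) ->
  F x @[x --> a^'+] --> la -> F x @[x --> b^'-] --> lb ->
  (\int[mu]_(x in `]a, b[) (f x)%:E = (lb - la)%:E)%E.
Proof.
move=> ab fM cf dF Fa Fb.
have idx : (fun x : R => x) x @[x --> a^'+] --> a by apply: cvg_at_right_filter; exact: cvg_id.
have idb : (fun x : R => x) x @[x --> b^'-] --> b by apply: cvg_at_left_filter; exact: cvg_id.
have mf := measurable_fun_oo cf.
(* Adding the bound [M] reduces to a nonnegative integrand with primitive [F x + M * x]. *)
have E : (\int[mu]_(x in `]a, b[) (f x + M)%:E = ((lb + M * b) - (la + M * a))%:E)%E.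
  apply: (@ge0_FTC_oo _ (fun x => F x + M * x)) => //.
  - by move=> x /fM; rewrite ler_norml => /andP[]; lra.
  - by move=> x /cf cfx; apply: cvgD => //; exact: cvg_cst.
  - move=> x /dF dFx; apply: is_deriveD.
    by apply: is_derive_eq; rewrite -?[LHS]/(M *: 1) ?scaler1//= /GRing.scale/= mulr1.
  - by apply: cvgD => //; apply: cvgM => //; exact: cvg_cst.
  - by apply: cvgD => //; apply: cvgM => //; exact: cvg_cst.
have iF := bounded_integrable_oo mf fM.
have iM : mu.-integrable `]a, b[ (cst M%:E).
  apply: (@bounded_integrable_oo (cst M) a b `|M|) => //.
move: E; under eq_integral do rewrite EFinD.
rewrite (integralD _ iF iM)//= integral_cst_oo ?ltW// => E.
have -> : (\int[mu]_(x in `]a, b[) (f x)%:E)%E = (((lb + M * b) - (la + M * a))%:E - (M * (b - a))%:E)%E.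
  by rewrite -E addeK.
by rewrite -EFinB; congr EFin; ring.
Qed.

Section mdens_pullback.
Variables (f F : R -> R).

Definition mdensF (A : set (measurableTypeR R)) : \bar R := (\int[mu]_(x in F @^-1` A) (f x)%:E)%E.

Hypothesis f0 : forall x, 0 <= f x.
Hypothesis mf : measurable_fun setT f.
Hypothesis mF : measurable_fun setT F.

Let mdensF0 : mdensF set0 = 0%E.
Proof. by rewrite /mdensF preimage_set0 integral_set0. Qed.

Let mdensF_ge0 A : (0 <= mdensF A)%E.
Proof. by apply: integral_ge0 => x _; rewrite lee_fin. Qed.

Let mdensF_sigma_additive : semi_sigma_additive mdensF.
Proof.
move=> /= A mA tA mUA.
rewrite /mdensF/= preimage_bigcup ge0_integral_bigcup//=; last 4 first.
- by move=> k; exact: (@measurable_preimage F (A k) mF (mA k)).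
- by apply: measurable_funTS; exact/measurable_EFinP.
- by move=> x _; rewrite lee_fin.
- apply/trivIsetP => /= i j _ _ ij; rewrite -preimage_setI.
  by move/trivIsetP : tA => /(_ _ _ _ _ ij) ->//; rewrite preimage_set0.
apply: is_cvg_ereal_nneg_natsum_cond => n _ _.
by apply: integral_ge0 => /= x ?; rewrite lee_fin.
Qed.

Definition mdensF_measure : {measure set (measurableTypeR R) -> \bar R} :=
  HB.pack mdensF (isMeasure.Build _ (measurableTypeR R) R mdensF mdensF0 mdensF_ge0 mdensF_sigma_additive).

Lemma mdensF_measureE A : mdensF_measure A = (\int[mu]_(x in F @^-1` A) (f x)%:E)%E.
Proof. by []. Qed.

End mdens_pullback.

Section mdens.
Variable f : R -> R.

(** The density is taken here against [lebR], so that the result lives on [R] itself and can be a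
    [probability R R]. *)
Definition mdens (A : set R) : \bar R := (\int[lebR]_(x in A) (f x)%:E)%E.

Hypothesis f0 : forall x, 0 <= f x.
Hypothesis mf : measurable_fun setT f.

Let mdens0 : mdens set0 = 0%E.
Proof. by rewrite /mdens integral_set0. Qed.

Let mdens_ge0 A : (0 <= mdens A)%E.
Proof. by apply: integral_ge0 => x _; rewrite lee_fin. Qed.

Let mdens_sigma_additive : semi_sigma_additive mdens.
Proof.
move=> /= A mA tA mUA.
rewrite /mdens/= ge0_integral_bigcup//=; last 2 first.
- by apply: measurable_funTS; exact/measurable_EFinP.
- by move=> x _; rewrite lee_fin.
apply: is_cvg_ereal_nneg_natsum_cond => n _ _.
by apply: integral_ge0 => /= x ?; rewrite lee_fin.
Qed.

Definition mdens_measure : {measure set R -> \bar R} :=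
  HB.pack mdens (isMeasure.Build _ R R mdens mdens0 mdens_ge0 mdens_sigma_additive).

Hypothesis f1 : mdens setT = 1%E.

Definition mdens_prob : probability R R :=
  HB.pack (Measure.sort mdens_measure) (Measure_isProbability.Build _ R R mdens_measure f1).

Lemma mdens_probE A : mdens_prob A = (\int[lebR]_(x in A) (f x)%:E)%E.
Proof. by []. Qed.

Lemma ge0_integral_mdens (h : R -> \bar R) :
  (forall x, (0 <= h x)%E) -> measurable_fun setT h ->
  (\int[mdens_prob]_x h x = \int[lebR]_x (h x * (f x)%:E))%E.
Proof.
move=> h0 mh.
exact: (@ge0_integral_transfer _ _ _ R R lebR mdens_prob id f).
Qed.

End mdens.

(* A monotone [F] from ]a, b[ onto ]p, q[ with [|F'| = f]; monotonicity only
   enters through the last hypothesis. *)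
Lemma lebesgue_measure_change_of_variables (f F : R -> R) a b p q :
  measurable_fun `]a, b[ f -> measurable_fun setT F ->
  (forall x, a < x < b -> 0 <= f x) ->
  (forall x, a < x < b -> p < F x < q) ->
  (forall x y, a < x < b -> a < y < b -> F x = F y -> x = y) ->
  (forall u v, p <= u -> u < v -> v <= q ->
    (\int[mu]_(x in `]a, b[ `&` F @^-1` `]u, v[) (f x)%:E = (v - u)%:E)%E) ->
  forall A : set R, measurable A ->
  mu (A `&` `]p, q[) = (\int[mu]_(x in `]a, b[ `&` F @^-1` A) (f x)%:E)%E.
Proof.
move=> mf mF f0 Fpq Finj Fint.
pose ft := f \_ `]a, b[.
have mft : measurable_fun setT ft by apply/(measurable_restrictT f).
have ft0 x : 0 <= ft x.
  by rewrite /ft patchE; case: ifPn => //; rewrite inE/= in_itv/= => /f0.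
pose m1 := mdensF_measure ft0 mft mF.
pose D : set R := `]p, q[%classic.
have mD : measurable D by exact: measurable_itv.
have mDC : measurable (~` D) by exact: measurableC.
(* Lebesgue measure outside []p, q[] completes [m1] to a measure on the whole line; the sum agrees
   with Lebesgue measure on half-open intervals, hence everywhere. *)
pose m2 := mrestr mu mDC.
have m1E A : measurable A -> m1 A = (\int[mu]_(x in `]a, b[ `&` F @^-1` A) (f x)%:E)%E.
  move=> mA; rewrite /m1 mdensF_measureE setIC [RHS]integral_mkcondr.
  by apply: eq_integral => x _; rewrite /ft !patchE; case: ifPn.
have m1D A : measurable A -> m1 A = m1 (A `&` D).
  move=> mA; rewrite !m1E//; last exact: measurableI.
  congr (integral _ _ _); apply/seteqP; split=> x [] /= xab Fx; last by split=> //; case: Fx.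
  by split=> //; split=> //; move: xab; rewrite /D/= !in_itv/=; exact: Fpq.
have mfS A : measurable A -> measurable_fun (`]a, b[ `&` F @^-1` A) (EFin \o f).
  move=> mA; apply/measurable_EFinP; apply: (measurable_funS _ _ mf) => //.
have itvD u v (X : set R) : X = `]u, v]%classic -> u < v -> mu (X `&` D) = m1 (X `&` D).
  move=> XE uv.
  have mX : measurable X by rewrite XE.
  have mXD : measurable (X `&` D) by exact: measurableI.
  pose u' := Num.max u p; pose v' := Num.min v q.
  have XDE x : (X `&` D) x <-> u' < x /\ x <= v /\ x < q.
    rewrite XE /D/= !in_itv/= /u' gt_max; split; last by move=> [/andP[-> ->] [-> ->]].
    by move=> [/andP[-> ->] /andP[-> ->]].
  have [uv'|vu'] := ltP u' v'; last first.
    have -> : X `&` D = set0.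
      apply/seteqP; split=> x // /XDE[h1 [h2 h3]].
      have h4 : x <= v' by rewrite /v' le_min h2 ltW.
      by move: (lt_le_trans h1 (le_trans h4 vu')); rewrite ltxx.
    by rewrite !measure0.
  have u'p : p <= u' by rewrite /u' le_max lexx orbT.
  have v'q : v' <= q by rewrite /v' ge_min lexx orbT.
  have -> : mu (X `&` D) = (v' - u')%:E.
    have [vq|qv] := ltP v q.
    - have -> : X `&` D = `]u', v]%classic.
        apply/seteqP; split=> x.
          by move=> /XDE[h1 [h2 h3]]; rewrite /= in_itv/= h1 h2.
        by rewrite /= in_itv/= => /andP[h1 h2]; apply/XDE; rewrite h1 h2 (le_lt_trans h2).
      have v'v : v' = v by rewrite /v' min_l// ltW.
      by rewrite lebesgue_measure_itv/= lte_fin -v'v uv' EFinB.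
    - have -> : X `&` D = `]u', q[%classic.
        apply/seteqP; split=> x.
          by move=> /XDE[h1 [h2 h3]]; rewrite /= in_itv/= h1 h3.
        by rewrite /= in_itv/= => /andP[h1 h2]; apply/XDE; rewrite h1 h2 (le_trans (ltW h2)).
      have v'v : v' = q by rewrite /v' min_r.
      by rewrite lebesgue_measure_itv/= lte_fin -v'v uv' EFinB.
  rewrite m1E// -(Fint u' v')//.
  (* The hypothesis concerns open intervals, whereas uniqueness is tested on half-open ones. By
     injectivity at most one point is mapped to the endpoint [v'], and it is negligible. *)
  have [[x0 x0ab Fx0]|nox] := pselect (exists2 x0, a < x0 < b & F x0 = v').
  - rewrite -(@integral_setD1 _ (EFin \o f) x0 (`]a, b[ `&` F @^-1` (X `&` D))); last 2 first.
    + apply: measurableD => //; apply: measurableI => //.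
      by exact: measurable_preimage.
    + by apply: (measurable_funS _ _ (mfS _ mXD)) => //; apply: measurableI => //; exact: measurable_preimage.
    congr (integral _ _ _); apply/seteqP; split=> x /=; rewrite !in_itv/=.
    + move=> [xab /andP[h1 h2]]; split.
        split=> //; apply/XDE; split=> //; move: h2; rewrite /v' lt_min => /andP[h2 h3].
        by rewrite (ltW h2).
      by move=> xx0; move: h2; rewrite xx0 Fx0 ltxx.
    + move=> [[xab /XDE[h1 [h2 h3]]] xx0]; split=> //; rewrite h1/= /v' lt_neqAle le_min h2 (ltW h3)/= andbT.
      apply/eqP => Fxv; apply: xx0; apply: Finj => //; by rewrite Fxv Fx0.
  - congr (integral _ _ _); apply/seteqP; split=> x /=; rewrite !in_itv/=.
    + move=> [xab /andP[h1 h2]]; split=> //; apply/XDE; split=> //.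
      by move: h2; rewrite /v' lt_min => /andP[h2 h3]; rewrite (ltW h2).
    + move=> [xab /XDE[h1 [h2 h3]]]; split=> //; rewrite h1/= lt_neqAle /v' le_min h2 (ltW h3)/= andbT.
      by apply/eqP => Fxv; apply: nox; exists x.
have key : forall X, ocitv X -> mu X = measure_add m1 m2 X.
  move=> X /ocitvP[->|[[u v]/= uv XE]]; first by rewrite !measure0.
  have mX : measurable X by rewrite XE; exact: measurable_itv.
  rewrite measure_addE m1D// -(itvD u v)//.
  by rewrite [LHS](measureDI mu mX mD) addeC /m2 /mrestr setDE.
move=> A mA.
rewrite -m1E// m1D//.
rewrite (@lebesgue_measure_unique R (measure_add m1 m2) key (A `&` D)); last exact: measurableI.
transitivity (m1 (A `&` D) + m2 (A `&` D))%E; first exact: measure_addE.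
rewrite /m2 /mrestr (_ : A `&` D `&` ~` D = set0) ?measure0 ?adde0//.
by rewrite -setIA setICr setI0.
Qed.

Lemma ge0_change_of_variables (f F : R -> R) a b p q (h : R -> \bar R) :
  measurable_fun `]a, b[ f -> measurable_fun setT F ->
  (forall x, a < x < b -> 0 <= f x) ->
  (forall x, a < x < b -> p < F x < q) ->
  (forall x y, a < x < b -> a < y < b -> F x = F y -> x = y) ->
  (forall u v, p <= u -> u < v -> v <= q ->
    (\int[mu]_(x in `]a, b[ `&` F @^-1` `]u, v[) (f x)%:E = (v - u)%:E)%E) ->
  measurable_fun `]p, q[ h -> (forall x, p < x < q -> (0 <= h x)%E) ->
  (\int[mu]_(x in `]p, q[) h x = \int[mu]_(x in `]a, b[) (h (F x) * (f x)%:E))%E.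
Proof.
move=> mf mF f0 Fpq Finj Fint mh h0.
pose ft := f \_ `]a, b[.
have mft : measurable_fun setT ft by apply/(measurable_restrictT f).
have ft0 x : 0 <= ft x.
  by rewrite /ft patchE; case: ifPn => //; rewrite inE/= in_itv/= => /f0.
pose ht := h \_ `]p, q[.
have mht : measurable_fun setT ht by apply/(measurable_restrictT h).
have ht0 x : (0 <= ht x)%E.
  by rewrite /ht patchE; case: ifPn => //; rewrite inE/= in_itv/= => /h0.
have mD : measurable (`]p, q[%classic : set (measurableTypeR R)) by exact: measurable_itv.
have := @ge0_integral_transfer _ _ _ (measurableTypeR R) (measurableTypeR R) mu (mrestr mu mD) F ft ft0 mft mF.
have H A : measurable A -> mrestr mu mD A = (\int[mu]_(x in F @^-1` A) (ft x)%:E)%E.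
  move=> mA; rewrite /mrestr (lebesgue_measure_change_of_variables mf mF f0 Fpq Finj Fint mA).
  rewrite setIC integral_mkcondr.
  by apply: eq_integral => x _; rewrite /ft !patchE; case: ifPn.
move=> /(_ H ht ht0 mht) E.
transitivity (\int[mrestr mu mD]_x ht x)%E.
  have i0 x : 0 <= (\1_(`]p, q[%classic) x : R) by rewrite indicE.
  have mi : measurable_fun setT (\1_(`]p, q[%classic) : _ -> R) by exact: measurable_indic.
  rewrite (@ge0_integral_transfer _ _ _ (measurableTypeR R) (measurableTypeR R) mu (mrestr mu mD) id _ i0 mi)//.
    rewrite [LHS]integral_mkcond; apply: eq_integral => x _.
    by rewrite /ht !patchE indicE; case: ifPn => _; rewrite ?mule1 ?mule0.
  by move=> A mA; rewrite /mrestr integral_indic// setIC.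
rewrite E [RHS]integral_mkcond; apply: eq_integral => x _.
rewrite /ft !patchE; case: ifPn => [|_]; last by rewrite mule0.
by rewrite inE/= in_itv/= => xab; rewrite /ht patchE ifT// inE/= in_itv/= Fpq.
Qed.

(** [G] is the inverse of the decreasing map [F], extended to the endpoints of the range. The two
    order equivalences turn the preimage of []u, v[] into []G v, G u[], where the fundamental
    theorem for [- F] gives the length [v - u]. *)
Lemma ge0_change_of_variables_decr (f F G : R -> R) a b p q (h : R -> \bar R) :
  measurable_fun setT F ->
  (forall x, a < x < b -> 0 <= f x) ->
  (forall x, a < x < b -> {for x, continuous f}) ->
  (forall x, a < x < b -> is_derive x 1 F (- f x)) ->
  (forall x, a < x < b -> p < F x < q) ->
  (forall y, p <= y <= q -> a <= G y <= b) ->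
  (forall x y, a < x < b -> p <= y <= q -> (F x < y) = (G y < x)) ->
  (forall x y, a < x < b -> p <= y <= q -> (y < F x) = (x < G y)) ->
  (forall u v, p <= u -> u < v -> v <= q -> G v < G u) ->
  (forall y, p <= y < q -> F x @[x --> (G y)^'-] --> y) ->
  (forall y, p < y <= q -> F x @[x --> (G y)^'+] --> y) ->
  measurable_fun `]p, q[ h -> (forall x, p < x < q -> (0 <= h x)%E) ->
  (\int[mu]_(x in `]p, q[) h x = \int[mu]_(x in `]a, b[) (h (F x) * (f x)%:E))%E.
Proof.
move=> mF f0 cf dF Fpq Gab FG1 FG2 Gdecr FGl FGr mh h0.
apply: ge0_change_of_variables => //.
- exact: measurable_fun_oo.
- move=> x y xab yab Fxy.
  have [xy|yx|//] := ltgtP x y; exfalso.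
  + have hy := Fpq _ yab.
    have Gy : G (F y) = y.
      have hyy : p <= F y <= q by move: hy => /andP[/ltW -> /ltW ->].
      have := FG1 y (F y) yab hyy; have := FG2 y (F y) yab hyy.
      by rewrite ltxx => /esym h1 /esym h2; apply/eqP; rewrite eq_le !leNgt h1 h2.
    have hyy : p <= F y <= q by move: hy => /andP[/ltW -> /ltW ->].
    by have := FG2 x (F y) xab hyy; rewrite Fxy ltxx Gy xy.
  + have hy := Fpq _ yab.
    have hyy : p <= F y <= q by move: hy => /andP[/ltW -> /ltW ->].
    have Gy : G (F y) = y.
      have := FG1 y (F y) yab hyy; have := FG2 y (F y) yab hyy.
      by rewrite ltxx => /esym h1 /esym h2; apply/eqP; rewrite eq_le !leNgt h1 h2.
    by have := FG1 x (F y) xab hyy; rewrite Fxy ltxx Gy yx.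
- move=> u v pu uv vq.
  have hu : p <= u <= q by rewrite pu (le_trans (ltW uv)).
  have hv : p <= v <= q by rewrite vq andbT (le_trans pu (ltW uv)).
  have := Gab _ hu; have := Gab _ hv => /andP[aGv Gvb] /andP[aGu Gub].
  have -> : `]a, b[ `&` F @^-1` `]u, v[ = `]G v, G u[%classic.
    apply/seteqP; split => x /=; rewrite !in_itv/=.
      by move=> [xab]; rewrite (FG1 _ _ xab hv) (FG2 _ _ xab hu) => /andP[-> ->].
    move=> /andP[h1 h2]; have xab : a < x < b by lra.
    by split => //; rewrite (FG1 _ _ xab hv) (FG2 _ _ xab hu) h1 h2.
  have GG : G v < G u by exact: Gdecr.
  have -> : (v - u = - u - - v)%R by ring.
  apply: (@ge0_FTC_oo f (fun x => - F x)) => //.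
  - by move=> x /andP[h1 h2]; apply: f0; lra.
  - by move=> x /andP[h1 h2]; apply: cf; lra.
  - move=> x /andP[h1 h2]; have xab : a < x < b by lra.
    by have := dF _ xab => ?; rewrite -[f x]opprK; exact: is_deriveN.
  - by apply: cvgN; apply: FGr; lra.
  - by apply: cvgN; apply: FGl; lra.
Qed.

Lemma ge0_change_of_variables_scale (k c : R) (h : R -> \bar R) : 0 < k -> 0 < c ->
  measurable_fun `]0, k * c[ h -> (forall x, 0 < x < k * c -> (0 <= h x)%E) ->
  (\int[mu]_(x in `]0%R, (k * c)%R[) h x = \int[mu]_(x in `]0%R, c[) (h (k * x)%R * k%:E))%E.
Proof.
move=> k0 c0 mh h0.
apply: (@ge0_change_of_variables (cst k) (fun x => k * x)) => //.
- exact: mulrl_measurable.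
- by move=> x _; exact: ltW.
- by move=> x /andP[x0 xc]; rewrite mulr_gt0//= ltr_pM2l.
- by move=> x y _ _ /(mulfI (lt0r_neq0 k0)).
- move=> u v u0 uv vk.
  have -> : `]0, c[ `&` (fun x => k * x) @^-1` `]u, v[ = `](u / k), (v / k)[%classic.
    apply/seteqP; split=> x /=; rewrite !in_itv/= ltr_pdivrMr// ltr_pdivlMr// ![x * k]mulrC.
      by move=> [].
    move=> /andP[h1 h2]; rewrite h1 h2; split=> //; apply/andP; split.
      by rewrite -(pmulr_rgt0 _ k0) (le_lt_trans u0).
    by rewrite -(ltr_pM2l k0) (lt_le_trans h2).
  rewrite integral_cst_oo; last by rewrite ler_pM2r ?invr_gt0// ltW.
  by congr EFin; field; exact: lt0r_neq0.
Qed.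

Lemma ge0_FTC_lebR f F a b (la lb : R) : a < b ->
  (forall x, a < x < b -> 0 <= f x) ->
  (forall x, a < x < b -> {for x, continuous f}) ->
  (forall x, a < x < b -> is_derive x 1 F (f x)) ->
  F x @[x --> a^'+] --> la -> F x @[x --> b^'-] --> lb ->
  (\int[lebR]_(x in `]a, b[) (f x)%:E = (lb - la)%:E)%E.
Proof.
move=> ab f0 cf dF Fa Fb; rewrite -(ge0_FTC_oo ab f0 cf dF Fa Fb) integral_lebR//.
by apply/measurable_EFinP; exact: measurable_fun_oo.
Qed.

Lemma bounded_FTC_lebR f F a b (la lb M : R) : a < b ->
  (forall x, a < x < b -> `|f x| <= M) ->
  (forall x, a < x < b -> {for x, continuous f}) ->
  (forall x, a < x < b -> is_derive x 1 F (f x)) ->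
  F x @[x --> a^'+] --> la -> F x @[x --> b^'-] --> lb ->
  (\int[lebR]_(x in `]a, b[) (f x)%:E = (lb - la)%:E)%E.
Proof.
move=> ab f0 cf dF Fa Fb; rewrite -(bounded_FTC_oo ab f0 cf dF Fa Fb) integral_lebR//.
by apply/measurable_EFinP; exact: measurable_fun_oo.
Qed.

Lemma lebR_oo a b : a <= b -> lebR `]a, b[ = (b - a)%:E.
Proof.
move=> ab; rewrite /lebR lebesgue_measure_itv/= lte_fin.
move: ab; rewrite le_eqVlt => /orP[/eqP ->|ab]; last by rewrite ab -EFinB.
by rewrite ltxx subrr.
Qed.

Lemma bounded_integrable_lebR f a b (M : R) : measurable_fun `]a, b[ f ->
  (forall x, a < x < b -> `|f x| <= M) ->
  lebR.-integrable `]a, b[ (EFin \o f).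
Proof.
by move=> mf fM; apply: integrable_lebR => //; exact: bounded_integrable_oo fM.
Qed.

End general_measure.

(** * Derivatives and complex powers along paths *)

Section calculus.
Context {R : realType}.
Implicit Types (f g : R -> R) (x y k a df dg : R).

Lemma mem_oo a b t : (t \in `]a, b[%classic) = (a < t < b).
Proof. by apply/idP/idP; rewrite inE/= in_itv. Qed.

(** The rules of this section are stated for pointwise expressions with the value of the derivative
    exposed, so that derivatives of composite formulas are assembled by plain application. *)
Lemma derive_const k x : is_derive x 1 (fun _ : R => k) 0.
Proof. exact: is_derive_cst. Qed.

Lemma derive_var x : is_derive x 1 (fun t : R => t) 1.
Proof. exact: is_derive_id. Qed.

Lemma derive_add f g x df dg : is_derive x 1 f df -> is_derive x 1 g dg ->
  is_derive x 1 (fun t => f t + g t) (df + dg).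
Proof. by move=> h1 h2; exact: is_deriveD. Qed.

Lemma derive_sub f g x df dg : is_derive x 1 f df -> is_derive x 1 g dg ->
  is_derive x 1 (fun t => f t - g t) (df - dg).
Proof. by move=> h1 h2; exact: is_deriveB. Qed.

Lemma derive_opp f x df : is_derive x 1 f df -> is_derive x 1 (fun t => - f t) (- df).
Proof. by move=> h1; exact: is_deriveN. Qed.

Lemma derive_mul f g x df dg : is_derive x 1 f df -> is_derive x 1 g dg ->
  is_derive x 1 (fun t => f t * g t) (df * g x + f x * dg).
Proof.
move=> h1 h2; apply: (is_derive_eq (is_deriveM h1 h2)).
by rewrite /GRing.scale/= addrC mulrC.
Qed.

Lemma derive_inv f x df : is_derive x 1 f df -> f x != 0 ->
  is_derive x 1 (fun t => (f t)^-1) (- df / f x ^+ 2).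
Proof.
move=> h1 fx0; apply: (is_derive_eq (is_deriveV fx0 h1)).
by rewrite /GRing.scale/=; field.
Qed.

Lemma derive_div f g x df dg : is_derive x 1 f df -> is_derive x 1 g dg -> g x != 0 ->
  is_derive x 1 (fun t => f t / g t) ((df * g x - f x * dg) / g x ^+ 2).
Proof.
move=> h1 h2 gx0; apply: (is_derive_eq (derive_mul h1 (derive_inv h2 gx0))).
by field.
Qed.

Lemma derive_comp f g x df dg : is_derive (g x) 1 f df -> is_derive x 1 g dg ->
  is_derive x 1 (fun t => f (g t)) (df * dg).
Proof. by move=> h1 h2; exact: (is_derive1_comp h1 h2). Qed.

Lemma derive_scale k x : is_derive x 1 (fun t : R => k * t) k.
Proof.
apply: (is_derive_eq (derive_mul (derive_const k x) (derive_var x))).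
by rewrite mul0r add0r mulr1.
Qed.

Lemma derive_sin_scale k x : is_derive x 1 (fun t => sin (k * t)) (k * cos (k * x)).
Proof.
apply: (is_derive_eq (derive_comp (is_derive_sin (k * x)) (derive_scale k x))).
by rewrite mulrC.
Qed.

Lemma derive_cos_scale k x : is_derive x 1 (fun t => cos (k * t)) (- k * sin (k * x)).
Proof.
apply: (is_derive_eq (derive_comp (is_derive_cos (k * x)) (derive_scale k x))).
by ring.
Qed.

Lemma derive_ln f x df : is_derive x 1 f df -> 0 < f x ->
  is_derive x 1 (fun t => ln (f t)) (df / f x).
Proof.
move=> h fx0; apply: (is_derive_eq (derive_comp (is_derive1_ln fx0) h)).
by rewrite mulrC.
Qed.

Lemma derive_powR f a x df : is_derive x 1 f df -> 0 < f x ->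
  is_derive x 1 (fun t => f t `^ a) (a * f x `^ a * (df / f x)).
Proof.
move=> h fx0; apply: (is_derive_eq (derive_comp (is_derive1_powR a fx0) h)).
have -> : f x `^ (a - 1) = f x `^ a / f x.
  by rewrite powRD ?(gt_eqF fx0) ?implybT// powRN powRr1// ltW.
by ring.
Qed.

Lemma derive_atan f x df : is_derive x 1 f df ->
  is_derive x 1 (fun t => atan (f t)) (df / (1 + f x ^+ 2)).
Proof.
move=> h; apply: (is_derive_eq (derive_comp (is_derive1_atan (f x)) h)).
by rewrite mulrC.
Qed.

Lemma derive_sqrt f x df : is_derive x 1 f df -> 0 < f x ->
  is_derive x 1 (fun t => Num.sqrt (f t)) (df / (2 * Num.sqrt (f x))).
Proof.
move=> h fx0; apply: (is_derive_eq (derive_comp (is_derive1_sqrt fx0) h)).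
by rewrite mulrC.
Qed.

Lemma derive_cos f x df : is_derive x 1 f df ->
  is_derive x 1 (fun t => cos (f t)) (- sin (f x) * df).
Proof. by move=> h; exact: derive_comp (is_derive_cos (f x)) h. Qed.

Lemma derive_sin f x df : is_derive x 1 f df ->
  is_derive x 1 (fun t => sin (f t)) (cos (f x) * df).
Proof. by move=> h; exact: derive_comp (is_derive_sin (f x)) h. Qed.

Lemma derive_near f g x df : (\forall t \near x, f t = g t) ->
  is_derive x 1 f df -> is_derive x 1 g df.
Proof. by move=> fg h; exact: near_eq_is_derive h. Qed.

Lemma derive_continuous f x df : is_derive x 1 f df -> {for x, continuous f}.
Proof.
by move=> [d _]; apply: differentiable_continuous; exact/derivable1_diffP.
Qed.

End calculus.

Section complex_modulus_argument.
Context {R : realType}.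
Implicit Types (w z : R[i]) (r a : R).
Local Notation Re := complex.Re.
Local Notation Im := complex.Im.

Lemma ReC r : Re r%:C = r. Proof. by []. Qed.
Lemma ImC r : Im r%:C = 0. Proof. by []. Qed.
Lemma ReD w z : Re (w + z) = Re w + Re z. Proof. by case: w; case: z. Qed.
Lemma ImD w z : Im (w + z) = Im w + Im z. Proof. by case: w; case: z. Qed.
Lemma ReN w : Re (- w) = - Re w. Proof. by case: w. Qed.
Lemma ImN w : Im (- w) = - Im w. Proof. by case: w. Qed.
Lemma ReM w z : Re (w * z) = Re w * Re z - Im w * Im z. Proof. by case: w; case: z. Qed.
Lemma ImM w z : Im (w * z) = Re w * Im z + Im w * Re z. Proof. by case: w; case: z. Qed.
Lemma ReV w : Re w^-1 = Re w / (Re w ^+ 2 + Im w ^+ 2). Proof. by case: w. Qed.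
Lemma ImV w : Im w^-1 = - Im w / (Re w ^+ 2 + Im w ^+ 2). Proof. by case: w => x y /=; rewrite mulNr. Qed.
Lemma Re_div w z : Re (w / z) = (Re w * Re z + Im w * Im z) / (Re z ^+ 2 + Im z ^+ 2).
Proof. by rewrite ReM ReV ImV; ring. Qed.
Lemma Im_div w z : Im (w / z) = (Im w * Re z - Re w * Im z) / (Re z ^+ 2 + Im z ^+ 2).
Proof. by rewrite ImM ReV ImV; ring. Qed.
Lemma complex_eq w z : Re w = Re z -> Im w = Im z -> w = z.
Proof. by case: w => a b; case: z => c d /= -> ->. Qed.

Lemma sqr_eq0_complex w : (Re w ^+ 2 + Im w ^+ 2 == 0) = (w == 0).
Proof.
case: w => a b /=; rewrite eq_complex/= paddr_eq0 ?sqr_ge0//.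
by rewrite !sqrf_eq0.
Qed.

Lemma cmod_ge0 w : 0 <= cmod w. Proof. exact: sqrtr_ge0. Qed.

Lemma sqr_cmod w : cmod w ^+ 2 = Re w ^+ 2 + Im w ^+ 2.
Proof. by rewrite /cmod sqr_sqrtr// addr_ge0 ?sqr_ge0. Qed.

Lemma cmod_eq0 w : (cmod w == 0) = (w == 0).
Proof. by rewrite -sqrf_eq0 sqr_cmod sqr_eq0_complex. Qed.

Lemma cmod_gt0 w : (0 < cmod w) = (w != 0).
Proof. by rewrite lt_def cmod_ge0 andbT cmod_eq0. Qed.

Lemma cmodM w z : cmod (w * z) = cmod w * cmod z.
Proof.
rewrite /cmod -sqrtrM ?addr_ge0 ?sqr_ge0// ReM ImM; congr Num.sqrt; ring.
Qed.

Lemma cmodV w : cmod w^-1 = (cmod w)^-1.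
Proof.
have [->|w0] := eqVneq w 0.
  by rewrite invr0 /cmod/= expr0n addr0 sqrtr0 invr0.
apply: (mulfI (_ : cmod w != 0)); first by rewrite cmod_eq0.
by rewrite -cmodM !mulfV ?cmod_eq0// /cmod/= expr1n expr0n addr0 sqrtr1.
Qed.

(** The plane cut along the nonpositive reals, expressed through the denominator of the half-angle
    formula in [carg]. *)
Definition slit w := 0 < cmod w + Re w.

Lemma slitP w : slit w <-> ~~ ((Im w == 0) && (Re w <= 0)).
Proof.
have h : cmod w ^+ 2 = Re w ^+ 2 + Im w ^+ 2 := sqr_cmod w.
have c0 := cmod_ge0 w.
split.
  rewrite /slit => s; apply/negP => /andP[/eqP i0 r0].
  have : cmod w = - Re w.
    by rewrite /cmod i0 expr0n addr0 sqrtr_sqr ler0_norm.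
  by move: s => /[swap] ->; rewrite addNr ltxx.
rewrite negb_and -ltNge /slit => /orP[i0|r0]; last by rewrite ltr_wpDl.
have : 0 < Im w ^+ 2 by rewrite exprn_even_gt0.
move=> i2; rewrite -ltrBlDr sub0r.
have [r0|r0] := ltP (- Re w) 0; first exact: lt_le_trans c0.
by rewrite -(@ltr_pXn2r _ 2)// ?nnegrE// h sqrrN ltrDl.
Qed.

Lemma slit_neq0 w : slit w -> w != 0.
Proof. by move=> /slitP; apply: contraNN => /eqP ->; rewrite /= eqxx lexx. Qed.

Lemma slit_Re_gt0 w : 0 < Re w -> slit w.
Proof. by move=> r0; rewrite /slit ltr_wpDl ?cmod_ge0. Qed.

Lemma slit_Im_neq0 w : Im w != 0 -> slit w.
Proof. by move=> i0; apply/slitP; rewrite negb_and i0. Qed.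

Lemma carg_slit w : slit w -> carg w = 2 * atan (Im w / (cmod w + Re w)).
Proof.
move=> /slitP; rewrite /carg; case: ifP => // /andP[-> r0].
by rewrite (ltW r0).
Qed.

Lemma cos_atan2 (t : R) : cos (atan t) ^+ 2 = (1 + t ^+ 2)^-1.
Proof.
have c0 : 0 < cos (atan t) by apply: cos_gt0_pihalf; rewrite atan_gtNpi2 atan_ltpi2.
have := @cos2_tan2 R (atan t) (lt0r_neq0 c0); rewrite atanK => <-.
by rewrite invrK.
Qed.

Lemma sin_cos_atan (t : R) : sin (atan t) * cos (atan t) = t * (1 + t ^+ 2)^-1.
Proof.
have c0 : 0 < cos (atan t) by apply: cos_gt0_pihalf; rewrite atan_gtNpi2 atan_ltpi2.
rewrite -cos_atan2 -{3}(atanK t) /tan expr2 mulrA divfK// lt0r_neq0//.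
Qed.

Lemma cos_carg_slit w : slit w -> cmod w * cos (carg w) = Re w.
Proof.
move=> sw; have w0 := slit_neq0 sw; have m0 : 0 < cmod w by rewrite cmod_gt0.
have h := sqr_cmod w; move: (sw); rewrite /slit => s.
rewrite carg_slit// mulr_natl cos_mulr2n cos_atan2.
set m := cmod w in h m0 s *.
have e : 1 + (Im w / (m + Re w)) ^+ 2 = 2 * m / (m + Re w).
  rewrite expr_div_n (_ : Im w ^+ 2 = m ^+ 2 - Re w ^+ 2); last by rewrite h; ring.
  by field; exact: lt0r_neq0.
by rewrite e; field; rewrite !lt0r_neq0.
Qed.

Lemma sin_carg_slit w : slit w -> cmod w * sin (carg w) = Im w.
Proof.
move=> sw; have w0 := slit_neq0 sw; have m0 : 0 < cmod w by rewrite cmod_gt0.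
have h := sqr_cmod w; move: (sw); rewrite /slit => s.
rewrite carg_slit// mulr_natl sin_mulr2n.
set m := cmod w in h m0 s *.
set t := Im w / (m + Re w).
have e : 1 + t ^+ 2 = 2 * m / (m + Re w).
  rewrite /t expr_div_n (_ : Im w ^+ 2 = m ^+ 2 - Re w ^+ 2); last by rewrite h; ring.
  by field; exact: lt0r_neq0.
rewrite [cos _ * sin _]mulrC sin_cos_atan e /t -mulr_natr.
by field; rewrite !lt0r_neq0.
Qed.

Lemma carg_slit_bound w : slit w -> - pi < carg w < pi.
Proof.
move=> sw; rewrite carg_slit//; set t := (X in atan X).
by have := atan_gtNpi2 t; have := atan_ltpi2 t; lra.
Qed.

Lemma carg_Im_gt0 w : 0 < Im w -> 0 < carg w < pi.
Proof.
move=> i0; have sw := slit_Im_neq0 (lt0r_neq0 i0).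
have /andP[_ ->] := carg_slit_bound sw; rewrite andbT carg_slit// mulr_gt0//.
by rewrite -(@atan0 R); apply: lt_atan; rewrite divr_gt0.
Qed.

Definition polar r a : R[i] := Complex (r * cos a) (r * sin a).

Lemma polarE w : slit w -> w = polar (cmod w) (carg w).
Proof. by move=> sw; apply: complex_eq => /=; rewrite ?cos_carg_slit ?sin_carg_slit. Qed.

Lemma cmod_polar r a : 0 <= r -> cmod (polar r a) = r.
Proof.
move=> r0; rewrite /cmod/= !exprMn -mulrDr cos2Dsin2 mulr1 sqrtr_sqr ger0_norm//.
Qed.

Lemma slit_polar r a : 0 < r -> - pi < a < pi -> slit (polar r a).
Proof.
move=> r0 /andP[a1 a2].
rewrite /slit cmod_polar ?ltW//= -{1}[r]mulr1 -mulrDr mulr_gt0//.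
have -> : a = 2 * (a / 2) by field.
rewrite mulr_natl cos_mulr2n addrC subrK.
rewrite pmulrn_lgt0// exprn_gt0// cos_gt0_pihalf//; lra.
Qed.

Lemma carg_polar r a : 0 < r -> - pi < a < pi -> carg (polar r a) = a.
Proof.
move=> r0 a12; have sp := slit_polar r0 a12; have /andP[a1 a2] := a12.
rewrite carg_slit// cmod_polar ?ltW//=.
have c0 : 0 < cos (a / 2) by apply: cos_gt0_pihalf; lra.
have -> : r * sin a / (r + r * cos a) = tan (a / 2).
  have -> : a = 2 * (a / 2) by field.
  rewrite (_ : 2 * (a / 2) / 2 = a / 2); last by field.
  rewrite mulr_natl cos_mulr2n sin_mulr2n /tan.
  have c0' := lt0r_neq0 c0; have r0' := lt0r_neq0 r0.
  rewrite -[_ *+ 2]mulr_natr -[(_ ^+ 2) *+ 2]mulr_natr.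
  have -> : r + r * (cos (a / 2) ^+ 2 * 2 - 1) = 2 * r * cos (a / 2) ^+ 2 by ring.
  by field; rewrite c0' r0'.
by rewrite tanK; [field|rewrite in_itv/=; lra].
Qed.

Lemma polarM r1 a1 r2 a2 : polar r1 a1 * polar r2 a2 = polar (r1 * r2) (a1 + a2).
Proof. by apply: complex_eq; rewrite ?ReM ?ImM/= ?cosD ?sinD; ring. Qed.

Lemma polarV r a : polar r a != 0 -> (polar r a)^-1 = polar r^-1 (- a).
Proof.
move=> p0; have r0 : r != 0.
  by apply: contraNneq p0 => ->; apply/eqP; apply: complex_eq; rewrite /= mul0r.
apply: (mulfI p0); rewrite mulfV// polarM mulfV// subrr.
by apply: complex_eq; rewrite /= ?cos0 ?sin0 ?mulr1 ?mulr0.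
Qed.

Lemma polar_neq0 r a : 0 < r -> polar r a != 0.
Proof. by move=> r0; rewrite -cmod_gt0 cmod_polar// ltW. Qed.

Lemma cpow_polar r a (p : R) : 0 < r -> - pi < a < pi ->
  cpow (polar r a) p = polar (r `^ p) (p * a).
Proof.
move=> r0 a12; rewrite /cpow (negbTE (polar_neq0 a r0)).
by rewrite carg_polar// cmod_polar ?ltW.
Qed.

Lemma cpowE w (p : R) : w != 0 -> cpow w p = polar (cmod w `^ p) (p * carg w).
Proof. by move=> w0; rewrite /cpow (negbTE w0). Qed.

End complex_modulus_argument.

Section complex_calculus.
Context {R : realType}.
Local Notation Re := complex.Re.
Local Notation Im := complex.Im.
Implicit Types (f g w : R -> R[i]) (d : R[i]) (t p : R).

(** Derivative of a path in the plane, coordinate by coordinate. The complex analysis below is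
    reduced to such real derivatives along paths. *)
Definition cder f t d :=
  is_derive t 1 (fun u => Re (f u)) (Re d) /\ is_derive t 1 (fun u => Im (f u)) (Im d).

Lemma cder_eq f t d d' : cder f t d -> d = d' -> cder f t d'.
Proof. by move=> ? <-. Qed.

Lemma cder_cst (c : R[i]) t : cder (fun _ => c) t 0.
Proof. by split; exact: derive_const. Qed.

Lemma cder_add f g t df dg : cder f t df -> cder g t dg ->
  cder (fun u => f u + g u) t (df + dg).
Proof.
move=> [h1 h2] [h3 h4]; split.
  rewrite (_ : (fun u => _) = fun u => Re (f u) + Re (g u)); last by apply/funext => u; rewrite ReD.
  by rewrite ReD; exact: derive_add.
rewrite (_ : (fun u => _) = fun u => Im (f u) + Im (g u)); last by apply/funext => u; rewrite ImD.
by rewrite ImD; exact: derive_add.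
Qed.

Lemma cder_opp f t df : cder f t df -> cder (fun u => - f u) t (- df).
Proof.
move=> [h1 h2]; split.
  rewrite (_ : (fun u => _) = fun u => - Re (f u)); last by apply/funext => u; rewrite ReN.
  by rewrite ReN; exact: derive_opp.
rewrite (_ : (fun u => _) = fun u => - Im (f u)); last by apply/funext => u; rewrite ImN.
by rewrite ImN; exact: derive_opp.
Qed.

Lemma cder_mul f g t df dg : cder f t df -> cder g t dg ->
  cder (fun u => f u * g u) t (df * g t + f t * dg).
Proof.
move=> [h1 h2] [h3 h4]; split.
  rewrite (_ : (fun u => _) = fun u => Re (f u) * Re (g u) - Im (f u) * Im (g u)); last first.
    by apply/funext => u; rewrite ReM.
  apply: (is_derive_eq (derive_sub (derive_mul h1 h3) (derive_mul h2 h4))).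
  by rewrite ReD !ReM; ring.
rewrite (_ : (fun u => _) = fun u => Re (f u) * Im (g u) + Im (f u) * Re (g u)); last first.
  by apply/funext => u; rewrite ImM.
apply: (is_derive_eq (derive_add (derive_mul h1 h4) (derive_mul h2 h3))).
by rewrite ImD !ImM; ring.
Qed.

Lemma cder_real (f : R -> R) t (d : R) : is_derive t 1 f d -> cder (fun u => (f u)%:C) t d%:C.
Proof. by move=> h; split => //; exact: derive_const. Qed.

Lemma derive_cmod w t d : w t != 0 -> cder w t d ->
  is_derive t 1 (fun u => cmod (w u)) ((Re (w t) * Re d + Im (w t) * Im d) / cmod (w t)).
Proof.
move=> w0 [h1 h2].
have s0 : 0 < Re (w t) ^+ 2 + Im (w t) ^+ 2 by rewrite -sqr_cmod exprn_gt0// cmod_gt0.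
have H : is_derive t 1 (fun u => Re (w u) ^+ 2 + Im (w u) ^+ 2)
    (2 * (Re (w t) * Re d + Im (w t) * Im d)).
  rewrite (_ : (fun u => _) = fun u => Re (w u) * Re (w u) + Im (w u) * Im (w u)); last first.
    by apply/funext => u; rewrite !expr2.
  apply: (is_derive_eq (derive_add (derive_mul h1 h1) (derive_mul h2 h2))).
  by ring.
apply: (is_derive_eq (derive_sqrt H s0)).
rewrite -/(cmod (w t)); have m0 : cmod (w t) != 0 by rewrite cmod_eq0.
by field.
Qed.

(** With [derive_carg] below, these are the real and imaginary parts of d log w = dw / w. *)
Lemma derive_ln_cmod w t d : w t != 0 -> cder w t d ->
  is_derive t 1 (fun u => ln (cmod (w u))) (Re (d / w t)).
Proof.
move=> w0 h; have m0 : 0 < cmod (w t) by rewrite cmod_gt0.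
apply: (is_derive_eq (derive_ln (derive_cmod w0 h) m0)).
rewrite Re_div -sqr_cmod; have m0' := lt0r_neq0 m0.
by field.
Qed.

Lemma cder_continuous f t d : cder f t d ->
  {for t, continuous (fun u => Re (f u))} /\ {for t, continuous (fun u => Im (f u))}.
Proof. by move=> [h1 h2]; split; [exact: derive_continuous h1|exact: derive_continuous h2]. Qed.

Lemma near_slit w t d : slit (w t) -> cder w t d -> \forall u \near t, slit (w u).
Proof.
move=> sw h; have w0 := slit_neq0 sw.
have c : {for t, continuous (fun u => cmod (w u) + Re (w u))}.
  apply: cvgD; first exact: derive_continuous (derive_cmod w0 h).
  by have [] := cder_continuous h.
exact: (cvgr_gt _ c _ sw).
Qed.

Lemma derive_carg w t d : slit (w t) -> cder w t d ->
  is_derive t 1 (fun u => carg (w u)) (Im (d / w t)).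
Proof.
move=> sw h; have w0 := slit_neq0 sw.
apply: (@derive_near _ (fun u => 2 * atan (Im (w u) / (cmod (w u) + Re (w u))))).
  near=> u; rewrite carg_slit//; near: u; exact: near_slit sw h.
have m0 : 0 < cmod (w t) by rewrite cmod_gt0.
have [h1 h2] := h.
have s0 := lt0r_neq0 sw; rewrite /slit in sw.
have H := derive_atan (derive_div h2 (derive_add (derive_cmod w0 h) h1) s0).
apply: (is_derive_eq (derive_mul (derive_const 2 t) H)).
rewrite mul0r add0r Im_div -sqr_cmod.
have e := sqr_cmod (w t).
set m := cmod (w t) in m0 sw s0 e *; set x := Re (w t) in sw s0 e *; set y := Im (w t) in e *.
have m0' := lt0r_neq0 m0.
have -> : 1 + (y / (m + x)) ^+ 2 = 2 * m / (m + x).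
  rewrite expr_div_n (_ : y ^+ 2 = m ^+ 2 - x ^+ 2); last by rewrite e; ring.
  by field.
have -> : Im d * (m + x) - y * ((x * Re d + y * Im d) / m + Re d) =
   (m + x) * (Im d * x - Re d * y) / m.
  have ey : y ^+ 2 = m ^+ 2 - x ^+ 2 by rewrite e; ring.
  apply: (mulIf m0'); rewrite divfK//.
  transitivity (Im d * (m + x) * m - (y * x * Re d + y ^+ 2 * Im d) - y * Re d * m); first by field.
  by rewrite ey; ring.
by field; rewrite m0' s0.
Unshelve. all: by end_near. Qed.

Lemma cder_polar (r a : R -> R) t dr da : is_derive t 1 r dr -> is_derive t 1 a da ->
  r t != 0 ->
  cder (fun u => polar (r u) (a u)) t (polar (r t) (a t) * Complex (dr / r t) da).
Proof.
move=> h1 h2 r0; split => /=.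
  apply: (is_derive_eq (derive_mul h1 (derive_cos h2))).
  by rewrite ?ReM/=; field.
apply: (is_derive_eq (derive_mul h1 (derive_sin h2))).
by rewrite ?ImM/=; field.
Qed.

Lemma cder_cpow w t d p : slit (w t) -> cder w t d ->
  cder (fun u => cpow (w u) p) t (p%:C * cpow (w t) p * (d / w t)).
Proof.
move=> sw h; have w0 := slit_neq0 sw.
have m0 : 0 < cmod (w t) by rewrite cmod_gt0.
have H1 := derive_powR p (derive_cmod w0 h) m0.
have H2 := derive_mul (derive_const p t) (derive_carg sw h).
have P0 : cmod (w t) `^ p != 0 by rewrite lt0r_neq0// powR_gt0.
have [H3 H4] := cder_polar H1 H2 P0.
have E : polar (cmod (w t) `^ p) (p * carg (w t)) * Complex
    (p * cmod (w t) `^ p * ((Re (w t) * Re d + Im (w t) * Im d) / cmod (w t) / cmod (w t)) /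
       cmod (w t) `^ p) (0 * carg (w t) + p * Im (d / w t)) =
    p%:C * cpow (w t) p * (d / w t).
  rewrite cpowE//; set P := polar _ _; set q := d / w t.
  have -> : p%:C * P * q = P * (p%:C * q) by ring.
  have m1 : cmod (w t) != 0 by rewrite lt0r_neq0.
  congr (_ * _); apply: complex_eq.
    rewrite [Re (Complex _ _)]/= ReM ReC ImC mul0r subr0 /q Re_div -sqr_cmod.
    by field; rewrite P0 m1.
  by rewrite [LHS]/= [RHS]ImM ReC ImC; ring.
have nw : \forall u \near t, w u != 0.
  near=> u; apply: slit_neq0; near: u; exact: near_slit sw h.
split; rewrite -E.
- apply: derive_near H3; near=> u; rewrite cpowE//; near: u; exact: nw.
- apply: derive_near H4; near=> u; rewrite cpowE//; near: u; exact: nw.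
Unshelve. all: by end_near. Qed.

Definition cmeas dT (T : measurableType dT) (f : T -> R[i]) :=
  measurable_fun setT (fun x => Re (f x)) /\ measurable_fun setT (fun x => Im (f x)).

Section cmeas.
Context dT (T : measurableType dT).
Implicit Types (h k : T -> R[i]).

Lemma cmeas_cst (c : R[i]) : cmeas (fun _ : T => c).
Proof. by split; exact: measurable_cst. Qed.

Lemma cmeas_real (h : T -> R) : measurable_fun setT h -> cmeas (fun x => (h x)%:C).
Proof. by move=> mh; split => //; exact: measurable_cst. Qed.

Lemma cmeas_polar (r a : T -> R) : measurable_fun setT r -> measurable_fun setT a ->
  cmeas (fun x => polar (r x) (a x)).
Proof.
move=> mr ma; split => /=; apply: measurable_funM => //.
  by apply: measurableT_comp ma; apply: continuous_measurable_fun; exact: continuous_cos.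
by apply: measurableT_comp ma; apply: continuous_measurable_fun; exact: continuous_sin.
Qed.

Lemma cmeas_add h k : cmeas h -> cmeas k -> cmeas (fun x => h x + k x).
Proof.
move=> [h1 h2] [h3 h4]; split.
  by under eq_fun do rewrite ReD; exact: measurable_funD.
by under eq_fun do rewrite ImD; exact: measurable_funD.
Qed.

Lemma cmeas_opp h : cmeas h -> cmeas (fun x => - h x).
Proof.
move=> [h1 h2]; split.
  by under eq_fun do rewrite ReN; exact: measurable_funN.
by under eq_fun do rewrite ImN; exact: measurable_funN.
Qed.

Lemma cmeas_mul h k : cmeas h -> cmeas k -> cmeas (fun x => h x * k x).
Proof.
move=> [h1 h2] [h3 h4]; split.
  under eq_fun do rewrite ReM.
  by apply: measurable_funB; exact: measurable_funM.
under eq_fun do rewrite ImM.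
by apply: measurable_funD; exact: measurable_funM.
Qed.

Lemma measurable_inv (h : T -> R) : measurable_fun setT h -> measurable_fun setT (fun x => (h x)^-1).
Proof. exact: measurableT_comp measurable_funV. Qed.

Lemma cmeas_inv h : cmeas h -> cmeas (fun x => (h x)^-1).
Proof.
move=> [h1 h2]; have mm : measurable_fun setT (fun x => (Re (h x) ^+ 2 + Im (h x) ^+ 2)^-1).
  by apply: measurable_inv; apply: measurable_funD; exact: measurable_funX.
split.
  by under eq_fun do rewrite ReV; exact: measurable_funM.
by under eq_fun do rewrite ImV; apply: measurable_funM => //; exact: measurable_funN.
Qed.

Lemma measurable_cmod h : cmeas h -> measurable_fun setT (fun x => cmod (h x)).
Proof.
move=> [h1 h2]; apply: measurableT_comp.
  by apply: continuous_measurable_fun; exact: sqrt_continuous.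
by apply: measurable_funD; exact: measurable_funX.
Qed.

Lemma measurable_carg h : cmeas h -> measurable_fun setT (fun x => carg (h x)).
Proof.
move=> mh; have [h1 h2] := mh; rewrite /carg; apply: measurable_fun_ifT => //.
- apply: measurable_and; first exact: measurable_fun_eqr.
  exact: measurable_fun_ltr.
- apply: measurable_funM => //; apply: measurableT_comp.
    by apply: continuous_measurable_fun => x; exact: continuous_atan.
  apply: measurable_funM => //; apply: measurable_inv; apply: measurable_funD => //.
  exact: measurable_cmod.
Qed.

Lemma cmeas_cpow h p : cmeas h -> cmeas (fun x => cpow (h x) p).
Proof.
move=> mh; have [h1 h2] := mh; have mm := measurable_cmod mh.
have [p1 p2] : cmeas (fun x => polar (cmod (h x) `^ p) (p * carg (h x))).
  apply: cmeas_polar; first exact: (measurableT_comp (measurable_powR p) mm).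
  by apply: measurable_funM => //; exact: measurable_carg.
have mb : measurable_fun setT (fun x => h x == 0).
  under eq_fun do rewrite -cmod_eq0.
  exact: measurable_fun_eqr.
split.
  rewrite (_ : (fun x => _) = fun x => if h x == 0 then 0 else Re (polar (cmod (h x) `^ p) (p * carg (h x)))).
    exact: measurable_fun_ifT.
  by apply/funext => x; rewrite /cpow; case: ifP.
rewrite (_ : (fun x => _) = fun x => if h x == 0 then 0 else Im (polar (cmod (h x) `^ p) (p * carg (h x)))).
  exact: measurable_fun_ifT.
by apply/funext => x; rewrite /cpow; case: ifP.
Qed.

End cmeas.
End complex_calculus.

(** * Positivity of the logarithmic energy *)

Section pos_def.
Context {R : realType}.
Local Notation leb := (@lebR R).
Implicit Types (m n : probability R R).

Definition bilin (k : R -> R -> \bar R) m n : \bar R := (\int[m]_x \int[n]_y k x y)%E.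

(** Nonnegativity of the energy of the signed measure [m - n] for a symmetric kernel, written
    without subtraction because the terms may be infinite. *)
Definition pos_def (k : R -> R -> \bar R) := forall m n,
  (bilin k m n + bilin k m n <= bilin k m m + bilin k n n)%E.

Lemma measurable_bool_real d (T : measurableType d) (b : T -> bool) :
  measurable_fun setT b -> measurable_fun setT (fun x => (b x)%:R : R).
Proof.
move=> mb; rewrite (_ : (fun x => _) = (fun x => if b x then 1 else 0)); last first.
  by apply/funext => x; case: (b x).
exact: measurable_fun_ifT.
Qed.

Lemma measurable_bilin_inner d (T : measurableType d) (k : T * R -> \bar R) n :
  (forall x, (0 <= k x)%E) -> measurable_fun setT k ->
  measurable_fun setT (fun x => \int[n]_y k (x, y))%E.
Proof. by move=> k0 mk; exact: (measurable_fun_fubini_tonelli_F (m2 := n)). Qed.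

Lemma bilinD (k1 k2 : R * R -> \bar R) m n :
  (forall x, (0 <= k1 x)%E) -> (forall x, (0 <= k2 x)%E) ->
  measurable_fun setT k1 -> measurable_fun setT k2 ->
  (bilin (fun x y => k1 (x, y) + k2 (x, y)) m n =
   bilin (fun x y => k1 (x, y)) m n + bilin (fun x y => k2 (x, y)) m n)%E.
Proof.
move=> k10 k20 mk1 mk2; rewrite /bilin -ge0_integralD//.
- apply: eq_integral => x _; rewrite ge0_integralD//.
  + exact: measurableT_comp mk1 (pair1_measurable x).
  + exact: measurableT_comp mk2 (pair1_measurable x).
- by move=> x _; exact: integral_ge0.
- exact: measurable_bilin_inner.
- by move=> x _; exact: integral_ge0.
- exact: measurable_bilin_inner.
Qed.

Section factor.
Variables (e : R * R -> R) (M : R -> R).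
Hypotheses (e0 : forall x, 0 <= e x) (me : measurable_fun setT e)
  (eM : forall t x, e (t, x) <= M t).

Let k x y : \bar R := (\int[leb]_t (e (t, x) * e (t, y))%:E)%E.
Let A m t : \bar R := (\int[m]_x (e (t, x))%:E)%E.

Lemma factor_fin_num m t : A m t \is a fin_num.
Proof.
have A0 : (0 <= A m t)%E by apply: integral_ge0 => x _; rewrite lee_fin.
rewrite ge0_fin_numE//.
have : (A m t <= \int[m]_x (M t)%:E)%E.
  apply: ge0_le_integral => //.
  - by move=> x _; rewrite lee_fin.
  - apply/measurable_EFinP; exact: measurableT_comp me (pair1_measurable t).
  - by move=> x _; rewrite lee_fin.
rewrite integral_cst// => /le_lt_trans; apply.
rewrite [X in (_ * X)%E](_ : _ = 1%E) ?mule1 ?ltry//.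
exact: probability_setT.
Qed.

Lemma measurable_factor m : measurable_fun setT (A m).
Proof.
apply: (@measurable_bilin_inner _ _ (EFin \o e)).
  by move=> x; rewrite lee_fin.
exact/measurable_EFinP.
Qed.

Lemma bilin_factor m n : bilin k m n = (\int[leb]_t (A m t * A n t))%E.
Proof.
rewrite /bilin /k.
have E1 x : (\int[n]_y \int[leb]_t (e (t, x) * e (t, y))%:E =
          \int[leb]_t ((e (t, x))%:E * A n t))%E.
  rewrite (fubini_tonelli (fun z => (e (z.2, x) * e (z.2, z.1))%:E))/=; last 2 first.
  - apply/measurable_EFinP; apply: measurable_funM.
    + exact: measurableT_comp me (measurable_fun_pair measurable_snd (measurable_cst _)).
    + exact: measurableT_comp me (measurable_fun_pair measurable_snd measurable_fst).
  - by move=> z; rewrite lee_fin mulr_ge0.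
  apply: eq_integral => t _; under eq_integral do rewrite EFinM.
  rewrite ge0_integralZl_EFin//.
  - by move=> y _; rewrite lee_fin.
  - apply/measurable_EFinP; exact: measurableT_comp me (pair1_measurable t).
under eq_integral do rewrite E1.
rewrite (fubini_tonelli (fun z => (e (z.2, z.1))%:E * A n z.2)%E)/=; last 2 first.
- apply: emeasurable_funM.
  + apply/measurable_EFinP; exact: measurableT_comp me (measurable_fun_pair measurable_snd measurable_fst).
  + exact: measurableT_comp (measurable_factor n) measurable_snd.
- by move=> z; rewrite mule_ge0 ?lee_fin//; apply: integral_ge0 => x _; rewrite lee_fin.
apply: eq_integral => t _; rewrite ge0_integralZr//.
- by apply/measurable_EFinP; exact: measurableT_comp me (pair1_measurable t).
- by move=> x _; rewrite lee_fin.
- by apply: integral_ge0 => x _; rewrite lee_fin.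
Qed.

(* The defect of positivity is the L^2 distance of the factors. *)
Lemma bilin_factor_sqr m n :
  (bilin k m n + bilin k m n + \int[leb]_t ((fine (A m t) - fine (A n t)) ^+ 2)%:E =
   bilin k m m + bilin k n n)%E.
Proof.
have A0 p t : 0 <= fine (A p t) by rewrite fine_ge0//; apply: integral_ge0 => x _; rewrite lee_fin.
have mfA p : measurable_fun setT (fun t => fine (A p t)).
  exact: measurableT_comp (fine_measurable measurableT) (measurable_factor p).
have E p q : bilin k p q = (\int[leb]_t (fine (A p t) * fine (A q t))%:E)%E.
  by rewrite bilin_factor; apply: eq_integral => t _; rewrite EFinM !fineK ?factor_fin_num.
have mP p q : measurable_fun setT (fun t => (fine (A p t) * fine (A q t))%:E).
  by apply/measurable_EFinP; exact: measurable_funM.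
have P0 p q t : setT t -> (0 <= (fine (A p t) * fine (A q t))%:E)%E.
  by move=> _; rewrite lee_fin mulr_ge0.
have mS : measurable_fun setT (fun t => ((fine (A m t) - fine (A n t)) ^+ 2)%:E).
  by apply/measurable_EFinP; apply: measurable_funX; exact: measurable_funB.
have S0 t : setT t -> (0 <= ((fine (A m t) - fine (A n t)) ^+ 2)%:E)%E.
  by move=> _; rewrite lee_fin sqr_ge0.
have PP0 t : setT t -> (0 <= (fine (A m t) * fine (A n t))%:E + (fine (A m t) * fine (A n t))%:E)%E.
  by move=> Tt; rewrite adde_ge0// P0.
rewrite !E.
rewrite -(ge0_integralD leb measurableT (P0 m n) (mP m n) (P0 m n) (mP m n)).
rewrite -(ge0_integralD leb measurableT PP0 (emeasurable_funD (mP m n) (mP m n)) S0 mS).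
rewrite -(ge0_integralD leb measurableT (P0 m m) (mP m m) (P0 n n) (mP n n)).
by apply: eq_integral => t _; rewrite -!EFinD; congr EFin; ring.
Qed.

Lemma pos_def_factor : pos_def k.
Proof.
move=> m n; rewrite -bilin_factor_sqr leeDl//.
by apply: integral_ge0 => t _; rewrite lee_fin sqr_ge0.
Qed.

End factor.

Lemma bilin_int (k : R * (R * R) -> R) m n :
  (forall x, 0 <= k x) -> measurable_fun setT k ->
  (bilin (fun x y => \int[leb]_t (k (t, (x, y)))%:E) m n =
   \int[leb]_t bilin (fun x y => (k (t, (x, y)))%:E) m n)%E.
Proof.
move=> k0 mk; rewrite /bilin.
have mk' : measurable_fun setT (fun z : (R * R) * R => k (z.1.2, (z.1.1, z.2))).
  apply: (measurableT_comp mk) => //.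
  apply: measurable_fun_pair.
    exact: measurableT_comp measurable_snd measurable_fst.
  apply: measurable_fun_pair; last exact: measurable_snd.
  exact: measurableT_comp measurable_fst measurable_fst.
have E1 x : (\int[n]_y \int[leb]_t (k (t, (x, y)))%:E =
          \int[leb]_t \int[n]_y (k (t, (x, y)))%:E)%E.
  rewrite (fubini_tonelli (fun z => (k (z.2, (x, z.1)))%:E))//=; last by move=> z; rewrite lee_fin.
  apply/measurable_EFinP; apply: (measurableT_comp mk) => //.
  apply: measurable_fun_pair; first exact: measurable_snd.
  by apply: measurable_fun_pair; [exact: measurable_cst|exact: measurable_fst].
under eq_integral do rewrite E1.
rewrite (fubini_tonelli (fun z => \int[n]_y (k (z.2, (z.1, y)))%:E)%E)//=.
- apply: (@measurable_bilin_inner _ _ (fun z : (R * R) * R => (k (z.1.2, (z.1.1, z.2)))%:E)).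
    by move=> z; rewrite lee_fin.
  exact/measurable_EFinP.
- by move=> z; apply: integral_ge0 => y _; rewrite lee_fin.
Qed.

Lemma le_integralDD (f1 f2 f3 f4 : R -> \bar R) :
  (forall x, (0 <= f1 x)%E) -> (forall x, (0 <= f2 x)%E) ->
  (forall x, (0 <= f3 x)%E) -> (forall x, (0 <= f4 x)%E) ->
  measurable_fun setT f1 -> measurable_fun setT f2 ->
  measurable_fun setT f3 -> measurable_fun setT f4 ->
  (forall x, (f1 x + f2 x <= f3 x + f4 x)%E) ->
  (\int[leb]_x f1 x + \int[leb]_x f2 x <= \int[leb]_x f3 x + \int[leb]_x f4 x)%E.
Proof.
move=> p1 p2 p3 p4 m1 m2 m3 m4 le; rewrite -!ge0_integralD//.
apply: ge0_le_integral => //.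
- by move=> x _; rewrite adde_ge0.
- exact: emeasurable_funD.
- exact: emeasurable_funD.
Qed.

Lemma pos_def_int (k : R * (R * R) -> R) :
  (forall x, 0 <= k x) -> measurable_fun setT k ->
  (forall t, pos_def (fun x y => (k (t, (x, y)))%:E)) ->
  pos_def (fun x y => \int[leb]_t (k (t, (x, y)))%:E)%E.
Proof.
move=> k0 mk kpd m n; rewrite !bilin_int//.
have mb p q : measurable_fun setT (fun t => bilin (fun x y => (k (t, (x, y)))%:E) p q).
  rewrite /bilin.
  apply: (@measurable_bilin_inner _ _ (fun z : R * R => \int[q]_y (k (z.1, (z.2, y)))%:E)%E).
    by move=> z; apply: integral_ge0 => y _; rewrite lee_fin.
  apply: (@measurable_bilin_inner _ _ (fun z : (R * R) * R => (k (z.1.1, (z.1.2, z.2)))%:E)).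
    by move=> z; rewrite lee_fin.
  apply/measurable_EFinP; apply: (measurableT_comp mk) => //.
  apply: measurable_fun_pair.
    exact: measurableT_comp measurable_fst measurable_fst.
  apply: measurable_fun_pair; last exact: measurable_snd.
  exact: measurableT_comp measurable_snd measurable_fst.
have b0 p q t : (0 <= bilin (fun x y => (k (t, (x, y)))%:E) p q)%E.
  by apply: integral_ge0 => x _; apply: integral_ge0 => y _; rewrite lee_fin.
by apply: le_integralDD => // t; exact: kpd.
Qed.

Lemma pos_def_ext (k1 k2 : R -> R -> \bar R) : (forall x y, k1 x y = k2 x y) ->
  pos_def k1 -> pos_def k2.
Proof.
move=> k12; suff -> : k1 = k2 by [].
by apply/funext => x; apply/funext => y; exact: k12.
Qed.

Lemma pos_defD (k1 k2 : R * R -> \bar R) :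
  (forall x, (0 <= k1 x)%E) -> (forall x, (0 <= k2 x)%E) ->
  measurable_fun setT k1 -> measurable_fun setT k2 ->
  pos_def (fun x y => k1 (x, y)) -> pos_def (fun x y => k2 (x, y)) ->
  pos_def (fun x y => k1 (x, y) + k2 (x, y))%E.
Proof.
move=> k10 k20 mk1 mk2 p1 p2 m n; rewrite !bilinD//.
rewrite addeACA [leRHS]addeACA; apply: leeD; [exact: p1|exact: p2].
Qed.

(** The value at 0 is the one that an energy requires; [- ln 0] would be 0. *)
Definition neglog (d : R) : \bar R := if d == 0 then +oo%E else (- ln d)%:E.

Section log_kernel.
Variable g : R -> R.
Hypothesis g01 : forall x, 0 <= g x <= 1.
Hypothesis mg : measurable_fun setT g.

(** With [d = |g x - g y|], integration over [0 < t < 1] gives [- ln d + d - 1]: up to [d - 1], the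
    logarithm is a superposition of tents, each of which is a positive definite kernel. *)
Definition tent (z : R * (R * R)) : R :=
  (0 < (z.1 : R) < 1)%R%:R * z.1^-1 ^+ 2 * Num.max 0 (z.1 - `|g z.2.1 - g z.2.2|).

(** The autocorrelations of [eleft] and [eright] are [min (g x) (g y)] and [1 - max (g x) (g y)].
    Their sum [1 - |g x - g y|] cancels the excess [d - 1] in the integral of the tents. *)
Definition eleft (z : R * R) : R := (0 < (z.1 : R) < 1)%R%:R * (z.1 < g z.2)%R%:R.
Definition eright (z : R * R) : R := (0 < (z.1 : R) < 1)%R%:R * (g z.2 < z.1)%R%:R.

Lemma tent_ge0 z : 0 <= tent z.
Proof. rewrite /tent; apply: mulr_ge0; last by rewrite le_max lexx.
by apply: mulr_ge0 => //; exact: sqr_ge0. Qed.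

Lemma measurable_g_fst d (T : measurableType d) (f : T -> R) :
  measurable_fun setT f -> measurable_fun setT (g \o f).
Proof. exact: measurableT_comp. Qed.

Lemma measurable_tent : measurable_fun setT tent.
Proof.
have m1 : measurable_fun setT (fun z : R * (R * R) => z.1) by exact: measurable_fst.
have m21 : measurable_fun setT (fun z : R * (R * R) => z.2.1).
  exact: measurableT_comp measurable_fst measurable_snd.
have m22 : measurable_fun setT (fun z : R * (R * R) => z.2.2).
  exact: measurableT_comp measurable_snd measurable_snd.
apply: measurable_funM; first apply: measurable_funM.
- apply: measurable_bool_real; apply: measurable_and; exact: measurable_fun_ltr.
- by apply: measurable_funX; exact: measurableT_comp measurable_funV m1.
- apply: measurable_maxr => //; apply: measurable_funB => //.
  apply: measurableT_comp; first exact: normr_measurable.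
  by apply: measurable_funB; exact: measurable_g_fst.
Qed.

Lemma measurable_eleft : measurable_fun setT eleft.
Proof.
apply: measurable_funM; apply: measurable_bool_real.
- by apply: measurable_and; apply: measurable_fun_ltr => //; exact: measurable_fst.
- by apply: measurable_fun_ltr; [exact: measurable_fst|apply: measurable_g_fst; exact: measurable_snd].
Qed.

Lemma measurable_eright : measurable_fun setT eright.
Proof.
apply: measurable_funM; apply: measurable_bool_real.
- by apply: measurable_and; apply: measurable_fun_ltr => //; exact: measurable_fst.
- by apply: measurable_fun_ltr; [apply: measurable_g_fst; exact: measurable_snd|exact: measurable_fst].
Qed.

(* [1[w <= x <= w + t]] correlates with itself into a tent function. *)
Lemma pos_def_tent t : pos_def (fun x y => (tent (t, (x, y)))%:E).
Proof.
pose e (z : R * R) : R := (0 < t < 1)%R%:R * t^-1 * (z.1 < g z.2)%R%:R * (g z.2 < z.1 + t)%R%:R.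
have e0 z : 0 <= e z.
  rewrite /e; case: (boolP (0 < t < 1)) => [/andP[t0 _]|_]; last by rewrite !mul0r.
  by rewrite mul1r !mulr_ge0// invr_ge0 ltW.
have me : measurable_fun setT e.
  apply: measurable_funM; first apply: measurable_funM => //.
  - apply: measurable_bool_real; apply: measurable_fun_ltr; first exact: measurable_fst.
    by apply: measurable_g_fst; exact: measurable_snd.
  - apply: measurable_bool_real; apply: measurable_fun_ltr.
      by apply: measurable_g_fst; exact: measurable_snd.
    by apply: measurable_funD => //; exact: measurable_fst.
have eM w x : e (w, x) <= `|t^-1|.
  rewrite /e/=; case: (0 < t < 1); last by rewrite !mul0r.
  by case: (w < g x); case: (g x < w + t); rewrite ?(mul1r, mulr1, mulr0, mul0r)// ler_norm.
apply: pos_def_ext (pos_def_factor e0 me eM) => x y.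
have [/andP[t0 t1]|] := boolP (0 < t < 1); last first.
  move=> tn; rewrite /tent/= (negbTE tn) !mul0r.
  rewrite (eq_integral (cst 0%E)) ?integral0//.
  by move=> w _; rewrite /e (negbTE tn) !mul0r.
(* []a, b[] is the set of positions [w] for which [g x] and [g y] both lie in the window []w, w +
   t[]. *)
pose a := Num.max (g x) (g y) - t; pose b := Num.min (g x) (g y).
transitivity (\int[leb]_(w in `]a, b[) (cst ((t^-1 ^+ 2)%:E)) w)%E.
  rewrite [RHS]integral_mkcond; apply: eq_integral => w _.
  rewrite patchE /e t0 t1/= !mul1r.
  have -> : (w \in (`]a, b[%classic : set R)) = [&& w < g x, g x < w + t, w < g y & g y < w + t].
    apply/idP/idP.
      rewrite inE/= in_itv/= /a /b ltrBlDr gt_max lt_min.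
      by move=> /andP[/andP[-> ->] /andP[-> ->]].
    move=> /and4P[h1 h2 h3 h4]; rewrite inE/= in_itv/= /a /b ltrBlDr gt_max lt_min.
    by rewrite h1 h2 h3 h4.
  case: (w < g x); case: (g x < w + t); case: (w < g y); case: (g y < w + t);
    rewrite ?(mulr1, mulr0, mul0r)//= expr2//.
rewrite integral_cst//= /tent/= t0 t1 mul1r.
have abE : b - a = t - `|g x - g y|.
  rewrite /a /b; have [xy|yx] := leP (g x) (g y).
    by rewrite ler0_norm ?subr_le0//; ring.
  by rewrite gtr0_norm ?subr_gt0//; ring.
have [ba|ab] := leP b a.
  rewrite (_ : `]a, b[%classic = set0) ?measure0 ?mule0; last by rewrite set_itv_ge// -leNgt bnd_simp.
  by rewrite max_l ?mulr0// -abE subr_le0.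
have -> : leb `]a, b[ = (b - a)%:E.
  by rewrite /lebR lebesgue_measure_itv/= lte_fin ab EFinB.
by rewrite -EFinM -abE max_r// subr_ge0 ltW.
Qed.

Lemma eleft_ge0 z : 0 <= eleft z. Proof. by rewrite /eleft mulr_ge0. Qed.
Lemma eright_ge0 z : 0 <= eright z. Proof. by rewrite /eright mulr_ge0. Qed.
Lemma eleft_le1 t x : eleft (t, x) <= 1.
Proof. by rewrite /eleft/=; case: (0 < t < 1); case: (t < g x); rewrite ?(mulr0, mulr1, mul0r). Qed.
Lemma eright_le1 t x : eright (t, x) <= 1.
Proof. by rewrite /eright/=; case: (0 < t < 1); case: (g x < t); rewrite ?(mulr0, mulr1, mul0r). Qed.

Lemma integral_eleft x y :
  (\int[leb]_w (eleft (w, x) * eleft (w, y))%:E = (Num.min (g x) (g y))%:E)%E.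
Proof.
have /andP[x0 x1] := g01 x; have /andP[y0 y1] := g01 y.
rewrite (eq_integral (fun w => (\1_(`]0%R, Num.min (g x) (g y)[%classic : set R) w)%:E)).
  rewrite integral_indic// setIT; apply: etrans (lebR_oo _) _; last by rewrite subr0.
  by rewrite le_min x0 y0.
move=> w _; rewrite indicE /eleft/=.
have -> : (w \in (`]0%R, Num.min (g x) (g y)[%classic : set R)) = [&& 0 < w < 1, w < g x & w < g y].
  apply/idP/idP; rewrite inE/= in_itv/= lt_min.
    by move=> /and3P[w0 wx wy]; rewrite w0 wx wy (lt_le_trans wx).
  by move=> /and3P[/andP[-> _] -> ->].
by case: (0 < w < 1); case: (w < g x); case: (w < g y); rewrite ?(mulr0, mulr1, mul0r).
Qed.

Lemma integral_eright x y :
  (\int[leb]_w (eright (w, x) * eright (w, y))%:E = (1 - Num.max (g x) (g y))%:E)%E.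
Proof.
have /andP[x0 x1] := g01 x; have /andP[y0 y1] := g01 y.
rewrite (eq_integral (fun w => (\1_(`]Num.max (g x) (g y), 1%R[%classic : set R) w)%:E)).
  rewrite integral_indic// setIT; apply: lebR_oo.
  by rewrite ge_max x1 y1.
move=> w _; rewrite indicE /eright/=.
have -> : (w \in (`]Num.max (g x) (g y), 1%R[%classic : set R)) = [&& 0 < w < 1, g x < w & g y < w].
  apply/idP/idP; rewrite inE/= in_itv/= gt_max.
    by move=> /andP[/andP[wx wy] w1]; rewrite w1 wx wy (le_lt_trans x0 wx).
  by move=> /and3P[/andP[_ ->] -> ->].
by case: (0 < w < 1); case: (g x < w); case: (g y < w); rewrite ?(mulr0, mulr1, mul0r).
Qed.

Lemma integral_invr (a : R) : 0 < a -> a < 1 ->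
  (\int[leb]_(t in `]a, 1%R[) (t^-1)%:E = (- ln a)%:E)%E.
Proof.
move=> a0 a1.
have -> : - ln a = ln 1 - ln a by rewrite ln1 sub0r.
apply: (@ge0_FTC_lebR R (fun t => t^-1) (@ln R)) => //.
- by move=> t /andP[t0 _]; rewrite invr_ge0 ltW// (lt_trans a0).
- move=> t /andP[at_ _]; apply: inv_continuous; exact: lt0r_neq0 (lt_trans a0 at_).
- by move=> t /andP[at_ _]; apply: is_derive1_ln; exact: lt_trans at_.
- by apply: cvg_at_right_filter; exact: continuous_ln.
- by apply: cvg_at_left_filter; exact: continuous_ln.
Qed.

Lemma integral_tent x y : `|g x - g y| != 0 ->
  (\int[leb]_t (tent (t, (x, y)))%:E =
   (- ln `|g x - g y| + `|g x - g y| - 1)%:E)%E.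
Proof.
have d1 : `|g x - g y| <= 1.
  by have /andP[x0 x1] := g01 x; have /andP[y0 y1] := g01 y; rewrite ler_norml; lra.
rewrite /tent/=; move: d1; set d := `|g x - g y| => d1 dn0.
have d0 : 0 < d by rewrite lt_def dn0 normr_ge0.
have [d_lt1|d_ge1] := ltP d 1; last first.
  have -> : d = 1 by apply/eqP; rewrite eq_le d1.
  rewrite ln1 oppr0 add0r subrr (eq_integral (cst 0%E)) ?integral0//.
  move=> t _; case: (boolP (0 < t < 1)) => [/andP[t0 t1]|_]; last by rewrite !mul0r.
  by rewrite max_l ?mulr0// subr_le0 ltW.
have -> : - ln d + d - 1 = (ln 1 + d / 1) - (ln d + d / d).
  by rewrite ln1 divff// divr1; ring.
transitivity (\int[leb]_(t in `]d, 1%R[) (t^-1 ^+ 2 * (t - d))%:E)%E; last first.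
apply: (@ge0_FTC_lebR R (fun t => t^-1 ^+ 2 * (t - d)) (fun t => ln t + d / t)) => //.
- by move=> t /andP[dt _]; rewrite mulr_ge0 ?sqr_ge0// subr_ge0 ltW.
- move=> t /andP[dt _]; have t0 : t != 0 by exact: lt0r_neq0 (lt_trans d0 dt).
  apply: cvgM; last by apply: cvgB; [exact: cvg_id|exact: cvg_cst].
  by apply: cvgM; exact: inv_continuous.
- move=> t /andP[dt _]; have t0 : 0 < t by exact: lt_trans dt.
  have t0' := lt0r_neq0 t0.
  have h1 := is_derive1_ln t0.
  have h2 : is_derive t 1 (fun t => d / t) (- d * t^-1 ^+ 2).
    have H := @derive_div R (fun _ => d) (fun u => u) t _ _ (derive_const _ _) (derive_var _) t0'.
      by apply: (is_derive_eq H); field.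
  apply: (is_derive_eq (derive_add h1 h2)); by field.
- apply: cvg_at_right_filter; apply: cvgD; first exact: continuous_ln.
  by apply: cvgM; [exact: cvg_cst|exact: inv_continuous].
- apply: cvg_at_left_filter; apply: cvgD; first exact: continuous_ln.
  by apply: cvgM; [exact: cvg_cst|exact: inv_continuous (oner_neq0 _)].
- rewrite [RHS]integral_mkcond; apply: eq_integral => t _; rewrite patchE.
  rewrite mem_oo; case: ifPn => [|/negP].
    move=> /andP[dt t1]; rewrite (lt_trans d0 dt) t1/= mul1r max_r//.
    by rewrite subr_ge0 ltW.
  move=> h; case: (boolP (0 < t < 1)) => [/andP[t0 t1]|_]; last by rewrite !mul0r.
  rewrite max_l ?mulr0// subr_le0 leNgt; apply/negP => dt; apply: h.
  by rewrite dt.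
Qed.

Lemma integral_tent0 x y : g x = g y ->
  (\int[leb]_t (tent (t, (x, y)))%:E = +oo)%E.
Proof.
move=> gxy; apply/eqyP => A A0.
(* On []a, 1[] the tent equals [1 / t], whose integral is [- ln a = A], and [A] is arbitrary. *)
pose a := expR (- A).
have a0 : 0 < a by exact: expR_gt0.
have a1 : a < 1 by rewrite /a -[ltRHS]expR0 ltr_expR oppr_lt0.
have -> : A = - ln a by rewrite /a expRK opprK.
rewrite -integral_invr// integral_mkcond.
apply: ge0_le_integral => //.
- move=> t _; apply: erestrict_ge0 => {}t/=; rewrite in_itv/= => /andP[at_ _].
  by rewrite lee_fin invr_ge0 ltW// (lt_trans a0).
- apply: (measurable_restrictT _ (measurable_itv `]a, 1%R[)).1.
  by apply/measurable_EFinP; apply: measurable_funTS; exact: measurable_funV.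
- apply/measurable_EFinP.
  have /= := @measurableT_comp _ _ _ _ _ _ _ setT (fun t : R => (t, (x, y))) measurable_tent.
  by apply; exact: pair2_measurable.
- move=> t _; rewrite patchE; case: ifPn => [|_]; last by rewrite lee_fin tent_ge0.
  rewrite inE/= in_itv/= => /andP[at_ t1].
  have t0 := lt_trans a0 at_.
  rewrite lee_fin /tent/= t0 t1/= gxy subrr normr0 subr0 mul1r max_r; last exact: ltW.
  have -> : t^-1 ^+ 2 * t = t^-1 by field; exact: lt0r_neq0.
  exact: lexx.
Qed.

Definition logk x y : \bar R := neglog `|g x - g y|.

Lemma neglog_repr x y : (logk x y =
  \int[leb]_t (tent (t, (x, y)))%:E + \int[leb]_w (eright (w, x) * eright (w, y))%:E +
  \int[leb]_w (eleft (w, x) * eleft (w, y))%:E)%E.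
Proof.
rewrite integral_eleft integral_eright /logk /neglog.
case: ifPn => [|h].
  by rewrite normr_eq0 subr_eq0 => /eqP gxy; rewrite integral_tent0.
rewrite integral_tent// -!EFinD; congr EFin.
have [xy|yx] := leP (g x) (g y).
  by rewrite (ler0_norm (_ : g x - g y <= 0)) ?subr_le0//; ring.
by rewrite (gtr0_norm (_ : 0 < g x - g y)) ?subr_gt0//; ring.
Qed.

Definition eleft_mean (m : probability R R) (w : R) : R :=
  fine (\int[m]_x (eleft (w, x))%:E)%E.

Let aux (a b s a1 b1 a2 b2 : \bar R) : (a + a <= a1 + a2)%E -> (b + b + s = b1 + b2)%E ->
  (a + b + (a + b) + s <= a1 + b1 + (a2 + b2))%E.
Proof.
by move=> h1 h2; rewrite addeACA -[X in (X <= _)%E]addeA [leRHS]addeACA; apply: leeD => //; rewrite h2.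
Qed.

(** Of the three positive definite parts only the one built on [eleft] keeps its exact defect. It
    compares the masses of the sets where [g > w], that is, distribution functions, and so detects
    equality of the measures. *)
Lemma neglog_energy_sqr m n :
  (bilin logk m n + bilin logk m n +
   \int[leb]_w ((eleft_mean m w - eleft_mean n w) ^+ 2)%:E <=
   bilin logk m m + bilin logk n n)%E.
Proof.
pose k1 (z : R * R) := (\int[leb]_t (tent (t, z))%:E)%E.
pose k3 (z : R * R) := (\int[leb]_w (eright (w, z.1) * eright (w, z.2))%:E)%E.
pose k2 (z : R * R) := (\int[leb]_w (eleft (w, z.1) * eleft (w, z.2))%:E)%E.
have -> : logk = (fun x y => (k1 (x, y) + k3 (x, y)) + k2 (x, y))%E.
  by apply/funext => x; apply/funext => y; rewrite neglog_repr.
have k10 z : (0 <= k1 z)%E by apply: integral_ge0 => t _; rewrite lee_fin tent_ge0.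
have k30 z : (0 <= k3 z)%E by apply: integral_ge0 => t _; rewrite lee_fin mulr_ge0 ?eright_ge0.
have k20 z : (0 <= k2 z)%E by apply: integral_ge0 => t _; rewrite lee_fin mulr_ge0 ?eleft_ge0.
have mee (e : R * R -> R) : measurable_fun setT e ->
    measurable_fun setT (fun z : (R * R) * R => e (z.2, z.1.1) * e (z.2, z.1.2)).
  move=> me; apply: measurable_funM; apply: (measurableT_comp me) => //.
    apply: measurable_fun_pair; first exact: measurable_snd.
    exact: measurableT_comp measurable_fst measurable_fst.
  apply: measurable_fun_pair; first exact: measurable_snd.
  exact: measurableT_comp measurable_snd measurable_fst.
have mk1 : measurable_fun setT k1.
  apply: (@measurable_fun_fubini_tonelli_F _ _ _ _ _ leb (fun z : (R * R) * R => (tent (z.2, z.1))%:E)).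
    apply/measurable_EFinP; apply: (measurableT_comp measurable_tent) => //.
    by apply: measurable_fun_pair; [exact: measurable_snd|exact: measurable_fst].
  by move=> z; rewrite lee_fin tent_ge0.
have mk3 : measurable_fun setT k3.
  apply: (@measurable_fun_fubini_tonelli_F _ _ _ _ _ leb (fun z : (R * R) * R => (eright (z.2, z.1.1) * eright (z.2, z.1.2))%:E)).
    by apply/measurable_EFinP; apply: mee; exact: measurable_eright.
  by move=> z; rewrite lee_fin mulr_ge0 ?eright_ge0.
have mk2 : measurable_fun setT k2.
  apply: (@measurable_fun_fubini_tonelli_F _ _ _ _ _ leb (fun z : (R * R) * R => (eleft (z.2, z.1.1) * eleft (z.2, z.1.2))%:E)).
    by apply/measurable_EFinP; apply: mee; exact: measurable_eleft.
  by move=> z; rewrite lee_fin mulr_ge0 ?eleft_ge0.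
rewrite !(@bilinD (fun z => k1 z + k3 z)%E k2)//; last 4 first.
all: try by [move=> z; rewrite adde_ge0 | exact: emeasurable_funD].
have pd1 : pos_def (fun x y => k1 (x, y)) by apply: (pos_def_int tent_ge0 measurable_tent); exact: pos_def_tent.
have pd3 : pos_def (fun x y => k3 (x, y)) by exact: (pos_def_factor eright_ge0 measurable_eright eright_le1).
have pd13 := pos_defD k10 k30 mk1 mk3 pd1 pd3.
have E := bilin_factor_sqr eleft_ge0 measurable_eleft eleft_le1 m n.
by apply: aux; [exact: pd13|exact: E].
Qed.

Definition upper (w : R) : set R := [set x | w < g x].

Lemma eleft_meanE m w : 0 < w < 1 -> (eleft_mean m w)%:E = m (upper w).
Proof.
move=> w01; rewrite /eleft_mean fineK; last exact: (factor_fin_num eleft_ge0 measurable_eleft eleft_le1).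
have mA : measurable (upper w).
  have := @measurable_preimage R g `]w, +oo[ mg (measurable_itv _).
  by congr measurable; apply/seteqP; split=> x /=; rewrite /upper/= in_itv/= andbT.
have := @integral_indic _ _ R m setT measurableT _ mA; rewrite setIT => <-.
apply: eq_integral => x _; rewrite /eleft/= w01 mul1r indicE.
suff -> : (x \in upper w) = (w < g x) by [].
by apply/idP/idP; rewrite inE.
Qed.

(** A null [L^2] distance gives equality of the tails at almost every level only. Tails are
    monotone, so a gap between the level [w] and a higher level [v] would persist on all of []w,
    v[]; letting [v] decrease to [w] settles every level. *)
Lemma neglog_energy_eq m n :
  (\int[leb]_w ((eleft_mean m w - eleft_mean n w) ^+ 2)%:E <= 0)%E ->
  forall w : R, 0 <= w < 1 -> (m (upper w) <= n (upper w))%E.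
Proof.
move=> S0 w /andP[w0 w1].
have mA v : measurable (upper v).
  have := @measurable_preimage R g `]v, +oo[ mg (measurable_itv _).
  by congr measurable; apply/seteqP; split=> x /=; rewrite /upper/= in_itv/= andbT.
have step v : w < v < 1 -> (m (upper v) <= n (upper w))%E.
  move=> /andP[wv v1]; rewrite leNgt; apply/negP => lt.
  have fm u : m (upper u) \is a fin_num by exact: fin_num_measure.
  have fn u : n (upper u) \is a fin_num by exact: fin_num_measure.
  pose e := fine (m (upper v)) - fine (n (upper w)).
  have e0 : 0 < e by rewrite subr_gt0 -lte_fin !fineK.
  have : (\int[leb]_(u in `]w, v[) (cst (e ^+ 2)%:E) u <= 0)%E.
    apply: le_trans S0; rewrite [leLHS]integral_mkcond.
    apply: ge0_le_integral => //.
    - by move=> u _; apply: erestrict_ge0 => {}u _; rewrite lee_fin sqr_ge0.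
    - apply/(measurable_restrictT (cst (e ^+ 2)%:E)) => //.
    - apply/measurable_EFinP; apply: measurable_funX; apply: measurable_funB.
        apply: measurableT_comp (fine_measurable measurableT) _ => //.
        exact: (measurable_factor eleft_ge0 measurable_eleft).
      apply: measurableT_comp (fine_measurable measurableT) _ => //.
      exact: (measurable_factor eleft_ge0 measurable_eleft).
    - move=> u _; rewrite patchE; case: ifPn => [|_]; last by rewrite lee_fin sqr_ge0.
      rewrite inE/= in_itv/= => /andP[wu uv].
      have u01 : 0 < u < 1 by rewrite (le_lt_trans w0 wu) (lt_trans uv v1).
      rewrite lee_fin ler_sqr ?nnegrE ?(ltW e0)//.
        apply: lerB.
          rewrite -lee_fin fineK// (eleft_meanE _ u01); apply: le_measure; rewrite ?inE//.
          by move=> x /=; exact: lt_trans.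
        rewrite -lee_fin (eleft_meanE _ u01) fineK//; apply: le_measure; rewrite ?inE//.
        by move=> x /=; exact: lt_trans.
      rewrite subr_ge0 -lee_fin !eleft_meanE//.
      apply: (@le_trans _ _ (n (upper w))).
        by apply: le_measure; rewrite ?inE// => x /=; exact: lt_trans.
      apply: (le_trans (ltW lt)).
      by apply: le_measure; rewrite ?inE// => x /=; exact: lt_trans.
  rewrite integral_cst// [X in (_ * X)%E](lebR_oo (ltW wv)) -EFinM lee_fin leNgt.
  have -> // : 0 < e ^+ 2 * (v - w) by apply: mulr_gt0; [exact: exprn_gt0|rewrite subr_gt0].
(* Levels below 1 that decrease strictly to [w]; their upper sets increase to that of [w]. *)
pose v k : R := w + (1 - w) * k.+3%:R^-1.
have -> : upper w = \bigcup_k upper (v k).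
  apply/seteqP; split=> x /=.
    move=> wx.
    have : \forall k \near \oo, (1 - w) * k.+3%:R^-1 < g x - w.
      by apply: (cvgr_lt 0 (cvg_harmonic_scale (1 - w))); rewrite subr_gt0.
    move=> [N _ /(_ N (leqnn N))]/= h; exists N => //=; move: h; rewrite ltrBrDl; exact.
  move=> [k _]/=; rewrite /v; apply: le_lt_trans.
  by rewrite lerDl mulr_ge0 ?invr_ge0// subr_ge0 ltW.
have cv : m (upper (v k)) @[k --> \oo] --> m (\bigcup_k upper (v k)).
  apply: nondecreasing_cvg_mu => //; first exact: bigcup_measurable.
  move=> i j ij; apply/subsetPset => x /=; apply: le_lt_trans.
  rewrite lerD2l ler_wpM2l ?subr_ge0 ?(ltW w1)//.
  by rewrite lef_pV2 ?posrE ?ltr0n// ler_nat !ltnS.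
rewrite -(cvg_lim _ cv)//; apply: lime_le; first by apply/cvg_ex; eexists; exact: cv.
near=> k; apply: le_trans (step (v k) _) _.
  rewrite /v; apply/andP; split.
    by rewrite ltrDl mulr_gt0 ?invr_gt0// subr_gt0.
  rewrite -ltrBrDl -[ltRHS]mulr1 ltr_pM2l ?subr_gt0// invf_lt1 ?ltr0n//.
  by rewrite (ltr_nat _ 1).
apply: le_measure; rewrite ?inE//; first exact: bigcup_measurable.
move=> x /= wx.
have : \forall k \near \oo, (1 - w) * k.+3%:R^-1 < g x - w.
  by apply: (cvgr_lt 0 (cvg_harmonic_scale (1 - w))); rewrite subr_gt0.
by move=> [N _ /(_ N (leqnn N))]/= h; exists N => //=; move: h; rewrite ltrBrDl; exact.
Unshelve. all: by end_near. Qed.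

End log_kernel.
End pos_def.

(** * Iterated integrals on sets, and limits of complex-valued functions *)

Section tonelli_on_sets.
Local Open Scope ereal_scope.
Context d1 d2 (T1 : measurableType d1) (T2 : measurableType d2) (R : realType).
Variables (m1 : {sigma_finite_measure set T1 -> \bar R})
  (m2 : {sigma_finite_measure set T2 -> \bar R}).
Variables (D1 : set T1) (D2 : set T2) (f : T1 * T2 -> \bar R).
Hypotheses (mD1 : measurable D1) (mD2 : measurable D2) (mf : measurable_fun setT f)
  (f0 : forall z, 0 <= f z).

Let F := f \_ (D1 `*` D2).

Let mF : measurable_fun setT F.
Proof.
apply/(measurable_restrictT _ _).1; last exact: measurable_funTS.
exact: measurableX.
Qed.

Let F0 z : 0 <= F z. Proof. by rewrite /F patchE; case: ifPn. Qed.

Let F1 x : \int[m2]_y F (x, y) = ((fun x => \int[m2]_(y in D2) f (x, y)) \_ D1) x.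
Proof.
rewrite patchE; case: ifPn => xD.
  rewrite [RHS]integral_mkcond; apply: eq_integral => y _; rewrite /F !patchE.
  by rewrite in_setX/= xD.
under eq_integral do rewrite /F patchE in_setX/= (negbTE xD).
by rewrite integral0.
Qed.

Let F2 y : \int[m1]_x F (x, y) = ((fun y => \int[m1]_(x in D1) f (x, y)) \_ D2) y.
Proof.
rewrite patchE; case: ifPn => xD.
  rewrite [RHS]integral_mkcond; apply: eq_integral => x _; rewrite /F !patchE.
  by rewrite in_setX/= xD andbT.
under eq_integral do rewrite /F patchE in_setX/= (negbTE xD) andbF.
by rewrite integral0.
Qed.

Lemma tonelli_set : \int[m1]_(x in D1) \int[m2]_(y in D2) f (x, y) =
  \int[m2]_(y in D2) \int[m1]_(x in D1) f (x, y).
Proof.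
rewrite integral_mkcond [RHS]integral_mkcond.
under eq_integral do rewrite -F1.
rewrite (fubini_tonelli F)//.
by apply: eq_integral => y _; exact: F2.
Qed.

Lemma measurable_integral_set : measurable_fun D1 (fun x => \int[m2]_(y in D2) f (x, y)).
Proof.
apply/(measurable_restrictT _ mD1); rewrite [X in measurable_fun _ X](_ : _ = fun x => \int[m2]_y F (x, y)).
  exact: measurable_fun_fubini_tonelli_F.
by apply/funext => x; rewrite F1.
Qed.

End tonelli_on_sets.

Section bounded_fubini.
Context {R : realType}.
Local Notation leb := (@lebR R).
Implicit Types (a b c d : R).

Lemma integral_shift (g : R -> R) a b (M l : R) : a <= b -> measurable_fun `]a, b[ g ->
  (forall y, a < y < b -> `|g y| <= M) ->
  (\int[leb]_(y in `]a, b[) (g y)%:E = l%:E)%E ->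
  (\int[leb]_(y in `]a, b[) (g y + M)%:E = (l + M * (b - a))%:E)%E.
Proof.
move=> ab mg gM gl.
under eq_integral do rewrite EFinD.
rewrite integralD//=.
- rewrite gl -[X in (_ + X)%E = _]/(\int[leb]_(y in `]a, b[) (cst M%:E) y)%E integral_cst//.
  by rewrite [X in (_ + _ * X)%E](lebR_oo ab).
- exact: bounded_integrable_lebR gM.
- by apply: (@bounded_integrable_lebR _ (fun=> M) a b `|M|).
Qed.

Lemma integral_bounded_fine (g : R -> R) a b (k : R) : measurable_fun `]a, b[ g ->
  (forall x, a < x < b -> `|g x| <= k) ->
  (\int[leb]_(x in `]a, b[) (g x)%:E = (fine (\int[leb]_(x in `]a, b[) (g x)%:E))%:E)%E.
Proof.
move=> mg gk; rewrite fineK//; apply: integrable_fin_num => //.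
exact: bounded_integrable_lebR gk.
Qed.

Lemma integral_bounded (g : R -> R) a b (M l : R) : a <= b -> measurable_fun `]a, b[ g ->
  (forall y, a < y < b -> `|g y| <= M) ->
  (\int[leb]_(y in `]a, b[) (g y)%:E = l%:E)%E -> `|l| <= M * (b - a).
Proof.
move=> ab mg gM gl; rewrite -lee_fin -[X in (X <= _)%E]/(`|l%:E|)%E -gl.
have mg' : measurable_fun `]a, b[ (fun x => (g x)%:E) by exact/measurable_EFinP.
have L := le_abse_integral leb (measurable_itv `]a, b[) mg'.
apply: (le_trans L).
rewrite EFinM -[X in (_ * X)%E](lebR_oo ab) -integral_cst; last exact: measurable_itv.
apply: ge0_le_integral => //.
exact: measurableT_comp mg'.
Qed.

(** Fubini's theorem for a bounded kernel of variable sign; this is the exchange that stands in for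
    Cauchy's theorem. Adding [M] reduces it to Tonelli. Measurability of [u] and [v], known only as
    values of integrals, is part of the conclusion. *)
Lemma bounded_fubini_oo (H : R * R -> R) a b c d (M : R) (u v : R -> R) :
  a <= b -> c <= d -> measurable_fun setT H ->
  (forall x y, a < x < b -> c < y < d -> `|H (x, y)| <= M) ->
  (forall x, a < x < b -> (\int[leb]_(y in `]c, d[) (H (x, y))%:E = (u x)%:E)%E) ->
  (forall y, c < y < d -> (\int[leb]_(x in `]a, b[) (H (x, y))%:E = (v y)%:E)%E) ->
  [/\ measurable_fun `]a, b[ u, measurable_fun `]c, d[ v &
  (\int[leb]_(x in `]a, b[) (u x)%:E = \int[leb]_(y in `]c, d[) (v y)%:E)%E].
Proof.
move=> ab cd mH HM Hu Hv.
(* The truncation at 0 acts off the rectangle only, where [H] need not be bounded by [M]. *)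
pose f (z : R * R) : \bar R := (Num.max 0 (H z + M))%:E.
have mf : measurable_fun setT f.
  apply/measurable_EFinP; apply: measurable_maxr => //.
  by apply: measurable_funD.
have f0 z : (0 <= f z)%E by rewrite lee_fin le_max lexx.
have fE x y : a < x < b -> c < y < d -> f (x, y) = (H (x, y) + M)%:E.
  move=> hx hy; rewrite /f max_r//; have := HM _ _ hx hy; rewrite ler_norml => /andP[+ _].
  lra.
have mx x : measurable_fun setT (fun y => H (x, y)).
  exact: measurableT_comp mH (pair1_measurable _).
have my y : measurable_fun setT (fun x => H (x, y)).
  exact: measurableT_comp mH (pair2_measurable _).
have E1 x : a < x < b -> (\int[leb]_(y in `]c, d[) f (x, y) = (u x + M * (d - c))%:E)%E.
  move=> hx; rewrite -(@integral_shift (fun y => H (x, y)))//.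
  - by apply: eq_integral => y; rewrite mem_oo => hy; rewrite fE.
  - exact: measurable_funTS.
  - by move=> y hy; exact: HM.
  - exact: Hu.
have E2 y : c < y < d -> (\int[leb]_(x in `]a, b[) f (x, y) = (v y + M * (b - a))%:E)%E.
  move=> hy; rewrite -(@integral_shift (fun x => H (x, y)))//.
  - by apply: eq_integral => x; rewrite mem_oo => hx; rewrite fE.
  - exact: measurable_funTS.
  - by move=> x hx; exact: HM.
  - exact: Hv.
have mu' : measurable_fun `]a, b[ u.
  have := @measurable_integral_set _ _ _ _ R leb `]a, b[ `]c, d[ f
     (measurable_itv _) (measurable_itv _) mf f0 => m.
  have m2 : measurable_fun `]a, b[ (fun x => u x + M * (d - c)).
    apply/measurable_EFinP; apply: eq_measurable_fun m => x; rewrite mem_oo => hx.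
    exact: E1.
  rewrite (_ : u = fun x => (u x + M * (d - c)) - M * (d - c)).
    exact: measurable_funB.
  by apply/funext => x; rewrite addrK.
have mv' : measurable_fun `]c, d[ v.
  pose f' z := f (z.2, z.1).
  have mf' : measurable_fun setT f'.
    by apply: (measurableT_comp mf); apply: measurable_fun_pair.
  have := @measurable_integral_set _ _ _ _ R leb `]c, d[ `]a, b[ f'
     (measurable_itv _) (measurable_itv _) mf' (fun z => f0 _) => m.
  have m2 : measurable_fun `]c, d[ (fun y => v y + M * (b - a)).
    apply/measurable_EFinP; apply: eq_measurable_fun m => x; rewrite mem_oo => hx.
    exact: E2.
  rewrite (_ : v = fun x => (v x + M * (b - a)) - M * (b - a)).
    exact: measurable_funB.
  by apply/funext => x; rewrite addrK.
split => //.
have T := @tonelli_set _ _ _ _ R leb leb `]a, b[ `]c, d[ f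
     (measurable_itv _) (measurable_itv _) mf f0.
have bu x : a < x < b -> `|u x| <= M * (d - c).
  move=> hx; apply: (integral_bounded cd _ _ (Hu _ hx)); first exact: measurable_funTS.
  by move=> y hy; exact: HM.
have bv y : c < y < d -> `|v y| <= M * (b - a).
  move=> hy; apply: (integral_bounded ab _ _ (Hv _ hy)); first exact: measurable_funTS.
  by move=> x hx; exact: HM.
have I1 := integral_shift ab mu' bu (integral_bounded_fine mu' bu).
have I2 := integral_shift cd mv' bv (integral_bounded_fine mv' bv).
have T1 : (\int[leb]_(x in `]a, b[) \int[leb]_(y in `]c, d[) f (x, y) =
   \int[leb]_(x in `]a, b[) (u x + M * (d - c))%:E)%E.
  by apply: eq_integral => x; rewrite mem_oo => hx; rewrite E1.
have T2 : (\int[leb]_(y in `]c, d[) \int[leb]_(x in `]a, b[) f (x, y) =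
   \int[leb]_(y in `]c, d[) (v y + M * (b - a))%:E)%E.
  by apply: eq_integral => x; rewrite mem_oo => hx; rewrite E2.
move: T; rewrite T1 T2 I1 I2 => -[e].
by rewrite (integral_bounded_fine mu' bu) (integral_bounded_fine mv' bv); congr EFin; lra.
Qed.

End bounded_fubini.

Section complex_limits.
Context {R : realType}.
Local Notation Re := (@complex.Re R).
Local Notation Im := (@complex.Im R).
Implicit Types (w z : R[i]) (b l p : R).

Lemma cmodD w z : cmod (w + z) <= cmod w + cmod z.
Proof. by case: w z => [a b] [c d]; exact: (le_normcD (Complex a b) (Complex c d)). Qed.

Lemma cmodN w : cmod (- w) = cmod w.
Proof. by rewrite /cmod ReN ImN !sqrrN. Qed.

Lemma ler_cmodB w z : cmod w - cmod z <= cmod (w - z).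
Proof. by rewrite lerBlDr; apply: le_trans (cmodD _ _); rewrite subrK. Qed.

Lemma ge_cmod_Im w : `|Im w| <= cmod w.
Proof. by rewrite -sqrtr_sqr ler_sqrt ?lerDr ?sqr_ge0// addr_ge0 ?sqr_ge0. Qed.

Lemma ge_cmod_Re w : `|Re w| <= cmod w.
Proof. by rewrite -sqrtr_sqr ler_sqrt ?lerDl ?sqr_ge0// addr_ge0 ?sqr_ge0. Qed.

Lemma cmod_real (a : R) : cmod a%:C = `|a|.
Proof. by rewrite /cmod/= expr0n addr0 sqrtr_sqr. Qed.

(** Serves to show that the boundary terms [ufun] are of order [e]. The bound comes from
    [atan y <= y] for [y >= 0] and the half-angle formula. *)
Lemma carg_Re_gt0 w : 0 < Re w -> `|carg w| <= `|Im w| / Re w.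
Proof.
move=> r0; rewrite carg_slit; last exact: slit_Re_gt0.
set t := Im w / (cmod w + Re w).
have sgn (y : R) : 0 <= y -> 0 <= atan y <= y.
  move=> y0; apply/andP; split; first by rewrite -[leLHS]atan0 (le_mono (@lt_atan R)).
  have D (x : R) : is_derive x 1 (fun y : R => y - atan y) (1 - 1 / (1 + x ^+ 2)).
    exact: derive_sub (derive_var x) (derive_atan (derive_var x)).
  have [|c _] := @MVT_segment R (fun y => y - atan y) _ 0 y y0 (fun x _ => D x).
    by apply: continuous_subspaceT => x; exact: derive_continuous (D x).
  rewrite atan0 !subr0 => e.
  rewrite -subr_ge0 e mulr_ge0// subr_ge0 ler_pdivrMr.
    by rewrite mul1r lerDl sqr_ge0.
  by rewrite ltr_pwDl// sqr_ge0.
have h : `|atan t| <= `|t|.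
  case: (leP 0 t) => t0.
    by have /andP[a0 a1] := sgn _ t0; rewrite !ger0_norm.
  have t1 : 0 <= - t by rewrite oppr_ge0 ltW.
  have /andP[] := sgn _ t1.
  by rewrite atanN => a0 a1; rewrite -normrN (ltr0_norm t0) ger0_norm.
have m : Re w <= cmod w by apply: le_trans (ge_cmod_Re w); exact: ler_norm.
rewrite normrM (ger0_norm (ler0n _ _)).
apply: (@le_trans _ _ (2 * `|t|)); first by rewrite ler_pM2l.
rewrite /t normrM normfV mulrCA ler_wpM2l// (gtr0_norm (ltr_wpDl _ r0)) ?cmod_ge0//.
rewrite ler_pdivrMr; last by rewrite ltr_wpDl// cmod_ge0.
by rewrite mulrC ler_pdivlMr//; lra.
Qed.

Section ccvg.
Context (T : Type) (F : set_system T) {FF : Filter F}.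
Implicit Types (f g : T -> R[i]).

Definition ccvg f w := Re (f x) @[x --> F] --> Re w /\ Im (f x) @[x --> F] --> Im w.

Lemma ccvg_cst w : ccvg (fun=> w) w.
Proof. by split; exact: cvg_cst. Qed.

Lemma ccvg_add f g w z : ccvg f w -> ccvg g z -> ccvg (fun x => f x + g x) (w + z).
Proof.
move=> [f1 f2] [g1 g2]; split.
  by rewrite ReD; under eq_fun do rewrite ReD; exact: cvgD.
by rewrite ImD; under eq_fun do rewrite ImD; exact: cvgD.
Qed.

Lemma ccvg_opp f w : ccvg f w -> ccvg (fun x => - f x) (- w).
Proof.
move=> [f1 f2]; split.
  by rewrite ReN; under eq_fun do rewrite ReN; exact: cvgN.
by rewrite ImN; under eq_fun do rewrite ImN; exact: cvgN.
Qed.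

Lemma ccvg_mul f g w z : ccvg f w -> ccvg g z -> ccvg (fun x => f x * g x) (w * z).
Proof.
move=> [f1 f2] [g1 g2]; split.
  by rewrite ReM; under eq_fun do rewrite ReM; apply: cvgB; exact: cvgM.
by rewrite ImM; under eq_fun do rewrite ImM; apply: cvgD; exact: cvgM.
Qed.

Lemma ccvg_inv f w : ccvg f w -> w != 0 -> ccvg (fun x => (f x)^-1) w^-1.
Proof.
move=> [f1 f2] w0.
have n0 : Re w ^+ 2 + Im w ^+ 2 != 0 by rewrite sqr_eq0_complex.
have c : (Re (f x) ^+ 2 + Im (f x) ^+ 2)^-1 @[x --> F] --> (Re w ^+ 2 + Im w ^+ 2)^-1.
  by apply: cvgV => //; apply: cvgD; apply: cvgM.
split.
  by rewrite ReV; under eq_fun do rewrite ReV; apply: cvgM.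
by rewrite ImV; under eq_fun do rewrite ImV; apply: cvgM => //; exact: cvgN.
Qed.

Lemma cvg_cmod f w : ccvg f w -> cmod (f x) @[x --> F] --> cmod w.
Proof.
move=> [f1 f2].
have c : Re (f x) ^+ 2 + Im (f x) ^+ 2 @[x --> F] --> Re w ^+ 2 + Im w ^+ 2.
  by apply: cvgD; apply: cvgM.
exact: (@continuous_cvg _ _ _ _ _ _ Num.sqrt _ (@sqrt_continuous R _) c).
Qed.

Lemma cvg_carg f w : ccvg f w -> slit w -> carg (f x) @[x --> F] --> carg w.
Proof.
move=> c sw; have [f1 f2] := c; have cm := cvg_cmod c.
have cs : cmod (f x) + Re (f x) @[x --> F] --> cmod w + Re w by exact: cvgD.
rewrite carg_slit//.
apply: (@cvg_trans _ (2 * atan (Im (f x) / (cmod (f x) + Re (f x))) @[x --> F])).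
  apply: near_eq_cvg; near=> x; rewrite carg_slit// /slit.
  near: x; exact: cvgr_gt cs _ sw.
apply: cvgM; first exact: cvg_cst.
have cq : Im (f x) / (cmod (f x) + Re (f x)) @[x --> F] --> Im w / (cmod w + Re w).
  by apply: cvgM => //; apply: cvgV => //; exact: lt0r_neq0.
exact: (@continuous_cvg _ _ _ _ _ _ atan _ (@continuous_atan R _) cq).
Unshelve. all: by end_near. Qed.

Lemma ccvg_polar (r a : T -> R) (r0 a0 : R) : r x @[x --> F] --> r0 -> a x @[x --> F] --> a0 ->
  ccvg (fun x => polar (r x) (a x)) (polar r0 a0).
Proof.
move=> c1 c2; split => /=; apply: cvgM => //.
  exact: (@continuous_cvg _ _ _ _ _ _ cos _ (@continuous_cos R _) c2).
exact: (@continuous_cvg _ _ _ _ _ _ sin _ (@continuous_sin R _) c2).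
Qed.

Lemma ccvg_ext f g w : (\forall x \near F, f x = g x) -> ccvg f w -> ccvg g w.
Proof.
move=> fg [f1 f2]; split.
  by apply: cvg_trans f1; apply: near_eq_cvg; near=> x; rewrite (near fg x)//.
by apply: cvg_trans f2; apply: near_eq_cvg; near=> x; rewrite (near fg x)//.
Unshelve. all: by end_near. Qed.

Lemma cvg_powR0 (h : T -> R) (l p : R) : 0 < l -> h x @[x --> F] --> l ->
  h x `^ p @[x --> F] --> l `^ p.
Proof.
move=> l0; apply: (@continuous_cvg T _ _ F FF h (fun y : R => y `^ p) l).
exact: derive_continuous (derive_powR p (derive_var l) l0).
Qed.

Lemma ccvg_cpow f w p : ccvg f w -> slit w -> ccvg (fun x => cpow (f x) p) (cpow w p).
Proof.
move=> c sw; have w0 := slit_neq0 sw; have cm := cvg_cmod c.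
have m0 : 0 < cmod w by rewrite cmod_gt0.
rewrite cpowE//; apply: (@ccvg_ext (fun x => polar (cmod (f x) `^ p) (p * carg (f x)))).
  near=> x; rewrite cpowE// -cmod_gt0; near: x; exact: cvgr_gt cm _ m0.
apply: ccvg_polar; first exact: cvg_powR0.
by apply: cvgM; [exact: cvg_cst|exact: cvg_carg].
Unshelve. all: by end_near. Qed.

Lemma cvg_ln (h : T -> R) (l : R) : 0 < l -> h x @[x --> F] --> l -> ln (h x) @[x --> F] --> ln l.
Proof.
move=> l0; apply: (@continuous_cvg T _ _ F FF h (@ln R) l).
exact: continuous_ln.
Qed.

End ccvg.

Lemma bounded_oc (g : R -> R) (b l : R) : 0 < b ->
  (forall x, 0 < x <= b -> {for x, continuous g}) -> g x @[x --> (0 : R)^'+] --> l ->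
  exists M, forall x, 0 < x <= b -> `|g x| <= M.
Proof.
move=> b0 cg gl.
have : \forall x \near (0:R)^'+, `|g x| < `|l| + 1.
  apply: (@cvgr_lt _ _ _ _ (fun x => `|g x|) _ (cvg_norm gl)); lra.
move=> [e /= e0 He].
pose a := Num.min (e / 2) b.
have a0 : 0 < a by rewrite lt_min b0 divr_gt0.
have ab : a <= b by rewrite ge_min lexx orbT.
have ca : {within `[a, b], continuous (fun x => `|g x|)}.
  apply: continuous_in_subspaceT => y; rewrite inE/= in_itv/= => /andP[y1 y2].
  by apply: cvg_norm; apply: cg; rewrite y2 (lt_le_trans a0).
have [c cab Hc] := EVT_max ab ca.
exists (Num.max (`|l| + 1) `|g c|) => x /andP[x0 xb]; rewrite le_max.
have [xa|ax] := leP a x.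
  by rewrite Hc ?orbT// in_itv/= xa xb.
rewrite ltW//; apply: He => //=.
rewrite sub0r normrN gtr0_norm//; apply: (lt_le_trans ax).
by rewrite ge_min ler_pdivrMr// ler_pMr// ler1n.
Qed.

(** Bernoulli's inequality for real exponents, obtained from Young's inequality for the product
    [u * 1]. *)
Lemma bernoulli_powR (u p : R) : 1 < p -> 0 <= u -> 1 + p * (u - 1) <= u `^ p.
Proof.
move=> p1 u0; have p0 : 0 < p by exact: lt_trans p1.
have pn := lt0r_neq0 p0.
have q0 : 0 < p / (p - 1) by rewrite divr_gt0// subr_gt0.
have pn1 : p - 1 != 0 by rewrite lt0r_neq0// subr_gt0.
have := @conjugate_powR R u 1 p (p / (p - 1)) u0 ler01 p0 q0.
rewrite powR1 mulr1 => /(_ _).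
have e : p^-1 + (p / (p - 1))^-1 = 1 by field; rewrite pn pn1.
move=> /(_ e); have -> : 1 / (p / (p - 1)) = 1 - p^-1 by field; rewrite pn pn1.
move=> h; rewrite -(ler_pM2l (x := p^-1)) ?invr_gt0//.
have -> : p^-1 * (1 + p * (u - 1)) = u - (1 - p^-1) by field.
by rewrite (mulrC p^-1); lra.
Qed.

End complex_limits.

(** * Parametrisation of the arcs *)

Section angular_parametrisation.
Context {R : realType}.
Variable th : R.
Hypothesis th0 : 0 < th.
Implicit Types (a f g k p x y t u v : R).

(* The upper arc is [f |-> sin f / sin (th f) * e^(i (1 + th) f)], [0 < f < phim],
   and [Jc th c] takes the value [c * Xf f] on it. *)
Definition phim : R := pi / (1 + th).
Definition pexp : R := 1 + th^-1.
(** At the point [s] of the upper arc with angle [f], [Rq] is [1 / |s|] and [Rw] is [|(s + 1) / s|],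
    so [Xf] is the modulus of [J_1(s)]; [Bx] is the value of [J_1] at [1 / th]. *)
Definition Rq f : R := sin (th * f) / sin f.
Definition Rw f : R := sin ((1 + th) * f) / sin f.
Definition Xf f : R := Rw f `^ pexp / Rq f.
Definition Bx : R := (1 + th) `^ pexp / th.

Lemma th1_gt0 : 0 < 1 + th. Proof. by rewrite addr_gt0. Qed.
Let th1 := th1_gt0.

Lemma phim_gt0 : 0 < phim.
Proof. by rewrite divr_gt0 ?pi_gt0. Qed.

Lemma phimE : (1 + th) * phim = pi.
Proof. by rewrite /phim mulrC divfK// lt0r_neq0. Qed.

Lemma pexp_gt1 : 1 < pexp. Proof. by rewrite ltrDl invr_gt0. Qed.

Lemma pexp_th : pexp * th = 1 + th.
Proof. by rewrite /pexp mulrDl mul1r mulVf ?lt0r_neq0// addrC. Qed.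

Lemma Bx_gt0 : 0 < Bx.
Proof. by rewrite divr_gt0 ?powR_gt0. Qed.

Lemma angle_bounds f : 0 < f < phim ->
  [/\ 0 < f < pi, 0 < th * f < pi & 0 < (1 + th) * f < pi].
Proof.
move=> /andP[f0 fm].
have h : (1 + th) * f < pi by rewrite -phimE ltr_pM2l.
have tf : 0 < th * f by rewrite mulr_gt0.
by split; apply/andP; split => //; lra.
Qed.

Lemma sin_f_gt0 f : 0 < f < phim -> 0 < sin f.
Proof. by move=> /angle_bounds[h _ _]; exact: sin_gt0_pi. Qed.
Lemma sin_thf_gt0 f : 0 < f < phim -> 0 < sin (th * f).
Proof. by move=> /angle_bounds[_ h _]; exact: sin_gt0_pi. Qed.
Lemma sin_alf_gt0 f : 0 < f < phim -> 0 < sin ((1 + th) * f).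
Proof. by move=> /angle_bounds[_ _ h]; exact: sin_gt0_pi. Qed.

Lemma Rq_gt0 f : 0 < f < phim -> 0 < Rq f.
Proof. by move=> h; exact: divr_gt0 (sin_thf_gt0 h) (sin_f_gt0 h). Qed.
Lemma Rw_gt0 f : 0 < f < phim -> 0 < Rw f.
Proof. by move=> h; exact: divr_gt0 (sin_alf_gt0 h) (sin_f_gt0 h). Qed.
Lemma Xf_gt0 f : 0 < f < phim -> 0 < Xf f.
Proof. by move=> h; rewrite divr_gt0 ?powR_gt0 ?Rw_gt0 ?Rq_gt0. Qed.

(** The squared modulus of [th sin f - sin (th f) e^(i (1 + th) f)], see [NfE]. The function [xl] is
    minus the logarithmic derivative of [Xf], and its positivity makes [Xf] decreasing. *)
Definition Nf f : R := th ^+ 2 * sin f ^+ 2 -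
  2 * th * sin f * sin (th * f) * cos ((1 + th) * f) + sin (th * f) ^+ 2.

Definition xl f : R := Nf f / (th * sin f * sin (th * f) * sin ((1 + th) * f)).

Lemma NfE f : Nf f = (th * sin f - sin (th * f) * cos ((1 + th) * f)) ^+ 2 +
  (sin (th * f) * sin ((1 + th) * f)) ^+ 2.
Proof. move: (cos2Dsin2 ((1 + th) * f)); rewrite /Nf.
set C := cos ((1 + th) * f); set S := sin ((1 + th) * f) => e.
have eS : S ^+ 2 = 1 - C ^+ 2 by rewrite -e; ring.
by rewrite [(_ * S) ^+ 2]exprMn eS; ring. Qed.

Lemma Nf_gt0 f : 0 < f < phim -> 0 < Nf f.
Proof.
move=> h; rewrite NfE; apply: ltr_wpDl; first exact: sqr_ge0.
by rewrite exprn_gt0// mulr_gt0 ?sin_thf_gt0 ?sin_alf_gt0.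
Qed.

Lemma xl_den_gt0 f : 0 < f < phim -> 0 < th * sin f * sin (th * f) * sin ((1 + th) * f).
Proof. move=> h; have s1 := sin_f_gt0 h; have s2 := sin_thf_gt0 h; have s3 := sin_alf_gt0 h.
by rewrite mulr_gt0// mulr_gt0// mulr_gt0. Qed.

Lemma xl_gt0 f : 0 < f < phim -> 0 < xl f.
Proof. by move=> h; rewrite divr_gt0 ?Nf_gt0 ?xl_den_gt0. Qed.

Lemma cos_f_sin_al f : cos f * sin ((1 + th) * f) = sin (th * f) + cos ((1 + th) * f) * sin f.
Proof.
have -> : th * f = (1 + th) * f - f by ring.
by rewrite sinB; ring.
Qed.

Lemma cos_thf_sin_al f :
  cos (th * f) * sin ((1 + th) * f) = sin f + cos ((1 + th) * f) * sin (th * f).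
Proof.
have {3}-> : f = (1 + th) * f - th * f by ring.
by rewrite sinB; ring.
Qed.

Lemma derive_Rq f : 0 < f < phim -> is_derive f 1 Rq
  ((th * cos (th * f) * sin f - sin (th * f) * cos f) / sin f ^+ 2).
Proof.
move=> h; apply: (is_derive_eq (derive_div (derive_sin_scale th f)
  (derive_sin (derive_var f)) (lt0r_neq0 (sin_f_gt0 h)))).
by rewrite mulr1.
Qed.

Lemma derive_Rw f : 0 < f < phim -> is_derive f 1 Rw
  (((1 + th) * cos ((1 + th) * f) * sin f - sin ((1 + th) * f) * cos f) / sin f ^+ 2).
Proof.
move=> h; apply: (is_derive_eq (derive_div (derive_sin_scale (1 + th) f)
  (derive_sin (derive_var f)) (lt0r_neq0 (sin_f_gt0 h)))).
by rewrite mulr1.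
Qed.

Lemma derive_Xf f : 0 < f < phim -> is_derive f 1 Xf (- (Xf f * xl f)).
Proof.
move=> h; have q0 := Rq_gt0 h; have w0 := Rw_gt0 h.
have s0 := lt0r_neq0 (sin_f_gt0 h); have t0 := lt0r_neq0 (sin_thf_gt0 h).
have a0 := lt0r_neq0 (sin_alf_gt0 h); have thn := lt0r_neq0 th0.
apply: (is_derive_eq (derive_div (derive_powR pexp (derive_Rw h) w0) (derive_Rq h)
  (lt0r_neq0 q0))).
have -> : Xf f = Rw f `^ pexp / Rq f by [].
set P := Rw f `^ pexp.
have -> : xl f = Nf f / (th * sin f * sin (th * f) * sin ((1 + th) * f)) by [].
have := cos_f_sin_al f; have := cos_thf_sin_al f; rewrite /Nf /Rw /Rq /pexp.
set s := sin f in s0 *; set t := sin (th * f) in t0 *; set a := sin ((1 + th) * f) in a0 *.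
(* The two relations eliminate [cos f] and [cos (th f)]; what remains is a rational identity in
   three sines and one cosine. *)
set C := cos ((1 + th) * f); move=> /(canRL (mulfK a0)) -> /(canRL (mulfK a0)) ->.
by field; rewrite s0 t0 a0 thn.
Qed.

Lemma Xf_continuous f : 0 < f < phim -> {for f, continuous Xf}.
Proof. by move=> h; exact: derive_continuous (derive_Xf h). Qed.

Lemma Xf_decr f g : 0 < f -> f < g -> g < phim -> Xf g < Xf f.
Proof.
move=> f0 fg gm.
apply: (@ltr0_derive1_lt_oo R Xf 0 phim); rewrite ?in_itv/= ?f0 ?gm ?(lt_trans f0)//.
- by move=> x; rewrite in_itv/= => h; have [] := derive_Xf h.
- move=> x; rewrite in_itv/= => h; rewrite derive1E (derive_val (is_derive := derive_Xf h)).
  by rewrite oppr_lt0 mulr_gt0 ?Xf_gt0 ?xl_gt0.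
- by move=> x; rewrite inE/= in_itv/=; exact: Xf_continuous.
- by rewrite (lt_trans fg).
Qed.

Lemma Xf_lt f g : 0 < f < phim -> 0 < g < phim -> (Xf f < Xf g) = (g < f).
Proof.
move=> /andP[f0 fm] /andP[g0 gm]; case: (ltgtP f g) => fg.
- by apply/negbTE; rewrite -leNgt ltW// Xf_decr.
- by rewrite Xf_decr.
- by rewrite fg ltxx.
Qed.

Lemma cvg_sin_ratio k : sin (k * f) / sin f @[f --> (0 : R)^'+] --> k.
Proof.
have pi2 : 0 < pi / 2 :> R by rewrite divr_gt0 ?pi_gt0.
apply: (@lhopital_at_right R (fun f => sin (k * f)) (fun f => k * cos (k * f))
   sin cos 0 (pi / 2) k) => //.
- by move=> x _; exact: derive_sin_scale.
- rewrite -[X in _ --> X](_ : sin (k * 0) = 0); last by rewrite mulr0 sin0.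
  apply: cvg_at_right_filter; exact: derive_continuous (derive_sin_scale k 0).
- rewrite -[X in _ --> X]sin0; apply: cvg_at_right_filter; exact: continuous_sin.
- move=> x; rewrite in_itv/= => /andP[x0 x1]; apply: lt0r_neq0; apply: cos_gt0_pihalf.
  by rewrite x1 andbT (lt_trans _ x0)// oppr_lt0.
- rewrite -[X in _ --> X](_ : k * cos (k * 0) / cos 0 = k); last first.
    by rewrite mulr0 cos0 divr1 mulr1.
  apply: cvgM.
    apply: cvgM; first exact: cvg_cst.
    apply: cvg_at_right_filter; exact: derive_continuous (derive_cos_scale k 0).
  apply: cvgV; first by rewrite cos0 oner_neq0.
  by apply: cvg_at_right_filter; exact: continuous_cos.
Qed.

Lemma powR_continuous_pos p x : 0 < x -> {for x, continuous (fun y : R => y `^ p)}.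
Proof. by move=> x0; exact: derive_continuous (derive_powR p (derive_var x) x0). Qed.

Lemma cvg_powR_pos (T : Type) (F : set_system T) (FF : Filter F) (h : T -> R) (l p : R) :
  0 < l -> h z @[z --> F] --> l -> h z `^ p @[z --> F] --> l `^ p.
Proof.
move=> l0; exact: (@continuous_cvg T _ _ F FF h (fun y : R => y `^ p) l (powR_continuous_pos l0)).
Qed.

Lemma cvg_Rq0 : Rq f @[f --> 0^'+] --> th.
Proof. exact: cvg_sin_ratio. Qed.

Lemma cvg_Xf0 : Xf f @[f --> 0^'+] --> Bx.
Proof.
apply: cvgM; last by apply: cvgV; [exact: lt0r_neq0|exact: cvg_Rq0].
have c : Rw f @[f --> 0^'+] --> 1 + th := @cvg_sin_ratio (1 + th).
exact: cvg_powR_pos c.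
Qed.

Lemma sin_pi_sub x : sin (pi - x) = sin x.
Proof. by rewrite sinB sinpi cospi mul0r sub0r mulN1r opprK. Qed.

Lemma phim_lt_pi : 0 < phim < pi.
Proof. by rewrite phim_gt0/= -phimE ltr_pMl ?phim_gt0// ltrDl. Qed.

Lemma sin_phim_gt0 : 0 < sin phim.
Proof. exact: sin_gt0_pi phim_lt_pi. Qed.

Lemma Rq_phim : Rq phim = 1.
Proof.
have e : th * phim = pi - phim by rewrite -phimE; ring.
by rewrite /Rq e sin_pi_sub divff// lt0r_neq0// sin_phim_gt0.
Qed.

Lemma Rw_phim : Rw phim = 0.
Proof. by rewrite /Rw phimE sinpi mul0r. Qed.

Lemma sin_ratio_continuous k f : sin f != 0 -> {for f, continuous (fun f => sin (k * f) / sin f)}.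
Proof.
move=> h; exact: derive_continuous (derive_div (derive_sin_scale k f) (derive_sin (derive_var f)) h).
Qed.

Lemma cvg_Rqm : Rq f @[f --> phim^'-] --> (1 : R).
Proof.
rewrite -[X in _ --> X]Rq_phim; apply: cvg_at_left_filter.
by apply: sin_ratio_continuous; rewrite lt0r_neq0// sin_phim_gt0.
Qed.

Lemma cvg_Rwm : Rw f @[f --> phim^'-] --> (0 : R).
Proof.
rewrite -[X in _ --> X]Rw_phim; apply: cvg_at_left_filter.
by apply: sin_ratio_continuous; rewrite lt0r_neq0// sin_phim_gt0.
Qed.

Lemma cvg_Xfm : Xf f @[f --> phim^'-] --> (0 : R).
Proof.
rewrite -[X in _ --> X](_ : 0 * 1^-1 = 0); last by rewrite mul0r.
apply: cvgM; last by apply: cvgV; [exact: oner_neq0|exact: cvg_Rqm].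
apply: (@squeeze_cvgr _ _ _ _ (cst 0) Rw); [|exact: cvg_cst|exact: cvg_Rwm].
near=> f; rewrite /= powR_ge0/=.
have w1 : Rw f < 1 by near: f; apply: cvgr_lt cvg_Rwm _ _.
have f1 : 0 < f by near: f; apply: nbhs_left_gt; exact: phim_gt0.
have f2 : f < phim by near: f; exact: nbhs_left_lt.
have w0 := Rw_gt0 (introT andP (conj f1 f2)).
rewrite -[leRHS]powRr1 ?(ltW w0)//; apply: ger_powR; first by rewrite w0 ltW.
exact: ltW pexp_gt1.
Unshelve. all: by end_near. Qed.

Lemma Xf_ltB f : 0 < f < phim -> Xf f < Bx.
Proof.
move=> /andP[f0 fm].
have h2 : 0 < f / 2 by rewrite divr_gt0.
have h3 : f / 2 < f by rewrite ltr_pdivrMr// ltr_pMr// ltr1n.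
apply: (lt_le_trans (Xf_decr h2 h3 fm)).
apply: (@cvgr_to_ge _ _ _ _ _ _ _ cvg_Xf0); near=> g.
apply: ltW; apply: Xf_decr; last exact: lt_trans fm.
  by near: g; exact: nbhs_right_gt.
by near: g; exact: nbhs_right_lt.
Unshelve. all: by end_near. Qed.

Lemma Xf_range f : 0 < f < phim -> 0 < Xf f < Bx.
Proof. by move=> h; rewrite Xf_gt0// Xf_ltB. Qed.

Lemma Xf_surj x : 0 < x < Bx -> exists2 f, 0 < f < phim & Xf f = x.
Proof.
move=> /andP[x0 xB].
have [f1 [f10 f1m f1x]] : exists f1, [/\ 0 < f1, f1 < phim / 2 & x < Xf f1].
  have : \forall f \near 0^'+, [/\ 0 < f, f < phim / 2 & x < Xf f].
    near=> f; split; near: f; first exact: nbhs_right_gt.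
      by apply: nbhs_right_lt; rewrite divr_gt0 ?phim_gt0.
    exact: cvgr_gt cvg_Xf0 _ xB.
  by move=> /filter_ex[f hf]; exists f.
have [f2 [f20 f2m f2x]] : exists f2, [/\ phim / 2 < f2, f2 < phim & Xf f2 < x].
  have : \forall f \near phim^'-, [/\ phim / 2 < f, f < phim & Xf f < x].
    near=> f; split; near: f; [|exact: nbhs_left_lt|exact: cvgr_lt cvg_Xfm _ x0].
    by apply: nbhs_left_gt; rewrite ltr_pdivrMr// ltr_pMr ?phim_gt0// ltr1n.
  by move=> /filter_ex[f hf]; exists f.
have f12 := lt_trans f1m f20.
have cX : {within `[f1, f2], continuous Xf}.
  apply: continuous_in_subspaceT => y; rewrite inE/= in_itv/= => /andP[y1 y2].
  by apply: Xf_continuous; rewrite (lt_le_trans f10 y1) (le_lt_trans y2 f2m).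
have hx : Num.min (Xf f1) (Xf f2) <= x <= Num.max (Xf f1) (Xf f2).
  by rewrite ge_min le_max (ltW f2x) (ltW f1x) orbT.
have [c] := IVT (ltW f12) cX hx.
rewrite in_itv/= => /andP[c1 c2] cx; exists c => //.
by rewrite (lt_le_trans f10 c1) (le_lt_trans c2 f2m).
Unshelve. all: by end_near. Qed.

(* extended to [R] by the values at the endpoints, [Phi 0 = phim] and [Phi Bx = 0] *)
Definition Phi x : R := if x <= 0 then phim else if Bx <= x then 0 else
  xget 0 [set f | 0 < f < phim /\ Xf f = x].

Lemma PhiP x : 0 < x < Bx -> 0 < Phi x < phim /\ Xf (Phi x) = x.
Proof.
move=> h; have [f fh fx] := Xf_surj h.
move: (h) => /andP[x0 xB]; rewrite /Phi leNgt x0/= leNgt xB/=.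
by case: xgetP => [y _ []//|/(_ f)]/=; case.
Qed.

Lemma Phi_range x : 0 < x < Bx -> 0 < Phi x < phim. Proof. by move=> /PhiP[]. Qed.
Lemma PhiK x : 0 < x < Bx -> Xf (Phi x) = x. Proof. by move=> /PhiP[]. Qed.

Lemma Xf_inj f g : 0 < f < phim -> 0 < g < phim -> Xf f = Xf g -> f = g.
Proof.
move=> hf hg e; case: (ltgtP f g) => // fg; exfalso.
  by have := Xf_lt hg hf; rewrite e ltxx fg.
by have := Xf_lt hf hg; rewrite e ltxx fg.
Qed.

Lemma XfK f : 0 < f < phim -> Phi (Xf f) = f.
Proof.
move=> h; have [h1 h2] := PhiP (Xf_range h); exact: Xf_inj.
Qed.

Lemma Phi0 : Phi 0 = phim. Proof. by rewrite /Phi lexx. Qed.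
Lemma PhiB : Phi Bx = 0. Proof. by rewrite /Phi leNgt Bx_gt0/= lexx. Qed.

Lemma Xf_lt_Phi f y : 0 < f < phim -> 0 <= y <= Bx -> (Xf f < y) = (Phi y < f).
Proof.
move=> h; rewrite !le_eqVlt => /andP[/orP[/eqP <-|y0]].
  move=> _; rewrite Phi0; move: (h) => /andP[f0 fm].
  by rewrite (ltNge phim) (ltW fm)/= ltNge ltW// Xf_gt0.
move=> /orP[/eqP ->|yB].
  by rewrite PhiB Xf_ltB//; case/andP: h => ->.
have [h1 h2] := PhiP (introT andP (conj y0 yB)).
by rewrite -{1}h2 Xf_lt.
Qed.

Lemma lt_Xf_Phi f y : 0 < f < phim -> 0 <= y <= Bx -> (y < Xf f) = (f < Phi y).
Proof.
move=> h; rewrite !le_eqVlt => /andP[/orP[/eqP <-|y0]].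
  by move=> _; rewrite Phi0 Xf_gt0//; case/andP: h.
move=> /orP[/eqP ->|yB].
  rewrite PhiB; move: (h) => /andP[f0 fm].
  by rewrite (ltNge f) (ltW f0)/= ltNge ltW// Xf_ltB.
have [h1 h2] := PhiP (introT andP (conj y0 yB)).
by rewrite -{1}h2 Xf_lt.
Qed.

Lemma Phi_ge0 y : 0 <= y <= Bx -> 0 <= Phi y <= phim.
Proof.
rewrite !le_eqVlt => /andP[/orP[/eqP <-|y0]].
  by rewrite Phi0 eqxx phim_gt0 orbT.
move=> /orP[/eqP ->|yB]; first by rewrite PhiB eqxx phim_gt0 orbT.
by have /andP[-> ->] := Phi_range (introT andP (conj y0 yB)); rewrite !orbT.
Qed.

Lemma Phi_decr u v : 0 <= u -> u < v -> v <= Bx -> Phi v < Phi u.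
Proof.
rewrite le_eqVlt => /orP[/eqP <-|u0] uv.
  rewrite Phi0 le_eqVlt => /orP[/eqP ->|vB]; first by rewrite PhiB phim_gt0.
  by have /andP[] := Phi_range (introT andP (conj uv vB)).
move=> vB; have hu : 0 < u < Bx by rewrite u0 (lt_le_trans uv).
by rewrite -Xf_lt_Phi ?Phi_range ?PhiK// vB (ltW (lt_trans u0 uv)).
Qed.

Lemma derive_Phi x : 0 < x < Bx -> is_derive x 1 Phi (- (xl (Phi x))^-1 / x).
Proof.
move=> h; have [h1 h2] := PhiP h; have x0 : x != 0 by case/andP: h => /lt0r_neq0.
have nr : \forall g \near Phi x, 0 < g < phim.
  by case/andP: h1 => p0 pm; near=> g; apply/andP; split; near: g;
    [exact: lt_nbhsr|exact: lt_nbhsl].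
rewrite -{1}h2.
have -> : - (xl (Phi x))^-1 / x = (- (Xf (Phi x) * xl (Phi x)))^-1.
  by rewrite h2; field; rewrite x0 lt0r_neq0// xl_gt0.
apply: is_derive_inverse (derive_Xf h1) _.
- by near=> g; apply: XfK; near: g.
- by near=> g; apply: Xf_continuous; near: g.
- by rewrite oppr_eq0 lt0r_neq0// mulr_gt0 ?Xf_gt0 ?xl_gt0.
Unshelve. all: by end_near. Qed.

Lemma Phi_continuous x : 0 < x < Bx -> {for x, continuous Phi}.
Proof. by move=> h; exact: derive_continuous (derive_Phi h). Qed.

(* [- x Phi'(x)], since [xl] is minus the logarithmic derivative of [Xf] *)
Definition Df x : R := if 0 < x < Bx then (xl (Phi x))^-1 else 0.

Lemma DfE x : 0 < x < Bx -> Df x = (xl (Phi x))^-1.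
Proof. by rewrite /Df => ->. Qed.

Lemma Df_ge0 x : 0 <= Df x.
Proof. by rewrite /Df; case: ifPn => // h; rewrite invr_ge0 ltW// xl_gt0// Phi_range. Qed.

Lemma Df_gt0 x : 0 < x < Bx -> 0 < Df x.
Proof. by move=> h; rewrite DfE// invr_gt0 xl_gt0// Phi_range. Qed.

Lemma xl_continuous f : 0 < f < phim -> {for f, continuous xl}.
Proof.
move=> h.
have ds := derive_sin (derive_var f); have dt := derive_sin_scale th f.
have da := derive_sin_scale (1 + th) f; have dc := derive_cos_scale (1 + th) f.
have den := derive_mul (derive_mul (derive_mul (derive_const th f) ds) dt) da.
have num := derive_add (derive_sub (derive_mul (derive_const (th ^+ 2) f) (derive_mul ds ds))
  (derive_mul (derive_mul (derive_mul (derive_const (2 * th) f) ds) dt) dc)) (derive_mul dt dt).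
exact: derive_continuous (derive_div num den (lt0r_neq0 (xl_den_gt0 h))).
Qed.

Lemma Df_continuous x : 0 < x < Bx -> {for x, continuous Df}.
Proof.
move=> h; have hp := Phi_range h.
have nr : \forall g \near x, 0 < g < Bx.
  by case/andP: h => p0 pm; near=> g; apply/andP; split; near: g;
    [exact: lt_nbhsr|exact: lt_nbhsl].
suff : Df y @[y --> x] --> (xl (Phi x))^-1 by rewrite -DfE.
apply: (@cvg_trans _ ((xl (Phi y))^-1 @[y --> x])).
  apply: near_eq_cvg; near=> y; rewrite DfE//; near: y; exact: nr.
have xn : xl (Phi x) != 0 by rewrite lt0r_neq0// xl_gt0.
apply: (@continuous_cvg _ _ _ _ (nbhs_filter x) (fun y => xl (Phi y)) GRing.inv _ (inv_continuous xn)).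
by apply: continuous_cvg (Phi_continuous h); exact: xl_continuous.
Unshelve. all: by end_near. Qed.

Lemma measurable_Df : measurable_fun setT Df.
Proof.
rewrite (_ : Df = Df \_ `]0, Bx[); first exact: measurable_patch_oo Df_continuous.
apply/funext => x; rewrite patchE mem_oo; case: ifPn => // h.
by rewrite /Df (negbTE h).
Qed.

Lemma measurable_sin_scale k : measurable_fun setT (fun f : R => sin (k * f)).
Proof.
apply: continuous_measurable_fun => f; exact: derive_continuous (derive_sin_scale k f).
Qed.

Lemma measurable_sinR : measurable_fun setT (sin : R -> R).
Proof. by apply: continuous_measurable_fun; exact: continuous_sin. Qed.

Lemma measurable_Rq : measurable_fun setT Rq.
Proof.
apply: measurable_funM; first exact: measurable_sin_scale.
exact: measurable_inv measurable_sinR.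
Qed.

Lemma measurable_Xf : measurable_fun setT Xf.
Proof.
apply: measurable_funM; last exact: measurable_inv measurable_Rq.
apply: (measurableT_comp (measurable_powR pexp)).
apply: measurable_funM; first exact: measurable_sin_scale.
exact: measurable_inv measurable_sinR.
Qed.

(** Substitution [x = Xf f]: as [df = - (Df x / x) dx], the image of Lebesgue measure on the angles
    has density [Df x / x]. *)
Lemma integral_Xf_lebesgue (k : R -> \bar R) : measurable_fun setT k ->
  (forall x, (0 <= k x)%E) ->
  (\int[lebesgue_measure]_(f in `]0%R, phim[) k (Xf f) =
   \int[lebesgue_measure]_(x in `]0%R, Bx[) (k x * (Df x / x)%:E))%E.
Proof.
move=> mk k0; apply/esym.
apply: etrans (_ : (\int[lebesgue_measure]_(f in `]0%R, phim[)
  (k (Xf f) * (Df (Xf f) / Xf f)%:E * (Xf f * xl f)%:E))%E = _).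
  apply: (@ge0_change_of_variables_decr R (fun f => Xf f * xl f) Xf Phi 0 phim 0 Bx
    (fun x => k x * (Df x / x)%:E)%E).
- exact: measurable_Xf.
- by move=> f h; rewrite ltW// mulr_gt0 ?Xf_gt0 ?xl_gt0.
- by move=> f h; apply: cvgM; [exact: Xf_continuous|exact: xl_continuous].
- exact: derive_Xf.
- exact: Xf_range.
- exact: Phi_ge0.
- exact: Xf_lt_Phi.
- exact: lt_Xf_Phi.
- exact: Phi_decr.
- move=> y /andP[]; rewrite le_eqVlt => /orP[/eqP <- _|y0 yB].
    by rewrite Phi0; exact: cvg_Xfm.
  have h := introT andP (conj y0 yB).
  by rewrite -[X in _ --> X](PhiK h); apply: cvg_at_left_filter; apply: Xf_continuous; exact: Phi_range.
- move=> y /andP[y0]; rewrite le_eqVlt => /orP[/eqP ->|yB].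
    by rewrite PhiB; exact: cvg_Xf0.
  have h := introT andP (conj y0 yB).
  by rewrite -[X in _ --> X](PhiK h); apply: cvg_at_right_filter; apply: Xf_continuous; exact: Phi_range.
- apply: measurable_funTS; apply: emeasurable_funM => //; apply/measurable_EFinP.
  by apply: measurable_funM; [exact: measurable_Df|exact: measurable_funV].
- move=> x /andP[x0 _]; rewrite mule_ge0// lee_fin mulr_ge0 ?Df_ge0// invr_ge0 ltW//.
apply: eq_integral => f; rewrite mem_oo => h.
  have X0 := lt0r_neq0 (Xf_gt0 h); have x0 := lt0r_neq0 (xl_gt0 h).
  rewrite -muleA -EFinM (DfE (Xf_range h)) XfK//.
  by rewrite (_ : _ * _ = 1) ?mule1//; field; rewrite X0 x0.
Qed.

Lemma integral_Xf (c : R) (k : R -> \bar R) : 0 < c -> measurable_fun setT k ->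
  (forall x, (0 <= k x)%E) ->
  (\int[lebR]_(f in `]0%R, phim[) k (c * Xf f)%R =
   \int[lebR]_(x in `]0%R, (c * Bx)%R[) (k x * (Df (x / c) / x)%:E))%E.
Proof.
move=> c0 mk k0.
have mkc : measurable_fun setT (fun x : R => k (c * x)%R).
  by apply: (measurableT_comp mk); exact: measurable_funM.
have mD : measurable_fun setT (fun x : R => Df (x / c) / x).
  apply: measurable_funM; last exact: measurable_funV.
  by apply: (measurableT_comp measurable_Df); exact: measurable_funM.
have mkD : measurable_fun setT (fun x => k x * (Df (x / c) / x)%:E)%E.
  by apply: emeasurable_funM => //; exact/measurable_EFinP.
rewrite -!integral_lebR//; last 2 first.
- exact: measurable_funTS.
- apply: measurable_funTS; apply: (measurableT_comp mkc); exact: measurable_Xf.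
apply: etrans (@integral_Xf_lebesgue (fun x => k (c * x)%R) mkc (fun x => k0 _)) _.
rewrite (@ge0_change_of_variables_scale R c Bx) ?Bx_gt0//.
- apply: eq_integral => x; rewrite mem_oo => /andP[x0 xB].
  rewrite -muleA -EFinM; congr (_ * _%:E)%E.
  have xn := lt0r_neq0 x0; have cn := lt0r_neq0 c0.
  have -> : c * x / c = x by field.
  by field; rewrite xn cn.
- exact: measurable_funTS.
- move=> x /andP[x0 _]; rewrite mule_ge0// lee_fin mulr_ge0 ?Df_ge0// invr_ge0 ltW//.
Qed.

End angular_parametrisation.

(** * The logarithmic integral along the arc *)

Section logarithmic_integral.
Context {R : realType}.
Variable th : R.
Hypothesis th0 : 0 < th.
Local Notation Re := (@complex.Re R).
Local Notation Im := (@complex.Im R).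
Local Notation phm := (phim th).
Local Notation p := (pexp th).
Local Notation X := (Xf th).
Local Notation B := (Bx th).
Local Notation leb := (@lebR R).
Implicit Types (z : R[i]) (k f x e : R).

Lemma realM_polar (k r a : R) : k%:C * polar r a = polar (k * r) a.
Proof. by apply: complex_eq; rewrite ?ReM ?ImM/= !mul0r ?subr0 ?addr0 mulrA. Qed.

Lemma Im_realM (k : R) z : Im (k%:C * z) = k * Im z.
Proof. by rewrite ImM/= mul0r addr0. Qed.

Definition dRq f : R := (th * cos (th * f) * sin f - sin (th * f) * cos f) / sin f ^+ 2.

Lemma sin_gt0_phim f : 0 < f <= phm -> 0 < sin f.
Proof.
move=> /andP[f0 fm]; apply: sin_gt0_pi; rewrite f0 (le_lt_trans fm)//.
by case/andP: (phim_lt_pi th0).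
Qed.

(** The quotient is 0/0 at angle 0; after cancellation the derivative of the numerator is
    [(1 - th^2) sin (th f) sin f], of second order. The limit serves to bound [dRq] on the whole
    arc. *)
Lemma cvg_dRq0 : dRq f @[f --> (0 : R)^'+] --> (0 : R).
Proof.
have pi2 : 0 < pi / 2 :> R by rewrite divr_gt0 ?pi_gt0.
apply: (@lhopital_at_right R (fun f => th * cos (th * f) * sin f - sin (th * f) * cos f)
  (fun f => (1 - th ^+ 2) * sin (th * f) * sin f) (fun f => sin f ^+ 2)
  (fun f => 2 * sin f * cos f) 0 (pi / 2) 0 pi2).
- move=> f _; apply: (is_derive_eq (derive_sub (derive_mul
    (derive_mul (derive_const th f) (derive_cos_scale th f)) (derive_sin (derive_var f)))
    (derive_mul (derive_sin_scale th f) (derive_cos (derive_var f))))).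
  ring.
- move=> f _; apply: (is_derive_eq (derive_mul (derive_sin (derive_var f)) (derive_sin (derive_var f)))).
  ring.
- rewrite -[X in _ --> X](_ : th * cos (th * 0) * sin 0 - sin (th * 0) * cos 0 = 0); last first.
    by rewrite mulr0 sin0; ring.
  apply: cvg_at_right_filter; exact: derive_continuous (derive_sub (derive_mul
    (derive_mul (derive_const th 0) (derive_cos_scale th 0)) (derive_sin (derive_var 0)))
    (derive_mul (derive_sin_scale th 0) (derive_cos (derive_var 0)))).
- rewrite -[X in _ --> X](_ : sin 0 ^+ 2 = 0); last by rewrite sin0 expr0n.
  apply: cvg_at_right_filter.
  exact: derive_continuous (derive_mul (derive_sin (derive_var 0)) (derive_sin (derive_var 0))).
- move=> f; rewrite in_itv/= => /andP[f0 f1].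
  have s0 : 0 < sin f by apply: sin_gt0_pi; rewrite f0; lra.
  have c0 : 0 < cos f by apply: cos_gt0_pihalf; rewrite f1 andbT; lra.
  by rewrite lt0r_neq0// !mulr_gt0.
- apply: (@cvg_trans _ ((1 - th ^+ 2) * sin (th * f) / (2 * cos f) @[f --> (0:R)^'+])).
    apply: near_eq_cvg; near=> f.
    have f0 : 0 < f by near: f; exact: nbhs_right_gt.
    have f1 : f < pi / 2 by near: f; exact: nbhs_right_lt.
    have s0 : sin f != 0 by apply/lt0r_neq0/sin_gt0_pi; rewrite f0; lra.
    have c0 : cos f != 0 by apply/lt0r_neq0/cos_gt0_pihalf; rewrite f1 andbT; lra.
    by field; rewrite s0 c0.
  have c0 : 2 * cos 0 != 0 :> R by rewrite cos0 mulr1.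
  have := derive_continuous (derive_div (derive_mul (derive_const (1 - th ^+ 2) 0)
    (derive_sin_scale th 0)) (derive_mul (derive_const 2 0) (derive_cos (derive_var 0))) c0).
  rewrite /prop_for /continuous_at mulr0 sin0 mulr0 mul0r => c.
  exact: cvg_at_right_filter.
Unshelve. all: by end_near. Qed.

Lemma Rq_bounded : exists M, forall f, 0 < f < phm -> Rq th f <= M /\ `|dRq f| <= M.
Proof.
have [|M1 H1] := bounded_oc (phim_gt0 th0) _ (cvg_Rq0 (th := th)).
  by move=> f h; apply: sin_ratio_continuous; rewrite lt0r_neq0// sin_gt0_phim.
have [|M2 H2] := bounded_oc (phim_gt0 th0) _ cvg_dRq0.
  move=> f h; have s0 := lt0r_neq0 (sin_gt0_phim h).
  have s2 : sin f * sin f != 0 by rewrite mulf_neq0.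
  exact: derive_continuous (derive_div (derive_sub (derive_mul
    (derive_mul (derive_const th f) (derive_cos_scale th f)) (derive_sin (derive_var f)))
    (derive_mul (derive_sin_scale th f) (derive_cos (derive_var f))))
    (derive_mul (derive_sin (derive_var f)) (derive_sin (derive_var f))) s2).
exists (Num.max M1 M2) => f /andP[f0 fm]; rewrite !le_max; split.
  by rewrite (le_trans (ler_norm _))// H1// f0 ltW.
by rewrite H2 ?orbT// f0 ltW.
Qed.

(** The conjugate of [1 / s] at the point of angle [f]. With [q = 1 / s] one has
    [J_1(s) = (1 + q)^p / q], so [Ff z q = q (J_1(1 / q) - z)], which equals 1 at [q = 0]. The
    points [k Q(f)], [0 < k <= 1], sweep the region between the arc [Qf] and the segment
    [[-1, th]]. *)
Definition Qf f : R[i] := polar (Rq th f) ((1 + th) * f).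
Definition dQf f : R[i] := Qf f * Complex (dRq f / Rq th f) (1 + th).
Definition wk k f : R[i] := 1 + k%:C * Qf f.
Definition Ff z (q : R[i]) : R[i] := cpow (1 + q) p - z * q.
Definition dFf z (q : R[i]) : R[i] := p%:C * (cpow (1 + q) p / (1 + q)) - z.

Lemma wk_Re k f : Re (wk k f) = 1 + k * (Rq th f * cos ((1 + th) * f)).
Proof. by rewrite /wk ReD ReM/= mul0r subr0. Qed.

Lemma wk_Im k f : Im (wk k f) = k * (Rq th f * sin ((1 + th) * f)).
Proof. by rewrite /wk ImD ImM/= mul0r addr0 add0r. Qed.

Lemma wk_Im_gt0 k f : 0 < f < phm -> 0 < k -> 0 < Im (wk k f).
Proof. by move=> h k0; rewrite wk_Im (mulr_gt0 k0 (mulr_gt0 (Rq_gt0 th0 h) (sin_alf_gt0 th0 h))). Qed.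

Lemma wk_slit k f : 0 < f < phm -> 0 <= k -> slit (wk k f).
Proof.
move=> h; rewrite le_eqVlt => /predU1P[<-|k0].
  by apply: slit_Re_gt0; rewrite wk_Re mul0r addr0.
by apply: slit_Im_neq0; rewrite lt0r_neq0// wk_Im_gt0.
Qed.

Lemma carg_wk k f : 0 < f < phm -> 0 < k <= 1 -> 0 < carg (wk k f) <= th * f.
Proof.
move=> h /andP[k0 k1]; have i0 := wk_Im_gt0 h k0; have s := wk_slit h (ltW k0).
have /andP[w0 w1] := carg_Im_gt0 i0; rewrite w0/= leNgt; apply/negP => lt.
have [_ /andP[t0 t1] _] := angle_bounds th0 h.
have m0 : 0 < cmod (wk k f) by rewrite cmod_gt0 slit_neq0.
have : 0 < cmod (wk k f) * sin (carg (wk k f) - th * f).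
  by rewrite mulr_gt0//; apply: sin_gt0_pi; lra.
rewrite sinB mulrBr !mulrA cos_carg_slit// sin_carg_slit// wk_Re wk_Im.
have e : sin ((1 + th) * f) * cos (th * f) - cos ((1 + th) * f) * sin (th * f) = sin f.
  by rewrite -sinB; congr sin; ring.
have -> : k * (Rq th f * sin ((1 + th) * f)) * cos (th * f) -
   (1 + k * (Rq th f * cos ((1 + th) * f))) * sin (th * f) =
   k * Rq th f * (sin ((1 + th) * f) * cos (th * f) - cos ((1 + th) * f) * sin (th * f))
   - sin (th * f) by ring.
rewrite e -mulrA /Rq divfK; last by rewrite lt0r_neq0// (sin_f_gt0 th0).
have st := sin_thf_gt0 th0 h.
by apply/negP; rewrite -leNgt; nra.
Qed.

Definition Jk k f : R[i] :=
  polar (cmod (wk k f) `^ p / (k * Rq th f)) (p * carg (wk k f) - (1 + th) * f).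

Lemma Ff_factor z k f : 0 < f < phm -> 0 < k ->
  Ff z (k%:C * Qf f) = polar (k * Rq th f) ((1 + th) * f) * (Jk k f - z).
Proof.
move=> h k0; rewrite /Ff -/(wk k f) mulrBr /Jk polarM.
have r0 : k * Rq th f != 0 by rewrite lt0r_neq0// mulr_gt0// Rq_gt0.
have -> : k * Rq th f * (cmod (wk k f) `^ p / (k * Rq th f)) = cmod (wk k f) `^ p.
  by rewrite mulrCA divff// mulr1.
have -> : (1 + th) * f + (p * carg (wk k f) - (1 + th) * f) = p * carg (wk k f) by ring.
rewrite cpowE; last by rewrite slit_neq0// wk_slit// ltW.
by congr (_ - _); rewrite mulrC realM_polar.
Qed.

(** The argument [p arg (1 + q) - (1 + th) f] lies between [- pi] and 0, by [carg_wk] and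
    [p * th = 1 + th]. *)
Lemma Im_Jk k f : 0 < f < phm -> 0 < k <= 1 -> Im (Jk k f) <= 0.
Proof.
move=> h hk; have /andP[w0 w1] := carg_wk h hk; have [_ _ /andP[a0 a1]] := angle_bounds th0 h.
have k0 : 0 < k by case/andP: hk.
have pt := pexp_th th0; have p1 := pexp_gt1 th0.
rewrite /Jk/= mulr_ge0_le0//.
  by rewrite divr_ge0 ?powR_ge0// ltW// mulr_gt0// Rq_gt0.
rewrite -oppr_ge0 -sinN; apply: sin_ge0_pi.
have e1 : p * carg (wk k f) <= (1 + th) * f.
  by rewrite -pt -mulrA ler_pM2l// (lt_trans ltr01).
have e2 : 0 <= p * carg (wk k f) by rewrite mulr_ge0 ?(ltW w0)// (le_trans ler01)// ltW.
by apply/andP; split; lra.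
Qed.

(** As [Im z > 0], the quotient [Ff / q] has negative imaginary part. A nonpositive real value of
    [Ff], divided by [q] in the upper half-plane, would have a nonnegative one. Hence the principal
    logarithm of [Ff] is smooth on the region. *)
Lemma Ff_slit z k f : 0 < f < phm -> 0 < k <= 1 -> 0 < Im z -> slit (Ff z (k%:C * Qf f)).
Proof.
move=> h hk z0; have k0 : 0 < k by case/andP: hk.
have r0 : 0 < k * Rq th f by rewrite mulr_gt0// Rq_gt0.
apply/slitP/negP => /andP[/eqP I0 R0].
have : Im (Ff z (k%:C * Qf f) * polar 1 (- ((1 + th) * f))) < 0.
  rewrite Ff_factor// mulrAC polarM mulr1 subrr.
  have -> : polar (k * Rq th f) 0 = (k * Rq th f)%:C.
    by apply: complex_eq; rewrite /= ?cos0 ?sin0 ?mulr1 ?mulr0.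
  rewrite Im_realM pmulr_rlt0// ImD ImN; have := Im_Jk h hk; lra.
rewrite ImM I0 mul0r addr0/= mul1r sinN mulrN.
by apply/negP; rewrite -leNgt -mulNr mulr_ge0 ?oppr_ge0// ltW// (sin_alf_gt0 th0 h).
Qed.

Lemma cmod_Ff_ge z k f : 0 < f < phm -> 0 < k <= 1 -> 0 < Im z ->
  k * Rq th f * Im z <= cmod (Ff z (k%:C * Qf f)).
Proof.
move=> h hk z0; have k0 : 0 < k by case/andP: hk.
have r0 : 0 < k * Rq th f by rewrite mulr_gt0// Rq_gt0.
rewrite Ff_factor// cmodM cmod_polar ?(ltW r0)// ler_pM2l//.
apply: le_trans (ge_cmod_Im _); rewrite ImD ImN.
have := Im_Jk h hk; rewrite -normrN => j; apply: le_trans (ler_norm _); lra.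
Qed.

Lemma cmod_wk_bounds k f : 0 < f < phm -> 0 < k <= 1 ->
  1 - k * Rq th f <= cmod (wk k f) <= 1 + k * Rq th f.
Proof.
move=> h /andP[k0 k1].
have e : cmod (k%:C * Qf f) = k * Rq th f.
  by rewrite realM_polar cmod_polar// ltW// mulr_gt0// Rq_gt0.
have c1 : cmod (1 : R[i]) = 1 by rewrite -[1]/(1%:C) cmod_real normr1.
apply/andP; split; last first.
  by rewrite -[X in _ <= X + _]c1 -[X in _ <= _ + X]e; exact: cmodD.
rewrite -[X in X - _ <= _]c1 -e -(cmodN (k%:C * _)); apply: le_trans (ler_cmodB _ _) _.
by rewrite opprK.
Qed.

Lemma cmod_Ff_lb z k f : 0 < f < phm -> 0 < k <= 1 -> 0 < Im z ->
  Num.min (1 / 2) (Im z / (2 * (p + cmod z))) <= cmod (Ff z (k%:C * Qf f)).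
Proof.
move=> h hk z0; have /andP[k0 k1] := hk; have p1 := pexp_gt1 th0.
have r0 : 0 < k * Rq th f by rewrite mulr_gt0// Rq_gt0.
have A0 : 0 < p + cmod z by rewrite ltr_wpDr ?cmod_ge0// (lt_trans ltr01).
(* For small [|q|] Bernoulli's inequality gives [|1 + q|^p >= 1 - p |q|], so [Ff] has modulus at
   least 1/2. Otherwise [|q|] is bounded below and [|Ff| >= |q| Im z]. *)
rewrite ge_min; case: (leP (k * Rq th f) (1 / (2 * (p + cmod z)))) => kr; apply/orP.
  left; apply: (@le_trans _ _ (cmod (cpow (wk k f) p) - cmod (z * (k%:C * Qf f)))); last first.
    exact: ler_cmodB.
  rewrite cmodM realM_polar cmod_polar ?(ltW r0)//.
  rewrite cpowE; last by rewrite slit_neq0// wk_slit// ltW.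
  rewrite cmod_polar ?powR_ge0//.
  have /andP[b1 _] := cmod_wk_bounds h hk.
  have be := bernoulli_powR p1 (cmod_ge0 (wk k f)).
  have : k * Rq th f * (p + cmod z) <= 1 / 2.
    move: kr; rewrite ler_pdivlMr ?mulr_gt0//; lra.
  have : p * (- (k * Rq th f)) <= p * (cmod (wk k f) - 1) by rewrite ler_wpM2l//; lra.
  move: be; set Y := cmod (wk k f) `^ p; set K := k * Rq th f; set W := cmod (wk k f); nra.
right; apply: le_trans (cmod_Ff_ge h hk z0).
have : 1 / (2 * (p + cmod z)) * Im z <= k * Rq th f * Im z by rewrite ler_pM2r// ltW.
by rewrite mul1r mulrC.
Qed.

Lemma cder_Ff z (q : R -> R[i]) t d : slit (1 + q t) -> cder q t d ->
  cder (fun u => Ff z (q u)) t (dFf z (q t) * d).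
Proof.
move=> s h.
have H := cder_add (cder_cpow p s (cder_add (cder_cst 1 t) h))
  (cder_opp (cder_mul (cder_cst z t) h)).
by apply: (cder_eq H); rewrite /dFf; ring.
Qed.

Lemma cder_Qf f : 0 < f < phm -> cder Qf f (dQf f).
Proof.
move=> h; have q0 := lt0r_neq0 (Rq_gt0 th0 h).
exact: cder_polar (derive_Rq th0 h) (derive_scale (1 + th) f) q0.
Qed.

Lemma cder_kQ k f : 0 < f < phm -> cder (fun f => k%:C * Qf f) f (k%:C * dQf f).
Proof.
move=> h; apply: (cder_eq (cder_mul (cder_cst k%:C f) (cder_Qf h))).
by rewrite mul0r add0r.
Qed.

Lemma cder_Qk k f : cder (fun k => k%:C * Qf f) k (Qf f).
Proof.
apply: (cder_eq (cder_mul (cder_real (derive_var k)) (cder_cst (Qf f) k))).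
by rewrite mulr0 addr0 mul1r.
Qed.

Lemma ccvg_realM (T : Type) (F : set_system T) (FF : Filter F) (q : T -> R[i]) (l : R[i]) k :
  ccvg F q l -> ccvg F (fun t => k%:C * q t) (k%:C * l).
Proof. by move=> c; apply: ccvg_mul c; exact: ccvg_cst. Qed.

Lemma ccvg_Ff (T : Type) (F : set_system T) (FF : Filter F) (q : T -> R[i]) (l : R[i]) z :
  ccvg F q l -> slit (1 + l) -> ccvg F (fun t => Ff z (q t)) (Ff z l).
Proof.
move=> c s; apply: ccvg_add.
  by apply: ccvg_cpow => //; apply: ccvg_add c; exact: ccvg_cst.
by apply: ccvg_opp; apply: ccvg_mul c; exact: ccvg_cst.
Qed.

Lemma ccvg_dFf (T : Type) (F : set_system T) (FF : Filter F) (q : T -> R[i]) (l : R[i]) z :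
  ccvg F q l -> slit (1 + l) -> ccvg F (fun t => dFf z (q t)) (dFf z l).
Proof.
move=> c s; have cw : ccvg F (fun t => 1 + q t) (1 + l).
  by apply: ccvg_add c; exact: ccvg_cst.
apply: ccvg_add; last exact: ccvg_cst.
apply: ccvg_mul; first exact: ccvg_cst.
apply: ccvg_mul; first exact: ccvg_cpow.
by apply: ccvg_inv => //; exact: slit_neq0.
Qed.

(** Two derivatives share this density: [k * Hk] is the derivative in [f] of [arg Ff], and [Hk] is
    the derivative in [k] of [(1 + th) ln |Ff| + (dRq / Rq) arg Ff], all at [k Q(f)]. Integrating it
    in both orders amounts to Cauchy's theorem for [log (Ff) / q]. *)
Definition Hk z (t : R * R) : R :=
  Im (dFf z (t.1%:C * Qf t.2) * dQf t.2 / Ff z (t.1%:C * Qf t.2)).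

Lemma measurable_Hk z : measurable_fun setT (Hk z).
Proof.
have mQ : cmeas (fun t : R * R => Qf t.2).
  apply: cmeas_polar; first exact: measurableT_comp (measurable_Rq th) measurable_snd.
  by apply: measurable_funM => //; exact: measurable_snd.
have mkQ : cmeas (fun t : R * R => t.1%:C * Qf t.2).
  by apply: cmeas_mul => //; apply: cmeas_real; exact: measurable_fst.
have mw : cmeas (fun t : R * R => 1 + t.1%:C * Qf t.2).
  by apply: cmeas_add => //; exact: cmeas_cst.
have md : measurable_fun setT dRq.
  apply: measurable_funM.
    apply: measurable_funB.
      apply: measurable_funM; last exact: measurable_sinR.
      apply: measurable_funM => //; apply: continuous_measurable_fun => f.
      exact: derive_continuous (derive_cos_scale th f).
    apply: measurable_funM; first exact: measurable_sin_scale.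
    by apply: continuous_measurable_fun; exact: continuous_cos.
  by apply: measurable_inv; apply: measurable_funX; exact: measurable_sinR.
have mdQ : cmeas (fun t : R * R => dQf t.2).
  apply: cmeas_mul => //; split => /=; last exact: measurable_cst.
  apply: (measurableT_comp (f := fun f => dRq f / Rq th f)) measurable_snd.
  by apply: measurable_funM => //; apply: measurable_inv; exact: measurable_Rq.
have mF : cmeas (fun t : R * R => Ff z (t.1%:C * Qf t.2)).
  apply: cmeas_add; first exact: cmeas_cpow.
  by apply: cmeas_opp; apply: cmeas_mul => //; exact: cmeas_cst.
have mdF : cmeas (fun t : R * R => dFf z (t.1%:C * Qf t.2)).
  apply: cmeas_add; last by apply: cmeas_opp; exact: cmeas_cst.
  apply: cmeas_mul; first exact: cmeas_cst.
  by apply: cmeas_mul; [exact: cmeas_cpow|exact: cmeas_inv].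
by have [] := cmeas_mul (cmeas_mul mdF mdQ) (cmeas_inv mF).
Qed.

Lemma cmod_complex (a b : R) : cmod (Complex a b) <= `|a| + `|b|.
Proof.
have -> : Complex a b = a%:C + Complex 0 1 * b%:C.
  by apply: complex_eq; rewrite ?ReD ?ImD ?ReM ?ImM/=; ring.
apply: le_trans (cmodD _ _) _; rewrite cmodM !cmod_real.
by rewrite (_ : cmod (Complex 0 1) = 1) ?mul1r// /cmod/= expr0n expr1n add0r sqrtr1.
Qed.

(** The bound depends on [Im z] and degenerates as [z] approaches the real axis, so the limit is
    taken only after the exchange of integrals. *)
Lemma Hk_bounded z : 0 < Im z -> exists M, forall k f, 0 < k <= 1 -> 0 < f < phm ->
  `|Hk z (k, f)| <= M.
Proof.
move=> z0; have [M HM] := Rq_bounded; have p1 := pexp_gt1 th0.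
set dl := Num.min (1 / 2) (Im z / (2 * (p + cmod z))).
have dl0 : 0 < dl.
  rewrite lt_min divr_gt0//= divr_gt0// mulr_gt0// ltr_wpDr ?cmod_ge0//.
  exact: lt_trans ltr01 _.
have h2 : 0 < phm / 2 < phm.
  have := phim_gt0 th0; set y := phm => y0; apply/andP; split; lra.
have M0 : 0 <= M by have [_] := HM _ h2; apply: le_trans.
exists ((p * (1 + M) `^ (p - 1) + cmod z) * (M + (1 + th) * M) / dl) => k f hk h.
have [q1 q2] := HM _ h; have q0 := Rq_gt0 th0 h; have /andP[k0 k1] := hk.
apply: le_trans (ge_cmod_Im _) _; rewrite /= !cmodM cmodV.
have sw := wk_slit h (ltW k0); have w0 := slit_neq0 sw.
have m0 : 0 < cmod (wk k f) by rewrite cmod_gt0.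
apply: ler_pM; rewrite ?mulr_ge0 ?cmod_ge0 ?invr_ge0 ?cmod_ge0//; last first.
  rewrite lef_pV2 ?posrE//; first exact: cmod_Ff_lb.
  by rewrite (lt_le_trans dl0)// cmod_Ff_lb.
apply: ler_pM; rewrite ?mulr_ge0 ?cmod_ge0//.
  apply: le_trans (cmodD _ _) _; rewrite cmodN lerD2r !cmodM cmodV cmod_real.
  rewrite gtr0_norm ?(lt_trans ltr01)// ler_pM2l ?(lt_trans ltr01)// -/(wk k f).
  rewrite cpowE// cmod_polar ?powR_ge0//.
  have -> : cmod (wk k f) `^ p / cmod (wk k f) = cmod (wk k f) `^ (p - 1).
    by rewrite powRB ?powRr1 ?(ltW m0)// lt0r_neq0 ?implybT.
  apply: ge0_ler_powR; rewrite ?nnegrE ?subr_ge0 ?(ltW p1) ?(ltW m0) ?addr_ge0//.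
  have /andP[_ b2] := cmod_wk_bounds h hk; apply: (le_trans b2); rewrite lerD2l.
  by apply: le_trans q1; rewrite ler_piMl// ltW.
rewrite cmod_polar ?(ltW q0)//.
apply: (@le_trans _ _ (Rq th f * (`|dRq f / Rq th f| + `|1 + th|))).
  by rewrite ler_pM2l//; exact: cmod_complex.
rewrite mulrDr normrM normfV (gtr0_norm q0) mulrCA divff ?(lt0r_neq0 q0)// mulr1.
by rewrite (gtr0_norm (th1_gt0 th0)) lerD// mulrC ler_pM2l// (th1_gt0 th0).
Qed.

Lemma Ff_real z (y : R) : 0 < 1 + y ->
  Ff z y%:C = Complex ((1 + y) `^ p - Re z * y) (- (Im z * y)).
Proof.
move=> y0; have -> : Ff z y%:C = ((1 + y) `^ p)%:C - z * y%:C.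
  rewrite /Ff; congr (_ - _); have -> : 1 + y%:C = polar (1 + y) 0 :> R[i].
    by apply: complex_eq; rewrite ?ReD ?ImD/= ?cos0 ?sin0 ?mulr1 ?mulr0 ?addr0.
  rewrite cpow_polar//; last by rewrite oppr_lt0 pi_gt0.
  by apply: complex_eq; rewrite /= mulr0 ?cos0 ?sin0 ?mulr1 ?mulr0.
by apply: complex_eq; rewrite ?ReD ?ImD ?ReN ?ImN ?ReM ?ImM/=; ring.
Qed.

(** The quotient [(1 + y)^p / y] is minimal at [y = th], with value [B], the critical value of [J_1]
    at [1 / th]. The bound is Bernoulli's inequality at [(1 + y) / (1 + th)]. *)
Lemma powR_tangent (y : R) : 0 <= y -> B * y <= (1 + y) `^ p.
Proof.
move=> y0; have t1 := th1_gt0 th0; have p1 := pexp_gt1 th0.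
have be := @bernoulli_powR R ((1 + y) / (1 + th)) p p1.
have -> : (1 + y) `^ p = (1 + th) `^ p * ((1 + y) / (1 + th)) `^ p.
  have e : (1 + th) * ((1 + y) / (1 + th)) = 1 + y by field; exact: lt0r_neq0.
  have hq : 0 <= (1 + y) / (1 + th) by apply: divr_ge0; [rewrite addr_ge0|exact: ltW].
  by rewrite -powRM ?e// ltW.
rewrite /Bx -mulrA ler_pM2l ?powR_gt0//.
apply: le_trans (be _); last by apply: divr_ge0; [rewrite addr_ge0|exact: ltW].
rewrite /pexp le_eqVlt; apply/orP; left; apply/eqP; field.
by rewrite !lt0r_neq0.
Qed.

Variable x : R.
Hypothesis hx : 0 < x < B.

(** On the real segment [[-1, th]] the real part of [Ff] stays above a constant independent of [k].
    On the positive side this is where [x < B] enters, through [powR_tangent]. *)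
Lemma Re_Ff_endpoints : exists2 c : R, 0 < c & forall k : R, 0 < k < 1 ->
  c <= (1 + k * th) `^ p - x * (k * th) /\ c <= (1 - k) `^ p + x * k.
Proof.
have /andP[x0 xB] := hx; have p1 := pexp_gt1 th0; have p0 := lt_trans ltr01 p1.
(* The value 1/2 serves small [|q|]; the other two are [(B - x) q] for [q >= 1 / (2 x)] and [x k]
   for [k >= 1 / (2 p)]. *)
exists (Num.min (1 / 2) (Num.min ((B - x) / (2 * x)) (x / (2 * p)))).
  by rewrite !lt_min !divr_gt0 ?mulr_gt0 ?subr_gt0.
move=> k /andP[k0 k1]; have y0 : 0 < k * th by rewrite mulr_gt0.
split; rewrite !ge_min.
  have y1 : 1 <= (1 + k * th) `^ p.
    have := @bernoulli_powR R (1 + k * th) p p1; rewrite addrAC subrr add0r.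
    move=> /(_ (ltW (addr_gt0 ltr01 y0))); apply: le_trans.
    by rewrite lerDl mulr_ge0 ?(ltW p0) ?(ltW y0).
  case: (leP (x * (k * th)) (1 / 2)) => h; first by apply/orP; left; lra.
  apply/orP; right; apply/orP; left.
  have := powR_tangent (ltW y0); rewrite ler_pdivrMr ?mulr_gt0//.
  set Y := (1 + k * th) `^ p; set y := k * th in y0 h *; nra.
have y1 : 1 - p * k <= (1 - k) `^ p.
  have := @bernoulli_powR R (1 - k) p p1; rewrite addrAC subrr add0r mulrN.
  by apply; rewrite subr_ge0 ltW.
case: (leP (p * k) (1 / 2)) => h.
  by apply/orP; left; have := mulr_gt0 x0 k0; lra.
apply/orP; right; apply/orP; right; rewrite ler_pdivrMr ?mulr_gt0//.
have := powR_ge0 (1 - k) p; set Y := (1 - k) `^ p; nra.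
Qed.

Definition zx e : R[i] := Complex x e.

(** The two terms come from the ends of the arc, where [Qf] tends to [-1] and to [th]. *)
Definition ufun e k : R := (carg (Ff (zx e) (- k)%:C) - carg (Ff (zx e) (k * th)%:C)) / k.

Lemma integral_Hk_f e k : 0 < e -> 0 < k < 1 ->
  (\int[leb]_(f in `]0%R, phm[) (Hk (zx e) (k, f))%:E = (ufun e k)%:E)%E.
Proof.
move=> e0 /andP[k0 k1]; have hk : 0 < k <= 1 by rewrite k0 ltW.
have [M HM] := @Hk_bounded (zx e) e0; have [c c0 Hc] := Re_Ff_endpoints.
have [c1 c2] := Hc _ (introT andP (conj k0 k1)).
have H1 : 0 < 1 + k * th by rewrite addr_gt0 ?mulr_gt0.
have H2 : 0 < 1 + - k by rewrite subr_gt0.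
rewrite /ufun mulrBl.
have Cf f : 0 < f < phm -> ccvg (nbhs f) Qf (Qf f).
  by move=> h; have [] := cder_continuous (cder_Qf h).
apply: (@bounded_FTC_lebR R (fun f => Hk (zx e) (k, f)) (fun f => carg (Ff (zx e) (k%:C * Qf f)) / k)
   0 phm _ _ M (phim_gt0 th0)).
- by move=> f h; exact: HM.
- move=> f h; have cQ := Cf _ h; have sw := wk_slit h (ltW k0).
  have ckQ := @ccvg_realM _ _ (nbhs_filter f) _ _ k cQ.
  have cF := @ccvg_Ff _ _ (nbhs_filter f) _ _ (zx e) ckQ sw.
  have cdF := @ccvg_dFf _ _ (nbhs_filter f) _ _ (zx e) ckQ sw.
  have q0 := lt0r_neq0 (Rq_gt0 th0 h); have s0 := lt0r_neq0 (sin_f_gt0 th0 h).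
  have s2 : sin f * sin f != 0 by rewrite mulf_neq0.
  have dq := derive_continuous (derive_div (derive_div (derive_sub (derive_mul
    (derive_mul (derive_const th f) (derive_cos_scale th f)) (derive_sin (derive_var f)))
    (derive_mul (derive_sin_scale th f) (derive_cos (derive_var f))))
    (derive_mul (derive_sin (derive_var f)) (derive_sin (derive_var f))) s2) (derive_Rq th0 h) q0).
  have cdQ : ccvg (nbhs f) dQf (dQf f).
    by apply: ccvg_mul => //; split => //=; exact: cvg_cst.
  have cM : ccvg (nbhs f) (fun f => dFf (zx e) (k%:C * Qf f) * dQf f / Ff (zx e) (k%:C * Qf f))
     (dFf (zx e) (k%:C * Qf f) * dQf f / Ff (zx e) (k%:C * Qf f)).
    apply: ccvg_mul; first exact: ccvg_mul.
    by apply: ccvg_inv => //; apply: slit_neq0; exact: Ff_slit.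
  by case: cM.
- move=> f h; have sw := wk_slit h (ltW k0).
  have H := derive_carg (@Ff_slit (zx e) k f h hk e0) (cder_Ff (zx e) sw (cder_kQ k h)).
  apply: (is_derive_eq (derive_mul H (derive_const k^-1 f))).
  rewrite mulr0 addr0 /Hk/= mulrCA -!mulrA Im_realM mulrAC divff ?mul1r ?lt0r_neq0//.
- apply: cvgM; last exact: cvg_cst.
  have cQ : ccvg ((0:R)^'+) Qf th%:C.
    have -> : th%:C = polar th ((1 + th) * 0).
      by apply: complex_eq; rewrite /= mulr0 ?cos0 ?sin0 ?mulr1 ?mulr0.
    apply: ccvg_polar; first exact: cvg_Rq0.
    by apply: cvg_at_right_filter; exact: derive_continuous (derive_scale (1 + th) 0).
  have ckQ : ccvg ((0:R)^'+) (fun f => k%:C * Qf f) (k%:C * th%:C) by exact: ccvg_realM.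
  have e1 : k%:C * th%:C = (k * th)%:C by rewrite -rmorphM.
  have sw : slit (1 + k%:C * th%:C) by apply: slit_Re_gt0; rewrite e1 ReD.
  have cF : ccvg ((0:R)^'+) (fun f => Ff (zx e) (k%:C * Qf f)) (Ff (zx e) (k%:C * th%:C)).
    exact: ccvg_Ff.
  rewrite -e1; apply: cvg_carg cF _; apply: slit_Re_gt0.
  by rewrite e1 Ff_real//= (lt_le_trans c0).
- apply: cvgM; last exact: cvg_cst.
  have cQ : ccvg (phm^'-) Qf (-1).
    have -> : -1 = polar (Rq th phm) ((1 + th) * phm) :> R[i].
      rewrite Rq_phim// phimE//.
      by apply: complex_eq; rewrite ?ReN ?ImN/= ?cospi ?sinpi ?mulr0 ?oppr0 ?mul1r.
    apply: ccvg_polar; first by rewrite Rq_phim//; exact: cvg_Rqm.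
    by apply: cvg_at_left_filter; exact: derive_continuous (derive_scale (1 + th) phm).
  have ckQ : ccvg (phm^'-) (fun f => k%:C * Qf f) (k%:C * -1) by exact: ccvg_realM.
  have e1 : k%:C * -1 = (- k)%:C by rewrite mulrN1 rmorphN.
  have sw : slit (1 + k%:C * -1) by apply: slit_Re_gt0; rewrite e1 ReD.
  have cF : ccvg (phm^'-) (fun f => Ff (zx e) (k%:C * Qf f)) (Ff (zx e) (k%:C * -1)).
    exact: ccvg_Ff.
  rewrite -e1; apply: cvg_carg cF _; apply: slit_Re_gt0.
  by rewrite e1 Ff_real//= mulrN opprK (lt_le_trans c0).
Qed.

Lemma ufun_bound : exists C, forall e k, 0 < e -> 0 < k < 1 -> `|ufun e k| <= C * e.
Proof.
have [c c0 Hc] := Re_Ff_endpoints.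
exists ((1 + th) / c) => e k e0 hk; have [c1 c2] := Hc _ hk; have /andP[k0 k1] := hk.
have H1 : 0 < 1 + k * th by rewrite addr_gt0 ?mulr_gt0.
have H2 : 0 < 1 + - k by rewrite subr_gt0.
have y0 : 0 < k * th by rewrite mulr_gt0.
rewrite /ufun normrM normfV (gtr0_norm k0) ler_pdivrMr//.
apply: le_trans (ler_normB _ _) _.
have c2' : c <= (1 + - k) `^ p - x * - k by rewrite mulrN opprK.
have b1 : `|carg (Ff (zx e) (- k)%:C)| <= e * k / c.
  have r0 := lt_le_trans c0 c2'.
  rewrite Ff_real//; apply: le_trans (@carg_Re_gt0 _ (Complex _ _) r0) _; rewrite [Im _]/= [Re _]/=.
  have -> : - (e * - k) = e * k by ring.
  by rewrite gtr0_norm ?mulr_gt0// ler_pM2l ?mulr_gt0// lef_pV2 ?posrE.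
have b2 : `|carg (Ff (zx e) (k * th)%:C)| <= e * (k * th) / c.
  have r0 := lt_le_trans c0 c1.
  rewrite Ff_real//; apply: le_trans (@carg_Re_gt0 _ (Complex _ _) r0) _; rewrite [Im _]/= [Re _]/=.
  by rewrite normrN gtr0_norm ?mulr_gt0// ler_pM2l ?mulr_gt0// lef_pV2 ?posrE.
apply: (le_trans (lerD b1 b2)); rewrite le_eqVlt; apply/orP; left; apply/eqP.
by field; exact: lt0r_neq0.
Qed.

Definition vfun e f : R := (1 + th) * ln (cmod (Ff (zx e) (Qf f))) +
  dRq f / Rq th f * carg (Ff (zx e) (Qf f)).

Lemma Im_mul_complex z (a b : R) : Im (z * Complex a b) = b * Re z + a * Im z.
Proof. by rewrite ImM/=; ring. Qed.

Lemma integral_Hk_k e f : 0 < e -> 0 < f < phm ->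
  (\int[leb]_(k in `]0%R, 1%R[) (Hk (zx e) (k, f))%:E = (vfun e f)%:E)%E.
Proof.
move=> e0 h; have [M HM] := @Hk_bounded (zx e) e0.
have F0 : Ff (zx e) (0%:C * Qf f) = 1.
  by rewrite mul0r -[0]/(0%:C) Ff_real ?addr0// powR1 !mulr0 subr0 oppr0.
have sF k : 0 <= k <= 1 -> slit (Ff (zx e) (k%:C * Qf f)).
  move=> /andP[]; rewrite le_eqVlt => /predU1P[<- _|k0 k1].
    by rewrite F0; exact: slit_Re_gt0.
  by apply: Ff_slit => //; rewrite k0.
have DF k : 0 <= k <= 1 ->
    cder (fun k => Ff (zx e) (k%:C * Qf f)) k (dFf (zx e) (k%:C * Qf f) * Qf f).
  by move=> /andP[k0 _]; apply: cder_Ff (cder_Qk k f); exact: wk_slit.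
set G := fun k => (1 + th) * ln (cmod (Ff (zx e) (k%:C * Qf f))) +
  dRq f / Rq th f * carg (Ff (zx e) (k%:C * Qf f)).
have DG k : 0 <= k <= 1 -> is_derive k 1 G (Hk (zx e) (k, f)).
  move=> hk; have s := sF _ hk; have d := DF _ hk.
  apply: (is_derive_eq (derive_add (derive_mul (derive_const (1 + th) k) (derive_ln_cmod (slit_neq0 s) d))
    (derive_mul (derive_const (dRq f / Rq th f) k) (derive_carg s d)))).
  rewrite !mul0r !add0r /Hk [(k, f).1]/= [(k, f).2]/= /dQf.
  set u := dFf _ _; set v := Ff _ _; set c := Complex _ _.
  have -> : u * (Qf f * c) / v = u * Qf f / v * c by ring.
  by rewrite [RHS]Im_mul_complex.
have -> : vfun e f = G 1 - G 0.
  rewrite /G F0 mul1r -/(vfun e f) -[X in cmod X]/(1%:C) cmod_real normr1 ln1.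
  have -> : carg (1 : R[i]) = 0.
    have -> : 1 = polar 1 0 :> R[i] by apply: complex_eq; rewrite /= ?cos0 ?sin0 ?mulr1 ?mulr0.
    by rewrite carg_polar// oppr_lt0 pi_gt0.
  by rewrite !mulr0 addr0 subr0.
apply: (@bounded_FTC_lebR R (fun k => Hk (zx e) (k, f)) G 0 1 _ _ M ltr01).
- by move=> k /andP[k0 k1]; apply: HM => //; rewrite k0 ltW.
- move=> k /andP[k0 k1]; have hk : 0 <= k <= 1 by rewrite !ltW.
  have sw := wk_slit h (ltW k0).
  have ckQ : ccvg (nbhs k) (fun k => k%:C * Qf f) (k%:C * Qf f).
    by have [] := cder_continuous (cder_Qk k f).
  have cF := @ccvg_Ff _ _ (nbhs_filter k) _ _ (zx e) ckQ sw.
  have cdF := @ccvg_dFf _ _ (nbhs_filter k) _ _ (zx e) ckQ sw.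
  have cM : ccvg (nbhs k) (fun k => dFf (zx e) (k%:C * Qf f) * dQf f / Ff (zx e) (k%:C * Qf f))
     (dFf (zx e) (k%:C * Qf f) * dQf f / Ff (zx e) (k%:C * Qf f)).
    apply: ccvg_mul; first by apply: ccvg_mul cdF _; exact: ccvg_cst.
    by apply: ccvg_inv => //; apply: slit_neq0; exact: sF.
  by case: cM.
- by move=> k /andP[k0 k1]; apply: DG; rewrite !ltW.
- by apply: cvg_at_right_filter; apply: derive_continuous (DG 0 _); rewrite lexx ler01.
- by apply: cvg_at_left_filter; apply: derive_continuous (DG 1 _); rewrite lexx ler01.
Qed.

(** On the arc [J_1] takes the real value [X f], so [Ff = Q(f) (X f - x - i e)]; the last factor has
    argument [atan ((X f - x) / e) - pi / 2]. *)
Lemma Ff_Qf e f : 0 < e -> 0 < f < phm -> Ff (zx e) (Qf f) =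
  polar (Rq th f * Num.sqrt ((X f - x) ^+ 2 + e ^+ 2))
    ((1 + th) * f - pi / 2 + atan ((X f - x) / e)).
Proof.
move=> e0 h.
have s0 := sin_f_gt0 th0 h; have a0 := sin_alf_gt0 th0 h.
have W : wk 1 f = polar (Rw th f) (th * f).
  have e1 : cos ((1 + th) * f) = cos f * cos (th * f) - sin f * sin (th * f).
    by rewrite -cosD; congr cos; ring.
  have e2 : sin ((1 + th) * f) = sin f * cos (th * f) + cos f * sin (th * f).
    by rewrite -sinD; congr sin; ring.
  have sn := lt0r_neq0 s0; have c2 := cos2Dsin2 (th * f).
  apply: complex_eq; rewrite ?wk_Re ?wk_Im/= mul1r /Rq /Rw ?e1 e2; last by field.
  have {1}-> : (1 : R) = cos (th * f) ^+ 2 + sin (th * f) ^+ 2 by rewrite c2.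
  by field.
have hp : - pi < th * f < pi.
  by have [_ /andP[t0 t1] _] := angle_bounds th0 h; rewrite t1 andbT; lra.
have FX : Ff (zx e) (Qf f) = Qf f * Complex (X f - x) (- e).
  rewrite /Ff -[Qf f]mul1r -[1 * Qf f]/(1%:C * Qf f) -/(wk 1 f) W cpow_polar ?Rw_gt0//.
  have -> : p * (th * f) = (1 + th) * f by rewrite mulrA pexp_th.
  have -> : polar (Rw th f `^ p) ((1 + th) * f) = (X f)%:C * Qf f.
    by rewrite realM_polar /Xf divfK// lt0r_neq0// Rq_gt0.
  rewrite mul1r -mulrBl mulrC; congr (_ * _).
  by apply: complex_eq; rewrite ?ReD ?ImD ?ReN ?ImN/= ?add0r.
have n0 : 0 < (X f - x) ^+ 2 + e ^+ 2 by rewrite ltr_wpDl ?sqr_ge0// exprn_gt0.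
have -> : (1 + th) * f - pi / 2 + atan ((X f - x) / e) =
  (1 + th) * f + (atan ((X f - x) / e) - pi / 2) by ring.
rewrite FX /Qf -polarM; congr (_ * _).
set t := (X f - x) / e; set r := Num.sqrt _.
have r0 : 0 < r by rewrite sqrtr_gt0.
have ca : 0 < cos (atan t) by apply: cos_gt0_pihalf; rewrite atan_gtNpi2 atan_ltpi2.
have rc : r * cos (atan t) = e.
  apply/eqP; rewrite -(eqrXn2 (n := 2))// ?mulr_ge0 ?(ltW r0) ?(ltW ca) ?(ltW e0)//.
  rewrite exprMn cos_atan2 sqr_sqrtr ?(ltW n0)// /t.
  have ne : e ^+ 2 + (X f - x) ^+ 2 != 0 by rewrite addrC lt0r_neq0.
  by apply/eqP; field; rewrite lt0r_neq0//= lt0r_neq0// addrC.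
have rs : r * sin (atan t) = X f - x.
  have : r * sin (atan t) = t * (r * cos (atan t)).
    have /(congr1 (fun u => u / cos (atan t))) := sin_cos_atan t.
    rewrite mulfK ?(lt0r_neq0 ca)// => ->; rewrite -cos_atan2.
    by field; rewrite lt0r_neq0.
  by rewrite rc => ->; rewrite /t divfK// lt0r_neq0.
by apply: complex_eq; rewrite /= ?cosBpihalf ?sinBpihalf ?mulrN ?rc ?rs.
Qed.

Lemma vfunE e f : 0 < e -> 0 < f < phm -> vfun e f =
  (1 + th) * (ln (Rq th f) + ln ((X f - x) ^+ 2 + e ^+ 2) / 2) +
  dRq f / Rq th f * ((1 + th) * f - pi / 2 + atan ((X f - x) / e)).
Proof.
move=> e0 h; have q0 := Rq_gt0 th0 h.
have n0 : 0 < (X f - x) ^+ 2 + e ^+ 2 by rewrite ltr_wpDl ?sqr_ge0// exprn_gt0.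
have r0 : 0 < Num.sqrt ((X f - x) ^+ 2 + e ^+ 2) by rewrite sqrtr_gt0.
have [_ _ /andP[a0 a1]] := angle_bounds th0 h.
have ha : - pi < (1 + th) * f - pi / 2 + atan ((X f - x) / e) < pi.
  have := atan_gtNpi2 ((X f - x) / e); have := atan_ltpi2 ((X f - x) / e).
  set y := atan _ => y1 y2; apply/andP; split; lra.
rewrite /vfun Ff_Qf// (cmod_polar _ (ltW (mulr_gt0 q0 r0))) (carg_polar (mulr_gt0 q0 r0) ha).
rewrite lnM ?posrE//; congr (_ * (_ + _) + _).
by rewrite -{2}(sqr_sqrtr (ltW n0)) expr2 lnM ?posrE//; field.
Qed.

(** The exchange of integrals: the integral over the arc equals that of [ufun], which is of order
    [e]. *)
Lemma integral_vfun : exists C, forall e, 0 < e ->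
  measurable_fun `]0, phm[ (vfun e) /\
  exists2 u, `|u| <= C * e & (\int[leb]_(f in `]0%R, phm[) (vfun e f)%:E = u%:E)%E.
Proof.
have [C HC] := ufun_bound; exists C => e e0; have [M HM] := @Hk_bounded (zx e) e0.
have [|mu mv I] := @bounded_fubini_oo R (Hk (zx e)) 0 1 0 phm M (ufun e) (vfun e) ler01
  (ltW (phim_gt0 th0)) (measurable_Hk _) _ (fun k hk => integral_Hk_f e0 hk)
  (fun f hf => integral_Hk_k e0 hf).
  by move=> k f /andP[k0 k1] hf; apply: HM => //; rewrite k0 ltW.
split => //; exists (fine (\int[leb]_(k in `]0%R, 1%R[) (ufun e k)%:E)).
  rewrite -[leRHS]mulr1 -{2}(subr0 1).
  apply: (integral_bounded ler01 mu (fun k hk => HC e k e0 hk)).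
  exact: integral_bounded_fine mu (fun k hk => HC e k e0 hk).
rewrite -I; exact: integral_bounded_fine mu (fun k hk => HC e k e0 hk).
Qed.

End logarithmic_integral.

Section logarithmic_integral_limit.
Context {R : realType}.
Variable th : R.
Hypothesis th0 : 0 < th.
Local Notation phm := (phim th).
Local Notation p := (pexp th).
Local Notation X := (Xf th).
Local Notation B := (Bx th).
Local Notation leb := (@lebR R).
Implicit Types (k f x e : R) (n : nat).

Lemma integral_split_lebR (h : R -> R) (a c b : R) : a < c < b -> measurable_fun `]a, b[ h ->
  (\int[leb]_(x in `]a, b[) (h x)%:E =
   \int[leb]_(x in `]a, c[) (h x)%:E + \int[leb]_(x in `]c, b[) (h x)%:E)%E.
Proof.
move=> /andP[ac cb] mh.
have s1 : `]a, c[ `<=` `]a, b[ by apply: subset_itvl; rewrite bnd_simp ltW.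
have s2 : `[c, b[ `<=` `]a, b[.
  by move=> t; rewrite /= !in_itv/= => /andP[t1 t2]; rewrite t2 (lt_le_trans ac).
have s3 : `]c, b[ `<=` `]a, b[ by apply: subset_itvr; rewrite bnd_simp ltW.
have m1 := measurable_funS (measurable_itv `]a, b[) s1 mh.
have m2 := measurable_funS (measurable_itv `]a, b[) s2 mh.
have m3 := measurable_funS (measurable_itv `]a, b[) s3 mh.
rewrite -!integral_lebR//; [|exact/measurable_EFinP..].
have m3' : measurable_fun [set` Interval (BRight c) (BLeft b)] (EFin \o h) by exact/measurable_EFinP.
rewrite [X in (_ + X)%E](integral_itv_obnd_cbnd m3').
have U : `]a, b[%classic = `]a, c[ `|` `[c, b[ :> set R.
  apply/seteqP; split => t.
    by rewrite /= !in_itv/= => /andP[t1 t2]; case: (ltP t c) => tc; [left; rewrite t1|right].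
  by case; [exact: s1|exact: s2].
rewrite U (@integral_setU_EFin _ _ _ lebesgue_measure)//=.
- by rewrite -U.
- apply/disj_setPRL => t; rewrite /= !in_itv/= => /andP[t1 t2] /andP[t3 t4].
  by move: t4; rewrite ltNge t1.
Qed.

Lemma measurable_neglog : measurable_fun setT (@neglog R).
Proof.
apply: measurable_fun_ifT => //; first exact: measurable_fun_eqr.
by apply/measurable_EFinP; apply: measurable_funN; exact: measurable_ln.
Qed.

Definition eps n : R := (n.+1%:R)^-1.

Lemma eps_gt0 n : 0 < eps n. Proof. by rewrite invr_gt0. Qed.

Lemma eps_le1 n : eps n <= 1. Proof. by rewrite invf_le1// ler1n. Qed.

Lemma cvg_eps : eps n @[n --> \oo] --> (0 : R).
Proof. exact: cvg_harmonic. Qed.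

Lemma eps_nincr n m : (n <= m)%N -> eps m <= eps n.
Proof. by move=> nm; rewrite lef_pV2 ?posrE// ler_nat ltnS. Qed.

Lemma ln_sqr_half (d : R) : d != 0 -> ln (d ^+ 2) / 2 = ln `|d|.
Proof.
move=> d0; rewrite -real_normK ?num_real// expr2 lnM ?posrE ?normr_gt0//.
by field.
Qed.

Lemma cvg_neglog (K d : R) :
  ((K - ln (d ^+ 2 + eps n ^+ 2) / 2)%:E @[n --> \oo] --> K%:E + neglog `|d|)%E.
Proof.
rewrite /neglog normr_eq0; have [->|d0] := eqVneq d 0.
  rewrite addey//; apply/cvgeryP/cvgryPge => A.
  exists (Num.truncn (expR (A - K))) => // n /= Nn.
  rewrite expr0n add0r ln_sqr_half ?lt0r_neq0 ?eps_gt0// (gtr0_norm (eps_gt0 _)).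
  rewrite /eps lnV ?posrE// opprK -lerBlDl -[leLHS]expRK ler_ln ?posrE ?expR_gt0//.
  by rewrite ltW// -truncn_le_nat.
rewrite -EFinD; apply: cvg_EFin; first by apply: nearW.
rewrite -(ln_sqr_half d0).
apply: cvgB; first exact: cvg_cst.
apply: cvgM; last exact: cvg_cst.
apply: cvg_ln; first by rewrite exprn_even_gt0.
rewrite -[X in _ --> X]addr0; apply: cvgD; first exact: cvg_cst.
rewrite -[X in _ --> X](mulr0 0); by apply: cvgM; exact: cvg_eps.
Qed.

Lemma cvg_atan_eps (d : R) : atan (d / eps n) @[n --> \oo] --> Num.sg d * (pi / 2).
Proof.
have P (y : R) : 0 < y -> atan (y / eps n) @[n --> \oo] --> pi / 2.
  move=> y0; apply: (cvg_comp _ _ _ (@cvgy_atan R)).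
  apply/cvgryPge => A; exists (Num.truncn (`|A| / y)) => // n /= Nn.
  rewrite /eps invrK; apply: le_trans (ler_norm _) _.
  by rewrite mulrC -ler_pdivrMr// ltW// -truncn_le_nat.
case: (ltrgtP d 0) => d0.
- rewrite (ltr0_sg d0) mulN1r.
  have e n : atan (d / eps n) = - atan (- d / eps n) by rewrite mulNr atanN opprK.
  by under eq_fun do rewrite e; apply: cvgN; apply: P; rewrite oppr_gt0.
- by rewrite (gtr0_sg d0) mul1r; exact: P.
- rewrite d0 sgr0 mul0r; under eq_fun do rewrite mul0r atan0; exact: cvg_cst.
Qed.

Lemma Rq_lower : exists2 m : R, 0 < m & forall f, 0 < f < phm -> m <= Rq th f.
Proof.
have c0 : (Rq th f)^-1 @[f --> (0 : R)^'+] --> th^-1.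
  by apply: cvgV; [exact: lt0r_neq0|exact: cvg_Rq0].
have q0 f : 0 < f <= phm -> 0 < Rq th f.
  move=> /andP[f0]; rewrite le_eqVlt => /predU1P[->|fm]; first by rewrite Rq_phim.
  by rewrite Rq_gt0 ?f0.
have [|M HM] := bounded_oc (phim_gt0 th0) _ c0.
  move=> f h; apply: (cvgV (lt0r_neq0 (q0 f h))).
  by apply: sin_ratio_continuous; rewrite lt0r_neq0// (sin_gt0_phim th0).
exists (M + 1)^-1.
  have h : 0 < phm <= phm by rewrite phim_gt0 ?lexx.
  by rewrite invr_gt0 ltr_wpDl// (le_trans _ (HM _ h)).
move=> f /andP[f0 fm]; have h : 0 < f <= phm by rewrite f0 ltW.
have := HM _ h; rewrite normfV (gtr0_norm (q0 _ h)) => hM.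
rewrite -(invrK (Rq th f)) lef_pV2 ?posrE ?invr_gt0 ?q0//.
  by rewrite (le_trans hM)// lerDl.
by rewrite ltr_wpDl// (le_trans _ hM)// invr_ge0 ltW// q0.
Qed.

Lemma measurable_dRq : measurable_fun setT (dRq th).
Proof.
apply: measurable_funM.
  apply: measurable_funB.
    apply: measurable_funM; last exact: measurable_sinR.
    apply: measurable_funM => //; apply: continuous_measurable_fun => f.
    exact: derive_continuous (derive_cos_scale th f).
  apply: measurable_funM; first exact: measurable_sin_scale.
  by apply: continuous_measurable_fun; exact: continuous_cos.
by apply: measurable_inv; apply: measurable_funX; exact: measurable_sinR.
Qed.

Variable be : R.
Hypothesis hbe : 0 < be < phm.
Let x := X be.
Let hx : 0 < x < B. Proof. exact: Xf_range. Qed.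

Variable K : R.
Hypothesis hK : ln (B ^+ 2 + 1) / 2 <= K.

(** [K] makes the singular part [g] nonnegative, and [g] increases with [n], so monotone convergence
    applies to it; the remaining part [h] is bounded and converges by domination. *)
Let g n f : R := K - ln ((X f - x) ^+ 2 + eps n ^+ 2) / 2.
Let hh (s : R) f : R := (1 + th) * (ln (Rq th f) + K) +
  dRq th f / Rq th f * ((1 + th) * f - pi / 2 + s).
Let h n f : R := hh (atan ((X f - x) / eps n)) f.

Let hgv n f : 0 < f < phm -> (1 + th) * g n f = h n f - vfun th x (eps n) f.
Proof. by move=> hf; rewrite (vfunE th0 x (eps_gt0 n) hf) /g /h /hh; field; rewrite lt0r_neq0// Rq_gt0. Qed.

Let sq_gt0 n f : 0 < (X f - x) ^+ 2 + eps n ^+ 2.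
Proof. by rewrite ltr_wpDl ?sqr_ge0// exprn_gt0// eps_gt0. Qed.

Let g_ge0 n f : 0 < f < phm -> 0 <= g n f.
Proof.
move=> hf; rewrite subr_ge0 (le_trans _ hK)// ler_pM2r// ler_ln ?posrE//.
  have /andP[X0 XB] := Xf_range th0 hf; have /andP[x0 xB] := hx.
  have := eps_le1 n; have := eps_gt0 n; set u := eps n => u0 u1.
  apply: lerD; nra.
by rewrite ltr_wpDl// sqr_ge0.
Qed.

Let g_nd n m f : (n <= m)%N -> g n f <= g m f.
Proof.
move=> nm; rewrite lerD2l lerN2 ler_pM2r// ler_ln ?posrE// lerD2l.
by rewrite lerXn2r ?nnegrE ?(ltW (eps_gt0 _))// eps_nincr.
Qed.

Let hh_bounded : exists M, forall s f, `|s| <= pi / 2 -> 0 < f < phm -> `|hh s f| <= M.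
Proof.
have [m m0 Hm] := Rq_lower; have [M HM] := Rq_bounded th0.
exists ((1 + th) * (Num.max `|ln m| `|ln M| + `|K|) + M / m * (pi + pi / 2 + pi / 2)).
move=> s f hs hf; have [M1 M2] := HM _ hf; have m1 := Hm _ hf; have q0 := Rq_gt0 th0 hf.
have M0 : 0 < M by exact: lt_le_trans M1.
have [_ _ /andP[a0 a1]] := angle_bounds th0 hf; have pi0 := pi_gt0 R.
apply: le_trans (ler_normD _ _) _; apply: lerD.
  rewrite normrM (gtr0_norm (th1_gt0 th0)) ler_pM2l ?th1_gt0//.
  apply: le_trans (ler_normD _ _) _; rewrite lerD2r le_max.
  have l1 : ln m <= ln (Rq th f) by rewrite ler_ln ?posrE.
  have l2 : ln (Rq th f) <= ln M by rewrite ler_ln ?posrE.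
  case: (leP 0 (ln (Rq th f))) => l0.
    by rewrite (ger0_norm l0) (le_trans l2 (ler_norm _)) orbT.
  by rewrite (ltr0_norm l0) -normrN (le_trans _ (ler_norm _))// lerN2.
rewrite normrM; apply: ler_pM => //.
  rewrite normrM normfV (gtr0_norm q0); apply: ler_pM => //; first by rewrite invr_ge0 ltW.
  by rewrite lef_pV2 ?posrE.
apply: le_trans (ler_normD _ _) _; apply: lerD => //.
apply: le_trans (ler_normB _ _) _; rewrite (gtr0_norm a0) ger0_norm; last by lra.
by rewrite lerD2r ltW.
Qed.

Let atan_le (t : R) : `|atan t| <= pi / 2.
Proof. by rewrite ler_norml !ltW ?atan_gtNpi2 ?atan_ltpi2. Qed.

Let measurable_hh (s : R -> R) : measurable_fun setT s ->
  measurable_fun setT (fun f => hh (s f) f).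
Proof.
move=> ms; apply: measurable_funD.
  apply: measurable_funM => //; apply: measurable_funD => //.
  exact: measurableT_comp (@measurable_ln R) (measurable_Rq th).
apply: measurable_funM.
  apply: measurable_funM; first exact: measurable_dRq.
  exact: measurable_inv (measurable_Rq th).
by apply: measurable_funD => //; apply: measurable_funB.
Qed.

Let measurable_h n : measurable_fun setT (h n).
Proof.
apply: measurable_hh; apply: measurableT_comp.
  by apply: continuous_measurable_fun => t; exact: continuous_atan.
apply: measurable_funM => //; apply: measurable_funB => //; exact: measurable_Xf.
Qed.

Let measurable_g n : measurable_fun setT (g n).
Proof.
apply: measurable_funB => //; apply: measurable_funM => //.
apply: measurableT_comp (@measurable_ln R) _.
apply: measurable_funD => //; apply: measurable_funX; apply: measurable_funB => //.
exact: measurable_Xf.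
Qed.

Let vfun_bounded e : 0 < e -> exists M, forall f, 0 < f < phm -> `|vfun th x e f| <= M.
Proof.
move=> e0; have [M HM] := @Hk_bounded R th th0 (zx x e) e0; exists (M * (1 - 0)) => f hf.
have mH := measurableT_comp (@measurable_Hk R th (zx x e)) (@pair2_measurable _ _ _ _ f).
apply: (integral_bounded ler01 _ _ (integral_Hk_k th0 x e0 hf)).
  by apply: measurable_funTS; exact: mH.
by move=> k /andP[k0 k1]; apply: HM => //; rewrite k0 ltW.
Qed.

Let h_inf f : R := hh (Num.sg (X f - x) * (pi / 2)) f.

Let sg_le (t : R) : `|Num.sg t * (pi / 2)| <= pi / 2.
Proof.
have pi0 := pi_gt0 R; rewrite normrM (ger0_norm (_ : 0 <= pi / 2)); last by lra.
by rewrite normr_sg; case: (t != 0); rewrite /= ?mul1r ?mul0r; lra.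
Qed.

Let cvg_integral_h :
  (\int[leb]_(f in `]0%R, phm[) (h n f)%:E @[n --> \oo] --> \int[leb]_(f in `]0%R, phm[) (h_inf f)%:E)%E.
Proof.
have [M HM] := hh_bounded.
apply: (@dominated_cvg _ _ _ leb `]0%R, phm[ (measurable_itv _)
   (fun n f => (h n f)%:E) (fun f => (h_inf f)%:E) (fun=> M%:E)).
- by move=> n; apply/measurable_EFinP; apply: measurable_funTS.
- move=> f _; apply: cvg_EFin; first by apply: nearW.
  apply: cvgD; first exact: cvg_cst.
  apply: cvgM; first exact: cvg_cst.
  by apply: cvgD; [exact: cvg_cst|exact: cvg_atan_eps].
- by [].
- by apply: (@bounded_integrable_lebR R (fun=> M) 0 phm `|M|).
- by move=> n f; rewrite /= in_itv/= => hf; rewrite lee_fin; exact: HM.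
Qed.

Let mu_cont f : 0 < f < phm ->
  is_derive f 1 (fun f => (1 + th) * f * ln (Rq th f) + (1 + th) * K * f)
   ((1 + th) * (ln (Rq th f) + K) + dRq th f / Rq th f * ((1 + th) * f)).
Proof.
move=> hf; have q0 := Rq_gt0 th0 hf.
apply: (is_derive_eq (derive_add (derive_mul (derive_scale (1 + th) f)
  (derive_ln (derive_Rq th0 hf) q0)) (derive_scale ((1 + th) * K) f))).
rewrite -/(dRq th f); ring.
Qed.

(** In the limit the term [- pi / 2 + atan] is 0 before the angle [be] of [x] and [- pi] after it.
    The latter contributes [pi ln (Rq be)], since [Rq] is 1 at [phm]. *)
Let integral_h_inf :
  (\int[leb]_(f in `]0%R, phm[) (h_inf f)%:E = ((1 + th) * K * phm + pi * ln (Rq th be))%:E)%E.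
Proof.
have [M HM] := hh_bounded; have /andP[b0 bm] := hbe; have qb := Rq_gt0 th0 hbe.
have mh : measurable_fun setT h_inf.
  apply: measurable_hh; apply: measurable_funM => //.
  have mX : measurable_fun setT (fun f => X f - x).
    by apply: measurable_funB => //; exact: measurable_Xf.
  have sgE (t : R) : Num.sg t = (0 < t)%R%:R - (t < 0)%R%:R.
    by case: (ltrgtP t 0) => t0; rewrite ?(gtr0_sg t0) ?(ltr0_sg t0) ?t0 ?sgr0 ?subr0 ?sub0r.
  under eq_fun do rewrite sgE.
  by apply: measurable_funB; apply: measurable_bool_real; exact: measurable_fun_ltr.
rewrite (integral_split_lebR hbe); last exact: measurable_funTS.
pose G f := (1 + th) * f * ln (Rq th f) + (1 + th) * K * f.
have E1 f : 0 < f < be -> h_inf f = (1 + th) * (ln (Rq th f) + K) + dRq th f / Rq th f * ((1 + th) * f).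
  move=> /andP[f0 fb]; rewrite /h_inf /hh gtr0_sg ?subr_gt0 ?Xf_decr//; ring.
have E2 f : be < f < phm -> h_inf f =
    ((1 + th) * (ln (Rq th f) + K) + dRq th f / Rq th f * ((1 + th) * f)) - pi * (dRq th f / Rq th f).
  move=> /andP[f0 fb]; rewrite /h_inf /hh ltr0_sg ?subr_lt0 ?Xf_decr//; field.
  by rewrite lt0r_neq0// Rq_gt0// fb (lt_trans b0).
have cR f : 0 < f < phm -> {for f, continuous (Rq th)}.
  by move=> hf; exact: derive_continuous (derive_Rq th0 hf).
have cd f : 0 < f < phm -> {for f, continuous (fun f => dRq th f / Rq th f)}.
  move=> hf; have q0 := lt0r_neq0 (Rq_gt0 th0 hf); have s0 := lt0r_neq0 (sin_f_gt0 th0 hf).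
  have s2 : sin f * sin f != 0 by rewrite mulf_neq0.
  exact: derive_continuous (derive_div (derive_div (derive_sub (derive_mul
    (derive_mul (derive_const th f) (derive_cos_scale th f)) (derive_sin (derive_var f)))
    (derive_mul (derive_sin_scale th f) (derive_cos (derive_var f))))
    (derive_mul (derive_sin (derive_var f)) (derive_sin (derive_var f))) s2) (derive_Rq th0 hf) q0).
pose H1 f := (1 + th) * (ln (Rq th f) + K) + dRq th f / Rq th f * ((1 + th) * f).
have cH1 f : 0 < f < phm -> {for f, continuous H1}.
  move=> hf; apply: cvgD.
    apply: cvgM; first exact: cvg_cst.
    apply: cvgD; last exact: cvg_cst.
    by apply: cvg_ln; [exact: Rq_gt0|exact: cR].
  by apply: cvgM; [exact: cd|exact: derive_continuous (derive_scale (1 + th) f)].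
have cG f : 0 < f < phm -> {for f, continuous G}.
  by move=> hf; exact: derive_continuous (mu_cont hf).
have I1 : (\int[leb]_(f in `]0%R, be[) (h_inf f)%:E = (G be - 0)%:E)%E.
  transitivity (\int[leb]_(f in `]0%R, be[) (H1 f)%:E)%E.
    by apply: eq_integral => f; rewrite mem_oo => hf; rewrite E1.
  apply: (@bounded_FTC_lebR R H1 G 0 be _ _ M b0).
  - move=> f /andP[f0 fb]; rewrite /H1 -E1 ?f0//; apply: HM => //.
    by rewrite f0 (lt_trans fb).
  - by move=> f /andP[f0 fb]; apply: cH1; rewrite f0 (lt_trans fb).
  - by move=> f /andP[f0 fb]; apply: mu_cont; rewrite f0 (lt_trans fb).
  - rewrite -[X in _ --> X](_ : (1 + th) * 0 * ln th + (1 + th) * K * 0 = 0); last by ring.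
    apply: cvgD.
      apply: cvgM; last by apply: cvg_ln => //; exact: cvg_Rq0.
      by apply: cvg_at_right_filter; exact: derive_continuous (derive_scale (1 + th) 0).
    by apply: cvg_at_right_filter; exact: derive_continuous (derive_scale ((1 + th) * K) 0).
  - by apply: cvg_at_left_filter; exact: cG.
pose G2 f := G f - pi * ln (Rq th f).
have I2 : (\int[leb]_(f in `]be, phm[) (h_inf f)%:E = ((1 + th) * K * phm - G2 be)%:E)%E.
  transitivity (\int[leb]_(f in `]be, phm[) (H1 f - pi * (dRq th f / Rq th f))%:E)%E.
    by apply: eq_integral => f; rewrite mem_oo => hf; rewrite E2.
  apply: (@bounded_FTC_lebR R (fun f => H1 f - pi * (dRq th f / Rq th f)) G2 be phm _ _ M bm).
  - move=> f hf; rewrite /H1 -E2//; apply: HM => //.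
    by case/andP: hf => f0 ->; rewrite (lt_trans b0).
  - move=> f /andP[f0 fb]; have hf : 0 < f < phm by rewrite fb (lt_trans b0).
    apply: cvgB; first exact: cH1.
    by apply: cvgM; [exact: cvg_cst|exact: cd].
  - move=> f /andP[f0 fb]; have hf : 0 < f < phm by rewrite fb (lt_trans b0).
    apply: (is_derive_eq (derive_sub (mu_cont hf) (derive_mul (derive_const pi f)
      (derive_ln (derive_Rq th0 hf) (Rq_gt0 th0 hf))))).
    by rewrite mul0r add0r.
  - apply: cvg_at_right_filter; apply: cvgB; first exact: cG.
    apply: cvgM; first exact: cvg_cst.
    by apply: cvg_ln => //; exact: cR.
  - rewrite -[X in _ --> X](_ : (1 + th) * phm * ln 1 + (1 + th) * K * phm - pi * ln 1 =
      (1 + th) * K * phm); last by rewrite ln1; ring.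
    have cl : ln (Rq th f) @[f --> phm^'-] --> ln (1 : R).
      by apply: cvg_ln => //; exact: cvg_Rqm.
    apply: cvgB; last by apply: cvgM => //; exact: cvg_cst.
    apply: cvgD.
      apply: cvgM => //.
      by apply: cvg_at_left_filter; exact: derive_continuous (derive_scale (1 + th) phm).
    by apply: cvg_at_left_filter; exact: derive_continuous (derive_scale ((1 + th) * K) phm).
by rewrite I1 I2 -EFinD; congr EFin; rewrite /G2; ring.
Qed.

(** The integral of [ln |X f - x|] is thus [- phm ln (Rq be)], which still depends on [x]; only its
    sum with the dual integral of [log_integral_dual] is constant. *)
Lemma log_integral :
  (\int[leb]_(f in `]0%R, phm[) (K%:E + neglog `|X f - x|%R) =
   (phm * (K + ln (Rq th be)))%:E)%E.
Proof.
have t1 := th1_gt0 th0.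
have L1 : ((\int[leb]_(f in `]0%R, phm[) ((1 + th) * g n f)%:E) @[n --> \oo] -->
    (1 + th)%:E * \int[leb]_(f in `]0%R, phm[) (K%:E + neglog `|X f - x|%R))%E.
  have mc : ((\int[leb]_(f in `]0%R, phm[) ((1 + th) * g n f)%:E) @[n --> \oo] -->
     \int[leb]_(f in `]0%R, phm[) (limn (fun n => ((1 + th) * g n f)%:E)))%E.
    apply: (@cvg_monotone_convergence _ _ _ leb `]0%R, phm[ (measurable_itv _)
      (fun n f => ((1 + th) * g n f)%:E)).
    - by move=> n; apply/measurable_EFinP; apply: measurable_funTS; apply: measurable_funM.
    - move=> n f; rewrite /= in_itv/= => hf.
      by rewrite lee_fin mulr_ge0 ?(ltW t1)// g_ge0.
    - by move=> f _ n m nm; rewrite lee_fin ler_pM2l// g_nd.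
  have cl f : 0 < f < phm -> ((g n f)%:E @[n --> \oo] --> K%:E + neglog `|X f - x|%R)%E.
    by move=> _; exact: cvg_neglog.
  have le0 f : 0 < f < phm -> (0 <= K%:E + neglog `|X f - x|%R)%E.
    move=> hf; rewrite -(cvg_lim _ (cl f hf))//; apply: lime_ge.
      by apply/cvg_ex; eexists; exact: cl f hf.
    by apply: nearW => n; rewrite lee_fin g_ge0.
  rewrite -ge0_integralZl//.
  - move: mc; congr (_ --> _); apply: eq_integral => f; rewrite mem_oo => hf.
    apply/cvg_lim => //; under eq_fun do rewrite EFinM.
    by apply: cvgeZl => //; exact: cl.
  - apply: emeasurable_funD => //.
    apply: measurable_funTS; apply: (measurableT_comp measurable_neglog).
    by apply: measurableT_comp => //; apply: measurable_funB => //; exact: measurable_Xf.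
  - by rewrite lee_fin ltW.
have [C HC] := integral_vfun th0 hx.
have E n : exists2 u : R, `|u| <= C * eps n &
   (\int[leb]_(f in `]0%R, phm[) ((1 + th) * g n f)%:E =
    \int[leb]_(f in `]0%R, phm[) (h n f)%:E - u%:E)%E.
  have [mv [u uC uE]] := HC _ (eps_gt0 n); exists u => //.
  have [M HM] := hh_bounded; have [M' HM'] := vfun_bounded (eps_gt0 n).
  rewrite -uE -integralB//=.
  - by apply: eq_integral => f; rewrite mem_oo => hf; rewrite hgv// EFinB.
  - apply: (bounded_integrable_lebR (measurable_funTS (measurable_h n))) => f hf.
    by apply: HM => //; exact: atan_le.
  - exact: bounded_integrable_lebR mv HM'.
pose u n := s2val (cid2 (E n)).
have uC n : `|u n| <= C * eps n by rewrite /u; case: cid2.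
have uE n : (\int[leb]_(f in `]0%R, phm[) ((1 + th) * g n f)%:E =
    \int[leb]_(f in `]0%R, phm[) (h n f)%:E - (u n)%:E)%E by rewrite /u; case: cid2.
have u0 : u n @[n --> \oo] --> (0 : R).
  apply: (@squeeze_cvgr _ _ _ _ (fun n => - (C * eps n)) (fun n => C * eps n)).
  - by apply: nearW => n; rewrite -ler_norml.
  - rewrite -[X in _ --> X]oppr0 -(mulr0 C); apply: cvgN.
    by apply: cvgM; [exact: cvg_cst|exact: cvg_eps].
  - by rewrite -[X in _ --> X](mulr0 C); apply: cvgM; [exact: cvg_cst|exact: cvg_eps].
have L2 : ((\int[leb]_(f in `]0%R, phm[) ((1 + th) * g n f)%:E) @[n --> \oo] -->
    ((1 + th) * K * phm + pi * ln (Rq th be))%:E)%E.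
  under eq_fun do rewrite uE.
  have -> : (((1 + th) * K * phm + pi * ln (Rq th be))%:E =
      \int[leb]_(f in `]0%R, phm[) (h_inf f)%:E - 0%:E)%E by rewrite integral_h_inf sube0.
  apply: cvgeB => //; last by apply: cvg_EFin => //; exact: nearW.
  by rewrite integral_h_inf.
have := cvg_unique _ L1 L2; set I := (\int[leb]_(f in _) _)%E => e.
have : ((1 + th)^-1%:E * ((1 + th)%:E * I) = (1 + th)^-1%:E * ((1 + th) * K * phm + pi * ln (Rq th be))%:E)%E.
  by rewrite e.
rewrite muleA -EFinM mulVf ?lt0r_neq0// mul1e => ->; congr EFin.
by rewrite -(phimE th0); field; rewrite lt0r_neq0.
Qed.

End logarithmic_integral_limit.

Section neglog_arithmetic.
Context {R : realType}.
Implicit Types (a b d x y : R).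

Lemma neglogM d a : 0 <= d -> 0 < a -> (neglog (d * a) = neglog d + (- ln a)%:E)%E.
Proof.
move=> d0 a0; rewrite /neglog mulf_eq0 (gt_eqF a0) orbF; case: ifPn => // dn.
have dp : 0 < d by rewrite lt0r dn.
by rewrite -EFinD; congr EFin; rewrite lnM ?posrE//; ring.
Qed.

Lemma neglog_shift_ge0 d (A K : R) : `|d| <= A -> ln (A ^+ 2 + 1) / 2 <= K ->
  (0 <= K%:E + neglog `|d|%R)%E.
Proof.
move=> dA hK; rewrite /neglog normr_eq0; case: ifPn => d0; first by rewrite addey.
rewrite -EFinD lee_fin subr_ge0 -ln_sqr_half// (le_trans _ hK)// ler_pM2r//.
have d2 : d ^+ 2 <= A ^+ 2.
  by rewrite -(real_normK (num_real d)) lerXn2r ?nnegrE ?(le_trans _ dA).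
rewrite ler_ln ?posrE ?exprn_even_gt0//; first by rewrite ler_wpDr.
by rewrite ltr_wpDl ?sqr_ge0.
Qed.

(** This lemma and the next ones move finite terms across relations whose other terms may be
    infinite. *)
Lemma adde_fin_regroup (a b : \bar R) (t r s t' : R) : t = t' + r + s ->
  (a + b + t%:E = r%:E + a + (s%:E + b) + t'%:E)%E.
Proof.
move=> ->; case: a => [a| |]; case: b => [b| |] //=.
by rewrite -!EFinD; congr EFin; ring.
Qed.

Lemma lee_fin_sub (a : \bar R) (r s : R) : (a + r%:E <= s%:E)%E -> (a <= (s - r)%:E)%E.
Proof.
case: a => [a| |] /=; rewrite ?leNye// ?leye_eq//.
by rewrite -EFinD !lee_fin lerBrDr.
Qed.

Lemma adde_fin_trans (i n : \bar R) (a b c q : R) : (n + q%:E = a%:E)%E ->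
  (i + b%:E = n + c%:E)%E -> (i + q%:E = (a + c - b)%:E)%E.
Proof.
case: n => [n| |]; case: i => [i| |] //=.
by rewrite -!EFinD => -[e1] -[e2]; congr EFin; lra.
Qed.

Lemma adde_fin_cancel (n j : \bar R) (a b c : R) : (n + a%:E = b%:E)%E ->
  (n + j = c%:E)%E -> j = (c - b + a)%:E.
Proof.
case: n => [n| |]; case: j => [j| |] //=.
by rewrite -!EFinD => -[e1] -[e2]; congr EFin; lra.
Qed.

Lemma le_eq2 (a a' b b' : \bar R) : a = a' -> b = b' -> (a' <= b')%E -> (a <= b)%E.
Proof. by move=> -> ->. Qed.

End neglog_arithmetic.

(** * Logarithmic potentials on the half-line *)

Section kernel.
Context {R : realType}.
Variable th : R.
Hypothesis th0 : 0 < th.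
Local Notation phm := (phim th).
Local Notation X := (Xf th).
Local Notation B := (Bx th).
Local Notation leb := (@lebR R).
Implicit Types (a c f u x y : R).

Lemma integral_cst_lebR a b (M : R) : a <= b ->
  (\int[leb]_(x in `]a, b[) M%:E = (M * (b - a))%:E)%E.
Proof.
move=> ab; rewrite -[LHS]/(\int[leb]_(y in `]a, b[) (cst M%:E) y)%E integral_cst//.
by rewrite [X in (_ * X)%E](lebR_oo ab).
Qed.

Lemma integral_cst_phim (M : R) : (\int[leb]_(f in `]0%R, phm[) M%:E = (M * phm)%:E)%E.
Proof. by rewrite integral_cst_lebR ?subr0// ltW// phim_gt0. Qed.

(* [x / (1 + x)] and [x^th / (1 + x^th)] map the half-line into [[0, 1]]; the two
   logarithmic kernels become nonnegative there, at the cost of the term [tau]. *)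
Definition gmap x : R := if 0 <= x then x / (1 + x) else 0.
Definition gmapth x : R := if 0 <= x then gmap (x `^ th) else 0.
Definition tau x : R := ln (1 + x) + ln (1 + x `^ th).
Definition kb x y : \bar R := (neglog `|x - y|%R + neglog `|x `^ th - y `^ th|%R)%E.
Definition nk x y : \bar R := (logk gmap x y + logk gmapth x y)%E.

Lemma gmap01 x : 0 <= gmap x <= 1.
Proof.
rewrite /gmap; case: ifPn => [x0|_]; last by rewrite lexx ler01.
have x1 : 0 < 1 + x by rewrite ltr_pwDl.
by rewrite divr_ge0 ?(ltW x1)//= ler_pdivrMr// mul1r lerDr.
Qed.

Lemma gmapth01 x : 0 <= gmapth x <= 1.
Proof. by rewrite /gmapth; case: ifPn => _; [exact: gmap01|rewrite lexx ler01]. Qed.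

Lemma measurable_gmap : measurable_fun setT gmap.
Proof.
apply: measurable_fun_ifT => //; first exact: measurable_fun_ler.
by apply: measurable_funM => //; apply: measurable_inv; exact: measurable_funD.
Qed.

Lemma measurable_gmapth : measurable_fun setT gmapth.
Proof.
apply: measurable_fun_ifT => //; first exact: measurable_fun_ler.
exact: measurableT_comp measurable_gmap (measurable_powR th).
Qed.

Lemma measurable_tau : measurable_fun setT tau.
Proof.
apply: measurable_funD; apply: (measurableT_comp (@measurable_ln R)).
  exact: measurable_funD.
by apply: measurable_funD => //; exact: measurable_powR.
Qed.

Lemma neglog_ge0 (d : R) : 0 <= d <= 1 -> (0 <= neglog d)%E.
Proof.
move=> /andP[d0 d1]; rewrite /neglog; case: ifPn => // dn.
by rewrite lee_fin oppr_ge0 ln_le0.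
Qed.

Lemma logk_ge0 (g : R -> R) x y : (forall x, 0 <= g x <= 1) -> (0 <= logk g x y)%E.
Proof.
move=> g01; apply: neglog_ge0; rewrite normr_ge0/= ler_norml.
by have /andP[? ?] := g01 x; have /andP[? ?] := g01 y; apply/andP; split; lra.
Qed.

Lemma nk_ge0 x y : (0 <= nk x y)%E.
Proof. by rewrite adde_ge0// logk_ge0//; [exact: gmap01|exact: gmapth01]. Qed.

Lemma measurable_logk (g : R -> R) : measurable_fun setT g ->
  measurable_fun setT (fun z : R * R => logk g z.1 z.2).
Proof.
move=> mg; apply: (measurableT_comp (@measurable_neglog R)).
apply: measurableT_comp => //; apply: measurable_funB.
  exact: measurableT_comp mg measurable_fst.
exact: measurableT_comp mg measurable_snd.
Qed.

Lemma measurable_nk : measurable_fun setT (fun z : R * R => nk z.1 z.2).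
Proof.
apply: emeasurable_funD; first exact: measurable_logk measurable_gmap.
exact: measurable_logk measurable_gmapth.
Qed.

Lemma neglog_gmap x y : 0 <= x -> 0 <= y ->
  (neglog `|gmap x - gmap y|%R = neglog `|x - y|%R + (ln (1 + x) + ln (1 + y))%:E)%E.
Proof.
move=> x0 y0; have x1 : 0 < 1 + x by rewrite ltr_pwDl.
have y1 : 0 < 1 + y by rewrite ltr_pwDl.
have p0 : 0 < ((1 + x) * (1 + y))^-1 by rewrite invr_gt0 mulr_gt0.
have -> : gmap x - gmap y = (x - y) * ((1 + x) * (1 + y))^-1.
  by rewrite /gmap x0 y0; field; rewrite !lt0r_neq0.
rewrite normrM (gtr0_norm p0) neglogM// lnV ?posrE ?mulr_gt0// opprK.
by rewrite lnM ?posrE.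
Qed.

Lemma nkE x y : 0 <= x -> 0 <= y -> (nk x y = kb x y + (tau x + tau y)%:E)%E.
Proof.
move=> x0 y0; rewrite /nk /logk neglog_gmap// /gmapth x0 y0 neglog_gmap ?powR_ge0//.
rewrite /kb /tau addeACA -EFinD; congr (_ + _%:E)%E; ring.
Qed.

Lemma kb_scale c x y : 0 < c -> 0 <= x -> 0 <= y ->
  (kb (c * x) (c * y) = kb x y + (- ((1 + th) * ln c))%:E)%E.
Proof.
move=> c0 x0 y0; have ct : 0 < c `^ th by rewrite powR_gt0.
rewrite /kb !powRM// ?(ltW c0)// -!mulrBr !normrM (gtr0_norm c0) (gtr0_norm ct).
rewrite (mulrC c) (mulrC (c `^ th)) !neglogM// addeACA -EFinD.
by congr (_ + _%:E)%E; rewrite ln_powR; ring.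
Qed.

Lemma nkC x y : nk x y = nk y x.
Proof. by rewrite /nk /logk (distrC (gmap x)) (distrC (gmapth x)). Qed.

Lemma tau_ge0 x : 0 <= x -> 0 <= tau x.
Proof.
by move=> x0; rewrite addr_ge0// ln_ge0// lerDl// powR_ge0.
Qed.

(* [nk] is [kb] up to finite terms, so homogeneity of [kb] transfers to [nk] *)
Lemma nk_scale c x y : 0 < c -> 0 <= x -> 0 <= y ->
  (nk (c * x) (c * y) = nk x y +
   (tau (c * x) + tau (c * y) - tau x - tau y - (1 + th) * ln c)%:E)%E.
Proof.
move=> c0 x0 y0; rewrite !nkE ?mulr_ge0 ?(ltW c0)// kb_scale//.
move: (kb x y) => k; rewrite -!addeA -!EFinD; congr (_ + _%:E)%E; ring.
Qed.

Lemma phimV : phim th^-1 = th * phm.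
Proof. by rewrite /phim; field; rewrite !lt0r_neq0 ?th1_gt0// addrC th1_gt0. Qed.

Lemma RqV f : 0 < f < phm -> Rq th^-1 (th * f) = (Rq th f)^-1.
Proof. by move=> h; rewrite /Rq mulKf ?lt0r_neq0// invf_div. Qed.

(** Exchanging [th] with [1 / th], at the angle [th * f], turns [X] into [X^th] and [Rq] into its
    inverse. The logarithmic integral of [X^th] is therefore the one already computed, with [ln Rq]
    of opposite sign. *)
Lemma XfV f : 0 < f < phm -> Xf th^-1 (th * f) = X f `^ th.
Proof.
move=> h; have w0 := Rw_gt0 th0 h; have q0 := Rq_gt0 th0 h.
have s0 := sin_f_gt0 th0 h; have t0 := sin_thf_gt0 th0 h.
rewrite /Xf RqV// invrK.
have -> : Rw th^-1 (th * f) = Rw th f / Rq th f.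
  rewrite /Rw /Rq; have -> : (1 + th^-1) * (th * f) = (1 + th) * f by field; exact: lt0r_neq0.
  by field; rewrite !lt0r_neq0.
have wp := powR_gt0 (pexp th) w0.
have wq := divr_gt0 w0 q0; have wq' := powR_gt0 (pexp th^-1) wq; have xq := divr_gt0 wp q0.
apply: (@ln_inj R); rewrite ?posrE; [exact: mulr_gt0|exact: powR_gt0|].
have e1 : ln (Rw th f / Rq th f) = ln (Rw th f) - ln (Rq th f) by rewrite ln_div.
have e2 : ln (Rw th f `^ pexp th / Rq th f) = pexp th * ln (Rw th f) - ln (Rq th f).
  by rewrite ln_div// ln_powR.
have -> : ln ((Rw th f / Rq th f) `^ pexp th^-1 * Rq th f) =
    ln ((Rw th f / Rq th f) `^ pexp th^-1) + ln (Rq th f) by rewrite lnM.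
rewrite !ln_powR e1 e2 /pexp invrK.
by field; exact: lt0r_neq0.
Qed.

Lemma BxV : Bx th^-1 = B `^ th.
Proof.
have t1 := th1_gt0 th0; have ti0 : 0 < th^-1 by rewrite invr_gt0.
have t2 := th1_gt0 ti0; have wp := powR_gt0 (pexp th) t1; have wp' := powR_gt0 (pexp th^-1) t2.
apply: (@ln_inj R); rewrite ?posrE ?powR_gt0 ?Bx_gt0//.
rewrite ln_powR !ln_div ?posrE// !ln_powR lnV ?posrE// /pexp invrK.
have -> : 1 + th^-1 = (1 + th) / th by field; exact: lt0r_neq0.
by rewrite ln_div ?posrE//; field; exact: lt0r_neq0.
Qed.

Lemma integralD_phim (F G : R -> \bar R) : measurable_fun setT F -> measurable_fun setT G ->
  (forall f, 0 < f < phm -> (0 <= F f)%E) -> (forall f, 0 < f < phm -> (0 <= G f)%E) ->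
  (\int[leb]_(f in `]0%R, phm[) (F f + G f) =
   \int[leb]_(f in `]0%R, phm[) F f + \int[leb]_(f in `]0%R, phm[) G f)%E.
Proof.
move=> mF mG F0 G0; by rewrite ge0_integralD//; exact: measurable_funTS.
Qed.

Lemma le_integral_phim (F G : R -> \bar R) : measurable_fun setT F -> measurable_fun setT G ->
  (forall f, 0 < f < phm -> (0 <= F f)%E) -> (forall f, 0 < f < phm -> (F f <= G f)%E) ->
  (\int[leb]_(f in `]0%R, phm[) F f <= \int[leb]_(f in `]0%R, phm[) G f)%E.
Proof.
move=> mF mG F0 FG; apply: ge0_le_integral; rewrite //=; exact: measurable_funTS.
Qed.

Lemma eq_integral_phim (F G : R -> \bar R) : (forall f, 0 < f < phm -> F f = G f) ->
  (\int[leb]_(f in `]0%R, phm[) F f = \int[leb]_(f in `]0%R, phm[) G f)%E.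
Proof. by move=> FG; apply: eq_integral => f; rewrite mem_oo; exact: FG. Qed.

Lemma log_integral_dual be K : 0 < be < phm -> ln ((B `^ th) ^+ 2 + 1) / 2 <= K ->
  (\int[leb]_(f in `]0%R, phm[) (K%:E + neglog `|X f `^ th - X be `^ th|%R) =
   (phm * (K - ln (Rq th be)))%:E)%E.
Proof.
move=> hbe hK; have ti0 : 0 < th^-1 by rewrite invr_gt0.
have hbe' : 0 < th * be < phim th^-1 by rewrite phimV mulr_gt0//= ?ltr_pM2l//; case/andP: hbe.
have hK' : ln (Bx th^-1 ^+ 2 + 1) / 2 <= K by rewrite BxV.
have := log_integral ti0 hbe' hK'; rewrite phimV XfV// RqV// lnV ?posrE ?Rq_gt0//.
set F := fun f : R => (K%:E + neglog `|Xf th^-1 f - X be `^ th|%R)%E.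
have mF : measurable_fun setT F.
  apply: emeasurable_funD => //; apply: (measurableT_comp (@measurable_neglog R)).
  by apply: measurableT_comp => //; apply: measurable_funB => //; exact: measurable_Xf.
have F0 f : 0 < f < th * phm -> (0 <= F f)%E.
  move=> h; have h' : 0 < f < phim th^-1 by rewrite phimV.
  apply: (@neglog_shift_ge0 _ _ (B `^ th)) => //.
  have /andP[a0 a1] := Xf_range ti0 h'; have /andP[b0 b1] := Xf_range th0 hbe.
  have b2 : X be `^ th < B `^ th by rewrite gt0_ltr_powR ?nnegrE ?ltW// Bx_gt0.
  have b3 : 0 <= X be `^ th by exact: powR_ge0.
  by rewrite BxV in a1; rewrite ler_norml; apply/andP; split; lra.
rewrite -integral_lebR//; last exact: measurable_funTS.
rewrite ge0_change_of_variables_scale ?phim_gt0//; last exact: measurable_funTS.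
have mFs : measurable_fun setT (fun f : R => F (th * f)%R).
  by apply: (measurableT_comp mF); exact: measurable_funM.
rewrite integral_lebR//; last first.
  by apply: measurable_funTS; exact: emeasurable_funM.
have -> : (\int[leb]_(f in `]0%R, phm[) (F (th * f)%R * th%:E) =
    th%:E * \int[leb]_(f in `]0%R, phm[) (K%:E + neglog `|X f `^ th - X be `^ th|%R))%E.
  rewrite ge0_integralZr//.
  - rewrite muleC; congr (_ * _)%E; apply: eq_integral => f; rewrite mem_oo => h.
    by rewrite /F XfV.
  - exact: measurable_funTS.
  - move=> f; rewrite /= in_itv/= => /andP[f0 f1]; apply: F0.
    by rewrite mulr_gt0//= ltr_pM2l.
  - by rewrite lee_fin ltW.
set I := (\int[leb]_(f in _) _)%E => e.
have : (th^-1%:E * (th%:E * I) = th^-1%:E * (th * phm * (K - ln (Rq th be)))%:E)%E by rewrite e.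
rewrite muleA -EFinM mulVf ?lt0r_neq0// mul1e => ->; congr EFin.
by field; rewrite lt0r_neq0.
Qed.

(** [K0] and [K1] are the least shifts that [log_integral] and its dual allow. *)
Definition K0 : R := ln (B ^+ 2 + 1) / 2.
Definition K1 : R := ln ((B `^ th) ^+ 2 + 1) / 2.
Definition T1 : R := fine (\int[leb]_(f in `]0%R, phm[) (tau (X f))%:E)%E.

Lemma tau_bounded c : 0 <= c -> exists M, forall f, 0 < f < phm -> `|tau (c * X f)| <= M.
Proof.
move=> c0; exists (tau (c * B)) => f h; have /andP[X0 XB] := Xf_range th0 h.
have y0 : 0 <= c * X f by rewrite mulr_ge0// ltW.
have yB : c * X f <= c * B by rewrite ler_wpM2l// ltW.
rewrite ger0_norm ?tau_ge0// lerD// ler_ln ?posrE ?ltr_pwDl ?powR_ge0 ?(le_trans y0)//.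
  by rewrite lerD2l.
by rewrite lerD2l ge0_ler_powR ?nnegrE ?(ltW th0) ?(le_trans y0).
Qed.

Definition Tc c : R := fine (\int[leb]_(f in `]0%R, phm[) (tau (c * X f)%R)%:E)%E.

Lemma measurable_tau_X c : measurable_fun setT (fun f => tau (c * X f)).
Proof.
apply: (measurableT_comp measurable_tau); apply: measurable_funM => //.
exact: measurable_Xf.
Qed.

Lemma TcE c : 0 <= c -> (\int[leb]_(f in `]0%R, phm[) (tau (c * X f)%R)%:E = (Tc c)%:E)%E.
Proof.
move=> c0; have [M HM] := tau_bounded c0.
apply: integral_bounded_fine HM; apply: measurable_funTS; exact: measurable_tau_X.
Qed.

Lemma T1E : (\int[leb]_(f in `]0%R, phm[) (tau (X f))%:E = T1%:E)%E.
Proof. by have := TcE ler01; rewrite /Tc /T1; under eq_integral do rewrite mul1r. Qed.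

Definition Nx u : \bar R := (\int[leb]_(f in `]0%R, phm[) nk u (X f))%E.

Lemma measurable_nk_X u c : measurable_fun setT (fun f => nk u (c * X f)).
Proof.
have mz : measurable_fun setT (fun f => (u, c * X f)).
  apply: measurable_fun_pair => //; apply: measurable_funM => //; exact: measurable_Xf.
exact: measurableT_comp measurable_nk mz.
Qed.

Lemma measurable_nk_X1 u : measurable_fun setT (fun f => nk u (X f)).
Proof.
have mz : measurable_fun setT (fun f => (u, X f)).
  by apply: measurable_fun_pair => //; exact: measurable_Xf.
exact: measurableT_comp measurable_nk mz.
Qed.

(** The terms [ln (Rq be)] of the two logarithmic integrals cancel, so the potential for the kernel
    [kb] is 0 on the support; what remains comes from [tau]. *)
Lemma Nx_inside u : 0 < u < B -> Nx u = (phm * tau u + T1)%:E.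
Proof.
move=> hu; have [hb ub] := PhiP th0 hu; set be := Phi th u in hb ub.
have u0 : 0 <= u by case/andP: hu => /ltW.
have I1 := log_integral th0 hb (lexx K0); have I2 := log_integral_dual hb (lexx K1).
rewrite ub in I1 I2.
have mX := measurable_Xf th.
have m1 : measurable_fun setT (fun f => K0%:E + neglog `|X f - u|%R)%E.
  apply: emeasurable_funD => //; apply: (measurableT_comp (@measurable_neglog R)).
  by apply: measurableT_comp => //; apply: measurable_funB.
have m2 : measurable_fun setT (fun f => K1%:E + neglog `|X f `^ th - u `^ th|%R)%E.
  apply: emeasurable_funD => //; apply: (measurableT_comp (@measurable_neglog R)).
  apply: measurableT_comp => //; apply: measurable_funB => //.
  exact: measurableT_comp (measurable_powR th) mX.
have /andP[_ uB] := hu.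
have p1 f : 0 < f < phm -> (0 <= K0%:E + neglog `|X f - u|%R)%E.
  move=> h; have /andP[X0 XB] := Xf_range th0 h; apply: (@neglog_shift_ge0 _ _ B) => //.
  by rewrite ler_norml; apply/andP; split; lra.
have p2 f : 0 < f < phm -> (0 <= K1%:E + neglog `|X f `^ th - u `^ th|%R)%E.
  move=> h; have /andP[X0 XB] := Xf_range th0 h; apply: (@neglog_shift_ge0 _ _ (B `^ th)) => //.
  have a1 : X f `^ th < B `^ th by rewrite gt0_ltr_powR ?nnegrE ?ltW// Bx_gt0.
  have a2 : u `^ th < B `^ th by rewrite gt0_ltr_powR ?nnegrE// ltW// Bx_gt0.
  have a3 := powR_ge0 (X f) th; have a4 := powR_ge0 u th.
  by rewrite ler_norml; apply/andP; split; lra.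
have mn : measurable_fun setT (fun f => nk u (X f)) by exact: measurable_nk_X1.
have k00 : 0 <= K0 by rewrite divr_ge0// ln_ge0// lerDr sqr_ge0.
have k10 : 0 <= K1 by rewrite divr_ge0// ln_ge0// lerDr sqr_ge0.
have mt : measurable_fun setT (fun f => (tau u + tau (X f))%:E).
  by apply/measurable_EFinP; apply: measurable_funD => //; exact: measurableT_comp measurable_tau mX.
have t0 f : 0 < f < phm -> 0 <= tau (X f).
  by move=> /(Xf_range th0)/andP[X0 _]; rewrite tau_ge0// ltW.
have E : (Nx u + \int[leb]_(f in `]0%R, phm[) (K0 + K1)%:E =
   \int[leb]_(f in `]0%R, phm[) (K0%:E + neglog `|X f - u|%R) +
   \int[leb]_(f in `]0%R, phm[) (K1%:E + neglog `|X f `^ th - u `^ th|%R) +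
   \int[leb]_(f in `]0%R, phm[) (tau u + tau (X f))%:E)%E.
  rewrite -(integralD_phim m1 m2 p1 p2) -integralD_phim//; last 3 first.
  - exact: emeasurable_funD.
  - by move=> f h; rewrite adde_ge0 ?p1 ?p2.
  - by move=> f h; rewrite lee_fin; apply: addr_ge0; [exact: tau_ge0|exact: t0].
  rewrite /Nx -integralD_phim//; last 2 first.
  - by move=> f _; exact: nk_ge0.
  - by move=> f _; rewrite lee_fin addr_ge0.
  apply: eq_integral_phim => f h; have /andP[X0 _] := Xf_range th0 h.
  rewrite nkC nkE ?(ltW X0)// -addeA -EFinD; apply: adde_fin_regroup; ring.
have tE : (\int[leb]_(f in `]0%R, phm[) (tau u + tau (X f))%:E = (tau u * phm + T1)%:E)%E.
  rewrite EFinD -integral_cst_phim -T1E -integralD_phim//.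
  - by apply/measurable_EFinP; exact: measurableT_comp measurable_tau mX.
  - by move=> f _; rewrite lee_fin tau_ge0.
move: E; rewrite I1 I2 tE integral_cst_phim -!EFinD.
case: (Nx u) => [r| |]//; rewrite -?EFinD => -[] e; congr EFin; lra.
Qed.

(* [Pf u] is the integral of [ln |u - X| + ln |u^th - X^th|] over the arc; it
   vanishes below [B]. *)
Definition Pf u : R := if u <= B then 0 else phm * tau u + T1 - fine (Nx u).

(** The point [u] beyond [B] is compared with a point [v] inside, so close to [B] that [v] is nearer
    than [u] to every [X f], also after raising to the power [th]. *)
Lemma Nx_le u : B < u -> (Nx u <= (phm * tau u + T1)%:E)%E.
Proof.
move=> uB; have B0 := Bx_gt0 th0; have u0 := lt_trans B0 uB.
have ut : B `^ th < u `^ th by rewrite gt0_ltr_powR ?nnegrE// ltW.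
have [v [v0 vB v1 v2]] : exists v, [/\ 0 < v, v < B, B - v <= u - B &
    B `^ th - v `^ th <= u `^ th - B `^ th].
  have : \forall v \near B^'-, [/\ 0 < v, v < B, B - v <= u - B &
      B `^ th - v `^ th <= u `^ th - B `^ th].
    near=> v; split.
    - by near: v; exact: nbhs_left_gt.
    - by near: v; exact: nbhs_left_lt.
    - have : B - (u - B) < v by near: v; apply: nbhs_left_gt; lra.
      by move=> ?; lra.
    - have : B `^ th - (u `^ th - B `^ th) < v `^ th.
        near: v; apply: (@cvgr_gt _ _ _ _ (fun v : R => v `^ th) (B `^ th)); last by lra.
        apply: cvg_at_left_filter; exact: powR_continuous_pos.
      by move=> ?; lra.
  by move=> /filter_ex[v hv]; exists v.
have I := Nx_inside (introT andP (conj v0 vB)).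
have mX := measurable_Xf th.
have mn w : measurable_fun setT (fun f => nk w (X f)) by exact: measurable_nk_X1.
have neglog_le (a b : R) : 0 <= a -> a <= b -> (neglog b <= neglog a)%E.
  move=> a0 ab; rewrite /neglog; have [_|an] := eqVneq a 0; first by rewrite leey.
  have ap : 0 < a by rewrite lt0r an.
  by rewrite gt_eqF ?(lt_le_trans ap)// lee_fin lerN2 ler_ln ?posrE ?(lt_le_trans ap).
have L : (Nx u + \int[leb]_(f in `]0%R, phm[) (tau v)%:E <=
          Nx v + \int[leb]_(f in `]0%R, phm[) (tau u)%:E)%E.
  have tu := tau_ge0 (ltW u0); have tv := tau_ge0 (ltW v0).
  have D w t : 0 <= t -> (Nx w + \int[leb]_(f in `]0%R, phm[) t%:E =
      \int[leb]_(f in `]0%R, phm[) (nk w (X f) + t%:E))%E.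
    move=> t0; rewrite integralD_phim//; first by move=> f _; exact: nk_ge0.
  apply: (le_eq2 (D u (tau v) tv) (D v (tau u) tu)); apply: le_integral_phim.
  - exact: emeasurable_funD.
  - exact: emeasurable_funD.
  - by move=> f _; rewrite adde_ge0 ?nk_ge0.
  - move=> f h; have /andP[X0 XB] := Xf_range th0 h.
    have XBt : X f `^ th < B `^ th by rewrite gt0_ltr_powR ?nnegrE ?ltW.
    rewrite !nkE ?(ltW X0) ?(ltW u0) ?(ltW v0)// -!addeA -!EFinD.
    rewrite (_ : tau v + tau (X f) + tau u = tau u + tau (X f) + tau v); last by ring.
    apply: leeD; last apply: leeD2r; (apply: neglog_le; first exact: normr_ge0).
      rewrite ler_norml; have := ler_norm (u - X f) => un; apply/andP; split; lra.
    rewrite ler_norml; have := ler_norm (u `^ th - X f `^ th) => un.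
    have a3 := powR_ge0 (X f) th; have a4 : v `^ th < B `^ th by rewrite gt0_ltr_powR ?nnegrE// ltW.
    by apply/andP; split; lra.
move: L; rewrite I !integral_cst_phim -EFinD => /lee_fin_sub L.
by apply: (le_trans L); rewrite lee_fin; lra.
Unshelve. all: by end_near. Qed.

Lemma Nx_ge0 u : (0 <= Nx u)%E.
Proof. by apply: integral_ge0 => f _; exact: nk_ge0. Qed.

Lemma Pf_ge0 u : 0 <= Pf u.
Proof.
rewrite /Pf; case: (leP u B) => // uB; rewrite subr_ge0.
by have := Nx_le uB; have := Nx_ge0 u; case: (Nx u) => [r| |]//=; rewrite lee_fin.
Qed.

Lemma Nx_Pf u : 0 < u -> u != B -> (Nx u + (Pf u)%:E = (phm * tau u + T1)%:E)%E.
Proof.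
move=> u0 uB; rewrite /Pf; case: (leP u B) => h.
  by rewrite adde0 Nx_inside// u0 lt_neqAle uB.
have := Nx_le h; have := Nx_ge0 u; case: (Nx u) => [r| |]//= _ _.
by rewrite -EFinD; congr EFin; ring.
Qed.

Lemma measurable_Nx : measurable_fun setT Nx.
Proof.
apply: (@measurable_integral_set _ _ _ _ R leb setT `]0%R, phm[
  (fun z => nk z.1 (X z.2))) => //; last by move=> z; exact: nk_ge0.
have m : measurable_fun setT (fun z : R * R => (z.1, X z.2)).
  apply: measurable_fun_pair => //; exact: measurableT_comp (measurable_Xf th) measurable_snd.
exact: measurableT_comp measurable_nk m.
Qed.

Lemma measurable_Pf : measurable_fun setT Pf.
Proof.
apply: measurable_fun_ifT => //; first exact: measurable_fun_ler.
apply: measurable_funB.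
  apply: measurable_funD => //; apply: measurable_funM => //; exact: measurable_tau.
by apply: (measurableT_comp (fine_measurable measurableT)) measurable_Nx.
Qed.

Lemma eq_integral_off_point (D : set R) (F G : R -> \bar R) (a : R) : measurable D ->
  measurable_fun D F -> measurable_fun D G ->
  (forall f, D f -> f != a -> F f = G f) ->
  (\int[leb]_(f in D) F f = \int[leb]_(f in D) G f)%E.
Proof.
move=> mD mF mG FG; apply: ae_eq_integral => //.
exists [set a]; split; first exact: measurable_set1.
  by rewrite /= /lebR lebesgue_measure_set1.
move=> f /= nFG; apply: contrapT => /eqP fa; apply: nFG => Df; exact: FG.
Qed.

Lemma Tc_ge0 c : 0 <= c -> 0 <= Tc c.
Proof.
move=> c0; rewrite -lee_fin -TcE//; apply: integral_ge0 => f; rewrite /= in_itv/= => h.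
by rewrite lee_fin tau_ge0// mulr_ge0// ltW// Xf_gt0.
Qed.

Lemma integral_tau_affine a b c : 0 <= a -> 0 <= b -> 0 <= c ->
  (\int[leb]_(f in `]0%R, phm[) (a * tau (c * X f) + b)%:E = (a * Tc c + b * phm)%:E)%E.
Proof.
move=> a0 b0 c0; have mt := measurable_tau_X c.
have t0 f : 0 < f < phm -> 0 <= tau (c * X f).
  by move=> h; rewrite tau_ge0// mulr_ge0// ltW// Xf_gt0.
have -> : (\int[leb]_(f in `]0%R, phm[) (a * tau (c * X f) + b)%:E =
   \int[leb]_(f in `]0%R, phm[) ((a * tau (c * X f))%:E + b%:E))%E by [].
rewrite integralD_phim//.
- rewrite integral_cst_phim EFinD; congr (_ + _)%E.
  under eq_integral do rewrite EFinM.
  rewrite ge0_integralZl//; first by rewrite TcE// EFinM.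
  + by apply/measurable_EFinP; exact: measurable_funTS.
- by apply/measurable_EFinP; exact: measurable_funM.
- by move=> f h; rewrite lee_fin mulr_ge0 ?t0.
Qed.

Definition Ac c : R := Tc c - phm * (1 + th) * ln c.

(** Potential of the law of [c X], by homogeneity of the kernel. The value [x / c = B] is left out
    because [Nx_inside] covers the open interval only. *)
Lemma integral_nk_scale x c : 0 < x -> 0 < c -> x / c != B ->
  (\int[leb]_(f in `]0%R, phm[) nk x (c * X f)%R + (Pf (x / c))%:E =
   (phm * tau x + Ac c)%:E)%E.
Proof.
move=> x0 c0 xB; have u0 : 0 < x / c by rewrite divr_gt0.
have H := Nx_Pf u0 xB; set u := x / c in u0 xB H *.
have xE : x = c * u by rewrite /u mulrC divfK// lt0r_neq0.
(* Positive and negative parts of the constant that scaling produces; each is added on one side of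
   the identity, so that all terms stay nonnegative. *)
pose lp := Num.max 0 ((1 + th) * ln c); pose lm := Num.max 0 (- ((1 + th) * ln c)).
have l0 : lp - lm = (1 + th) * ln c.
  by rewrite /lp /lm; case: (ltrgtP 0 ((1 + th) * ln c)) => h;
    [rewrite max_l|rewrite max_r|rewrite -h oppr0 maxxx]; lra.
have lp0 : 0 <= lp by rewrite le_max lexx.
have lm0 : 0 <= lm by rewrite le_max lexx.
have tu := tau_ge0 (ltW u0); have tx := tau_ge0 (ltW x0).
have mn c' w : measurable_fun setT (fun f => nk w (c' * X f)) by exact: measurable_nk_X.
have mn1 w : measurable_fun setT (fun f => nk w (X f)) by exact: measurable_nk_X1.
have ma a b k : measurable_fun setT (fun f => (a * tau (k * X f) + b)%:E).
  apply/measurable_EFinP; apply: measurable_funD => //; apply: measurable_funM => //.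
  exact: measurable_tau_X.
have ta k f : 0 <= k -> 0 < f < phm -> 0 <= tau (k * X f).
  by move=> k0 h; rewrite tau_ge0// mulr_ge0// ltW// Xf_gt0.
have E : (\int[leb]_(f in `]0%R, phm[) nk x (c * X f)%R +
   \int[leb]_(f in `]0%R, phm[) (1 * tau (1 * X f) + (tau u + lp))%:E =
   Nx u + \int[leb]_(f in `]0%R, phm[) (1 * tau (c * X f) + (tau x + lm))%:E)%E.
  have F1 f : 0 < f < phm -> (0 <= (1 * tau (1 * X f) + (tau u + lp))%:E)%E.
    by move=> h; rewrite lee_fin mul1r; apply: addr_ge0; [exact: ta|exact: addr_ge0].
  have F2 f : 0 < f < phm -> (0 <= (1 * tau (c * X f) + (tau x + lm))%:E)%E.
    by move=> h; rewrite lee_fin mul1r; apply: addr_ge0; [apply: ta => //; exact: ltW|exact: addr_ge0].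
  have N1 f : 0 < f < phm -> (0 <= nk x (c * X f)%R)%E by move=> _; exact: nk_ge0.
  have N2 f : 0 < f < phm -> (0 <= nk u (X f))%E by move=> _; exact: nk_ge0.
  apply: etrans (esym (integralD_phim (mn c x) (ma _ _ _) N1 F1)) _.
  apply: etrans (integralD_phim (mn1 u) (ma _ _ _) N2 F2).
  apply: eq_integral_phim => f h; have X0 := Xf_gt0 th0 h.
  rewrite xE nk_scale ?(ltW u0) ?(ltW X0)// -xE.
  move: (nk u (X f)) => k; rewrite -addeA -EFinD; congr (_ + _%:E)%E.
  by rewrite -l0 !mul1r; ring.
move: E; rewrite (integral_tau_affine ler01 (addr_ge0 tu lp0) ler01).
rewrite (integral_tau_affine ler01 (addr_ge0 tx lm0) (ltW c0)).
have T1c : Tc 1 = T1 by rewrite /Tc /T1; under eq_integral do rewrite mul1r.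
rewrite T1c => E; apply: etrans (adde_fin_trans H E) _; congr EFin.
by rewrite /Ac -[phm * (1 + th) * ln c]mulrA -l0; ring.
Qed.

Lemma integral_nk_Xscale u y : 1 <= u -> 0 < y < B ->
  (\int[leb]_(f in `]0%R, phm[) nk (u * X f)%R y = (phm * tau y + Ac u)%:E)%E.
Proof.
move=> u1 /andP[y0 yB]; have u0 : 0 < u by exact: lt_le_trans u1.
have ub : y / u < B.
  by rewrite ltr_pdivrMr// (lt_le_trans yB)// ler_peMr// ltW// Bx_gt0.
have e : y / u != B by rewrite lt_eqF.
have := integral_nk_scale y0 u0 e; rewrite /Pf (ltW ub) adde0 => <-.
by apply: eq_integral => f _; rewrite nkC.
Qed.

(** By symmetry, the potential of [X] averaged over [u X] is the potential of [u X] averaged over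
    [X]. Since [u >= 1], the values of [X] lie inside the support of the law of [u X], where that
    potential is explicit. *)
Lemma integral_Nx_X u : 1 <= u ->
  (\int[leb]_(f in `]0%R, phm[) Nx (u * X f)%R + (phm * (1 + th) * ln u * phm)%:E =
   (phm * T1 + Tc u * phm)%:E)%E.
Proof.
move=> u1; have u0 : 0 < u by exact: lt_le_trans u1.
have mX := measurable_Xf th; have lu : 0 <= ln u by exact: ln_ge0.
have p0 := phim_gt0 th0; have t1 := th1_gt0 th0.
have EB : (\int[leb]_(f in `]0%R, phm[) Nx (u * X f)%R =
   \int[leb]_(g in `]0%R, phm[) \int[leb]_(f in `]0%R, phm[) nk (u * X f)%R (X g))%E.
  have m : measurable_fun setT (fun z : R * R => (u * X z.1, X z.2)).
    apply: measurable_fun_pair; last exact: measurableT_comp mX measurable_snd.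
    by apply: measurable_funM => //; exact: measurableT_comp mX measurable_fst.
  have mm : measurable_fun setT (fun z : R * R => nk (u * X z.1) (X z.2)).
    exact: measurableT_comp measurable_nk m.
  exact: (@tonelli_set _ _ _ _ R leb leb `]0%R, phm[ `]0%R, phm[ (fun z => nk (u * X z.1)%R (X z.2))
    (measurable_itv _) (measurable_itv _) mm (fun z => nk_ge0 _ _)).
have EI : (\int[leb]_(f in `]0%R, phm[) Nx (u * X f)%R = \int[leb]_(g in `]0%R, phm[)
      (Num.max 0 (phm * tau (X g) + Ac u))%:E)%E.
  apply: etrans EB _; apply: eq_integral_phim => g h.
  have E := integral_nk_Xscale u1 (Xf_range th0 h); rewrite E.
  have : (0 <= \int[leb]_(f in `]0%R, phm[) nk (u * X f)%R (X g))%E.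
    by apply: integral_ge0 => f _; exact: nk_ge0.
  by rewrite E lee_fin => i0; rewrite max_r.
have M0 g : 0 < g < phm -> 0 <= phm * tau (X g) + Ac u.
  move=> h; rewrite -lee_fin -(integral_nk_Xscale u1 (Xf_range th0 h)).
  by apply: integral_ge0 => f _; exact: nk_ge0.
have T1c : Tc 1 = T1 by rewrite /Tc /T1; under eq_integral do rewrite mul1r.
rewrite EI; clear EB EI.
rewrite -integral_cst_phim -T1c -(integral_tau_affine (ltW p0) (Tc_ge0 (ltW u0)) ler01).
rewrite -integralD_phim.
- apply: eq_integral_phim => g h; rewrite (max_r (M0 g h)) -EFinD; congr EFin.
  by rewrite /Ac mul1r; ring.
- apply/measurable_EFinP; apply: measurable_maxr; first exact: measurable_cst.
  apply: measurable_funD; last exact: measurable_cst.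
  apply: measurable_funM; first exact: measurable_cst.
  exact: measurableT_comp measurable_tau mX.
- exact: measurable_cst.
- by move=> f _; rewrite lee_fin le_max lexx.
- move=> f _; rewrite lee_fin; exact: mulr_ge0 (mulr_ge0 (ltW p0) (ltW t1)) lu.
Qed.

(** The average of [integral_Nx_X] is computed a second time through [Pf]. Comparison leaves only
    the logarithm produced by scaling, the same function of a ratio that represents [V] in
    [integral_wf_ln]. *)
Lemma integral_Pf_X u : 1 <= u ->
  (\int[leb]_(f in `]0%R, phm[) (Pf (u * X f)%R)%:E = (phm ^+ 2 * (1 + th) * ln u)%:E)%E.
Proof.
move=> u1; have u0 : 0 < u by exact: lt_le_trans u1.
have mX := measurable_Xf th; have lu : 0 <= ln u by exact: ln_ge0.
have p0 := phim_gt0 th0; have t1 := th1_gt0 th0.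
have muX : measurable_fun setT (fun f => u * X f) by exact: measurable_funM.
have mN : measurable_fun setT (fun f => Nx (u * X f)%R).
  exact: measurableT_comp measurable_Nx muX.
have mP : measurable_fun setT (fun f => (Pf (u * X f)%R)%:E).
  by apply/measurable_EFinP; exact: measurableT_comp measurable_Pf muX.
have ma a b k : measurable_fun setT (fun f => (a * tau (k * X f) + b)%:E).
  apply/measurable_EFinP; apply: measurable_funD => //; apply: measurable_funM => //.
  exact: measurable_tau_X.
have EA : (\int[leb]_(f in `]0%R, phm[) Nx (u * X f)%R +
    \int[leb]_(f in `]0%R, phm[) (Pf (u * X f)%R)%:E = (phm * Tc u + T1 * phm)%:E)%E.
  have T10 : 0 <= T1.
    by have := Tc_ge0 ler01; rewrite /Tc /T1; under eq_integral do rewrite mul1r.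
  rewrite -(integral_tau_affine (ltW p0) T10 (ltW u0)).
  have F1 f : 0 < f < phm -> (0 <= Nx (u * X f)%R)%E by move=> _; exact: Nx_ge0.
  have F2 f : 0 < f < phm -> (0 <= (Pf (u * X f)%R)%:E)%E by move=> _; rewrite lee_fin Pf_ge0.
  apply: etrans (esym (integralD_phim mN mP F1 F2)) _.
  (* The single angle at which [u * X f = B] is discarded. *)
  apply: (@eq_integral_off_point _ _ _ (Phi th (B / u))) => //.
  - by apply: measurable_funTS; exact: emeasurable_funD.
  - by apply: measurable_funTS; exact: ma.
  - move=> f; rewrite /= in_itv/= => h fP; have X0 := Xf_gt0 th0 h.
    apply: Nx_Pf; first by rewrite mulr_gt0.
    apply: contra fP => /eqP e; rewrite -e mulrAC divff ?lt0r_neq0// mul1r XfK//.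
apply: etrans (adde_fin_cancel (integral_Nx_X u1) EA) _; congr EFin; ring.
Qed.

End kernel.

(** * The inverse functions and the contour integral *)

Section conjugate_path.
Context {R : realType}.
Local Notation Re := (@complex.Re R).
Local Notation Im := (@complex.Im R).
Local Notation cj := (@conjc R).
Implicit Types (w z s : R[i]) (f : R -> R[i]) (t : R).

Lemma Re_cj w : Re (cj w) = Re w. Proof. by case: w. Qed.
Lemma Im_cj w : Im (cj w) = - Im w. Proof. by case: w. Qed.
Lemma cjD w z : cj (w + z) = cj w + cj z. Proof. exact: (rmorphD cj). Qed.
Lemma cjM w z : cj (w * z) = cj w * cj z. Proof. exact: (rmorphM cj). Qed.
Lemma cjV w : cj w^-1 = (cj w)^-1. Proof. exact: (fmorphV cj). Qed.
Lemma cj1 : cj 1 = 1. Proof. exact: (rmorph1 cj). Qed.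
Lemma cj_real (a : R) : cj a%:C = a%:C. Proof. exact: conjc_real. Qed.
Lemma cj_polar (r a : R) : cj (polar r a) = polar r (- a).
Proof. by apply: complex_eq; rewrite ?Re_cj ?Im_cj/= ?cosN ?sinN ?mulrN. Qed.

Lemma cpow_cj w (p : R) : slit w -> cpow (cj w) p = cj (cpow w p).
Proof.
move=> sw; have w0 : 0 < cmod w by rewrite cmod_gt0 slit_neq0.
have /andP[a1 a2] := carg_slit_bound sw.
have b : - pi < - carg w < pi by apply/andP; split; lra.
by rewrite {1}(polarE sw) cj_polar (cpow_polar p w0 b) (cpowE p (slit_neq0 sw)) cj_polar mulrN.
Qed.

Lemma Jc_cj (th c : R) s : Im s != 0 -> Jc th c (cj s) = cj (Jc th c s).
Proof.
move=> s0; have sn : s != 0 by apply: contra s0 => /eqP ->.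
have sl : slit ((s + 1) / s).
  apply: slit_Im_neq0; rewrite mulrDl divff// ImD mul1r ImV/= add0r.
  by rewrite mulf_neq0 ?oppr_eq0 ?invr_eq0// sqr_eq0_complex.
have e : (cj s + 1) / cj s = cj ((s + 1) / s) by rewrite rmorphM fmorphV rmorphD rmorph1.
have e2 : c%:C * (cj s + 1) = cj (c%:C * (s + 1)) by apply: complex_eq; rewrite !(ReM, ImM, ReD, ImD, Re_cj, Im_cj)/=; ring.
by rewrite /Jc e (cpow_cj _ sl) e2 -rmorphM.
Qed.

Lemma cder_near f g t d : (\forall u \near t, f u = g u) -> cder f t d -> cder g t d.
Proof.
move=> fg [d1 d2]; split.
  by apply: derive_near d1; near=> u; rewrite (near fg u).
by apply: derive_near d2; near=> u; rewrite (near fg u).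
Unshelve. all: by end_near. Qed.

Lemma cder_cj f t d : cder f t d -> cder (fun u => cj (f u)) t (cj d).
Proof.
move=> [d1 d2]; split; first by rewrite Re_cj; under eq_fun do rewrite Re_cj.
by rewrite Im_cj; under eq_fun do rewrite Im_cj; exact: derive_opp.
Qed.

Lemma cder_cderiv f t d : cder f t d -> cderiv f t = d.
Proof.
move=> [d1 d2]; apply: complex_eq; rewrite /cderiv/= derive1E.
  exact: (derive_val (is_derive := d1)).
exact: (derive_val (is_derive := d2)).
Qed.

Lemma cder_comp f (g : R -> R) t d dg : cder f (g t) d -> is_derive t 1 g dg ->
  cder (fun u => f (g u)) t (d * dg%:C).
Proof.
move=> [d1 d2] dg'; split.
  by rewrite ReM ReC ImC mulr0 subr0; exact: (derive_comp d1 dg').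
by rewrite ImM ReC ImC mulr0 add0r; exact: (derive_comp d2 dg').
Qed.

End conjugate_path.

Section upper_arc.
Context {R : realType}.
Variable th : R.
Hypothesis th0 : 0 < th.
Local Notation Re := (@complex.Re R).
Local Notation Im := (@complex.Im R).
Local Notation cj := (@conjc R).
Local Notation phm := (phim th).
Local Notation p := (pexp th).
Local Notation X := (Xf th).
Local Notation B := (Bx th).
Implicit Types (f x y c : R) (s : R[i]).

Definition Sf f : R[i] := polar (Rq th f)^-1 ((1 + th) * f).

Lemma Sf_Re f : Re (Sf f) = sin f / sin (th * f) * cos ((1 + th) * f).
Proof. by rewrite /Sf/= /Rq invf_div. Qed.
Lemma Sf_Im f : Im (Sf f) = sin f / sin (th * f) * sin ((1 + th) * f).
Proof. by rewrite /Sf/= /Rq invf_div. Qed.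

Lemma Sf_Im_gt0 f : 0 < f < phm -> 0 < Im (Sf f).
Proof.
move=> h; rewrite Sf_Im.
exact: mulr_gt0 (divr_gt0 (sin_f_gt0 th0 h) (sin_thf_gt0 th0 h)) (sin_alf_gt0 th0 h).
Qed.

Lemma Sf1 f : 0 < f < phm -> Sf f + 1 = polar (sin ((1 + th) * f) / sin (th * f)) f.
Proof.
move=> h; have t0 := lt0r_neq0 (sin_thf_gt0 th0 h).
apply: complex_eq; rewrite ?ReD ?ImD ?Sf_Re ?Sf_Im/= ?addr0; last by field.
have := cos_f_sin_al th f; set a := sin ((1 + th) * f); set C := cos ((1 + th) * f) => e.
have -> : a / sin (th * f) * cos f = cos f * a / sin (th * f) by field.
by rewrite e; field.
Qed.

Lemma Jc_Sf c f : 0 < f < phm -> Jc th c (Sf f) = (c * X f)%:C.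
Proof.
move=> h; have q0 := Rq_gt0 th0 h; have w0 := Rw_gt0 th0 h; have thn := lt0r_neq0 th0.
have s0 := lt0r_neq0 (sin_f_gt0 th0 h); have t0 := lt0r_neq0 (sin_thf_gt0 th0 h).
have qi : 0 < (Rq th f)^-1 by rewrite invr_gt0.
have [/andP[f1 f2] /andP[f3 f4] _] := angle_bounds th0 h.
rewrite /Jc Sf1// /Sf polarV ?polar_neq0// invrK polarM.
have -> : sin ((1 + th) * f) / sin (th * f) * Rq th f = Rw th f.
  by rewrite /Rq /Rw; field; rewrite s0 t0.
have -> : f - (1 + th) * f = - (th * f) by ring.
rewrite cpow_polar//; last by apply/andP; split; lra.
have -> : th^-1 * - (th * f) = - f by field.
rewrite -mulrA polarM subrr realM_polar.
have -> : sin ((1 + th) * f) / sin (th * f) * Rw th f `^ th^-1 = X f.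
  rewrite /Xf /pexp powRD ?(gt_eqF w0) ?implybT// powRr1 ?(ltW w0)//.
  by rewrite /Rq /Rw; field; rewrite s0 t0.
by apply: complex_eq; rewrite /= ?cos0 ?sin0 ?mulr1 ?mulr0.
Qed.

(** With [al = arg s] and [f = arg (s + 1)], the argument of [J] is [f + (f - al) / th]. It lies in
    []-pi, pi[] because [th > 1], so a positive real value forces it to vanish, and
    [al = (1 + th) f]. The law of sines in the triangle 0, -1, [s] then fixes [|s|]. *)
Lemma Sf_unique c x s : 1 < th -> 0 < c -> 0 < x -> 0 < Im s -> Jc th c s = x%:C ->
  exists2 f, 0 < f < phm & s = Sf f /\ c * X f = x.
Proof.
move=> th_gt1 c0 x0 i0 Js; have thn := lt0r_neq0 th0; have pi0 := pi_gt0 R.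
have i1 : 0 < Im (s + 1) by rewrite ImD addr0.
have sl := slit_Im_neq0 (lt0r_neq0 i0); have sl1 := slit_Im_neq0 (lt0r_neq0 i1).
have m0 : 0 < cmod s by rewrite cmod_gt0 slit_neq0.
have m1 : 0 < cmod (s + 1) by rewrite cmod_gt0 slit_neq0.
set al := carg s; set f := carg (s + 1).
have /andP[al0 al1] : 0 < al < pi := carg_Im_gt0 i0.
have /andP[f0 f1] : 0 < f < pi := carg_Im_gt0 i1.
have c1 : cmod s * cos al = Re s := cos_carg_slit sl.
have c2 : cmod s * sin al = Im s := sin_carg_slit sl.
have c3 : cmod (s + 1) * cos f = Re s + 1 by rewrite cos_carg_slit// ReD.
have c4 : cmod (s + 1) * sin f = Im s by rewrite sin_carg_slit// ImD addr0.
have sb : 0 < sin (al - f).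
  have : cmod s * cmod (s + 1) * sin (al - f) = Im s.
    rewrite sinB; transitivity ((cmod s * sin al) * (cmod (s + 1) * cos f) -
      (cmod s * cos al) * (cmod (s + 1) * sin f)); first by ring.
    by rewrite c1 c2 c3 c4; ring.
  by move=> e; rewrite -(pmulr_rgt0 _ (mulr_gt0 m0 m1)) e.
have fal : f < al.
  rewrite ltNge; apply/negP => le; have : 0 <= sin (f - al) by apply: sin_ge0_pi; lra.
  by move=> h; move: sb; rewrite -opprB sinN; lra.
have E : Jc th c s = polar (c * (cmod (s + 1) * (cmod (s + 1) / cmod s) `^ th^-1))
    (f + th^-1 * (f - al)).
  have V : s^-1 = polar (cmod s)^-1 (- al) by rewrite {1}(polarE sl) polarV ?polar_neq0.
  have E1 : s + 1 = polar (cmod (s + 1)) f := polarE sl1.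
  move: E1 m1; rewrite /Jc V; set m := cmod (s + 1) => -> m1.
  rewrite polarM cpow_polar; [|by rewrite divr_gt0|by apply/andP; split; lra].
  by rewrite -mulrA polarM realM_polar.
set r := c * _ in E; have r0 : 0 < r by rewrite !mulr_gt0 ?powR_gt0 ?divr_gt0.
have tg : f + th^-1 * (f - al) = 0.
  have ti : 0 < th^-1 < 1 by rewrite invr_gt0 th0 invf_lt1.
  have lo : - pi < f + th^-1 * (f - al) by case/andP: ti => t1 t2; nra.
  have hi : f + th^-1 * (f - al) < pi by case/andP: ti => t1 t2; nra.
  have := carg_polar r0 (introT andP (conj lo hi)); rewrite -E Js => <-.
  have -> : x%:C = polar x 0 by apply: complex_eq; rewrite /= ?cos0 ?sin0 ?mulr1 ?mulr0.
  by rewrite carg_polar// oppr_lt0 pi0.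
have alE : al = (1 + th) * f.
  have : th * (f + th^-1 * (f - al)) = 0 by rewrite tg mulr0.
  by rewrite mulrDr mulrA divff// mul1r; lra.
have hf : 0 < f < phm by rewrite f0/= /phim ltr_pdivlMr ?th1_gt0// mulrC -alE.
have sE : s = Sf f.
  have t0 := sin_thf_gt0 th0 hf.
  have rE : cmod s * sin (th * f) = sin f.
    have -> : th * f = al - f by rewrite alE; ring.
    rewrite sinB; apply: (mulfI (lt0r_neq0 m1)).
    transitivity ((cmod s * sin al) * (cmod (s + 1) * cos f) -
      (cmod s * cos al) * (cmod (s + 1) * sin f)); first by ring.
    by rewrite c1 c2 c3 c4; ring.
  rewrite {1}(polarE sl) /Sf -/al alE; congr polar.
  by rewrite /Rq invf_div -rE mulfK// lt0r_neq0.
exists f => //; split => //.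
have : (c * X f)%:C = x%:C by rewrite -(Jc_Sf c hf) -sE.
by case.
Qed.

Lemma bcE c : bc th c = c * B.
Proof. by rewrite /bc /Bx mulrA. Qed.

Lemma IplusE c x : 1 < th -> 0 < c -> 0 < x < c * B -> Iplus th c x = Sf (Phi th (x / c)).
Proof.
move=> th1 c0 /andP[x0 xB].
have hx : 0 < x / c < B by rewrite divr_gt0//= ltr_pdivrMr// mulrC.
have [hP PK] := PhiP th0 hx.
rewrite /Iplus gt_eqF// bcE lt_eqF//; case: xgetP => [s _ [i0 Js]|/(_ (Sf (Phi th (x / c))))].
  have [f hf [-> cX]] := Sf_unique th1 c0 x0 i0 Js.
  have -> : x / c = X f by rewrite -cX mulrAC divff ?mul1r// lt0r_neq0.
  by rewrite XfK.
case; split; first exact: Sf_Im_gt0.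
by rewrite Jc_Sf// PK mulrC divfK// lt0r_neq0.
Qed.

Lemma IminusE c x : 1 < th -> 0 < c -> 0 < x < c * B ->
  Iminus th c x = cj (Sf (Phi th (x / c))).
Proof.
move=> th1 c0 /andP[x0 xB].
have hx : 0 < x / c < B by rewrite divr_gt0//= ltr_pdivrMr// mulrC.
have [hP PK] := PhiP th0 hx.
rewrite /Iminus gt_eqF// bcE lt_eqF//; case: xgetP => [s _ [i0 Js]|/(_ (cj (Sf (Phi th (x / c)))))].
  have i1 : 0 < Im (cj s) by rewrite Im_cj oppr_gt0.
  have Js' : Jc th c (cj s) = x%:C by rewrite Jc_cj ?lt_eqF// Js conjc_real.
  have [f hf [sE cX]] := Sf_unique th1 c0 x0 i1 Js'.
  have -> : x / c = X f by rewrite -cX mulrAC divff ?mul1r// lt0r_neq0.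
  by rewrite XfK// -sE conjcK.
have i0 := Sf_Im_gt0 hP.
case; split; first by rewrite Im_cj oppr_lt0.
by rewrite Jc_cj ?lt0r_neq0// Jc_Sf// PK conjc_real mulrC divfK// lt0r_neq0.
Qed.

(* [s * qf s = d s / d (log x)] along the arc, obtained by differentiating [log (Jc s)] *)
Definition qf s : R[i] := 1 + (1 + th)%:C / (th%:C * s - 1).

Lemma thS1_neq0 f : 0 < f < phm -> th%:C * Sf f - 1 != 0.
Proof.
move=> h; have i0 := Sf_Im_gt0 h; apply/eqP => /(congr1 Im).
by rewrite ImD Im_realM ImN/= oppr0 addr0 => /eqP; rewrite mulf_eq0 !gt_eqF.
Qed.

Lemma qf_Sf f : 0 < f < phm ->
  qf (Sf f) = Complex (dRq th f / Rq th f / xl th f) (- (1 + th) / xl th f).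
Proof.
move=> h; have n0 := thS1_neq0 h; have x0 := lt0r_neq0 (xl_gt0 th0 h).
have s0 := lt0r_neq0 (sin_f_gt0 th0 h); have t0 := lt0r_neq0 (sin_thf_gt0 th0 h).
have a0 := lt0r_neq0 (sin_alf_gt0 th0 h); have thn := lt0r_neq0 th0.
have N0 := lt0r_neq0 (Nf_gt0 th0 h).
(* As [qf s = th (s + 1) / (th s - 1)], the claim is this identity up to the real factor [- xl]. *)
have H : (th%:C * Sf f - 1) * Complex (- (dRq th f / Rq th f)) (1 + th) =
    (- (xl th f * th))%:C * (Sf f + 1).
  have e1 := cos_f_sin_al th f; have e2 := cos_thf_sin_al th f.
  have cs := cos2Dsin2 ((1 + th) * f).
  have SE : Sf f = Complex (sin f / sin (th * f) * cos ((1 + th) * f))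
     (sin f / sin (th * f) * sin ((1 + th) * f)).
    by apply: complex_eq; rewrite ?Sf_Re ?Sf_Im.
  rewrite SE /dRq /Rq /xl /Nf.
  apply: complex_eq; rewrite !(ReM, ImM, ReD, ImD, ReN, ImN)/=.
    apply/eqP; rewrite -subr_eq0; apply/eqP.
    move: e1 e2 cs; set C := cos ((1 + th) * f); set a := sin ((1 + th) * f) in a0 *.
    set s := sin f in s0 *; set t := sin (th * f) in t0 *.
    move=> /(canRL (mulfK a0)) -> /(canRL (mulfK a0)) -> cs.
    transitivity (th * (1 + th) * s * (1 - (C ^+ 2 + a ^+ 2)) / (t * a)); last by rewrite cs subrr mulr0 mul0r.
    by rewrite /=; field; rewrite s0 t0 a0 thn.
  move: e1 e2; set C := cos ((1 + th) * f); set a := sin ((1 + th) * f) in a0 *.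
  set s := sin f in s0 *; set t := sin (th * f) in t0 *.
  move=> /(canRL (mulfK a0)) -> /(canRL (mulfK a0)) ->.
  by rewrite /=; field; rewrite s0 t0 a0 thn.
apply: (mulfI n0).
have -> : (th%:C * Sf f - 1) * qf (Sf f) = th%:C * (Sf f + 1).
  rewrite /qf mulrDr mulr1 mulrCA divff// mulr1 rmorphD/= rmorph1; ring.
have -> : Complex (dRq th f / Rq th f / xl th f) (- (1 + th) / xl th f) =
    Complex (- (dRq th f / Rq th f)) (1 + th) * (- (xl th f)^-1)%:C.
  by apply: complex_eq; rewrite ?ReM ?ImM/=; ring.
rewrite mulrA H mulrAC -rmorphM/=; congr (_%:C * _); field.
by rewrite x0.
Qed.

(** The inverse of [J_1] on the upper arc: [Iplus th c x] is [Sx (x / c)]. *)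
Definition Sx x : R[i] := Sf (Phi th x).

Lemma cder_Sf f : 0 < f < phm -> cder Sf f (Sf f * Complex (- (dRq th f / Rq th f)) (1 + th)).
Proof.
move=> h; have q0 := lt0r_neq0 (Rq_gt0 th0 h).
have qi : (Rq th f)^-1 != 0 by rewrite invr_eq0.
have := cder_polar (derive_inv (derive_Rq th0 h) q0) (derive_scale (1 + th) f) qi.
move=> H; apply: (cder_eq H); congr (_ * Complex _ _).
by rewrite -/(dRq th f); field.
Qed.

Lemma cder_Sx x : 0 < x < B -> cder Sx x (Sx x * qf (Sx x) * (x^-1)%:C).
Proof.
move=> hx; have hP := Phi_range th0 hx; have x0 : x != 0 by case/andP: hx => /lt0r_neq0.
have xn := lt0r_neq0 (xl_gt0 th0 hP).
apply: (cder_eq (cder_comp (cder_Sf hP) (derive_Phi th0 hx))).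
rewrite /Sx qf_Sf// -[LHS]mulrA -[RHS]mulrA -/(dRq th (Phi th x)); congr (_ * _).
by apply: complex_eq; rewrite ?ReM ?ImM/=; field; rewrite x0 xn ?lt0r_neq0 ?Rq_gt0.
Qed.

Lemma qf_Sx x : 0 < x < B -> Im (qf (Sx x)) = - ((1 + th) * Df th x).
Proof.
move=> hx; have hP := Phi_range th0 hx.
by rewrite /Sx qf_Sf//= DfE// mulNr.
Qed.

Lemma cder_Sx_scale c x : 0 < c -> 0 < x < c * B ->
  cder (fun y => Sx (y / c)) x (Sx (x / c) * qf (Sx (x / c)) * (x^-1)%:C).
Proof.
move=> c0 /andP[x0 xB]; have hx : 0 < x / c < B by rewrite divr_gt0//= ltr_pdivrMr// mulrC.
have D : is_derive x 1 (fun y : R => y / c) c^-1.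
  have H := derive_mul (derive_var x) (derive_const c^-1 x).
  by apply: (is_derive_eq H); rewrite mul1r mulr0 addr0.
apply: (cder_eq (@cder_comp R Sx (fun y => y / c) x _ _ (cder_Sx hx) D)).
rewrite -mulrA -rmorphM/=; congr (_ * _%:C).
by field; rewrite !lt0r_neq0.
Qed.

End upper_arc.

Section log_ratio.
Context {R : realType}.
Variable th : R.
Hypothesis th0 : 0 < th.
Local Notation Re := (@complex.Re R).
Local Notation Im := (@complex.Im R).
Local Notation cj := (@conjc R).
Local Notation phm := (phim th).
Local Notation B := (Bx th).
Local Notation leb := (@lebR R).
Local Notation S := (Sx th).
Implicit Types (f x y c k : R) (s : R[i]).

Lemma ccvg_cj (T : Type) (F : set_system T) (FF : Filter F) (g : T -> R[i]) s :
  ccvg F g s -> ccvg F (fun t => cj (g t)) (cj s).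
Proof.
move=> [c1 c2]; split; first by rewrite Re_cj; under eq_fun do rewrite Re_cj.
by rewrite Im_cj; under eq_fun do rewrite Im_cj; exact: cvgN.
Qed.

Lemma cvg_Phi_B : Phi th t @[t --> B^'-] --> (0 : R)^'+.
Proof.
move=> P [e /= e0 He].
pose e' := Num.min (e / 2) (phm / 2).
have p0 := phim_gt0 th0.
have h : 0 < e' < phm.
  apply/andP; split; first by rewrite lt_min; apply/andP; split; exact: divr_gt0.
  by rewrite gt_min; apply/orP; right; lra.
have X0 := Xf_gt0 th0 h.
have : \forall t \near B^'-, P (Phi th t); last by [].
near=> t.
have t1 : Xf th e' < t by near: t; apply: nbhs_left_gt; exact: Xf_ltB.
have tB : t < B by near: t; exact: nbhs_left_lt.
have ht : 0 < t < B by rewrite tB (lt_trans X0).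
have /andP[f0 fm] := Phi_range th0 ht.
apply: He => //=; rewrite sub0r normrN gtr0_norm//.
have : Phi th t < e' by rewrite -Xf_lt_Phi// (ltW tB) (ltW (lt_trans X0 t1)).
by rewrite lt_min => /andP[+ _]; lra.
Unshelve. all: by end_near. Qed.

Lemma cvg_quot x (b : R) : 0 < x -> 0 < b -> x / k @[k --> (x / b)^'+] --> b^'-.
Proof.
move=> x0 b0 P [e /= e0 He].
have : \forall k \near (x / b)^'+, P (x / k); last by [].
have xb : 0 < x / b by rewrite divr_gt0.
have cq : x / k @[k --> (x / b)^'+] --> b.
  have bE : x / (x / b) = b by field; rewrite !lt0r_neq0.
  rewrite -[X in _ --> X]bE.
  apply: cvg_at_right_filter; apply: cvgM; first exact: cvg_cst.
  by apply: inv_continuous; exact: lt0r_neq0.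
near=> k.
have k1 : x / b < k by near: k; exact: nbhs_right_gt.
have k0 := lt_trans xb k1.
apply: He => /=; last by rewrite ltr_pdivrMr// mulrC -ltr_pdivrMr.
rewrite distrC; near: k; move/cvgrPdist_lt : cq => /(_ _ e0); apply: filterS => k.
by rewrite distrC.
Unshelve. all: by end_near. Qed.

Lemma ccvg_Sf0 : ccvg ((0 : R)^'+) (Sf th) (th^-1)%:C.
Proof.
have -> : (th^-1)%:C = polar th^-1 ((1 + th) * 0).
  by apply: complex_eq; rewrite /= mulr0 ?cos0 ?sin0 ?mulr1 ?mulr0.
apply: ccvg_polar.
  by apply: cvgV; [exact: lt0r_neq0|exact: cvg_Rq0].
by apply: cvg_at_right_filter; exact: derive_continuous (derive_scale (1 + th) 0).
Qed.

Lemma ccvg_S_B : ccvg (B^'-) S (th^-1)%:C.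
Proof. by have [c1 c2] := ccvg_Sf0; split; [exact: cvg_comp cvg_Phi_B c1|exact: cvg_comp cvg_Phi_B c2]. Qed.

Lemma ccvg_S_quot x : 0 < x -> ccvg ((x / B)^'+) (fun k => S (x / k)) (th^-1)%:C.
Proof.
move=> x0; have [c1 c2] := ccvg_S_B; have q := cvg_quot x0 (Bx_gt0 th0).
by split; [exact: cvg_comp q c1|exact: cvg_comp q c2].
Qed.

Lemma cder_S_quot x k : 0 < x -> x / B < k ->
  cder (fun k => S (x / k)) k (S (x / k) * qf th (S (x / k)) * (- k^-1)%:C).
Proof.
move=> x0 xk; have B0 := Bx_gt0 th0; have k0 : 0 < k by rewrite (lt_trans _ xk)// divr_gt0.
have hx : 0 < x / k < B by rewrite divr_gt0//= ltr_pdivrMr// mulrC -ltr_pdivrMr.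
have D := derive_div (derive_const x k) (derive_var k) (lt0r_neq0 k0).
apply: (cder_eq (@cder_comp R S (fun k => x / k) k _ _ (cder_Sx th0 hx) D)).
rewrite -[LHS]mulrA -rmorphM/=; congr (_ * _%:C).
by field; rewrite !lt0r_neq0.
Qed.

(** Both points move at the speed [s * qf s] per unit of [log x], and the difference of the two
    speeds is divisible by [t - s]. This makes the derivative of [log (t - s)] explicit. *)
Lemma sqf_diff s t : th%:C * s - 1 != 0 -> th%:C * t - 1 != 0 ->
  t * qf th t - s * qf th s =
  (t - s) * (1 - (1 + th)%:C * ((th%:C * s - 1)^-1 * (th%:C * t - 1)^-1)).
Proof. by move=> s0 t0; rewrite /qf; field; rewrite s0 t0. Qed.

Lemma Im_inv_S x : 0 < x < B -> Im (th%:C * S x - 1)^-1 = - Df th x.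
Proof.
move=> hx; have := qf_Sx th0 hx; rewrite /qf ImD Im_realM [Im 1]/= add0r -mulrN.
by move=> /(mulfI _) -> //; rewrite lt0r_neq0// th1_gt0.
Qed.

Lemma S_Im_gt0 x : 0 < x < B -> 0 < Im (S x).
Proof. by move=> hx; apply: Sf_Im_gt0 => //; exact: Phi_range. Qed.

Lemma S_inj x y : 0 < x < B -> 0 < y < B -> S x = S y -> x = y.
Proof.
move=> hx hy e; have jx := Jc_Sf th0 1 (Phi_range th0 hx); have jy := Jc_Sf th0 1 (Phi_range th0 hy).
move: jx; rewrite -/(S x) e jy !mul1r !PhiK// => -[]; exact: esym.
Qed.

(** The logarithm in [psi], with the endpoint parameter replaced by a variable scale [k]; its
    derivative in [k] exhibits it as an integral over scales. *)
Definition ell x y k : R := ln (cmod (S (y / k) - cj (S (x / k)))) - ln (cmod (S (y / k) - S (x / k))).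

(** By [sqf_diff] the derivatives of the two logarithms differ, up to the factor [(1 + th) / k], by
    the real part of [conj a * b - a * b], where [a] and [b] are the inverses of [th s - 1] and
    [th t - 1]. This is [2 Im a Im b], and the imaginary parts are [- Df]. *)
Lemma derive_ell x y k : 0 < x -> 0 < y -> x != y -> x / B < k -> y / B < k ->
  is_derive k 1 (ell x y) (2 * (1 + th) * (Df th (x / k) * Df th (y / k) / k)).
Proof.
move=> x0 y0 xy xk yk; have B0 := Bx_gt0 th0.
have k0 : 0 < k by rewrite (lt_trans _ xk)// divr_gt0.
have hx : 0 < x / k < B by rewrite divr_gt0//= ltr_pdivrMr// mulrC -ltr_pdivrMr.
have hy : 0 < y / k < B by rewrite divr_gt0//= ltr_pdivrMr// mulrC -ltr_pdivrMr.
have dx := cder_S_quot x0 xk; have dy := cder_S_quot y0 yk.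
have ix := S_Im_gt0 hx; have iy := S_Im_gt0 hy.
have nx := thS1_neq0 th0 (Phi_range th0 hx); have ny := thS1_neq0 th0 (Phi_range th0 hy).
rewrite -/(S (x / k)) in nx; rewrite -/(S (y / k)) in ny.
have ax := Im_inv_S hx; have ay := Im_inv_S hy.
have w1 : S (y / k) - cj (S (x / k)) != 0.
  apply/eqP => /(congr1 Im); rewrite ImD ImN Im_cj opprK [Im 0]/= => e.
  by have := addr_gt0 iy ix; rewrite e ltxx.
have w2 : S (y / k) - S (x / k) != 0.
  rewrite subr_eq0; apply/eqP => /(S_inj hy hx) e; move/eqP: xy; apply.
  by apply: (mulIf (invr_neq0 (lt0r_neq0 k0))); rewrite e.
have D1 := derive_ln_cmod w1 (cder_add dy (cder_opp (cder_cj dx))).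
have D2 := derive_ln_cmod w2 (cder_add dy (cder_opp dx)).
apply: (is_derive_eq (derive_sub D1 D2)).
set s := S (x / k) in nx ax w1 w2 *; set t := S (y / k) in ny ay w1 w2 *.
set a := (th%:C * s - 1)^-1 in ax *; set b := (th%:C * t - 1)^-1 in ay *.
have cs : cj (th%:C * s - 1) = th%:C * cj s - 1.
  by apply: complex_eq; rewrite !(Re_cj, Im_cj, ReM, ImM, ReD, ImD, ReN, ImN)/=; ring.
have ncs : th%:C * cj s - 1 != 0 by rewrite -cs fmorph_eq0.
have cq : cj (s * qf th s) = cj s * qf th (cj s).
  by rewrite cjM /qf cjD cj1 cjM cjV cs cj_real.
have ca : (th%:C * cj s - 1)^-1 = cj a by rewrite -cs -cjV.
have -> : (t * qf th t * (- k^-1)%:C - cj (s * qf th s * (- k^-1)%:C)) / (t - cj s) =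
   (1 - (1 + th)%:C * (cj a * b)) * (- k^-1)%:C.
  rewrite cjM cj_real cq; move: (- k^-1)%:C => K; rewrite -mulrBl sqf_diff// ca -/b.
  by rewrite mulrAC [_ * _ / (t - _)]mulrAC divff// mul1r.
have -> : (t * qf th t * (- k^-1)%:C - s * qf th s * (- k^-1)%:C) / (t - s) =
   (1 - (1 + th)%:C * (a * b)) * (- k^-1)%:C.
  move: (- k^-1)%:C => K; rewrite -mulrBl sqf_diff// -/a -/b.
  by rewrite mulrAC [_ * _ / (t - _)]mulrAC divff// mul1r.
clearbody a b; rewrite !(ReM, ImM, ReD, ImD, ReN, ImN, Re_cj, Im_cj, ReC, ImC) ax ay/=.
by ring.
Qed.

(** The integration starts at the scale [m] at which the larger of [x / k] and [y / k] reaches [B].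
    There the corresponding point of the arc is the real number [1 / th], so conjugating one of the
    two points does not change their distance, and [ell] tends to 0. Below [m] a factor [Df]
    vanishes. *)
Lemma integral_ell c x y : 0 < c -> 0 < x < c * B -> 0 < y < c * B -> x != y ->
  (\int[leb]_(k in `]0%R, c[) (Df th (x / k) * Df th (y / k) / k)%:E =
   (ell x y c / (2 * (1 + th)))%:E)%E.
Proof.
move=> c0 /andP[x0 xc] /andP[y0 yc] xy; have B0 := Bx_gt0 th0; have t1 := th1_gt0 th0.
pose m := Num.max (x / B) (y / B).
have m0 : 0 < m by rewrite lt_max divr_gt0.
have mc : m < c by rewrite gt_max !ltr_pdivrMr// xc yc.
have -> : (\int[leb]_(k in `]0%R, c[) (Df th (x / k) * Df th (y / k) / k)%:E =
    \int[leb]_(k in `]m, c[) (Df th (x / k) * Df th (y / k) / k)%:E)%E.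
  rewrite integral_mkcond [RHS]integral_mkcond; apply: eq_integral => k _; rewrite !patchE !mem_oo.
  case: (ltP m k) => mk /=; first by rewrite (lt_trans m0 mk).
  case: ifPn => // /andP[k0 _].
  move: mk; rewrite le_max => /orP[] kk.
    by rewrite {1}/Df ifN ?mul0r// negb_and -!leNgt; apply/orP; right; rewrite ler_pdivlMr// mulrC -ler_pdivlMr.
  rewrite {2}/Df ifN ?mulr0 ?mul0r// negb_and -!leNgt; apply/orP; right.
  by rewrite ler_pdivlMr// mulrC -ler_pdivlMr.
have lim0 : ell x y k / (2 * (1 + th)) @[k --> m^'+] --> (0 : R).
  rewrite -[X in _ --> X](mul0r (2 * (1 + th))^-1); apply: cvgM; last exact: cvg_cst.
  case: (ltgtP x y) xy => // [lt|gt] _.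
    have mE : m = y / B by rewrite /m max_r// ler_pM2r ?invr_gt0// ltW.
    rewrite mE; have c2 := ccvg_S_quot y0.
    have xk : x / B < y / B by rewrite ltr_pM2r ?invr_gt0.
    have [d1 d2] := cder_continuous (cder_S_quot x0 xk).
    have c1 : ccvg ((y / B)^'+) (fun k => S (x / k)) (S (x / (y / B))).
      by split; apply: cvg_at_right_filter.
    have hx : 0 < x / (y / B) < B.
      have yB := divr_gt0 y0 B0.
      by rewrite (divr_gt0 x0 yB)/= ltr_pdivrMr// mulrCA divff ?mulr1// lt0r_neq0.
    have ix := S_Im_gt0 hx; set s := S (x / (y / B)) in c1 ix *.
    have n0 : 0 < cmod ((th^-1)%:C - s).
      rewrite cmod_gt0; apply/eqP => /(congr1 Im); rewrite ImD ImN/= add0r => /eqP.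
      by rewrite oppr_eq0 gt_eqF.
    have e : cmod ((th^-1)%:C - cj s) = cmod ((th^-1)%:C - s).
      by rewrite /cmod !(ReD, ImD, ReN, ImN, Re_cj, Im_cj)/= !add0r opprK sqrrN.
    have l1 : cmod (S (y / k) - cj (S (x / k))) @[k --> (y / B)^'+] --> cmod ((th^-1)%:C - s).
      rewrite -e; apply: (@cvg_cmod _ _ _ _ (fun k => S (y / k) - cj (S (x / k)))).
      by apply: ccvg_add => //; apply: ccvg_opp; exact: ccvg_cj.
    rewrite -(subrr (ln (cmod ((th^-1)%:C - s)))); apply: cvgB; apply: cvg_ln => //.
    apply: (@cvg_cmod _ _ _ _ (fun k => S (y / k) - S (x / k))); apply: ccvg_add => //.
    exact: ccvg_opp.
  have mE : m = x / B by rewrite /m max_l// ler_pM2r ?invr_gt0// ltW.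
  rewrite mE; have c2 := ccvg_S_quot x0.
  have xk : y / B < x / B by rewrite ltr_pM2r ?invr_gt0.
  have [d1 d2] := cder_continuous (cder_S_quot y0 xk).
  have c1 : ccvg ((x / B)^'+) (fun k => S (y / k)) (S (y / (x / B))).
    by split; apply: cvg_at_right_filter.
  have hx : 0 < y / (x / B) < B.
    have yB := divr_gt0 x0 B0.
    by rewrite (divr_gt0 y0 yB)/= ltr_pdivrMr// mulrCA divff ?mulr1// lt0r_neq0.
  have ix := S_Im_gt0 hx; set s := S (y / (x / B)) in c1 ix *.
  have n0 : 0 < cmod (s - (th^-1)%:C).
    rewrite cmod_gt0; apply/eqP => /(congr1 Im); rewrite ImD ImN/= oppr0 addr0 => /eqP.
    by rewrite gt_eqF.
  rewrite -(subrr (ln (cmod (s - (th^-1)%:C)))); apply: cvgB; apply: cvg_ln => //.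
    apply: (@cvg_cmod _ _ _ _ (fun k => S (y / k) - cj (S (x / k)))); apply: ccvg_add => //.
    by apply: ccvg_opp; rewrite -cj_real; exact: ccvg_cj.
  apply: (@cvg_cmod _ _ _ _ (fun k => S (y / k) - S (x / k))); apply: ccvg_add => //.
  exact: ccvg_opp.
rewrite -[X in (X%:E)](subr0 (ell x y c / (2 * (1 + th)))).
have T2 : 2 * (1 + th) != 0 by rewrite lt0r_neq0// mulr_gt0.
have DE k : m < k -> is_derive k 1 (fun k => ell x y k / (2 * (1 + th))) (Df th (x / k) * Df th (y / k) / k).
  rewrite gt_max => /andP[k1 k2].
  apply: (is_derive_eq (derive_mul (derive_ell x0 y0 xy k1 k2) (derive_const (2 * (1 + th))^-1 k))).
  by rewrite mulr0 addr0 mulrAC divff ?mul1r.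
apply: (@ge0_FTC_lebR R (fun k => Df th (x / k) * Df th (y / k) / k)
  (fun k => ell x y k / (2 * (1 + th))) m c) => //.
- by move=> k /andP[mk _]; rewrite !mulr_ge0 ?(Df_ge0 th0)// invr_ge0 ltW// (lt_trans m0).
- move=> k /andP[mk _]; have k0 := lt_trans m0 mk.
  move: mk; rewrite gt_max => /andP[k1 k2].
  have hx : 0 < x / k < B by rewrite divr_gt0//= ltr_pdivrMr// mulrC -ltr_pdivrMr.
  have hy : 0 < y / k < B by rewrite divr_gt0//= ltr_pdivrMr// mulrC -ltr_pdivrMr.
  have cD z : 0 < z / k < B -> {for k, continuous (fun k => Df th (z / k))}.
    move=> hz; apply: (@continuous_comp _ _ _ (fun k => z / k) (Df th)); last exact: Df_continuous.
    by apply: cvgM; [exact: cvg_cst|apply: inv_continuous; exact: lt0r_neq0].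
  apply: cvgM; first by apply: cvgM; exact: cD.
  by apply: inv_continuous; exact: lt0r_neq0.
- by move=> k /andP[mk _]; exact: DE.
- by apply: cvg_at_left_filter; exact: derive_continuous (DE c mc).
Qed.

Lemma ell_log_ratio c x y : 1 < th -> 0 < c -> 0 < x < c * B -> 0 < y < c * B -> x != y ->
  ln (cmod ((Iplus th c y - Iminus th c x) / (Iplus th c y - Iplus th c x))) = ell x y c.
Proof.
move=> th_gt1 c0 hx hy xy; rewrite !IplusE// IminusE//.
have q z : 0 < z < c * B -> 0 < z / c < B.
  by move=> /andP[z0 zc]; rewrite divr_gt0//= ltr_pdivrMr// mulrC.
have ix := S_Im_gt0 (q _ hx); have iy := S_Im_gt0 (q _ hy).
rewrite cmodM cmodV -/(S (x / c)) -/(S (y / c)) /ell ln_div//; rewrite posrE cmod_gt0.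
  apply/eqP => /(congr1 Im); rewrite ImD ImN Im_cj opprK [Im 0]/= => e.
  by have := addr_gt0 iy ix; rewrite e ltxx.
rewrite subr_eq0; apply/eqP => /(S_inj (q _ hy) (q _ hx)) e; move/eqP: xy; apply.
by apply: (mulIf (invr_neq0 (lt0r_neq0 c0))); rewrite e.
Qed.

End log_ratio.

Section contour.
Context {R : realType}.
Variable th : R.
Hypothesis th_gt1 : 1 < th.
Let th0 : 0 < th. Proof. exact: lt_trans th_gt1. Qed.
Local Notation Re := (@complex.Re R).
Local Notation Im := (@complex.Im R).
Local Notation cj := (@conjc R).
Local Notation B := (Bx th).
Local Notation leb := (@lebR R).
Local Notation S := (Sx th).

(** Drops the endpoints, where [Iplus] and [Iminus] are defined by cases. *)
Lemma Rintegral_cc (h g : R -> R) (b : R) : 0 < b -> (forall x, 0 < x < b -> h x = g x) ->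
  measurable_fun `]0, b[ g ->
  Rintegral lebesgue_measure `[0, b] h = fine (\int[leb]_(x in `]0%R, b[) (g x)%:E)%E.
Proof.
move=> b0 hg mg; rewrite /Rintegral; congr fine.
have mh : measurable_fun `]0, b[ (EFin \o h).
  apply/measurable_EFinP; apply: eq_measurable_fun mg => x; rewrite mem_oo => hx.
  by rewrite hg.
apply: etrans (integral_itv_bndoo true false mh) _.
rewrite integral_lebR//; apply: eq_integral => x; rewrite mem_oo => hx.
by rewrite /= hg.
Qed.

Variables (V1 : R -> R).
Hypothesis V1_cont : forall x, 0 < x -> {for x, continuous V1}.
Hypothesis V1_ge0 : forall x, 0 < x -> 0 <= V1 x.

Definition mint (c : R) : R := fine (\int[leb]_(x in `]0%R, (c * B)%R[) (V1 x * Df th (x / c))%:E)%E.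

Lemma complex_real_quotient (r m k p : R) : p != 0 ->
  Complex r (k * m) - Complex r (- (k * m)) = Complex 0 (2 * p) * (k * (m / p))%:C.
Proof.
move=> p0.
have ReX (a b : R) : Re (Complex a b) = a by [].
have ImX (a b : R) : Im (Complex a b) = b by [].
apply: complex_eq; rewrite ?(ReM, ImM, ReD, ImD, ReN, ImN) ?(ReC, ImC) ?(ReX, ImX).
  by rewrite subrr mulr0 subr0 mul0r.
by rewrite mulr0 add0r opprK; field.
Qed.

(** Along the upper arc the integrand is [V'(x) qf dx], and along the lower arc it is the conjugate.
    Their difference is twice an imaginary part, given by [qf_Sx]. *)
Lemma Econtour_mint (c : R) : 0 < c -> Econtour th V1 c = ((1 + th) * (mint c / pi))%:C.
Proof.
move=> c0; have B0 := Bx_gt0 th0; have b0 : 0 < c * B by rewrite mulr_gt0.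
have q z : 0 < z < c * B -> 0 < z / c < B.
  by move=> /andP[z0 zc]; rewrite divr_gt0//= ltr_pdivrMr// mulrC.
have nb (x : R) : 0 < x < c * B -> \forall u \near x, 0 < u < c * B.
  by case/andP => p0 pm; near=> g; apply/andP; split; near: g; [exact: lt_nbhsr|exact: lt_nbhsl].
have dP x : 0 < x < c * B -> cderiv (Iplus th c) x = S (x / c) * qf th (S (x / c)) * (x^-1)%:C.
  move=> hx; apply: cder_cderiv; apply: cder_near (cder_Sx_scale th0 c0 hx).
  by near=> u; rewrite IplusE//; near: u; exact: nb.
have dM x : 0 < x < c * B -> cderiv (Iminus th c) x = cj (S (x / c) * qf th (S (x / c)) * (x^-1)%:C).
  move=> hx; apply: cder_cderiv; apply: cder_near (cder_cj (cder_Sx_scale th0 c0 hx)).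
  by near=> u; rewrite IminusE//; near: u; exact: nb.
have JP x : 0 < x < c * B -> Jc th c (S (x / c)) = x%:C.
  by move=> hx; rewrite /Sx Jc_Sf ?PhiK ?Phi_range ?q// mulrC divfK// lt0r_neq0.
set F := fun s : R[i] => (V1 (Re (Jc th c s)))%:C * Jc th c s / s.
have S0 x : 0 < x < c * B -> S (x / c) != 0.
  move=> hx; have := S_Im_gt0 th0 (q _ hx) => i0; apply/eqP => e; move: i0.
  by rewrite e ltxx.
have FP x : 0 < x < c * B -> F (Iplus th c x) * cderiv (Iplus th c) x = (V1 x)%:C * qf th (S (x / c)).
  move=> hx; have sn := S0 _ hx; have x0 : x%:C != 0 :> R[i].
    by case/andP: hx => x0 _; rewrite -[0]/(0%:C) eq_complex/= eqxx andbT gt_eqF.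
  rewrite dP// IplusE// /F -/(S (x / c)) JP//= rmorphV/=; first by field; rewrite sn x0.
  by rewrite unitfE; case/andP: hx => /lt0r_neq0.
have Fcj s : Im s != 0 -> F (cj s) = cj (F s).
  move=> s0; rewrite /F Jc_cj// Re_cj [RHS]cjM cjV; congr (_ / _).
  by rewrite [RHS]cjM cj_real.
have FM x : 0 < x < c * B -> F (Iminus th c x) * cderiv (Iminus th c) x =
    (V1 x)%:C * cj (qf th (S (x / c))).
  move=> hx; have i0 := S_Im_gt0 th0 (q _ hx); have := FP x hx; rewrite dP// IplusE// => e.
  rewrite dM// IminusE// Fcj ?lt0r_neq0// -cjM.
  by move/(congr1 cj): e => ->; rewrite cjM cj_real.
pose gR x := V1 x * Re (qf th (S (x / c))).
pose gI x := V1 x * Df th (x / c).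
have cS x : 0 < x < c * B -> ccvg (nbhs x) (fun y => S (y / c)) (S (x / c)).
  by move=> hx; have [] := cder_continuous (cder_Sx_scale th0 c0 hx).
have mR : measurable_fun `]0, c * B[ gR.
  apply: measurable_fun_oo => x hx; have x0 : 0 < x by case/andP: hx.
  apply: cvgM; first exact: V1_cont.
  have cq : ccvg (nbhs x) (fun y => qf th (S (y / c))) (qf th (S (x / c))).
    apply: ccvg_add; first exact: ccvg_cst.
    apply: ccvg_mul; first exact: ccvg_cst.
    apply: ccvg_inv; last by apply: thS1_neq0 => //; apply: Phi_range => //; exact: q.
    apply: ccvg_add; last exact: ccvg_cst.
    by apply: ccvg_mul (cS x hx); exact: ccvg_cst.
  by case: cq.
have cD (z : R) : 0 < z < c * B -> {for z, continuous (fun y : R => Df th (y / c))}.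
  move=> hz; apply: (@continuous_comp R R R (fun y => y / c) (Df th)).
    by apply: cvgM; [exact: cvg_id|exact: cvg_cst].
  by apply: Df_continuous => //; exact: q.
have cI (x : R) : 0 < x < c * B -> {for x, continuous gI}.
  move=> hx; have x0 : 0 < x by case/andP: hx.
  by apply: cvgM; [exact: V1_cont|exact: cD].
have mI : measurable_fun `]0, c * B[ gI by exact: measurable_fun_oo.
have mI1 : measurable_fun `]0, c * B[ (fun x => (1 + th) * gI x) by exact: measurable_funM.
have t1 := th1_gt0 th0.
have gI0 x : 0 < x < c * B -> 0 <= gI x.
  by move=> /andP[x0 _]; rewrite mulr_ge0 ?V1_ge0 ?(Df_ge0 th0).
have IE : fine (\int[leb]_(x in `]0%R, (c * B)%R[) ((1 + th) * gI x)%:E)%E = (1 + th) * mint c.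
  under eq_integral do rewrite EFinM.
  rewrite ge0_integralZl_EFin//; first last.
  - exact: ltW.
  - exact/measurable_EFinP.
  rewrite /mint; set I := (\int[leb]_(x in _) _)%E; case: I => [r| |]//=.
    by rewrite gt0_muley ?lte_fin//= mulr0.
  by rewrite gt0_muleNy ?lte_fin//= mulr0.
have NE : fine (\int[leb]_(x in `]0%R, (c * B)%R[) (- ((1 + th) * gI x))%:E)%E = - ((1 + th) * mint c).
  rewrite -IE; under eq_integral do rewrite EFinN.
  rewrite integral_ge0N ?fineN//.
  by move=> x; rewrite /= in_itv/= => hx; rewrite lee_fin mulr_ge0 ?gI0// ltW.
have mN : measurable_fun `]0, c * B[ (fun x => - ((1 + th) * gI x)) by exact: measurable_funN.
(* The real parts along the two arcs are integrals of the same function [gR], so they cancel without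
   any integrability having to be established. *)
have HR (h : R -> R[i]) : (forall x, 0 < x < c * B -> Re (h x) = gR x) ->
    Rintegral lebesgue_measure `[0, bc th c] (fun t => Re (h t)) =
    fine (\int[leb]_(x in `]0%R, (c * B)%R[) (gR x)%:E)%E.
  by move=> H; rewrite bcE; exact: Rintegral_cc.
have PR x : 0 < x < c * B -> Re (F (Iplus th c x) * cderiv (Iplus th c) x) = gR x.
  by move=> hx; rewrite FP// ReM ReC ImC mul0r subr0.
have MR x : 0 < x < c * B -> Re (F (Iminus th c x) * cderiv (Iminus th c) x) = gR x.
  by move=> hx; rewrite FM// ReM Re_cj ReC ImC mul0r subr0.
have PI : Rintegral lebesgue_measure `[0, bc th c]
    (fun x => Im (F (Iplus th c x) * cderiv (Iplus th c) x)) = - ((1 + th) * mint c).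
  rewrite bcE -NE; apply: Rintegral_cc => // x hx.
  by rewrite FP// Im_realM qf_Sx ?q// /gI; ring.
have MI : Rintegral lebesgue_measure `[0, bc th c]
    (fun x => Im (F (Iminus th c x) * cderiv (Iminus th c) x)) = (1 + th) * mint c.
  rewrite bcE -IE; apply: Rintegral_cc => // x hx.
  by rewrite FM// Im_realM Im_cj qf_Sx ?q// /gI; ring.
rewrite /Econtour /contour_gamma /cintegral -/F (HR _ PR) (HR _ MR) PI MI.
have pin : pi != 0 :> R by rewrite lt0r_neq0// pi_gt0.
have -> : 2%:R * pi%:C * 'i = Complex 0 (2 * pi) :> R[i].
  rewrite -(rmorph_nat (real_complex R)).
  by apply: complex_eq; rewrite !(ReM, ImM)/=; ring.
have n0 : Complex 0 (2 * pi) != 0 :> R[i].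
  by rewrite eq_complex/= eqxx/= mulf_neq0// pnatr_eq0.
set z := (X in _ * X = _).
have -> : z = Complex 0 (2 * pi) * ((1 + th) * (mint c / pi))%:C.
  exact: complex_real_quotient.
by rewrite mulKf.
Unshelve. all: by end_near. Qed.

End contour.

(** * The endpoint equation *)

Section potential.
Context {R : realType}.
Let leb := (@lebR R).

Lemma MVT_derive (f df : R -> R) (a b : R) : a < b ->
  (forall x : R, a <= x <= b -> is_derive x 1 f (df x)) ->
  exists2 c, a < c < b & f b - f a = df c * (b - a).
Proof.
move=> ab fd; have [||c cab E] := @MVT R f df a b ab.
- by move=> x; rewrite in_itv/= => /andP[ax xb]; apply: fd; rewrite !ltW.
- apply: continuous_in_subspaceT => x; rewrite inE/= in_itv/= => xab.
  exact: derive_continuous (fd x xab).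
by exists c => //; move: cab; rewrite in_itv.
Qed.

Lemma lipschitz_continuous (f : R -> R) (K : R) :
  (forall x y : R, x <= y -> 0 <= f y - f x <= K * (y - x)) -> continuous f.
Proof.
move=> fK x.
have K0 : 0 <= K by have := fK 0 1 ler01; rewrite subr0 mulr1 => /andP[] /le_trans; apply.
have fK' y : `|f x - f y| <= K * `|x - y|.
  have [xy|/ltW yx] := leP x y.
    have /andP[h1 h2] := fK _ _ xy; rewrite (distrC (f x)) (distrC (x : R) y).
    by rewrite (ger0_norm h1) ger0_norm ?subr_ge0.
  have /andP[h1 h2] := fK _ _ yx.
  by rewrite (ger0_norm h1) (ger0_norm (_ : 0 <= (x : R) - y)) ?subr_ge0.
have K1 : 0 < K + 1 by lra.
apply/cvgrPdist_lt => e e0; have q0 : 0 < e / (K + 1) by exact: divr_gt0.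
near=> y; apply: (le_lt_trans (fK' y)).
have : `|x - y| < e / (K + 1) by near: y; exists (e / (K + 1)).
rewrite ltr_pdivlMr// mulrC; apply: le_lt_trans.
by rewrite ler_wpM2r//; lra.
Unshelve. all: by end_near. Qed.

Lemma integral_gt0 d (T : measurableType d) (m : {measure set T -> \bar R})
    (D : set T) (f : T -> \bar R) : measurable D -> measurable_fun D f ->
  (forall x, D x -> (0 < f x)%E) -> (0 < m D)%E -> (0 < \int[m]_(x in D) f x)%E.
Proof.
move=> mD mf f0 mD0; rewrite lt_neqAle integral_ge0 ?andbT; last by move=> x Dx; exact/ltW/f0.
apply/eqP => I0; move: mD0; rewrite lt_neqAle measure_ge0 andbT => /negP; apply.
have /(ae_eq_integral_abs m mD mf)[N [mN N0 DN]] :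
    (\int[m]_(x in D) `|f x| = 0)%E.
  rewrite [RHS]I0; apply: eq_integral => x; rewrite inE => Dx.
  by rewrite gee0_abs// ltW// f0.
rewrite eq_sym; apply/eqP; apply: (subset_measure0 mD mN _ N0) => x Dx; apply: DN => /= /(_ Dx) fx.
by have := f0 x Dx; rewrite fx ltxx.
Qed.

Lemma integral_supp d (T : measurableType d) (m : {measure set T -> \bar R})
    (D E : set T) (F : T -> \bar R) : D `<=` E ->
  (forall x, E x -> ~ D x -> F x = 0%E) -> (\int[m]_(x in D) F x = \int[m]_(x in E) F x)%E.
Proof.
move=> DE F0; rewrite integral_mkcond [RHS]integral_mkcond; apply: eq_integral => x _.
rewrite !patchE; case: ifPn => [|/negP]; rewrite inE => Dx.
  by rewrite (_ : _ \in _ = true)//; apply/mem_set/DE.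
by case: ifPn => //; rewrite inE => Ex; rewrite F0.
Qed.

Implicit Types (x y c : R).

Lemma mul_ln_cvg0 x : 0 < x -> y * ln (x / y) @[y --> (0 : R)^'+] --> (0 : R).
Proof.
move=> x0.
(* The upper bound is [ln t <= t] at [t = sqrt (x / y)], doubled and multiplied by [y]. *)
apply: (@squeeze_cvgr _ _ _ _ (fun _ => 0) (fun y => 2 * Num.sqrt (x * y))).
- near=> y.
  have y0 : 0 < y by near: y; exact: nbhs_right_gt.
  have yx : y < x by near: y; exact: nbhs_right_lt.
  have q0 : 0 < x / y by exact: divr_gt0.
  apply/andP; split.
    by rewrite mulr_ge0 ?ln_ge0 ?ltW// ltr_pdivlMr// mul1r.
  have s0 : 0 < Num.sqrt (x / y) by rewrite sqrtr_gt0.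
  have -> : ln (x / y) = 2 * ln (Num.sqrt (x / y)).
    by rewrite -{1}(sqr_sqrtr (ltW q0)) lnXn// mulr_natl.
  have -> : Num.sqrt (x * y) = y * Num.sqrt (x / y).
    rewrite -{2}(ger0_norm (ltW y0)) -sqrtr_sqr -sqrtrM ?sqr_ge0//.
    by congr Num.sqrt; field; rewrite lt0r_neq0.
  have := ln_sublinear s0; nra.
- exact: cvg_cst.
- rewrite [X in _ --> X](_ : 0 = 2 * Num.sqrt (x * 0)); last by rewrite mulr0 sqrtr0 mulr0.
  apply: cvgM; first exact: cvg_cst.
  apply: continuous_cvg; first exact: sqrt_continuous.
  by apply: cvgM; [exact: cvg_cst|exact: cvg_at_right_filter].
Unshelve. all: by end_near. Qed.

Lemma integral_ln_quotient c : 0 < c ->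
  (\int[leb]_(k in `]0%R, c[) (ln (c / k))%:E = c%:E)%E.
Proof.
move=> c0; transitivity ((c - 0)%:E); last by rewrite subr0.
apply: (@ge0_FTC_lebR R (fun k => ln (c / k)) (fun k => k * ln (c / k) + k) 0 c 0 c) => //.
- move=> k /andP[k0 kc]; rewrite ln_ge0// ler_pdivlMr// mul1r; exact: ltW.
- move=> k /andP[k0 kc]; apply: continuous_comp.
    apply: cvgM; [exact: cvg_cst|apply: cvgV; [exact: lt0r_neq0|exact: cvg_id]].
  by apply: continuous_ln; exact: divr_gt0.
- move=> k /andP[k0 kc]; have k' := lt0r_neq0 k0; have c' := lt0r_neq0 c0.
  have q0 : 0 < c / k by exact: divr_gt0.
  have dq := derive_div (derive_const c k) (derive_var k) k'.
  apply: (is_derive_eq (derive_add (derive_mul (derive_var k) (derive_ln dq q0)) (derive_var k))).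
  by field; rewrite k' c'.
- rewrite -[X in _ --> X]addr0; apply: cvgD; first exact: mul_ln_cvg0.
  exact: cvg_at_right_filter.
- rewrite [X in _ --> X](_ : c = c * ln (c / c) + c); last by rewrite divff ?lt0r_neq0// ln1 mulr0 add0r.
  apply: cvg_at_left_filter; apply: cvgD; last exact: cvg_id.
  apply: cvgM; first exact: cvg_id.
  apply: continuous_comp; last by apply: continuous_ln; rewrite divff ?lt0r_neq0.
  by apply: cvgM; [exact: cvg_cst|apply: cvgV; [exact: lt0r_neq0|exact: cvg_id]].
Qed.

Variables (V V1 V2 : R -> R).
Hypothesis dV : forall x : R, 0 < x -> is_derive x 1 V (V1 x).
Hypothesis dV1 : forall x : R, 0 < x -> is_derive x 1 V1 (V2 x).
Hypothesis cV : {within `[0, +oo[, continuous V}.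
Hypothesis cV1 : {within `[0, +oo[, continuous V1}.
Hypothesis cV2 : {within `[0, +oo[, continuous V2}.
Hypothesis limV : V x / ln x @[x --> +oo] --> +oo.
Hypothesis w_gt0 : forall x : R, 0 < x -> 0 < V2 x * x + V1 x.

(** [Uf] is [x V'(x)] and [wf] is its derivative. Both are set to 0 off the positive axis, so as to
    be measurable on the whole line. *)
Definition wf y := if 0 < y then V2 y * y + V1 y else 0.
Definition Uf y := if 0 < y then y * V1 y else 0.

Lemma wf_ge0 y : 0 <= wf y.
Proof. by rewrite /wf; case: ifPn => // y0; exact/ltW/w_gt0. Qed.

Lemma wf_gt0 y : 0 < y -> 0 < wf y.
Proof. by move=> y0; rewrite /wf y0 w_gt0. Qed.

Lemma continuous_pos (f g : R -> R) y : {for y, continuous f} ->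
  (forall x, 0 < x -> f x = g x) -> 0 < y -> {for y, continuous g}.
Proof.
move=> fc fg y0; rewrite /prop_for /continuous_at -fg//.
apply: cvg_trans fc; apply: near_eq_cvg; near=> x; apply: fg.
by near: x; exact: lt_nbhsr.
Unshelve. all: by end_near. Qed.

Lemma cvg_pos (f g : R -> R) (l : R) : f x @[x --> (0 : R)^'+] --> l ->
  (forall x, 0 < x -> f x = g x) -> g x @[x --> (0 : R)^'+] --> l.
Proof.
move=> fc fg; apply: cvg_trans fc; apply: near_eq_cvg; near=> x; apply: fg.
by near: x; exact: nbhs_right_gt.
Unshelve. all: by end_near. Qed.

Lemma measurable_pos (f : R -> R) : (forall x, 0 < x -> {for x, continuous f}) ->
  (forall x, x <= 0 -> f x = 0) -> measurable_fun setT f.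
Proof.
move=> fc f0; have -> : f = f \_ `]0, +oo[%classic.
  apply/funext => x; rewrite patchE; case: ifPn => // /negP.
  by rewrite inE/= in_itv/= andbT => /negP; rewrite -leNgt => /f0.
apply/(measurable_restrictT f) => //.
apply: open_continuous_measurable_fun; first exact: interval_open.
by move=> x; rewrite inE/= in_itv/= andbT; exact: fc.
Qed.

Lemma V_continuous x : 0 < x -> {for x, continuous V}.
Proof. by move=> x0; exact: derive_continuous (dV x0). Qed.

Lemma V1_continuous x : 0 < x -> {for x, continuous V1}.
Proof. by move=> x0; exact: derive_continuous (dV1 x0). Qed.

Lemma V2_continuous x : 0 < x -> {for x, continuous V2}.
Proof.
move=> x0; have [h _] := (continuous_within_itvcyP 0 V2).1 cV2.
by apply: h; rewrite in_itv/= x0.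
Qed.

Lemma wf_continuous x : 0 < x -> {for x, continuous wf}.
Proof.
move=> x0; apply: (@continuous_pos (fun y => V2 y * y + V1 y)) => //; last by move=> y y0; rewrite /wf y0.
apply: cvgD; last exact: V1_continuous.
by apply: cvgM; [exact: V2_continuous|exact: cvg_id].
Qed.

Lemma wf_cvg0 : wf x @[x --> (0 : R)^'+] --> V1 0.
Proof.
apply: (@cvg_pos (fun y => V2 y * y + V1 y)); last by move=> y y0; rewrite /wf y0.
have [_ h1] := (continuous_within_itvcyP 0 V1).1 cV1.
have [_ h2] := (continuous_within_itvcyP 0 V2).1 cV2.
rewrite -[X in _ --> X]add0r; apply: cvgD => //; rewrite -[X in _ --> X](mulr0 (V2 0)).
by apply: cvgM => //; exact: cvg_at_right_filter.
Qed.

Lemma wf_bounded b : 0 < b -> exists2 W, 0 < W & forall x, 0 < x <= b -> wf x <= W.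
Proof.
move=> b0; have [|M HM] := bounded_oc b0 _ wf_cvg0.
  by move=> x /andP[x0 _]; exact: wf_continuous.
exists (`|M| + 1); first by rewrite ltr_wpDl.
move=> x xb; apply: (le_trans (ler_norm _)); apply: (le_trans (HM x xb)).
by apply: (le_trans (ler_norm _)); lra.
Qed.

Lemma measurable_wf : measurable_fun setT wf.
Proof.
by apply: measurable_pos; [exact: wf_continuous|move=> x x0; rewrite /wf ltNge x0].
Qed.

Lemma derive_Uf x : 0 < x -> is_derive x 1 Uf (wf x).
Proof.
move=> x0; apply: (@derive_near _ (fun y => y * V1 y)).
  by near=> y; rewrite /Uf (_ : 0 < y)//; near: y; exact: lt_nbhsr.
apply: (is_derive_eq (derive_mul (derive_var x) (dV1 x0))).
by rewrite /wf x0; ring.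
Unshelve. all: by end_near. Qed.

Lemma Uf_cvg0 : Uf x @[x --> (0 : R)^'+] --> (0 : R).
Proof.
apply: (@cvg_pos (fun y => y * V1 y)); last by move=> y y0; rewrite /Uf y0.
have [_ h1] := (continuous_within_itvcyP 0 V1).1 cV1.
rewrite -[X in _ --> X](mul0r (V1 0)); apply: cvgM => //; exact: cvg_at_right_filter.
Qed.

Lemma measurable_Uf : measurable_fun setT Uf.
Proof.
apply: measurable_pos; last by move=> x x0; rewrite /Uf ltNge x0.
by move=> x x0; exact: derive_continuous (derive_Uf x0).
Qed.

Lemma integral_wf y : 0 < y -> (\int[leb]_(x in `]0%R, y[) (wf x)%:E = (Uf y)%:E)%E.
Proof.
move=> y0; transitivity ((Uf y - 0)%:E); last by rewrite subr0.
apply: (@ge0_FTC_lebR R wf Uf 0 y 0 (Uf y)) => //.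
- by move=> x _; exact: wf_ge0.
- by move=> x /andP[x0 _]; exact: wf_continuous.
- by move=> x /andP[x0 _]; exact: derive_Uf.
- exact: Uf_cvg0.
- by apply: cvg_at_left_filter; exact: derive_continuous (derive_Uf y0).
Qed.

Lemma Uf_incr x y : 0 < x -> x < y -> Uf x < Uf y.
Proof.
move=> x0 xy; have [|c /andP[xc _] E] := MVT_derive xy (_ : forall z, x <= z <= y -> is_derive z 1 Uf (wf z)).
  by move=> z /andP[xz _]; apply: derive_Uf; exact: lt_le_trans xz.
rewrite -subr_gt0 E mulr_gt0 ?subr_gt0// wf_gt0//; exact: lt_trans xc.
Qed.

Lemma Uf_ge0 y : 0 <= Uf y.
Proof.
have [y0|y0] := ltP 0 y; last by rewrite /Uf ltNge y0.
by rewrite -lee_fin -integral_wf//; apply: integral_ge0 => x _; rewrite lee_fin wf_ge0.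
Qed.

Lemma Uf_gt0 y : 0 < y -> 0 < Uf y.
Proof.
by move=> y0; apply: (le_lt_trans (Uf_ge0 (y / 2))); apply: Uf_incr; lra.
Qed.

Lemma V1_gt0 x : 0 < x -> 0 < V1 x.
Proof. by move=> x0; have := Uf_gt0 x0; rewrite /Uf x0 pmulr_rgt0. Qed.

Lemma Uf_lip W b : (forall x, 0 < x <= b -> wf x <= W) ->
  forall x y, 0 < x -> x <= y -> y <= b -> Uf y - Uf x <= W * (y - x).
Proof.
move=> HW x y x0; rewrite le_eqVlt => /predU1P[->|xy] yb; first by rewrite !subrr mulr0.
have [|c /andP[xc cy] ->] := MVT_derive xy (_ : forall z, x <= z <= y -> is_derive z 1 Uf (wf z)).
  by move=> z /andP[xz _]; apply: derive_Uf; exact: lt_le_trans xz.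
rewrite ler_wpM2r ?subr_ge0 ?(ltW xy)//; apply: HW.
by rewrite (lt_trans x0 xc)/= (le_trans _ yb)// ltW.
Qed.

(** If [x V'(x)] stayed below [A], then [V] would grow at most like [A ln x], against the growth
    hypothesis. *)
Lemma Uf_unbounded A : exists2 y, 0 < y & A <= Uf y.
Proof.
apply: contrapT => /forall2NP H.
have H1 x : 0 < x -> Uf x < A by move=> x0; case: (H x) => //; rewrite ltNge => /negP.
have A0 : 0 < A by exact: lt_trans (Uf_gt0 ltr01) (H1 _ ltr01).
have HV x : 1 < x -> V x <= V 1 + A * ln x.
  move=> x1; have [|c /andP[c1 _] E] := MVT_derive x1
      (_ : forall z, 1 <= z <= x -> is_derive z 1 (fun t => V t - A * ln t) (V1 z - (0 * ln z + A * (1 / z)))).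
    move=> z /andP[z1 _]; have z0 : 0 < z by lra.
    exact: derive_sub (dV z0) (derive_mul (derive_const A z) (derive_ln (derive_var z) z0)).
  have c0 : 0 < c by lra.
  have : V1 c < A / c by rewrite ltr_pdivlMr// mulrC; have := H1 c c0; rewrite /Uf c0.
  move: E; rewrite ln1 mulr0 subr0 mul0r add0r mul1r => E h.
  have : (V1 c - A / c) * (x - 1) < 0 by rewrite nmulr_rlt0; lra.
  by rewrite -E; lra.
(* This slope times [ln x] exceeds [V 1 + A ln x] as soon as [ln x >= 1], whence the choice of a
   point beyond [expR 1]. *)
move/cvgryPge : limV => /(_ (`|V 1| + A + 1)) [M [_ HM]].
pose x := expR 1 + `|M| + 1.
have e0 := expR_gt0 (1 : R).
have xM : M < x by rewrite /x; have := ler_norm M; lra.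
have e1 : 1 < expR 1 :> R by rewrite expR_gt1.
have M0 := normr_ge0 M.
have x1 : 1 < x by rewrite /x; lra.
have lx : 1 <= ln x by rewrite -[leLHS]expRK ler_ln ?posrE// /x; lra.
have := HM x xM; rewrite /= ler_pdivlMr; last by lra.
have := HV x x1; have := ler_norm (V 1); have := normr_ge0 (V 1); nra.
Qed.

(** Integration by parts, with primitive [Uf y * ln (x / y) + V y]; the boundary term at 0 vanishes
    by [mul_ln_cvg0]. *)
Lemma integral_wf_ln x : 0 < x ->
  (\int[leb]_(y in `]0%R, x[) (wf y * ln (x / y))%:E = (V x - V 0)%:E)%E.
Proof.
move=> x0; have x' := lt0r_neq0 x0.
have [_ h0] := (continuous_within_itvcyP 0 V).1 cV.
have [_ h1] := (continuous_within_itvcyP 0 V1).1 cV1.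
apply: (@ge0_FTC_lebR R (fun y => wf y * ln (x / y)) (fun y => Uf y * ln (x / y) + V y) 0 x (V 0) (V x)) => //.
- move=> k /andP[k0 kc]; rewrite mulr_ge0 ?wf_ge0// ln_ge0// ler_pdivlMr// mul1r; exact: ltW.
- move=> k /andP[k0 kc]; apply: cvgM; first exact: wf_continuous.
  apply: continuous_comp; last by apply: continuous_ln; exact: divr_gt0.
  by apply: cvgM; [exact: cvg_cst|apply: cvgV; [exact: lt0r_neq0|exact: cvg_id]].
- move=> k /andP[k0 kc]; have k' := lt0r_neq0 k0.
  have q0 : 0 < x / k by exact: divr_gt0.
  have dq := derive_div (derive_const x k) (derive_var k) k'.
  apply: (is_derive_eq (derive_add (derive_mul (derive_Uf k0) (derive_ln dq q0)) (dV k0))).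
  by rewrite {1}/Uf k0; field; rewrite k' x'.
- rewrite -[X in _ --> X]add0r; apply: cvgD => //.
  apply: (@cvg_pos (fun y => V1 y * (y * ln (x / y)))); last first.
    by move=> y y0; rewrite /Uf y0; ring.
  by rewrite -[X in _ --> X](mulr0 (V1 0)); apply: cvgM => //; exact: mul_ln_cvg0.
- rewrite [X in _ --> X](_ : _ = Uf x * ln (x / x) + V x); last by rewrite divff// ln1 mulr0 add0r.
  apply: cvg_at_left_filter; apply: cvgD; last exact: V_continuous.
  apply: cvgM; first exact: derive_continuous (derive_Uf x0).
  apply: continuous_comp; last by apply: continuous_ln; rewrite divff.
  by apply: cvgM; [exact: cvg_cst|apply: cvgV; [exact: lt0r_neq0|exact: cvg_id]].
Qed.

End potential.

Lemma lebR_oo_gt0 (R : realType) (a b : R) : a < b -> (0 < lebR `]a, b[)%E.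
Proof. by move=> ab; rewrite lebR_oo ?lte_fin ?subr_gt0// ltW. Qed.

Lemma clamp_lip (R : realType) (a b x y : R) : a <= b -> x <= y ->
  Num.max a (Num.min b x) <= Num.max a (Num.min b y) /\
  Num.max a (Num.min b y) - Num.max a (Num.min b x) <= y - x.
Proof.
move=> ab xy; case: (leP b x) => h1; case: (leP b y) => h2;
  case: (leP a b) => h3; case: (leP a x) => h4; case: (leP a y) => h5; split; lra.
Qed.

(** * Mass, weight and density of the mixture *)

Section weight.
Context {R : realType}.
Variables (th : R) (w U : R -> R).
Hypothesis th0 : 0 < th.
Hypothesis w_ge0 : forall y : R, 0 <= w y.
Hypothesis w_gt0 : forall y : R, 0 < y -> 0 < w y.
Hypothesis w_eq0 : forall y : R, y <= 0 -> w y = 0.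
Hypothesis mw : measurable_fun [set: R] w.
Hypothesis U_ge0 : forall y : R, 0 <= U y.
Hypothesis U_incr : forall x y : R, 0 < x -> x < y -> U x < U y.
Hypothesis mU : measurable_fun [set: R] U.
Hypothesis integral_w : forall y : R, 0 < y ->
  (\int[lebR]_(x in `]0%R, y[) (w x)%:E = (U y)%:E)%E.
Hypothesis w_bounded : forall b : R, 0 < b ->
  exists2 W : R, 0 < W & forall x : R, 0 < x <= b -> w x <= W.
Hypothesis U_lip : forall W b : R, (forall x : R, 0 < x <= b -> w x <= W) ->
  forall x y : R, 0 < x -> x <= y -> y <= b -> U y - U x <= W * (y - x).
Hypothesis U_unbounded : forall A : R, exists2 y : R, 0 < y & A <= U y.

Let leb := (@lebR R).
Let phm := phim th.
Let B := Bx th.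
Let X := Xf th.
Let D := Df th.
Let phm0 : 0 < phm. Proof. exact: phim_gt0. Qed.
Let B0 : 0 < B. Proof. exact: Bx_gt0. Qed.
Let mX : measurable_fun [set: R] X := measurable_Xf th.
Let Xr (f : R) : 0 < f < phm -> 0 < X f < B. Proof. exact: Xf_range. Qed.

(** The total mass of the weight [wt] on []0, c[], by [integral_wt]; the endpoint parameter is the
    [c] for which it equals [pi]. *)
Definition Mf (c : R) : \bar R := (\int[lebR]_(f in `]0%R, phim th[) (U (c * Xf th f)%R)%:E)%E.
Definition mfun (c : R) : R := fine (Mf c).

Let mUX (c : R) : measurable_fun [set: R] (fun f => U (c * X f)).
Proof. by apply: (measurableT_comp mU); apply: measurable_funM. Qed.

Lemma U_ler (x y : R) : 0 < x -> x <= y -> U x <= U y.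
Proof. by move=> x0; rewrite le_eqVlt => /predU1P[->//|xy]; exact/ltW/U_incr. Qed.

Lemma MfE (c : R) : 0 < c -> Mf c = (mfun c)%:E.
Proof.
move=> c0; apply: (@integral_bounded_fine R _ 0 phm (U (c * B))).
  by apply: measurable_funTS; exact: mUX.
move=> f /Xr /andP[X0 XB]; rewrite ger0_norm//; apply: U_ler; first exact: mulr_gt0.
by rewrite ler_pM2l// ltW.
Qed.

Lemma mfun_sub (c c' : R) : 0 < c -> c < c' ->
  (\int[leb]_(f in `]0%R, phm[) (U (c' * X f) - U (c * X f))%:E = (mfun c' - mfun c)%:E)%E.
Proof.
move=> c0 cc.
have lU f : 0 < f < phm -> U (c * X f) <= U (c' * X f).
  move=> /Xr /andP[X0 XB]; apply: U_ler; first exact: mulr_gt0.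
  by rewrite ler_pM2r// ltW.
have md : measurable_fun [set: R] (fun f => U (c' * X f) - U (c * X f)).
  by apply: measurable_funB; exact: mUX.
have E : (Mf c' = Mf c + \int[leb]_(f in `]0%R, phm[) (U (c' * X f) - U (c * X f))%:E)%E.
  rewrite /Mf -ge0_integralD//.
  - by apply: eq_integral => f _; rewrite -EFinD; congr EFin; ring.
  - by move=> f _; rewrite lee_fin.
  - by apply/measurable_EFinP; apply: measurable_funTS; exact: mUX.
  - by move=> f; rewrite /= in_itv/= => /lU h; rewrite lee_fin subr_ge0.
  - by apply/measurable_EFinP; apply: measurable_funTS.
move: E; rewrite !MfE ?(lt_trans c0 cc)//.
set I := (\int[leb]_(f in _) _)%E; case: I => [r| |]//= [] ->.
by congr EFin; ring.
Qed.

Lemma mfun_incr (c c' : R) : 0 < c -> c < c' -> mfun c < mfun c'.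
Proof.
move=> c0 cc; rewrite -subr_gt0 -lte_fin -mfun_sub//; apply: integral_gt0 => //.
- apply/measurable_EFinP; apply: measurable_funTS.
  by apply: measurable_funB; exact: mUX.
- move=> f; rewrite /= in_itv/= => /Xr /andP[X0 XB]; rewrite lte_fin subr_gt0.
  by apply: U_incr; [exact: mulr_gt0|rewrite ltr_pM2r].
- exact: lebR_oo_gt0.
Qed.

Lemma mfun_ler (c c' : R) : 0 < c -> c <= c' -> mfun c <= mfun c'.
Proof. by move=> x0; rewrite le_eqVlt => /predU1P[->//|xy]; exact/ltW/mfun_incr. Qed.

Lemma mfun_lip (C : R) : 0 < C -> exists2 K : R, 0 < K & forall c c' : R, 0 < c -> c <= c' -> c' <= C ->
  mfun c' - mfun c <= K * (c' - c).
Proof.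
move=> C0; have CB0 : 0 < C * B by exact: mulr_gt0.
have [W W0 HW] := w_bounded CB0.
exists (W * B * phm); first exact: (mulr_gt0 (mulr_gt0 W0 B0) phm0).
move=> c c' c0; rewrite le_eqVlt => /predU1P[->|cc] cC; first by rewrite !subrr mulr0.
rewrite -lee_fin -mfun_sub//.
apply: (@le_trans _ _ (\int[leb]_(f in `]0%R, phm[) (W * B * (c' - c))%:E)%E); last first.
  by rewrite integral_cst_phim// lee_fin -/phm mulrAC.
apply: le_integral_phim => //.
- by apply/measurable_EFinP; apply: measurable_funB; exact: mUX.
- move=> f /Xr /andP[X0 XB]; rewrite lee_fin subr_ge0; apply: U_ler; first exact: mulr_gt0.
  by rewrite ler_pM2r// ltW.
- move=> f /Xr /andP[X0 XB]; rewrite lee_fin.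
  apply: (le_trans (U_lip HW (mulr_gt0 c0 X0) _ _)).
  + by rewrite ler_pM2r// ltW.
  + exact: (ler_pM (ltW (lt_trans c0 cc)) (ltW X0) cC (ltW XB)).
  + rewrite -mulrBl -mulrA ler_wpM2l ?(ltW W0)// mulrC ler_wpM2r ?subr_ge0 ?ltW//.
Qed.

Lemma mfun_small (v : R) : 0 < v -> exists2 c : R, 0 < c & mfun c <= v.
Proof.
move=> v0; have [W W0 HW] := w_bounded B0.
pose K := W * B * phm; have K0 : 0 < K by exact: (mulr_gt0 (mulr_gt0 W0 B0) phm0).
pose c := Num.min 1 (v / K); have c0 : 0 < c by rewrite lt_min ltr01/= divr_gt0.
have c1 : c <= 1 by rewrite ge_min lexx.
exists c => //; rewrite -lee_fin -MfE//.
apply: (@le_trans _ _ (\int[leb]_(f in `]0%R, phm[) (W * B * c)%:E)%E); last first.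
  rewrite integral_cst_phim// lee_fin -/phm mulrAC -/K mulrC.
  by rewrite -ler_pdivlMr// ge_min lexx orbT.
apply: le_integral_phim => //.
- by apply/measurable_EFinP; exact: mUX.
- by move=> f _; rewrite lee_fin.
move=> f /Xr /andP[X0 XB]; have y0 : 0 < c * X f by exact: mulr_gt0.
have yB : c * X f <= B by rewrite -[leRHS]mul1r; exact: (ler_pM (ltW c0) (ltW X0) c1 (ltW XB)).
rewrite -integral_w//.
apply: (@le_trans _ _ (\int[leb]_(f in `]0%R, (c * X f)%R[) W%:E)%E).
  apply: ge0_le_integral => //.
  - by move=> x _; rewrite lee_fin.
  - by apply/measurable_EFinP; apply: measurable_funTS.
  - move=> x; rewrite /= in_itv/= => /andP[x0 xy]; rewrite lee_fin HW// x0/=.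
    by apply: le_trans yB; exact: ltW.
rewrite integral_cst_lebR ?(ltW y0)// lee_fin subr0 -mulrA ler_wpM2l ?(ltW W0)//.
by rewrite mulrC ler_wpM2r ?ltW.
Qed.

Lemma mfun_large (v : R) : 0 < v -> exists2 c : R, 0 < c & v <= mfun c.
Proof.
(* On the first half of the angles [c * X f] is at least [y], so the value [2 v / phm] over a length
   [phm / 2] already gives [v]. *)
move=> v0; have [y y0 Hy] := U_unbounded (2 * v / phm).
have h2 : 0 < phm / 2 < phm by rewrite divr_gt0//= ltr_pdivrMr// ltr_pMr// ltr1n.
have /andP[X0 XB] := Xr h2.
pose c := y / X (phm / 2); have c0 : 0 < c by exact: divr_gt0.
exists c => //; rewrite -lee_fin -MfE//.
apply: (@le_trans _ _ (\int[leb]_(f in `]0%R, (phm / 2)%R[) (2 * v / phm)%:E)%E).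
  rewrite integral_cst_lebR ?lee_fin; last by apply: ltW; case/andP: h2.
  by rewrite subr0 le_eqVlt; apply/orP; left; apply/eqP; field; rewrite lt0r_neq0.
apply: (@le_trans _ _ (\int[leb]_(f in `]0%R, (phm / 2)%R[) (U (c * X f)%R)%:E)%E).
  apply: ge0_le_integral => //.
  - move=> x _; rewrite lee_fin; exact: (divr_ge0 (mulr_ge0 (ler0n _ _) (ltW v0)) (ltW phm0)).
  - by apply/measurable_EFinP; apply: measurable_funTS; exact: mUX.
  - move=> f; rewrite /= in_itv/= => /andP[f0 f2]; rewrite lee_fin; apply: (le_trans Hy).
    apply: U_ler => //; have -> : y = c * X (phm / 2) by rewrite /c divfK// lt0r_neq0.
    rewrite ler_pM2l// ltW//; apply: Xf_decr => //.
    by case/andP: h2.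
apply: ge0_subset_integral => //.
- by apply/measurable_EFinP; apply: measurable_funTS; exact: mUX.
- by move=> f _; rewrite lee_fin.
- by move=> f; rewrite /= !in_itv/= => /andP[-> f2]/=; case/andP: h2 => _; exact: lt_trans.
Qed.

Lemma mfun_onto (v : R) : 0 < v -> exists2 c : R, 0 < c & mfun c = v.
Proof.
move=> v0; have [a a0 Ha] := mfun_small v0; have [b b0 Hb] := mfun_large v0.
have ab : a <= b by rewrite leNgt; apply/negP => /(mfun_incr b0); lra.
(* Clamping to [[a, b]] turns the local Lipschitz bound into one on the whole line, hence into
   continuity there, as the intermediate value theorem is applied to it. *)
pose cl (x : R) : R := Num.max a (Num.min b x).
have cl0 x : 0 < cl x by rewrite lt_max a0.
have clb x : cl x <= b by rewrite ge_max ab/= ge_min lexx.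
have clm x y : x <= y -> cl x <= cl y /\ cl y - cl x <= y - x.
  exact: clamp_lip.
have [K K0 HK] := mfun_lip b0.
have cF : continuous (fun x => mfun (cl x)).
  apply: (@lipschitz_continuous R _ K) => x y /clm[h1 h2].
  rewrite subr_ge0 mfun_ler//=; apply: (le_trans (HK _ _ _ h1 _)) => //.
  by rewrite ler_wpM2l ?(ltW K0).
have cla : cl a = a by rewrite /cl min_r// max_l.
have clB : cl b = b by rewrite /cl min_l// max_r.
have [|c cab E] := @IVT R (fun x => mfun (cl x)) a b v ab (continuous_subspaceT cF).
  by rewrite cla clB ge_min le_max Ha Hb orbT.
by exists (cl c).
Qed.

(** [X] is known to be positive on the angular interval only; the absolute value keeps integrands
    nonnegative at all real angles, as [tonelli_set] demands. *)
Let Xp (f : R) : R := `|X f|.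
Let XpE (f : R) : 0 < f < phm -> Xp f = X f.
Proof. by move=> /Xr /andP[h _]; rewrite /Xp gtr0_norm. Qed.
Let Xp_ge0 (f : R) : 0 <= Xp f. Proof. exact: normr_ge0. Qed.
Let mXp : measurable_fun [set: R] Xp.
Proof. exact: measurableT_comp mX. Qed.

(* The equilibrium measure is a mixture over [0 < k < c] of the laws of [k * Xf],
   with weights proportional to [wt k]. *)
Definition wt (k : R) : \bar R :=
  (\int[lebR]_(f in `]0%R, phim th[) (`|Xf th f| * w (k * `|Xf th f|))%:E)%E.

Let mwt2 : measurable_fun [set: R * R] (fun z : R * R => Xp z.2 * w (z.1 * Xp z.2)).
Proof.
have m2 : measurable_fun [set: R * R] (fun z : R * R => Xp z.2) by exact: measurableT_comp mXp measurable_snd.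
by apply: measurable_funM => //; apply: (measurableT_comp mw); apply: measurable_funM.
Qed.

Lemma wt_ge0 k : (0 <= wt k)%E.
Proof. by apply: integral_ge0 => f _; rewrite lee_fin mulr_ge0. Qed.

Lemma measurable_wt : measurable_fun [set: R] wt.
Proof.
apply: (@measurable_integral_set _ _ R R R leb setT `]0%R, phm[%classic
  (fun z => (Xp z.2 * w (z.1 * Xp z.2))%:E)) => //.
- exact/measurable_EFinP.
- by move=> z; rewrite lee_fin; exact: (mulr_ge0 (Xp_ge0 _) (w_ge0 _)).
Qed.

Lemma wt_gt0 (k : R) : 0 < k -> (0 < wt k)%E.
Proof.
move=> k0; apply: integral_gt0 => //.
- apply/measurable_EFinP; apply: measurable_funTS; apply: measurable_funM => //.
  by apply: (measurableT_comp mw); apply: measurable_funM.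
- move=> f; rewrite /= in_itv/= => h; have /andP[X0 XB] := Xr h.
  rewrite -/(Xp f) XpE// lte_fin; exact: (mulr_gt0 X0 (w_gt0 (mulr_gt0 k0 X0))).
- exact: lebR_oo_gt0.
Qed.

Lemma wt_bounded (c : R) : 0 < c ->
  exists2 W : R, 0 < W & forall k, 0 < k < c -> (wt k <= W%:E)%E.
Proof.
move=> c0; have cB0 : 0 < c * B by exact: mulr_gt0.
have [W W0 HW] := w_bounded cB0.
exists (B * W * phm); first exact: (mulr_gt0 (mulr_gt0 B0 W0) phm0).
move=> k /andP[k0 kc].
apply: (@le_trans _ _ (\int[leb]_(f in `]0%R, phm[) (B * W)%:E)%E); last by rewrite integral_cst_phim.
apply: le_integral_phim => //.
- apply/measurable_EFinP; apply: measurable_funM => //.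
  by apply: (measurableT_comp mw); apply: measurable_funM.
- by move=> f _; rewrite lee_fin mulr_ge0.
move=> f h; have /andP[X0 XB] := Xr h; rewrite -/(Xp f) XpE// lee_fin ler_pM ?(ltW X0) ?(ltW XB)//.
by apply: HW; rewrite mulr_gt0//= ler_pM ?ltW.
Qed.

(** Tonelli, then the substitution [y = k * X f] at fixed [f]. The case [q = 1] gives the mass, and
    [q k = Pf (x / k)] the defect of the potential. *)
Lemma integral_wtM (c : R) (q : R -> R) : 0 < c -> measurable_fun [set: R] q ->
  (forall k, 0 <= q k) ->
  (\int[leb]_(k in `]0%R, c[) (wt k * (q k)%:E) =
   \int[leb]_(f in `]0%R, phm[) \int[leb]_(y in `]0%R, (c * X f)%R[) (w y * q (y / X f))%:E)%E.
Proof.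
move=> c0 mq q0.
transitivity (\int[leb]_(k in `]0%R, c[) \int[leb]_(f in `]0%R, phm[)
    (Xp f * w (k * Xp f) * q k)%:E)%E.
  apply: eq_integral => k _; under [RHS]eq_integral do rewrite EFinM.
  rewrite ge0_integralZr//.
  - apply/measurable_EFinP; apply: measurable_funTS; apply: measurable_funM => //.
    by apply: (measurableT_comp mw); apply: measurable_funM.
  - by move=> f _; rewrite lee_fin; exact: (mulr_ge0 (Xp_ge0 f) (w_ge0 _)).
  - by rewrite lee_fin.
have mF : measurable_fun [set: R * R] (fun z : R * R => (Xp z.2 * w (z.1 * Xp z.2) * q z.1)%:E).
  apply/measurable_EFinP; apply: measurable_funM; first exact: mwt2.
  exact: measurableT_comp mq measurable_fst.
have F0 (z : R * R) : (0 <= (Xp z.2 * w (z.1 * Xp z.2) * q z.1)%:E)%E.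
  by rewrite lee_fin; exact: (mulr_ge0 (mulr_ge0 (Xp_ge0 _) (w_ge0 _)) (q0 _)).
apply: etrans (@tonelli_set _ _ _ _ R leb leb `]0%R, c[ `]0%R, phm[
  (fun z => (Xp z.2 * w (z.1 * Xp z.2) * q z.1)%:E) (measurable_itv _) (measurable_itv _) mF F0) _.
apply: eq_integral => f; rewrite inE/= in_itv/= => h; have /andP[X0 XB] := Xr h.
have my : measurable_fun [set: R] (fun y : R => w y * q (y / X f)).
  by apply: measurable_funM => //; apply: (measurableT_comp mq); exact: measurable_funM.
have mk : measurable_fun [set: R] (fun k => Xp f * w (k * Xp f) * q k).
  apply: measurable_funM => //; apply: measurable_funM => //.
  by apply: (measurableT_comp mw); exact: measurable_funM.
rewrite -!integral_lebR//; last 2 first.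
- by apply/measurable_EFinP; apply: measurable_funTS.
- by apply/measurable_EFinP; apply: measurable_funTS.
rewrite (mulrC c) ge0_change_of_variables_scale//; last 2 first.
- by apply/measurable_EFinP; apply: measurable_funTS.
- by move=> y _; rewrite lee_fin mulr_ge0.
apply: eq_integral => k; rewrite inE/= in_itv/= => /andP[k0 kc].
rewrite XpE// -EFinM; congr EFin; rewrite (mulrC k).
have -> : X f * k / X f = k by field; rewrite lt0r_neq0.
by ring.
Qed.

Lemma integral_wt (c : R) : 0 < c -> (\int[leb]_(k in `]0%R, c[) wt k = Mf c)%E.
Proof.
move=> c0; transitivity (\int[leb]_(k in `]0%R, c[) (wt k * (cst 1 k)%:E))%E.
  by apply: eq_integral => k _; rewrite mule1.
rewrite integral_wtM//.
apply: eq_integral => f; rewrite inE/= in_itv/= => /Xr /andP[X0 XB].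
apply: etrans (integral_w (mulr_gt0 c0 X0)); apply: eq_integral => y _.
by rewrite mulr1.
Qed.

(** Because [D] vanishes beyond [B], the range of integration can be made independent of [k], ready
    for an exchange of integrals. *)
Lemma integral_Xf_ext (k c : R) (h : R -> \bar R) : 0 < k <= c ->
  measurable_fun [set: R] h -> (forall x, (0 <= h x)%E) ->
  (\int[leb]_(f in `]0%R, phm[) h (k * X f)%R =
   \int[leb]_(x in `]0%R, (c * B)%R[) (h x * (D (x / k) / x)%:E))%E.
Proof.
move=> /andP[k0 kc] mh h0; rewrite integral_Xf//; apply: integral_supp.
  move=> x; rewrite /= !in_itv/= => /andP[-> xB]/=.
  by apply: (lt_le_trans xB); rewrite ler_wpM2r// ltW.
move=> x; rewrite /= !in_itv/= => /andP[x0 _] /negP; rewrite x0/= => xB.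
have -> : Df th (x / k) = 0.
  by rewrite /Df ltr_pdivrMr// (mulrC (Bx th)) (negbTE xB) andbF.
by rewrite mul0r mule0.
Qed.

Lemma wtE (k c : R) : 0 < k <= c ->
  wt k = (\int[leb]_(y in `]0%R, (c * B)%R[) (w y * (D (y / k) / k))%:E)%E.
Proof.
move=> kc; have /andP[k0 _] := kc.
transitivity (\int[leb]_(f in `]0%R, phm[) (fun y : R => (`|y| * w y / k)%:E) (k * X f)%R)%E.
  apply: eq_integral => f; rewrite inE/= in_itv/= => h; have /andP[X0 XB] := Xr h.
  rewrite -/(Xp f) XpE//; congr EFin; rewrite (gtr0_norm (mulr_gt0 k0 X0)).
  by field; rewrite lt0r_neq0.
rewrite (@integral_Xf_ext k c (fun y : R => (`|y| * w y / k)%:E) kc); last 2 first.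
- apply/measurable_EFinP; apply: measurable_funM => //; apply: measurable_funM => //.
- by move=> y; rewrite lee_fin divr_ge0 ?mulr_ge0// ltW.
apply: eq_integral => y; rewrite inE/= in_itv/= => /andP[y0 yB].
by rewrite -EFinM; congr EFin; rewrite gtr0_norm//; field; rewrite !lt0r_neq0.
Qed.

(** For uniform angle the law of [k X] has density [Df (x / k) / (phim x)]; the factor [1 / pi]
    normalises the total weight. *)
Definition rhoE (c x : R) : \bar R :=
  ((pi * phim th * x)^-1%:E * \int[lebR]_(k in `]0%R, c[) (wt k * (Df th (x / k))%:E))%E.

Let mD : measurable_fun [set: R] D := measurable_Df th0.
Let mDq : measurable_fun [set: R * R] (fun z : R * R => D (z.1 / z.2)).
Proof.
apply: (measurableT_comp mD); apply: measurable_funM; first exact: measurable_fst.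
by apply: measurable_inv; exact: measurable_snd.
Qed.
Let D_ge0 (x : R) : 0 <= D x := Df_ge0 th0 x.

Let mwtD : measurable_fun [set: R * R] (fun z : R * R => (wt z.2 * (D (z.1 / z.2))%:E)%E).
Proof.
apply: emeasurable_funM; last exact/measurable_EFinP.
exact: measurableT_comp measurable_wt measurable_snd.
Qed.

Lemma measurable_rhoE (c : R) : measurable_fun [set: R] (rhoE c).
Proof.
apply: emeasurable_funM.
  by apply/measurable_EFinP; apply: measurable_inv; exact: measurable_funM.
apply: (@measurable_integral_set _ _ R R R leb setT `]0%R, c[%classic
  (fun z => (wt z.2 * (D (z.1 / z.2))%:E)%E)) => //.
by move=> z; rewrite mule_ge0 ?wt_ge0// lee_fin.
Qed.

Lemma rhoE_ge0 (c x : R) : 0 < x -> (0 <= rhoE c x)%E.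
Proof.
move=> x0; rewrite mule_ge0//.
  by rewrite lee_fin invr_ge0; exact: (ltW (mulr_gt0 (mulr_gt0 (pi_gt0 R) phm0) x0)).
by apply: integral_ge0 => k _; rewrite mule_ge0 ?wt_ge0// lee_fin.
Qed.

Lemma rhoE_gt0 (c x : R) : 0 < c -> 0 < x < c * B -> (0 < rhoE c x)%E.
Proof.
move=> c0 /andP[x0 xB]; have xc : x / B < c by rewrite ltr_pdivrMr.
rewrite mule_gt0//.
  by rewrite lte_fin invr_gt0; exact: (mulr_gt0 (mulr_gt0 (pi_gt0 R) phm0) x0).
have m : measurable_fun [set: R] (fun k => (wt k * (D (x / k))%:E)%E).
  apply: emeasurable_funM; first exact: measurable_wt.
  apply/measurable_EFinP; apply: (measurableT_comp mD).
  by apply: measurable_funM => //; exact: measurable_inv.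
apply: (@lt_le_trans _ _ (\int[leb]_(k in `](x / B)%R, c[) (wt k * (D (x / k))%:E))%E).
  apply: integral_gt0 => //; first exact: measurable_funTS.
    move=> k; rewrite /= in_itv/= => /andP[k0 kc].
    have k1 : 0 < k by apply: lt_trans k0; exact: divr_gt0.
    rewrite mule_gt0 ?wt_gt0// lte_fin Df_gt0// divr_gt0//= ltr_pdivrMr//.
    by move: k0; rewrite ltr_pdivrMr// mulrC.
  exact: lebR_oo_gt0.
apply: ge0_subset_integral => //; first exact: measurable_funTS.
  by move=> k _; rewrite mule_ge0 ?wt_ge0// lee_fin.
move=> k; rewrite /= !in_itv/= => /andP[k0 ->]; rewrite andbT.
by apply: lt_trans k0; exact: divr_gt0.
Qed.

Lemma integral_rhoE (c : R) (h : R -> \bar R) : 0 < c ->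
  measurable_fun [set: R] h -> (forall x, (0 <= h x)%E) ->
  (\int[leb]_(x in `]0%R, (c * B)%R[) (h x * rhoE c x) =
   (pi * phm)^-1%:E * \int[leb]_(k in `]0%R, c[) (wt k * \int[leb]_(g in `]0%R, phm[) h (k * X g)%R))%E.
Proof.
move=> c0 mh h0; have pp : 0 < pi * phm by exact: (mulr_gt0 (pi_gt0 R) phm0).
pose F (z : R * R) : \bar R := (wt z.1 * (h z.2 * (D (z.2 / z.1) * `|z.2|^-1)%:E))%E.
have F0 z : (0 <= F z)%E by rewrite !mule_ge0 ?wt_ge0// lee_fin mulr_ge0 ?invr_ge0.
have mF : measurable_fun [set: R * R] F.
  apply: emeasurable_funM; first exact: measurableT_comp measurable_wt measurable_fst.
  apply: emeasurable_funM; first exact: measurableT_comp mh measurable_snd.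
  apply/measurable_EFinP; apply: measurable_funM.
    apply: (measurableT_comp mD); apply: measurable_funM; first exact: measurable_snd.
    by apply: measurable_inv; exact: measurable_fst.
  by apply: measurable_inv; apply: measurableT_comp => //; exact: measurable_snd.
have mwD (x : R) : measurable_fun [set: R] (fun k => (wt k * (D (x / k))%:E)%E).
  apply: emeasurable_funM; first exact: measurable_wt.
  apply/measurable_EFinP; apply: (measurableT_comp mD).
  by apply: measurable_funM => //; exact: measurable_inv.
have E1 : (\int[leb]_(k in `]0%R, c[) (wt k * \int[leb]_(g in `]0%R, phm[) h (k * X g)%R) =
    \int[leb]_(k in `]0%R, c[) \int[leb]_(x in `]0%R, (c * B)%R[) F (k, x))%E.
  apply: eq_integral => k; rewrite inE/= in_itv/= => /andP[k0 kc].
  rewrite (@integral_Xf_ext k c)//; last by rewrite k0 ltW.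
  have mm : measurable_fun `]0%R, (c * B)%R[ (fun x => (h x * (D (x / k) / x)%:E)%E).
    apply: measurable_funTS; apply: emeasurable_funM => //; apply/measurable_EFinP.
    apply: measurable_funM; last exact: measurable_inv.
    by apply: (measurableT_comp mD); exact: measurable_funM.
  rewrite -(ge0_integralZl _ (measurable_itv _) mm _ (wt_ge0 k)); last first.
    by move=> x; rewrite /= in_itv/= => /andP[x0 _]; rewrite mule_ge0// lee_fin divr_ge0// ltW.
  by apply: eq_integral => x; rewrite inE/= in_itv/= => /andP[x0 _]; rewrite /F/= (gtr0_norm x0).
rewrite E1 (@tonelli_set _ _ _ _ R leb leb `]0%R, c[ `]0%R, (c * B)%R[ F)//.
rewrite -ge0_integralZl//; last 3 first.
- apply: (@measurable_integral_set _ _ R R R leb `]0%R, (c * B)%R[%classic `]0%R, c[%classic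
    (fun z => F (z.2, z.1))) => //.
  by apply: (measurableT_comp mF); apply: measurable_fun_pair; [exact: measurable_snd|exact: measurable_fst].
- by move=> x _; exact: integral_ge0.
- by rewrite lee_fin invr_ge0 ltW.
apply: eq_integral => x; rewrite inE/= in_itv/= => /andP[x0 xB].
have -> : (\int[leb]_(k in `]0%R, c[) F (k, x) = (h x * x^-1%:E) * \int[leb]_(k in `]0%R, c[) (wt k * (D (x / k))%:E))%E.
  rewrite -ge0_integralZl//; last 3 first.
  - exact: measurable_funTS.
  - by move=> k _; rewrite mule_ge0 ?wt_ge0// lee_fin.
  - by rewrite mule_ge0// lee_fin invr_ge0 ltW.
  apply: eq_integral => k _; rewrite /F/= (gtr0_norm x0) EFinM.
  by rewrite muleCA -!muleA; congr (_ * _)%E; rewrite [RHS]muleCA; congr (_ * _)%E; rewrite muleC.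
rewrite /rhoE invfM EFinM !muleA; congr (_ * _)%E.
by rewrite -muleA muleC -!muleA; congr (_ * _)%E; rewrite muleC.
Qed.

End weight.

Lemma fine_mulr (R : realType) (r : R) (I : \bar R) : 0 < r -> fine (r%:E * I) = r * fine I.
Proof.
move=> r0; case: I => [s| |]//=.
  by rewrite gt0_muley ?lte_fin//= mulr0.
by rewrite gt0_muleNy ?lte_fin//= mulr0.
Qed.

Lemma cmod0 (R : realType) : cmod (0 : R[i]) = 0.
Proof. by rewrite /cmod/= expr0n/= addr0 sqrtr0. Qed.

(** * The density and the Euler-Lagrange conditions *)

Section density.
Context {R : realType}.
Variables (th : R) (w U : R -> R).
Hypothesis th1 : 1 < th.
Hypothesis w_ge0 : forall y : R, 0 <= w y.
Hypothesis w_gt0 : forall y : R, 0 < y -> 0 < w y.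
Hypothesis mw : measurable_fun [set: R] w.
Hypothesis integral_w : forall y : R, 0 < y ->
  (\int[lebR]_(x in `]0%R, y[) (w x)%:E = (U y)%:E)%E.
Variable c : R.
Hypothesis c0 : 0 < c.
Hypothesis Mc : Mf th U c = pi%:E.

Let leb := (@lebR R).
Local Notation phm := (phim th).
Local Notation B := (Bx th).
Local Notation X := (Xf th).
Local Notation D := (Df th).
Let th0 : 0 < th. Proof. exact: lt_trans th1. Qed.
Let phm0 : 0 < phm. Proof. exact: phim_gt0. Qed.
Let B0 : 0 < B. Proof. exact: Bx_gt0. Qed.
Let b0 : 0 < c * B. Proof. exact: (mulr_gt0 c0 B0). Qed.
Let mD : measurable_fun [set: R] D. Proof. exact: measurable_Df. Qed.
Let D0 (x : R) : 0 <= D x. Proof. exact: Df_ge0. Qed.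
Let wt0 k : (0 <= wt th w k)%E. Proof. exact: wt_ge0. Qed.
Let mwt : measurable_fun [set: R] (wt th w). Proof. exact: measurable_wt. Qed.

Let Ik (x : R) : \bar R := (\int[leb]_(k in `]0%R, c[) (wt th w k * (D (x / k))%:E))%E.
Let Ek (x y : R) : \bar R := (\int[leb]_(k in `]0%R, c[) (D (x / k) * D (y / k) * `|k|^-1)%:E)%E.

Let mEF (x : R) : measurable_fun [set: R * R] (fun z : R * R => D (x / z.2) * D (z.1 / z.2) * `|z.2|^-1).
Proof.
have m2 := @measurable_snd _ _ R R; have m1 := @measurable_fst _ _ R R.
have mi : measurable_fun [set: R * R] (fun z : R * R => z.2^-1) by exact: measurable_inv.
apply: measurable_funM; last first.
  by apply: measurable_inv; exact: measurableT_comp m2.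
apply: measurable_funM; apply: (measurableT_comp mD).
  by apply: measurable_funM.
by apply: measurable_funM.
Qed.

Let EF0 (x y k : R) : 0 <= D (x / k) * D (y / k) * `|k|^-1.
Proof. by rewrite mulr_ge0 ?invr_ge0// mulr_ge0. Qed.

Let Ek0 x y : (0 <= Ek x y)%E.
Proof. by apply: integral_ge0 => k _; rewrite lee_fin. Qed.

Let mEk (x : R) : measurable_fun [set: R] (Ek x).
Proof.
apply: (@measurable_integral_set _ _ R R R leb setT `]0%R, c[%classic
  (fun z => (D (x / z.2) * D (z.1 / z.2) * `|z.2|^-1)%:E)) => //.
  exact/measurable_EFinP.
by move=> z; rewrite lee_fin.
Qed.

Let EkE (x y : R) : 0 < x < c * B -> 0 < y < c * B -> x != y ->
  Ek x y = (ell th x y c / (2 * (1 + th)))%:E.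
Proof.
move=> hx hy xy; apply: etrans (integral_ell th0 c0 hx hy xy); apply: eq_integral => k.
by rewrite inE/= in_itv/= => /andP[k0 _]; rewrite gtr0_norm.
Qed.

(** After the exchange of [y] and [k], the integral of [w(y) D(y / k) / k] is [wt k] by [wtE]. *)
Lemma integral_wEk (x : R) :
  (\int[leb]_(y in `]0%R, (c * B)%R[) ((w y)%:E * Ek x y) = Ik x)%E.
Proof.
have mF : measurable_fun [set: R * R] (fun z : R * R => w z.1 * (D (x / z.2) * D (z.1 / z.2) * `|z.2|^-1)).
  by apply: measurable_funM => //; exact: measurableT_comp mw measurable_fst.
transitivity (\int[leb]_(y in `]0%R, (c * B)%R[) \int[leb]_(k in `]0%R, c[)
    (w y * (D (x / k) * D (y / k) * `|k|^-1))%:E)%E.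
  apply: eq_integral => y _; under [RHS]eq_integral do rewrite EFinM.
  rewrite ge0_integralZl_EFin//.
  - by move=> k _; rewrite lee_fin.
  - apply/measurable_EFinP; apply: measurable_funTS.
    have mi : measurable_fun [set: R] (fun k : R => k^-1) by exact: measurable_inv.
    apply: measurable_funM; last by apply: measurable_inv; exact: normr_measurable.
    by apply: measurable_funM; apply: (measurableT_comp mD); exact: measurable_funM.
rewrite (@tonelli_set _ _ _ _ R leb leb `]0%R, (c * B)%R[ `]0%R, c[
  (fun z => (w z.1 * (D (x / z.2) * D (z.1 / z.2) * `|z.2|^-1))%:E)
  (measurable_itv _) (measurable_itv _)); last 2 first.
- exact/measurable_EFinP.
- by move=> z; rewrite lee_fin; exact: (mulr_ge0 (w_ge0 _) (EF0 _ _ _)).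
apply: eq_integral => k; rewrite inE/= in_itv/= => /andP[k0 kc].
have kc' : 0 < k <= c by rewrite k0 ltW.
rewrite (wtE th0 w_ge0 mw kc') -ge0_integralZr//; last 3 first.
- apply/measurable_EFinP; apply: measurable_funTS; apply: measurable_funM => //.
  by apply: measurable_funM => //; apply: (measurableT_comp mD); exact: measurable_funM.
- by move=> y _; rewrite lee_fin; exact: (mulr_ge0 (w_ge0 _) (divr_ge0 (D0 _) (ltW k0))).
- by rewrite lee_fin.
by apply: eq_integral => y _; rewrite -EFinM; congr EFin; rewrite gtr0_norm//; ring.
Qed.

(** [psi] averages [w] against a logarithm that is [2 (1 + th)] times an integral over scales;
    exchanging the two integrals recovers the density of the mixture. *)
Lemma psi_rhoE (V1 V2 : R -> R) (x : R) : (forall y, 0 < y -> w y = V2 y * y + V1 y) ->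
  0 < x < c * B -> psi th c V1 V2 x = fine (rhoE th w c x).
Proof.
move=> wE hx; have /andP[x0 xB] := hx.
have t0 : 0 < 2 * (1 + th) by move: th1; lra.
(* At [y = x] the integrand of [psi] is 0 through the conventions for the inverse and the logarithm
   of 0, and [EkE] does not apply; the point is set apart. *)
pose g (y : R) : R := if y == x then 0 else w y * (2 * (1 + th) * fine (Ek x y)).
have mg : measurable_fun [set: R] g.
  apply: measurable_fun_ifT => //; first exact: measurable_fun_eqr.
  apply: measurable_funM => //; apply: measurable_funM => //.
  exact: (measurableT_comp (fine_measurable measurableT) (mEk x)).
rewrite /psi bcE (@Rintegral_cc R _ g (c * B) b0); last 2 first.
- move=> y hy; have /andP[y0 yB] := hy; rewrite /g; case: eqVneq => [->|yx].
    by rewrite subrr invr0 mulr0 cmod0 ln0// mulr0.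
  have xy : x != y by rewrite eq_sym.
  rewrite ell_log_ratio// EkE// -wE//=; congr (_ * _).
  by field; rewrite lt0r_neq0//; move: th1; lra.
- exact: measurable_funTS.
have -> : (\int[leb]_(y in `]0%R, (c * B)%R[) (g y)%:E =
    (2 * (1 + th))%:E * \int[leb]_(y in `]0%R, (c * B)%R[) ((w y)%:E * Ek x y))%E.
  have mm : measurable_fun [set: R] (fun y => ((w y)%:E * Ek x y)%E).
    by apply: emeasurable_funM => //; exact/measurable_EFinP.
  rewrite -ge0_integralZl//; last 3 first.
  - exact: measurable_funTS.
  - by move=> y _; rewrite mule_ge0// lee_fin.
  - by rewrite lee_fin ltW.
  apply: (@eq_integral_off_point R `]0, (c * B)[%classic _ _ x) => //.
  - by apply/measurable_EFinP; exact: measurable_funTS.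
  - by apply: measurable_funTS; exact: emeasurable_funM.
  move=> y; rewrite /= in_itv/= => hy yx; have xy : x != y by rewrite eq_sym.
  by rewrite /g (negbTE yx) EkE// -!EFinM; congr EFin; rewrite /=; ring.
rewrite integral_wEk fine_mulr// /rhoE fine_mulr; last first.
  by rewrite invr_gt0; exact: (mulr_gt0 (mulr_gt0 (pi_gt0 R) phm0) x0).
rewrite mulrA; congr (_ * _).
(* Reconciles the constants [2 (1 + th) / (2 pi^2)] and [1 / (pi phm)]. *)
have -> : pi = (1 + th) * phm :> R by rewrite phimE.
have t1 : 1 + th != 0 by rewrite lt0r_neq0//; move: th1; lra.
have := lt0r_neq0 phm0; have := lt0r_neq0 x0; move: (phim th) => p x' p'.
by field; rewrite x' p' t1.
Qed.

Let pp0 : 0 < pi * phm. Proof. exact: (mulr_gt0 (pi_gt0 R) phm0). Qed.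
Let mrhoE : measurable_fun [set: R] (rhoE th w c). Proof. exact: measurable_rhoE. Qed.

Lemma integral_wtc : (\int[leb]_(k in `]0%R, c[) wt th w k = pi%:E)%E.
Proof. by apply: etrans Mc; exact: integral_wt. Qed.

Lemma integral_rhoE1 : (\int[leb]_(x in `]0%R, (c * B)%R[) rhoE th w c x = 1)%E.
Proof.
transitivity (\int[leb]_(x in `]0%R, (c * B)%R[) (cst 1%E x * rhoE th w c x))%E.
  by apply: eq_integral => x _; rewrite mul1e.
apply: etrans (integral_rhoE th0 w_ge0 mw c0 (measurable_cst 1%E) (fun _ => lee01)) _.
transitivity ((pi * phm)^-1%:E * \int[leb]_(k in `]0%R, c[) (wt th w k * phm%:E))%E.
  congr (_ * _)%E; apply: eq_integral => k _; congr (_ * _)%E.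
  by apply: etrans (integral_cst_phim th0 1) _; rewrite mul1r.
rewrite ge0_integralZr ?lee_fin ?(ltW phm0)//; last exact: measurable_funTS.
rewrite integral_wtc -!EFinM; congr EFin.
by rewrite mulVf// lt0r_neq0.
Qed.

(** The density of the mixture is an extended real; total mass 1 confines its infinite values to a
    null set, so that taking [fine] loses nothing. *)
Lemma rhoE_fin_ae : {ae leb, forall x, `]0, (c * B)[%classic x -> rhoE th w c x \is a fin_num}.
Proof.
apply: integrable_ae => //; apply/integrableP; split; first exact: measurable_funTS.
apply: (@le_lt_trans _ _ 1%E); last exact: ltry.
rewrite -integral_rhoE1 le_eqVlt; apply/orP; left; apply/eqP.
apply: eq_integral => x; rewrite inE/= in_itv/= => /andP[x0 _].
by rewrite gee0_abs//; exact: rhoE_ge0.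
Qed.

Definition rho : R -> R := (fun x => fine (rhoE th w c x)) \_ `]0, (c * Bx th)[.

Lemma rhoP x : 0 < x < c * B -> rho x = fine (rhoE th w c x).
Proof. by move=> h; rewrite /rho patchE mem_oo h. Qed.

Lemma rho_out x : ~~ (0 < x < c * B) -> rho x = 0.
Proof. by move=> /negbTE h; rewrite /rho patchE mem_oo h. Qed.

Lemma rho_ge0 x : 0 <= rho x.
Proof.
have [h|h] := boolP (0 < x < c * B); last by rewrite rho_out.
by rewrite rhoP//; apply: fine_ge0; apply: rhoE_ge0 => //; case/andP: h.
Qed.

Lemma measurable_rho : measurable_fun [set: R] rho.
Proof.
apply/(measurable_restrictT (fun x => fine (rhoE th w c x))) => //.
apply: measurable_funTS; exact: (measurableT_comp (fine_measurable measurableT) mrhoE).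
Qed.

Lemma integral_rho (A : set R) (h : R -> \bar R) : measurable A ->
  measurable_fun [set: R] h -> (forall x, (0 <= h x)%E) ->
  (\int[leb]_(x in A) (h x * (rho x)%:E) =
   \int[leb]_(x in A `&` `]0%R, (c * B)%R[) (h x * rhoE th w c x))%E.
Proof.
move=> mA mh h0; have mE := measurable_rho.
have mAI : measurable (A `&` `]0%R, (c * B)%R[%classic) by exact: measurableI.
transitivity (\int[leb]_(x in A `&` `]0%R, (c * B)%R[) (h x * (rho x)%:E))%E.
  apply/esym; apply: integral_supp => [x []//|x Ax nx].
  by rewrite rho_out ?mule0//; apply/negP => hx; apply: nx; split=> //; rewrite /= in_itv.
apply: ge0_ae_eq_integral => //.
- by apply: measurable_funTS; apply: emeasurable_funM => //; exact/measurable_EFinP.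
- by apply: measurable_funTS; exact: emeasurable_funM.
- by move=> x _; rewrite mule_ge0// lee_fin rho_ge0.
- by move=> x [_]; rewrite /= in_itv/= => /andP[x0 _]; rewrite mule_ge0//; exact: rhoE_ge0.
have := rhoE_fin_ae; apply: filterS => x H [_ xI]; congr (_ * _)%E.
by rewrite rhoP ?fineK ?H//; move: xI; rewrite /= in_itv.
Qed.

Lemma rho_total : mdens rho [set: R] = 1%E.
Proof.
transitivity (\int[leb]_(x in setT) (cst 1%E x * (rho x)%:E))%E.
  by apply: eq_integral => x _; rewrite mul1e.
rewrite integral_rho// setTI; apply: etrans integral_rhoE1.
by apply: eq_integral => x _; rewrite mul1e.
Qed.

Definition nu : probability R R := mdens_prob rho_ge0 measurable_rho rho_total.

Lemma nu_rhoE (A : set R) : measurable A ->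
  nu A = (\int[leb]_(x in A `&` `]0%R, (c * B)%R[) rhoE th w c x)%E.
Proof.
move=> mA; rewrite mdens_probE; transitivity (\int[leb]_(x in A) (cst 1%E x * (rho x)%:E))%E.
  by apply: eq_integral => x _; rewrite mul1e.
by rewrite integral_rho//; apply: eq_integral => x _; rewrite mul1e.
Qed.

Lemma nu_psi (V1 V2 : R -> R) (A : set R) : (forall y, 0 < y -> w y = V2 y * y + V1 y) ->
  measurable A ->
  nu A = (\int[lebesgue_measure]_(x in A `&` `]0%R, bc th c[) (psi th c V1 V2 x)%:E)%E.
Proof.
move=> wE mA; have mAI : measurable (A `&` `]0%R, bc th c[%classic) by exact: measurableI.
transitivity (\int[lebesgue_measure]_(x in A `&` `]0%R, bc th c[) (rho x)%:E)%E; last first.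
  apply: eq_integral => x; rewrite inE => -[_]; rewrite /= in_itv/= bcE => hx.
  by rewrite (psi_rhoE wE hx) rhoP.
rewrite integral_lebR//; last first.
  by apply/measurable_EFinP; apply: measurable_funTS; exact: measurable_rho.
rewrite mdens_probE; apply/esym; apply: integral_supp => [x []//|x Ax nx].
rewrite rho_out//; apply/negP => hx; apply: nx; split=> //.
by rewrite /= in_itv/= bcE.
Qed.

Lemma nu_oo_gt0 (a b : R) : 0 <= a -> a < b -> b <= c * B -> (0 < nu `]a, b[%classic)%E.
Proof.
move=> a0 ab bB; rewrite nu_rhoE//.
have sub : `]a, b[%classic `<=` `]0%R, (c * B)%R[%classic.
  move=> x; rewrite /= !in_itv/= => /andP[ax xb].
  by rewrite (le_lt_trans a0 ax) (lt_le_trans xb bB).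
rewrite (setIidl sub); apply: integral_gt0 => //.
- exact: measurable_funTS.
- move=> x /sub; rewrite /= in_itv/= => hx; exact: rhoE_gt0.
- exact: lebR_oo_gt0.
Qed.

Lemma nu_supp : nu `]0%R, (c * B)%R[%classic = 1%E.
Proof. by rewrite nu_rhoE// setIid integral_rhoE1. Qed.

Lemma integral_nu (h : R -> \bar R) : measurable_fun [set: R] h -> (forall x, (0 <= h x)%E) ->
  (\int[nu]_x h x = (pi * phm)^-1%:E *
    \int[leb]_(k in `]0%R, c[) (wt th w k * \int[leb]_(g in `]0%R, phm[) h (k * X g)%R))%E.
Proof.
move=> mh h0; rewrite ge0_integral_mdens// integral_rho// setTI.
exact: integral_rhoE.
Qed.

End density.

Section tau_extra.
Context {R : realType}.
Variable th : R.

Lemma tau_le (x y : R) : 0 < th -> 0 <= x -> x <= y -> tau th x <= tau th y.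
Proof.
move=> th0 x0 xy; have y0 : 0 <= y by exact: le_trans xy.
have px := powR_ge0 x th; have py := powR_ge0 y th.
have pxy : x `^ th <= y `^ th by apply: ge0_ler_powR => //; exact: ltW.
by apply: lerD; rewrite ler_ln ?posrE; lra.
Qed.

Lemma tau_le2 (x : R) : 1 < th -> 0 < x -> x <= 1 -> tau th x <= 2 * x.
Proof.
move=> th1 x0 x1; have lx : ln x <= 0 by exact: ln_le0.
have px : x `^ th <= x.
  rewrite /powR gt_eqF// -[leRHS]lnK ?posrE// ler_expR.
  by nra.
have p0 := powR_ge0 x th.
have h1 : ln (1 + x) <= x by apply: le_ln1Dx; lra.
have h2 : ln (1 + x `^ th) <= x `^ th by apply: le_ln1Dx; lra.
by rewrite /tau; lra.
Qed.

End tau_extra.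

Section euler_lagrange.
Context {R : realType}.
Variables (th : R) (w U V : R -> R).
Hypothesis th1 : 1 < th.
Hypothesis w_ge0 : forall y : R, 0 <= w y.
Hypothesis w_gt0 : forall y : R, 0 < y -> 0 < w y.
Hypothesis mw : measurable_fun [set: R] w.
Hypothesis w_bounded : forall b : R, 0 < b ->
  exists2 W : R, 0 < W & forall x : R, 0 < x <= b -> w x <= W.
Hypothesis integral_w : forall y : R, 0 < y ->
  (\int[lebR]_(x in `]0%R, y[) (w x)%:E = (U y)%:E)%E.
Hypothesis integral_w_ln : forall x : R, 0 < x ->
  (\int[lebR]_(y in `]0%R, x[) (w y * ln (x / y))%:E = (V x - V 0)%:E)%E.
Variable c : R.
Hypothesis c0 : 0 < c.
Hypothesis Mc : Mf th U c = pi%:E.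

Let leb := (@lebR R).
Local Notation phm := (phim th).
Local Notation B := (Bx th).
Local Notation X := (Xf th).
Local Notation D := (Df th).
Let th0 : 0 < th. Proof. exact: lt_trans th1. Qed.
Let phm0 : 0 < phm. Proof. exact: phim_gt0. Qed.
Let B0 : 0 < B. Proof. exact: Bx_gt0. Qed.
Let b0 : 0 < c * B. Proof. exact: (mulr_gt0 c0 B0). Qed.
Let wt0 k : (0 <= wt th w k)%E. Proof. exact: wt_ge0. Qed.
Let mwt : measurable_fun [set: R] (wt th w). Proof. exact: measurable_wt. Qed.
Let Xr (f : R) : 0 < f < phm -> 0 < X f < B. Proof. exact: Xf_range. Qed.
Let mX : measurable_fun [set: R] X. Proof. exact: measurable_Xf. Qed.
Let pp0 : 0 < pi * phm. Proof. exact: (mulr_gt0 (pi_gt0 R) phm0). Qed.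

(** [phm * tau x + Ac k] is a sum of nonnegative terms for almost every [x > 0], and [tau x] tends
    to 0 with [x]. *)
Lemma Ac_ge0 (k : R) : 0 < k -> 0 <= Ac th k.
Proof.
move=> k0; rewrite leNgt; apply/negP => A0.
have a0 : 0 < - Ac th k / (4 * phm) by rewrite divr_gt0 ?oppr_gt0// mulr_gt0.
have kB : 0 < k * B / 2 by rewrite divr_gt0// mulr_gt0.
(* The last bound makes [phm * tau x] at most half of [- Ac k]; the middle one avoids the
   exceptional value [x = k * B]. *)
pose x := Num.min (Num.min 1 (k * B / 2)) (- Ac th k / (4 * phm)).
have x0 : 0 < x by rewrite !lt_min ltr01 kB a0.
have x1 : x <= 1 by rewrite !ge_min lexx.
have x2 : x <= k * B / 2 by rewrite !ge_min lexx !orbT.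
have x3 : x * (4 * phm) <= - Ac th k.
  have p4 : 0 < 4 * phm by exact: (mulr_gt0 _ phm0).
  by rewrite -(ler_pdivlMr _ _ p4) /x ge_min lexx orbT.
have xk : x / k != B.
  by rewrite lt_eqF// ltr_pdivrMr// mulrC; move: x2 kB; lra.
have := integral_nk_scale th0 x0 k0 xk => E.
have : (0 <= (phm * tau th x + Ac th k)%:E)%E.
  rewrite -E adde_ge0//; last by rewrite lee_fin Pf_ge0.
  by apply: integral_ge0 => f _; exact: nk_ge0.
rewrite lee_fin; have := tau_le2 th1 x0 x1; move: phm0 x3 A0; move: (phim th) (tau th x) => p t p0.
by nra.
Qed.

Lemma measurable_Ac : measurable_fun `]0, c[ (Ac th).
Proof.
have mt : measurable_fun [set: R] (fun k : R => fine (\int[leb]_(f in `]0%R, phm[) (`|tau th (k * X f)|)%:E)%E).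
  apply: (measurableT_comp (fine_measurable measurableT)).
  apply: (@measurable_integral_set _ _ R R R leb setT `]0%R, phm[%classic
    (fun z => (`|tau th (z.1 * X z.2)|)%:E)) => //.
  apply/measurable_EFinP; apply: measurableT_comp => //; apply: (measurableT_comp (measurable_tau th)).
  by apply: measurable_funM => //; exact: measurableT_comp mX measurable_snd.
apply: (@eq_measurable_fun _ _ _ _ _ (fun k : R => fine (\int[leb]_(f in `]0%R, phm[) (`|tau th (k * X f)|)%:E)%E
   - phm * (1 + th) * ln k)).
  move=> k; rewrite inE/= in_itv/= => /andP[k0 _]; rewrite /Ac /Tc; congr (fine _ - _).
  apply: eq_integral => f; rewrite inE/= in_itv/= => /Xr /andP[X0 _].
  by rewrite ger0_norm// tau_ge0//; exact: (ltW (mulr_gt0 k0 X0)).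
by apply: measurable_funTS; apply: measurable_funB => //; exact: measurable_funM.
Qed.

Lemma Ac_le (k : R) : 0 < k < c -> Ac th k <= phm * tau th (c * B) + `|pi * ln c| + pi * ln (c / k).
Proof.
move=> /andP[k0 kc]; rewrite /Ac (mulrC phm) phimE//.
have -> : pi * ln k = pi * ln c - pi * ln (c / k).
  by rewrite ln_div ?posrE//; ring.
have h1 : - (pi * ln c) <= `|pi * ln c| by rewrite -normrN ler_norm.
suff h2 : Tc th k <= phm * tau th (c * B) by move: h1 h2; lra.
rewrite -lee_fin -TcE ?(ltW k0)//.
apply: (@le_trans _ _ (\int[leb]_(f in `]0%R, phm[) (tau th (c * B))%:E)%E); last first.
  by rewrite integral_cst_phim// mulrC.
apply: le_integral_phim => //.
- by apply/measurable_EFinP; exact: measurable_tau_X.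
- by move=> f /Xr /andP[X0 _]; rewrite lee_fin tau_ge0//; exact: (ltW (mulr_gt0 k0 X0)).
move=> f /Xr /andP[X0 XB]; rewrite lee_fin; apply: tau_le => //.
  exact: (ltW (mulr_gt0 k0 X0)).
exact: (ler_pM (ltW k0) (ltW X0) (ltW kc) (ltW XB)).
Qed.

Let KA : \bar R := (\int[leb]_(k in `]0%R, c[) (wt th w k * (Ac th k)%:E))%E.

(** [wt] is bounded, and [Ac k] is at most a constant plus [pi ln (c / k)], which is integrable at
    0. Finiteness allows this constant to be cancelled in the Euler-Lagrange relations. *)
Lemma KA_fin : KA = (fine KA)%:E.
Proof.
have KA0 : (0 <= KA)%E.
  apply: integral_ge0 => k; rewrite /= in_itv/= => /andP[k0 _].
  by rewrite mule_ge0// lee_fin Ac_ge0.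
suff : (KA < +oo)%E by move=> KAy; rewrite fineK// ge0_fin_numE.
have [W W0 HW] := wt_bounded th0 w_ge0 mw w_bounded c0.
pose C1 := phm * tau th (c * B) + `|pi * ln c|.
have C10 : 0 <= C1.
  by apply: addr_ge0 => //; apply: mulr_ge0; [exact: ltW|apply: tau_ge0; exact: ltW].
have lnq (k : R) : 0 < k < c -> 0 <= ln (c / k).
  by move=> /andP[k0 kc]; rewrite ln_ge0// ler_pdivlMr// mul1r ltW.
have mln : measurable_fun [set: R] (fun k => ln (c / k)).
  apply: (measurableT_comp (@measurable_ln R)); apply: measurable_funM => //.
  exact: measurable_inv.
apply: (@le_lt_trans _ _ (\int[leb]_(k in `]0%R, c[) ((W * C1)%:E + (W * pi)%:E * (ln (c / k))%:E))%E).
  apply: ge0_le_integral => //.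
  - move=> k; rewrite /= in_itv/= => /andP[k0 _].
    by rewrite mule_ge0// lee_fin Ac_ge0.
  - apply: emeasurable_funM; first exact: measurable_funTS.
    by apply/measurable_EFinP; exact: measurable_Ac.
  - apply: measurable_funTS; apply: emeasurable_funD => //; apply: emeasurable_funM => //.
    exact/measurable_EFinP.
  move=> k; rewrite /= in_itv/= => hk; have /andP[k0 kc] := hk.
  rewrite -EFinM -EFinD -mulrA -mulrDr EFinM; apply: lee_pmul => //.
  - by rewrite lee_fin Ac_ge0.
  - exact: HW.
  - by rewrite lee_fin Ac_le.
have g1 k : `]0, c[%classic k -> (0 <= (W * C1)%:E)%E by rewrite lee_fin mulr_ge0// ltW.
have Wpi : 0 <= W * pi by apply: mulr_ge0; [exact: ltW|exact: pi_ge0].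
have g2 k : `]0, c[%classic k -> (0 <= (ln (c / k))%:E)%E by rewrite /= in_itv/= => hk; rewrite lee_fin lnq.
have g3 k : `]0, c[%classic k -> (0 <= (W * pi)%:E * (ln (c / k))%:E)%E by move=> /g2 h; rewrite mule_ge0// lee_fin.
have m2 : measurable_fun `]0, c[ (fun k => (ln (c / k))%:E) by apply/measurable_EFinP; exact: measurable_funTS.
have m3 : measurable_fun `]0, c[ (fun k => ((W * pi)%:E * (ln (c / k))%:E)%E) by exact: emeasurable_funM.
rewrite (ge0_integralD _ (measurable_itv _) g1 (measurable_cst _) g3 m3).
rewrite (ge0_integralZl_EFin _ (measurable_itv _) g2 m2 Wpi).
by rewrite integral_ln_quotient// integral_cst_lebR ?(ltW c0)// -EFinM -EFinD ltry.
Qed.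

Let Nk (x k : R) : \bar R := (\int[leb]_(g in `]0%R, phm[) nk th x (k * X g)%R)%E.
(** [Jx] is the potential of the mixture up to the factor [pi * phm]. [Gx] is what it lacks, the
    contribution of the copies [k X] whose support does not reach [x]. *)
Let Jx (x : R) : \bar R := (\int[leb]_(k in `]0%R, c[) (wt th w k * Nk x k))%E.
Let Gx (x : R) : \bar R := (\int[leb]_(k in `]0%R, c[) (wt th w k * (Pf th (x / k))%:E))%E.

Let mNk (x : R) : measurable_fun [set: R] (Nk x).
Proof.
apply: (@measurable_integral_set _ _ R R R leb setT `]0%R, phm[%classic
    (fun z => nk th x (z.1 * X z.2)%R)) => //; last by move=> z; exact: nk_ge0.
have mp : measurable_fun [set: R * R] (fun z : R * R => (x, z.1 * X z.2)).
  apply: measurable_fun_pair => //; apply: measurable_funM => //.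
  exact: measurableT_comp mX measurable_snd.
exact: (measurableT_comp (measurable_nk th) mp).
Qed.

Let Nk0 x k : (0 <= Nk x k)%E.
Proof. by apply: integral_ge0 => g _; exact: nk_ge0. Qed.

Let mPq (x : R) : measurable_fun [set: R] (fun k : R => Pf th (x / k)).
Proof.
apply: (measurableT_comp (measurable_Pf th)); apply: measurable_funM => //.
exact: measurable_inv.
Qed.

Lemma euler_lagrange_sum (x : R) : 0 < x ->
  (Jx x + Gx x = (pi * phm * tau th x + fine KA)%:E)%E.
Proof.
move=> x0.
have mJ : measurable_fun `]0%R, c[ (fun k => (wt th w k * Nk x k)%E).
  by apply: measurable_funTS; exact: emeasurable_funM.
have mG : measurable_fun `]0%R, c[ (fun k => (wt th w k * (Pf th (x / k))%:E)%E).
  by apply: measurable_funTS; apply: emeasurable_funM => //; exact/measurable_EFinP.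
have mA : measurable_fun `]0%R, c[ (fun k => (wt th w k * (Ac th k)%:E)%E).
  by apply: emeasurable_funM; [exact: measurable_funTS|apply/measurable_EFinP; exact: measurable_Ac].
have mT : measurable_fun `]0%R, c[ (fun k => (wt th w k * (phm * tau th x)%:E)%E).
  by apply: measurable_funTS; exact: emeasurable_funM.
have t0 : 0 <= phm * tau th x by apply: mulr_ge0; [exact: ltW|apply: tau_ge0; exact: ltW].
transitivity (\int[leb]_(k in `]0%R, c[) (wt th w k * Nk x k + wt th w k * (Pf th (x / k))%:E))%E.
  rewrite ge0_integralD//.
  - by move=> k _; rewrite mule_ge0.
  - by move=> k _; rewrite mule_ge0// lee_fin Pf_ge0.
transitivity (\int[leb]_(k in `]0%R, c[) (wt th w k * (phm * tau th x)%:E + wt th w k * (Ac th k)%:E))%E.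
  apply: (@eq_integral_off_point R `]0, c[%classic _ _ (x / B)) => //.
  - exact: emeasurable_funD.
  - exact: emeasurable_funD.
  move=> k; rewrite /= in_itv/= => /andP[k0 kc] kx.
  have xk : x / k != B.
    apply: contra kx => /eqP <-; apply/eqP; field.
    by rewrite !lt0r_neq0.
  rewrite -ge0_muleDr//; last by rewrite lee_fin Pf_ge0.
  rewrite (integral_nk_scale th0 x0 k0 xk) EFinD ge0_muleDr// lee_fin//.
  exact: Ac_ge0.
rewrite ge0_integralD//; last 2 first.
- by move=> k _; rewrite mule_ge0.
- by move=> k; rewrite /= in_itv/= => /andP[k0 _]; rewrite mule_ge0// lee_fin Ac_ge0.
rewrite -/KA KA_fin [in RHS]EFinD; congr (_ + _)%E.
rewrite ge0_integralZr//; last exact: measurable_funTS.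
by rewrite (integral_wtc th1 w_ge0 mw integral_w c0 Mc) -EFinM; congr EFin; ring.
Qed.

Let Fx (x f y : R) : \bar R := (w y * Pf th (x / y * X f))%:E.
Let Fx0 x f y : (0 <= Fx x f y)%E.
Proof. by rewrite lee_fin; exact: (mulr_ge0 (w_ge0 _) (Pf_ge0 _ _)). Qed.

Let GxE (x : R) : Gx x = (\int[leb]_(f in `]0%R, phm[) \int[leb]_(y in `]0%R, (c * X f)%R[) Fx x f y)%E.
Proof.
rewrite /Gx (integral_wtM th0 w_ge0 mw c0 (mPq x)); last by move=> k; exact: Pf_ge0.
apply: eq_integral => f _; apply: eq_integral => y _; rewrite /Fx; congr (_ * Pf th _)%:E.
by rewrite invfM invrK mulrA.
Qed.

Let Fx_eq0 x f y : x / y * X f <= B -> Fx x f y = 0%E.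
Proof. by move=> h; rewrite /Fx /Pf h mulr0. Qed.

Let mFx2 (x : R) : measurable_fun [set: R * R] (fun z : R * R => Fx x z.1 z.2).
Proof.
apply/measurable_EFinP; apply: measurable_funM; first exact: measurableT_comp mw measurable_snd.
apply: (measurableT_comp (measurable_Pf th)); apply: measurable_funM.
  by apply: measurable_funM => //; apply: measurable_inv; exact: measurable_snd.
exact: measurableT_comp mX measurable_fst.
Qed.

Let mFx (x f : R) : measurable_fun [set: R] (Fx x f).
Proof.
apply/measurable_EFinP; apply: measurable_funM => //.
apply: (measurableT_comp (measurable_Pf th)); apply: measurable_funM => //.
by apply: measurable_funM => //; exact: measurable_inv.
Qed.

(** The integrand of [Gx] taken over [y < x] instead of [y < c X f]: its average over [f] is
    [w(y) ln (x / y)] up to a constant, so the representation of [V] applies. *)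
Let GxR (x : R) : 0 < x ->
  (\int[leb]_(f in `]0%R, phm[) \int[leb]_(y in `]0%R, x[) Fx x f y = (pi * phm * (V x - V 0))%:E)%E.
Proof.
move=> x0.
rewrite (@tonelli_set _ _ _ _ R leb leb `]0%R, phm[ `]0%R, x[ (fun z => Fx x z.1 z.2)
  (measurable_itv _) (measurable_itv _) (mFx2 x) (fun z => Fx0 x z.1 z.2)).
rewrite EFinM -(integral_w_ln x0) -ge0_integralZl_EFin//; last 3 first.
- move=> y; rewrite /= in_itv/= => /andP[y0 yx]; rewrite lee_fin mulr_ge0// ln_ge0//.
  by rewrite ler_pdivlMr// mul1r ltW.
- apply/measurable_EFinP; apply: measurable_funTS; apply: measurable_funM => //.
  apply: (measurableT_comp (@measurable_ln R)); apply: measurable_funM => //.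
  exact: measurable_inv.
- exact: ltW.
apply: eq_integral => y; rewrite inE/= in_itv/= => /andP[y0 yx].
have u1 : 1 <= x / y by rewrite ler_pdivlMr// mul1r ltW.
transitivity ((w y)%:E * \int[leb]_(f in `]0%R, phm[) (Pf th (x / y * X f))%:E)%E.
  rewrite -ge0_integralZl_EFin//.
  - by move=> f _; rewrite lee_fin Pf_ge0.
  - apply/measurable_EFinP; apply: measurable_funTS; apply: (measurableT_comp (measurable_Pf th)).
    exact: measurable_funM.
rewrite (integral_Pf_X th0 u1) -!EFinM; congr EFin.
by rewrite -(phimE th0); ring.
Qed.

Let Fc (x f y : R) : \bar R := if y < c * X f then Fx x f y else 0%E.
Let Fc0 x f y : (0 <= Fc x f y)%E. Proof. by rewrite /Fc; case: ifP. Qed.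

Let mFc2 (x : R) : measurable_fun [set: R * R] (fun z : R * R => Fc x z.1 z.2).
Proof.
apply: measurable_fun_ifT => //; first apply: measurable_fun_ltr; first exact: measurable_snd.
  by apply: measurable_funM => //; exact: measurableT_comp mX measurable_fst.
Qed.

Let mFc (x f : R) : measurable_fun [set: R] (Fc x f).
Proof. by apply: measurable_fun_ifT => //; exact: measurable_fun_ltr. Qed.

Let GxD0 (x f : R) : 0 < x -> 0 < f < phm ->
  (\int[leb]_(y in `]0%R, (c * X f)%R[) Fx x f y = \int[leb]_(y in `]0%R, x[) Fc x f y)%E.
Proof.
move=> x0 /Xr /andP[X0 XB].
transitivity (\int[leb]_(y in `]0%R, (c * X f)%R[ `&` `]0%R, x[) Fx x f y)%E.
  apply/esym; apply: integral_supp => [y []//|y].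
  rewrite /= !in_itv/= => /andP[y0 yc] H; apply: Fx_eq0.
  have xy : x <= y.
    by rewrite leNgt; apply/negP => yx; apply: H; rewrite y0 yc yx.
  apply: (le_trans _ (ltW XB)); rewrite -[leRHS]mul1r; apply: (ler_wpM2r (ltW X0)).
  by rewrite ler_pdivrMr// mul1r.
transitivity (\int[leb]_(y in `]0%R, (c * X f)%R[ `&` `]0%R, x[) Fc x f y)%E.
  apply: eq_integral => y; rewrite inE => -[]; rewrite /= in_itv/= => /andP[_ yc] _.
  by rewrite /Fc yc.
apply: integral_supp => [y []//|y].
rewrite /= !in_itv/= => /andP[y0 yx] H; rewrite /Fc; case: ifPn => // yc.
by exfalso; apply: H; rewrite y0 yc yx.
Qed.

(** The integrand vanishes for [y >= x], because [X f < B]. So [Gx] is an integral over the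
    intersection of [y < c X f] and [y < x], whence an inequality. *)
Lemma Gx_le (x : R) : 0 < x -> (Gx x <= (pi * phm * (V x - V 0))%:E)%E.
Proof.
move=> x0; apply: (le_eq2 (GxE x) (esym (GxR x0))).
apply: (@le_trans _ _ (\int[leb]_(f in `]0%R, phm[) \int[leb]_(y in `]0%R, x[) Fc x f y)%E).
  rewrite le_eqVlt; apply/orP; left; apply/eqP; apply: eq_integral => f.
  by rewrite inE/= in_itv/= => hf; rewrite GxD0.
apply: ge0_le_integral => //.
- by move=> f _; exact: integral_ge0.
- exact: (@measurable_integral_set _ _ R R R leb `]0%R, phm[%classic `]0%R, x[%classic
    (fun z => Fc x z.1 z.2) (measurable_itv _) (measurable_itv _) (mFc2 x) (fun z => Fc0 x z.1 z.2)).
- exact: (@measurable_integral_set _ _ R R R leb `]0%R, phm[%classic `]0%R, x[%classic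
    (fun z => Fx x z.1 z.2) (measurable_itv _) (measurable_itv _) (mFx2 x) (fun z => Fx0 x z.1 z.2)).
move=> f _; apply: ge0_le_integral => //.
- exact: measurable_funTS.
- exact: measurable_funTS.
by move=> y _; rewrite /Fc; case: ifP.
Qed.

(** For [x <= c B] the integrand also vanishes when [y >= c X f], since then
    [x X f / y <= x / c <= B]; the restriction to the intersection loses nothing. *)
Lemma Gx_eq (x : R) : 0 < x -> x <= c * B -> Gx x = (pi * phm * (V x - V 0))%:E.
Proof.
move=> x0 xB; apply: etrans (GxE x) _; apply: etrans _ (GxR x0).
apply: eq_integral => f; rewrite inE/= in_itv/= => hf; apply: etrans (GxD0 x0 hf) _.
apply: eq_integral => y; rewrite inE/= in_itv/= => /andP[y0 yx].
have /andP[X0 XB] := Xr hf; rewrite /Fc; case: ltP => // cy; rewrite Fx_eq0//.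
rewrite mulrAC ler_pdivrMr//; apply: (@le_trans _ _ (c * B * X f)).
  exact: (ler_wpM2r (ltW X0)).
by rewrite mulrAC mulrC; exact: (ler_wpM2l (ltW B0)).
Qed.

(** The Euler-Lagrange constant for the kernel [nk] and the external field [V - V 0 - tau]. *)
Definition Lc : R := fine (\int[lebR]_(k in `]0%R, c[) (wt th w k * (Ac th k)%:E))%E / (pi * phim th).

Let nu' := nu th1 w_ge0 mw integral_w c0 Mc.

Let NJ (x : R) : (\int[nu']_y nk th x y = (pi * phm)^-1%:E * Jx x)%E.
Proof.
rewrite /nu' integral_nu//; last by move=> y; exact: nk_ge0.
have mp : measurable_fun [set: R] (fun y : R => (x, y)) by exact: measurable_fun_pair.
exact: (measurableT_comp (measurable_nk th) mp).
Qed.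

Lemma euler_lagrange_ge (x : R) : 0 < x ->
  ((tau th x + Lc - (V x - V 0))%:E <= \int[nu']_y nk th x y)%E.
Proof.
move=> x0; rewrite NJ; have := Gx_le x0; have := euler_lagrange_sum x0.
case: (Jx x) => [j| |]; case: (Gx x) => [g| |]//=.
move=> [] E; rewrite lee_fin => gle; rewrite -EFinM lee_fin.
have -> : tau th x + Lc - (V x - V 0) = (pi * phm)^-1 * (pi * phm * tau th x + fine KA - pi * phm * (V x - V 0)).
  rewrite /Lc -/KA; move: (pi * phm) (lt0r_neq0 pp0) (fine KA) => p p' k; by field.
by rewrite ler_wpM2l ?invr_ge0 ?(ltW pp0)//; lra.
Qed.

Lemma euler_lagrange_eq (x : R) : 0 < x -> x <= c * B ->
  (\int[nu']_y nk th x y = (tau th x + Lc - (V x - V 0))%:E)%E.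
Proof.
move=> x0 xB; rewrite NJ; have := Gx_eq x0 xB; have := euler_lagrange_sum x0.
case: (Jx x) => [j| |]; case: (Gx x) => [g| |]//=.
move=> [] E [] gle; rewrite -EFinM; congr EFin.
have -> : j = pi * phm * tau th x + fine KA - pi * phm * (V x - V 0) by lra.
rewrite /Lc -/KA; move: (pi * phm) (lt0r_neq0 pp0) (fine KA) => p p' k; by field.
Qed.

End euler_lagrange.

(** * Comparison of energies *)

Section probability_integrals.
Context {R : realType}.

Lemma integral_full (m : probability R R) (D E : set R) (F : R -> \bar R) :
  measurable D -> measurable E -> D `<=` E -> m D = 1%E ->
  measurable_fun E F -> (forall x, E x -> (0 <= F x)%E) ->
  (\int[m]_(x in E) F x = \int[m]_(x in D) F x)%E.
Proof.
move=> mD mE DE D1 mF F0.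
rewrite (@ge0_negligible_integral _ _ _ m E (~` D) F)//; last 2 first.
- exact: measurableC.
- by rewrite [LHS](probability_setC m mD) D1 subee.
by rewrite setDE setCK setIidr.
Qed.

Lemma integral_fullT (m : probability R R) (D : set R) (F : R -> \bar R) :
  measurable D -> m D = 1%E -> measurable_fun [set: R] F -> (forall x, (0 <= F x)%E) ->
  (\int[m]_x F x = \int[m]_(x in D) F x)%E.
Proof. by move=> mD D1 mF F0; apply: integral_full. Qed.

Lemma integral_add_cst (m : probability R R) (D : set R) (f g : R -> \bar R) (a : \bar R) :
  measurable D -> m D = 1%E -> measurable_fun D f -> measurable_fun D g ->
  (forall x, D x -> (0 <= f x)%E) -> (forall x, D x -> (0 <= g x)%E) -> (0 <= a)%E ->
  (\int[m]_(x in D) (f x + (a + g x)) = \int[m]_(x in D) f x + (a + \int[m]_(x in D) g x))%E.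
Proof.
move=> mD D1 mf mg f0 g0 a0.
rewrite ge0_integralD//; last 2 first.
- by move=> x Dx; rewrite adde_ge0// g0.
- exact: emeasurable_funD.
by rewrite ge0_integralD// (integral_cst m mD a) [X in (_ * X)%E]D1 mule1.
Qed.

(** [f] may take negative values, though not below [- K], and the value [+oo]. The integral of its
    negative part is at most [K], so no infinite terms of opposite signs meet. *)
Lemma integral_shift_below (m : probability R R) (D : set R) (f g : R -> \bar R) (K : R) :
  measurable D -> m D = 1%E -> measurable_fun D g -> (forall x, D x -> (0 <= g x)%E) ->
  0 <= K -> (forall x, D x -> (f x + K%:E = g x)%E) ->
  (\int[m]_(x in D) f x + K%:E = \int[m]_(x in D) g x)%E.
Proof.
move=> mD D1 mg g0 K0 fg.
pose h x : \bar R := (g x - K%:E)%E.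
have -> : (\int[m]_(x in D) f x = \int[m]_(x in D) h x)%E.
  by apply: eq_integral => x; rewrite inE => Dx; rewrite /h -fg// addeK.
have mh : measurable_fun D h by exact: emeasurable_funD.
have mp : measurable_fun D h^\+%E by exact: measurable_funepos.
have mn : measurable_fun D h^\-%E by exact: measurable_funeneg.
have cE : (\int[m]_(x in D) (cst K%:E x) = K%:E)%E by rewrite integral_cst// [X in (_ * X)%E]D1 mule1.
have E : (\int[m]_(x in D) h^\+ x + K%:E = \int[m]_(x in D) g x + \int[m]_(x in D) h^\- x)%E.
  rewrite -{1}cE -ge0_integralD//.
  rewrite -ge0_integralD//; apply: eq_integral => x; rewrite inE => Dx.
  rewrite funeposE funenegE /h; have := g0 x Dx.
  case: (g x) => [r| |]// r0; last by rewrite /= maxye maxNye !addye.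
  rewrite /= -EFinD -!EFin_max -!EFinD; congr EFin; rewrite opprB.
  by case: (leP (r - K) 0); case: (leP (K - r) 0); lra.
have nK : (\int[m]_(x in D) h^\- x <= K%:E)%E.
  rewrite -cE; apply: ge0_le_integral => // x Dx.
  rewrite funenegE /h; have := g0 x Dx; case: (g x) => [r| |]//=.
    rewrite lee_fin => r0; rewrite -EFin_max lee_fin ge_max K0 andbT; lra.
  by move=> _; rewrite maxNye lee_fin.
have n0 : (0 <= \int[m]_(x in D) h^\- x)%E by apply: integral_ge0.
rewrite [in LHS]integralE.
move: E nK n0.
set p := (\int[m]_(x in D) h^\+ x)%E; set n := (\int[m]_(x in D) h^\- x)%E.
set a := (\int[m]_(x in D) g x)%E; clearbody p n a.
case: n => [n| |]//; case: p => [p| |]; case: a => [a| |]//= [] E _ _; rewrite -?EFinN -?EFinD; congr EFin.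
lra.
Qed.

Lemma prob_eq_rays (m1 m2 : probability R R) :
  (forall t : R, m1 `]t, +oo[%classic = m2 `]t, +oo[%classic) ->
  forall A, measurable A -> m1 A = m2 A.
Proof.
move=> H A mA.
apply: (@measure_unique _ R R (@RGenOInfty.G R) (fun n => `]- (n%:R : R), +oo[%classic)) => //.
- exact: (RGenOInfty.measurableE R).
- move=> _ _ [x ->] [y ->]; exists (Num.max x y); apply/seteqP; split=> z /=; rewrite !in_itv/= !andbT.
    by move=> [h1 h2]; rewrite gt_max h1.
  by rewrite gt_max => /andP[].
- by move=> n; exists (- n%:R).
- apply/seteqP; split=> // x _; exists (Num.truncn `|x|).+1 => //=.
  rewrite in_itv/= andbT; have := truncnS_gt `|x|; have := ler_norm (- x); rewrite normrN; lra.
- by move=> _ [x ->]; exact: H.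
- by move=> n; apply: (le_lt_trans (probability_le1 m1 _)) => //; exact: ltry.
Qed.

(** [n1], [n2] and [n12] stand for the energies of the minimiser and of [nu] and for their mixed
    energy, [Wm] and [Wn] for the integrals of the field. Once infinite terms are ruled out, [S <=
    n1 + n2 - 2 n12 <= 2 (n2 + Wn) - 2 (n12 + Wm) <= 0]. *)
Lemma sqr_zero_of_energy (n1 n2 n12 S Wm Wn : \bar R) (L : R) :
  (0 <= n1 -> 0 <= n2 -> 0 <= n12 -> 0 <= S -> 0 <= Wm -> 0 <= Wn ->
  n12 + n12 + S <= n1 + n2 -> n1 + (Wm + Wm) <= n2 + (Wn + Wn) ->
  n2 + Wn = L%:E -> L%:E <= n12 + Wm -> S <= 0)%E.
Proof.
case: n2 => [n2| |]; case: Wn => [Wn| |]//; case: n1 => [n1| |]; case: Wm => [Wm| |]//;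
  case: n12 => [n12| |]; case: S => [S| |]//.
rewrite -!EFinD !lee_fin => _ _ _ _ _ _ h1 h2 [h3] h4; lra.
Qed.

End probability_integrals.

Section comparison.
Context {R : realType}.
Variables (th : R) (w U V : R -> R).
Hypothesis th1 : 1 < th.
Hypothesis w_ge0 : forall y : R, 0 <= w y.
Hypothesis w_gt0 : forall y : R, 0 < y -> 0 < w y.
Hypothesis mw : measurable_fun [set: R] w.
Hypothesis w_bounded : forall b : R, 0 < b ->
  exists2 W : R, 0 < W & forall x : R, 0 < x <= b -> w x <= W.
Hypothesis integral_w : forall y : R, 0 < y ->
  (\int[lebR]_(x in `]0%R, y[) (w x)%:E = (U y)%:E)%E.
Hypothesis integral_w_ln : forall x : R, 0 < x ->
  (\int[lebR]_(y in `]0%R, x[) (w y * ln (x / y))%:E = (V x - V 0)%:E)%E.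
Hypothesis cV : {within `[0, +oo[, continuous V}.
Hypothesis limV : V x / ln x @[x --> +oo] --> +oo.

Local Notation H := (@halfline R).
Let th0 : 0 < th. Proof. exact: lt_trans th1. Qed.
Let mH : measurable H. Proof. exact: measurable_itv. Qed.
Let HE (x : R) : H x = (0 <= x) :> Prop.
Proof. by rewrite /halfline /= in_itv/= andbT. Qed.

Let V_ge (x : R) : 0 <= x -> V 0 <= V x.
Proof.
rewrite le_eqVlt => /predU1P[<-//|x0]; rewrite -subr_ge0 -lee_fin -integral_w_ln//.
apply: integral_ge0 => y; rewrite /= in_itv/= => /andP[y0 yx].
by rewrite lee_fin mulr_ge0// ln_ge0// ler_pdivlMr// mul1r ltW.
Qed.

Let tau_ln (x : R) : 1 <= x -> tau th x <= 2 * ln 2 + (1 + th) * ln x.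
Proof.
move=> x1; have x0 : 0 < x by lra.
have p0 : 0 < x `^ th by exact: powR_gt0.
have p1 : 1 <= x `^ th by rewrite -(powRr0 x); apply: ler_powR => //; exact: ltW.
have h1 : ln (1 + x) <= ln (2 * x) by rewrite ler_ln ?posrE; lra.
have h2 : ln (1 + x `^ th) <= ln (2 * x `^ th) by rewrite ler_ln ?posrE; lra.
move: h1 h2; rewrite !lnM ?posrE// ln_powR /tau; lra.
Qed.

(** [tau] grows like [(1 + th) ln x], and [V] faster than any multiple of [ln x]. The constant [K]
    makes the shifted energy nonnegative. *)
Lemma potential_dominates_tau : exists2 K : R, 0 <= K & forall x, 0 <= x -> 0 <= V x - tau th x + K.
Proof.
move/cvgryPge : limV => /(_ (2 + th)) [M [_ HM]].
pose M' := Num.max (expR 1) M.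
have e1 : 1 < expR 1 :> R by rewrite expR_gt1.
have M1 : 1 < M' by rewrite lt_max e1.
have l2 : 0 <= ln 2 :> R by rewrite ln_ge0// ler1n.
have t0 : 0 <= tau th M' by apply: tau_ge0; lra.
have v0 := normr_ge0 (V 0); have v1 := ler_norm (- V 0); rewrite normrN in v1.
exists (2 * ln 2 + tau th M' + `|V 0|); first by lra.
move=> x x0; have [xM|Mx] := leP x M'.
  by have := V_ge x0; have := tau_le th0 x0 xM; lra.
have MM : M < x by apply: le_lt_trans Mx; rewrite le_max lexx orbT.
have ex : expR 1 < x by apply: le_lt_trans Mx; rewrite le_max lexx.
have x1 : 1 <= x by lra.
have lx : 1 <= ln x by rewrite -[leLHS]expRK ler_ln ?posrE ?expR_gt0 ?ltW//; lra.
have := HM x MM; rewrite /= ler_pdivlMr; last by lra.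
by have := tau_ln x1; lra.
Qed.

Section shifted.
Variable K : R.
Hypothesis K0 : 0 <= K.
Hypothesis HK : forall x, 0 <= x -> 0 <= V x - tau th x + K.

(** The external field that goes with the kernel [nk]: the terms [tau] contained in [nk] are taken
    off [V]. *)
Let W (x : R) : R := V x - tau th x + K.

Let mV : measurable_fun H V.
Proof. exact: subspace_continuous_measurable_fun. Qed.

Let mW : measurable_fun H W.
Proof.
apply: measurable_funD => //; apply: measurable_funB => //.
by apply: measurable_funTS; exact: measurable_tau.
Qed.

Let nk0 x y : (0 <= nk th x y)%E. Proof. exact: nk_ge0. Qed.
Let mnk1 (x : R) : measurable_fun [set: R] (nk th x).
Proof.
have mp : measurable_fun [set: R] (fun y : R => (x, y)) by exact: measurable_fun_pair.
exact: (measurableT_comp (measurable_nk th) mp).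
Qed.

Lemma nk_diag (x : R) : nk th x x = +oo%E.
Proof. by rewrite /nk /logk !subrr normr0 /neglog eqxx. Qed.

Lemma energy_kernel_shift (x y : R) : 0 <= x -> 0 <= y ->
  (energy_kernel th V x y + K%:E = 2^-1%:E * (nk th x y + (W x + W y)%:E))%E.
Proof.
move=> x0 y0; rewrite /energy_kernel; case: eqVneq => [->|xy].
  by rewrite nk_diag !addye// gt0_muley// lte_fin invr_gt0.
have d1 : x - y != 0 by rewrite subr_eq0.
have d2 : x `^ th - y `^ th != 0.
  by rewrite subr_eq0; apply: contra xy => /eqP /(powR_injective th0) => ->//; rewrite nnegrE.
rewrite nkE// /kb /neglog !normr_eq0 (negbTE d1) (negbTE d2) -!EFinD -EFinM; congr EFin.
rewrite !lnV ?posrE ?normr_gt0// /W; lra.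
Qed.

Lemma energy_shift (m : probability R R) : on_halfline m ->
  (energy th V m + K%:E = 2^-1%:E * (bilin (nk th) m m +
     (\int[m]_(x in H) (W x)%:E + \int[m]_(x in H) (W x)%:E)))%E.
Proof.
move=> m1.
have hp : 0 < 2^-1 :> R by rewrite invr_gt0.
have W0 x : H x -> (0 <= (W x)%:E)%E by rewrite HE lee_fin => /HK.
have mWE : measurable_fun H (EFin \o W) by exact/measurable_EFinP.
set IW := (\int[m]_(x in H) (W x)%:E)%E.
have IW0 : (0 <= IW)%E by exact: integral_ge0.
have nH x : (\int[m]_y nk th x y = \int[m]_(y in H) nk th x y)%E.
  exact: (integral_fullT mH m1 (mnk1 x) (nk0 x)).
pose Q x : \bar R := (2^-1%:E * (\int[m]_y nk th x y + (IW + (W x)%:E)))%E.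
have mN : measurable_fun [set: R] (fun x => \int[m]_y nk th x y)%E.
  exact: (@measurable_integral_set _ _ R R R m setT setT (fun z => nk th z.1 z.2)
    measurableT measurableT (measurable_nk th) (fun z => nk0 z.1 z.2)).
have N0 x : (0 <= \int[m]_y nk th x y)%E by exact: integral_ge0.
have inner x : H x -> (\int[m]_(y in H) energy_kernel th V x y + K%:E = Q x)%E.
  move=> Hx; have x0 : 0 <= x by rewrite HE in Hx.
  have mg : measurable_fun H (fun y => (nk th x y + ((W x)%:E + (W y)%:E))%E).
    by apply: emeasurable_funD; [exact: measurable_funTS|exact: emeasurable_funD].
  have g0 y : H y -> (0 <= nk th x y + ((W x)%:E + (W y)%:E))%E.
    by move=> Hy; apply: adde_ge0 => //; apply: adde_ge0; exact: W0.
  rewrite (@integral_shift_below R m H _ (fun y => (2^-1%:E * (nk th x y + ((W x)%:E + (W y)%:E)))%E) K mH m1)//.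
  - rewrite (ge0_integralZl_EFin _ mH g0 mg (ltW hp)) /Q; congr (_ * _)%E.
    apply: etrans (@integral_add_cst R m H (nk th x) (fun y => (W y)%:E) (W x)%:E mH m1
      (measurable_funTS (mnk1 x)) mWE (fun y _ => nk0 x y) W0 (W0 x Hx)) _.
    by rewrite nH (addeC IW).
  - exact: emeasurable_funM.
  - by move=> y Hy; rewrite mule_ge0 ?g0// lee_fin ltW.
  - by move=> y; rewrite HE => y0; rewrite energy_kernel_shift// EFinD.
have mq : measurable_fun H (fun x => (\int[m]_y nk th x y + (IW + (W x)%:E))%E).
  by apply: emeasurable_funD; [exact: measurable_funTS|exact: emeasurable_funD].
have q0 x : H x -> (0 <= \int[m]_y nk th x y + (IW + (W x)%:E))%E.
  by move=> Hx; apply: adde_ge0 => //; apply: adde_ge0 => //; exact: W0.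
apply: etrans (@integral_shift_below R m H _ Q K mH m1 _ _ K0 inner) _.
- exact: emeasurable_funM.
- by move=> y Hy; apply: mule_ge0; [rewrite lee_fin ltW|exact: q0].
apply: etrans (ge0_integralZl_EFin _ mH q0 mq (ltW hp)) _; congr (_ * _)%E.
apply: etrans (@integral_add_cst R m H (fun x => \int[m]_y nk th x y)%E (fun y => (W y)%:E) IW mH m1
  (measurable_funTS mN) mWE (fun x _ => N0 x) W0 IW0) _.
congr (_ + _)%E; exact/esym/(integral_fullT mH m1 mN N0).
Qed.

Lemma nk_energy_sqr (m n : probability R R) :
  (bilin (nk th) m n + bilin (nk th) m n +
   \int[lebR]_w ((eleft_mean gmap m w - eleft_mean gmap n w) ^+ 2)%:E <=
   bilin (nk th) m m + bilin (nk th) n n)%E.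
Proof.
have k10 (z : R * R) : (0 <= logk gmap z.1 z.2)%E by apply: logk_ge0; exact: gmap01.
have k20 (z : R * R) : (0 <= logk (gmapth th) z.1 z.2)%E by apply: logk_ge0; exact: gmapth01.
have nD (a b : probability R R) : (bilin (nk th) a b = bilin (logk gmap) a b + bilin (logk (gmapth th)) a b)%E.
  exact: (bilinD a b k10 k20 (measurable_logk measurable_gmap) (measurable_logk (measurable_gmapth th))).
have h1 := neglog_energy_sqr gmap01 measurable_gmap m n.
have h2 := neglog_energy_sqr (gmapth01 th) (measurable_gmapth th) m n.
rewrite !nD; set S := (\int[lebR]_w _)%E in h1 *.
set S' := (\int[lebR]_w _)%E in h2.
have S'0 : (0 <= S')%E by apply: integral_ge0 => x _; rewrite lee_fin sqr_ge0.
have h3 := le_trans (leeDl _ S'0) h2.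
have := leeD h1 h3; clear h1 h2 h3; clearbody S; move: (bilin (logk gmap) m n) (bilin (logk (gmapth th)) m n) (bilin (logk gmap) m m)
  (bilin (logk (gmapth th)) m m) (bilin (logk gmap) n n) (bilin (logk (gmapth th)) n n).
move=> a b A1 B1 A2 B2.
by rewrite (addeAC (a + a)%E) (addeACA a a) (addeACA A1 A2).
Qed.

(** The Euler-Lagrange conditions are established for [x > 0] only, so the comparison needs that 0
    carries no mass; an atom would have infinite self-energy. *)
Lemma atom0_null (m : probability R R) : (bilin (nk th) m m < +oo)%E -> m [set 0%R] = 0%E.
Proof.
move=> nf; apply/eqP; rewrite eq_le measure_ge0 andbT leNgt; apply/negP => m0.
move: nf; rewrite ltNge => /negP; apply; rewrite leye_eq; apply/eqP.
have ms : measurable [set (0 : R)] by exact: measurable_set1.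
have s0 : (\int[m]_(y in [set 0%R]) nk th 0%R y = +oo)%E.
  transitivity (\int[m]_(y in [set 0%R]) cst +oo y)%E.
    by apply: eq_integral => y; rewrite inE/= => ->; rewrite nk_diag.
  by rewrite integral_cst// gt0_mulye.
have N0 : (\int[m]_y nk th 0%R y = +oo)%E.
  apply/eqP; rewrite -leye_eq -s0; exact: ge0_subset_integral.
have mN : measurable_fun [set: R] (fun x => \int[m]_y nk th x y)%E.
  exact: (@measurable_integral_set _ _ R R R m setT setT (fun z => nk th z.1 z.2)
    measurableT measurableT (measurable_nk th) (fun z => nk0 z.1 z.2)).
apply/eqP; rewrite -leye_eq.
have <- : (\int[m]_(x in [set 0%R]) \int[m]_y nk th x y = +oo)%E.
  transitivity (\int[m]_(y in [set 0%R]) cst +oo y)%E.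
    by apply: eq_integral => y; rewrite inE/= => ->; rewrite N0.
  by rewrite integral_cst// gt0_mulye.
apply: ge0_subset_integral => //.
by move=> x _; exact: integral_ge0.
Qed.

Variable c : R.
Hypothesis c0 : 0 < c.
Hypothesis Mc : Mf th U c = pi%:E.
Let nu' := nu th1 w_ge0 mw integral_w c0 Mc.
Let L2 : R := Lc th w c + V 0 + K.

Let N (x : R) : \bar R := (\int[nu']_y nk th x y)%E.
Let mN : measurable_fun [set: R] N.
Proof.
exact: (@measurable_integral_set _ _ R R R nu' setT setT (fun z => nk th z.1 z.2)
  measurableT measurableT (measurable_nk th) (fun z => nk0 z.1 z.2)).
Qed.
Let N0 x : (0 <= N x)%E. Proof. exact: integral_ge0. Qed.

Let N_ge (x : R) : 0 < x -> (L2%:E <= N x + (W x)%:E)%E.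
Proof.
move=> x0.
have h := euler_lagrange_ge th1 w_ge0 mw w_bounded integral_w integral_w_ln c0 Mc x0.
have := leeD h (lexx (W x)%:E); rewrite -EFinD; apply: le_trans.
by rewrite lee_fin /W /L2; lra.
Qed.

Let N_eq (x : R) : 0 < x < c * Bx th -> (N x + (W x)%:E = L2%:E)%E.
Proof.
move=> /andP[x0 xB].
have h := euler_lagrange_eq th1 w_ge0 mw w_bounded integral_w integral_w_ln c0 Mc x0 (ltW xB).
by rewrite /N /nu' h -EFinD; congr EFin; rewrite /W /L2; ring.
Qed.

Local Notation I := `]0%R, (c * Bx th)%R[%classic.
Let IH : I `<=` H.
Proof. by move=> x; rewrite HE /= in_itv/= => /andP[x0 _]; exact: ltW. Qed.
Let I1 : nu' I = 1%E. Proof. exact: nu_supp. Qed.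

Lemma nu_on_halfline : on_halfline nu'.
Proof.
apply/eqP; rewrite eq_le (probability_le1 nu' mH)/= -I1; apply: le_measure => //; rewrite inE//.
Qed.

Let W0 x : H x -> (0 <= (W x)%:E)%E. Proof. by rewrite HE lee_fin => /HK. Qed.
Let mWE : measurable_fun H (EFin \o W). Proof. exact/measurable_EFinP. Qed.

(** The equality case of the Euler-Lagrange conditions, integrated against [nu] itself; in
    particular its energy is finite. *)
Lemma nu_balance : (bilin (nk th) nu' nu' + \int[nu']_(x in H) (W x)%:E = L2%:E)%E.
Proof.
rewrite (integral_full (measurable_itv _) mH IH I1 mWE W0).
rewrite (_ : bilin _ _ _ = (\int[nu']_(x in I) N x)%E); last first.
  exact: (integral_fullT (measurable_itv _) I1 mN N0).
rewrite -ge0_integralD//; last 3 first.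
- exact: measurable_funTS.
- by move=> x /IH; exact: W0.
- exact: measurable_funS mWE.
transitivity (\int[nu']_(x in I) (cst L2%:E x))%E.
  by apply: eq_integral => x; rewrite inE/= in_itv/= => hx; rewrite N_eq.
by rewrite integral_cst// [X in (_ * X)%E]I1 mule1.
Qed.

Lemma equilibrium_unique (mu : probability R R) : is_equilibrium_measure th V mu ->
  forall A, measurable A -> mu A = nu' A.
Proof.
move=> [mu1 mumin].
have En := nu_balance.
have Wnu0 : (0 <= \int[nu']_(x in H) (W x)%:E)%E by exact: integral_ge0.
have Wmu0 : (0 <= \int[mu]_(x in H) (W x)%:E)%E by exact: integral_ge0.
have b0 (a b : probability R R) : (0 <= bilin (nk th) a b)%E.
  by apply: integral_ge0 => x _; exact: integral_ge0.
have Emin : (bilin (nk th) mu mu + (\int[mu]_(x in H) (W x)%:E + \int[mu]_(x in H) (W x)%:E) <=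
    bilin (nk th) nu' nu' + (\int[nu']_(x in H) (W x)%:E + \int[nu']_(x in H) (W x)%:E))%E.
  have h := leeD (mumin nu' nu_on_halfline) (lexx K%:E).
  have := le_eq2 (esym (energy_shift mu1)) (esym (energy_shift nu_on_halfline)) h.
  by rewrite lee_pmul2l// lte_fin invr_gt0.
have nf : (bilin (nk th) mu mu < +oo)%E.
  move: Emin En Wnu0 Wmu0 (b0 mu mu); move: (bilin _ _ _) (bilin _ _ _).
  move: (\int[mu]_(x in H) (W x)%:E)%E (\int[nu']_(x in H) (W x)%:E)%E => a b n1 n2.
  by case: n2 => [n2| |]; case: b => [b| |]//; case: n1 => [n1| |]//; case: a => [a| |]//; rewrite ltry.
have P1 : mu `]0, +oo[%classic = 1%E.
  have z0 := atom0_null nf.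
  have : mu H = (mu [set 0%R] + mu `]0%R, +oo[%classic)%E.
    rewrite -measureU//; last first.
      by apply/seteqP; split=> // x [/= ->]; rewrite in_itv/= ltxx.
    congr (mu _); apply/seteqP; split=> x.
      rewrite HE le_eqVlt => /predU1P[<-|x0]; first by left.
      by right; rewrite /= in_itv/= x0.
    by rewrite HE; case=> [->//|]; rewrite /= in_itv/= andbT; exact: ltW.
  by rewrite mu1 z0 add0e => <-.
have Pm : `]0%R, +oo[%classic `<=` H by move=> x; rewrite HE /= in_itv/= andbT; exact: ltW.
have L20 : 0 <= L2 by rewrite -lee_fin -En adde_ge0.
have Ege : (L2%:E <= bilin (nk th) mu nu' + \int[mu]_(x in H) (W x)%:E)%E.
  rewrite (integral_full (measurable_itv _) mH Pm P1 mWE W0).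
  rewrite (_ : bilin _ _ _ = (\int[mu]_(x in `]0%R, +oo[) N x)%E); last first.
    exact: (integral_fullT (measurable_itv _) P1 mN N0).
  rewrite -ge0_integralD//; last 3 first.
  - exact: measurable_funTS.
  - by move=> x /Pm; exact: W0.
  - exact: measurable_funS mWE.
  have <- : (\int[mu]_(x in `]0%R, +oo[) (cst L2%:E x) = L2%:E)%E.
    by rewrite integral_cst// [X in (_ * X)%E]P1 mule1.
  apply: ge0_le_integral => //.
  - by apply: emeasurable_funD; [exact: measurable_funTS|exact: measurable_funS mWE].
  - by move=> x; rewrite /= in_itv/= andbT => x0; exact: N_ge.
have S0 : (0 <= \int[lebR]_w ((eleft_mean gmap mu w - eleft_mean gmap nu' w) ^+ 2)%:E)%E.
  by apply: integral_ge0 => x _; rewrite lee_fin sqr_ge0.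
have S1 := sqr_zero_of_energy (b0 mu mu) (b0 nu' nu') (b0 mu nu') S0 Wmu0 Wnu0 (nk_energy_sqr mu nu') Emin En Ege.
(* [neglog_energy_eq] yields one inequality between the tails; exchanging the two measures yields
   the other. *)
have S2 : (\int[lebR]_w ((eleft_mean gmap nu' w - eleft_mean gmap mu w) ^+ 2)%:E <= 0)%E.
  by under eq_integral do rewrite -sqrrN opprB.
(* Rays are level sets of [gmap], so equality of the tails at all levels in [[0, 1[] determines the
   measures on the half-line. *)
have upE (t : R) : 0 <= t -> `]t, +oo[%classic = upper gmap (t / (1 + t)).
  move=> t0; have t1 : 0 < 1 + t by lra.
  apply/seteqP; split=> x; rewrite /upper /gmap /= in_itv/= andbT.
    move=> tx; have x0 : 0 <= x by lra.
    by rewrite x0 ltr_pdivrMr// mulrAC ltr_pdivlMr; lra.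
  case: ifPn => [x0|_]; first by rewrite ltr_pdivrMr// mulrAC ltr_pdivlMr; lra.
  by rewrite ltNge divr_ge0// ltW.
apply: prob_eq_rays => t; have [t0|t0] := leP 0 t.
  have r1 : 0 <= t / (1 + t) < 1.
    by rewrite divr_ge0//= ?ltr_pdivrMr; lra.
  rewrite upE//; apply/eqP; rewrite eq_le; apply/andP; split.
    exact: (neglog_energy_eq measurable_gmap S1 r1).
  exact: (neglog_energy_eq measurable_gmap S2 r1).
have one (m : probability R R) : on_halfline m -> m `]t, +oo[%classic = 1%E.
  move=> m1; apply/eqP; rewrite eq_le (probability_le1 m (measurable_itv _))/= -m1.
  apply: le_measure; rewrite ?inE//.
  by move=> x; rewrite HE /= in_itv/= andbT; exact: lt_le_trans.
by rewrite !one//; exact: nu_on_halfline.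
Qed.

End shifted.
End comparison.

(** * Endpoint, support and density of the equilibrium measure *)

Lemma mint_mfun (R : realType) (th : R) (V1 : R -> R) (c : R) : 0 < th -> 0 < c ->
  measurable_fun [set: R] (Uf V1) -> (forall y, 0 <= Uf V1 y) ->
  mint th V1 c = mfun th (Uf V1) c.
Proof.
move=> th0 c0 mU U0; rewrite /mint /mfun /Mf; congr fine.
rewrite (@integral_Xf R th th0 c (fun x => (Uf V1 x)%:E))//; last exact/measurable_EFinP.
apply: eq_integral => x; rewrite inE/= in_itv/= => /andP[x0 _].
by rewrite -EFinM; congr EFin; rewrite /Uf x0; field; rewrite lt0r_neq0.
Qed.

Lemma support_of_density (R : realType) (m : probability R R) (b : R) : 0 < b ->
  (forall a1 a2 : R, 0 <= a1 -> a1 < a2 -> a2 <= b -> (0 < m `]a1, a2[%classic)%E) ->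
  m `]0, b[%classic = 1%E -> measure_support m = `[0, b]%classic.
Proof.
move=> b0 pos m1; have mI : measurable `]0, b[%classic by exact: measurable_itv.
have out (x e : R) : 0 < e -> `]0, b[%classic `<=` ~` ball x e -> ~ (0 < m (ball x e))%E.
  move=> e0 sub; apply/negP; rewrite -leNgt.
  have -> : 0%E = m (~` `]0, b[%classic) by rewrite [RHS](probability_setC m mI) m1 subee.
  apply: le_measure; rewrite ?inE; [exact: measurable_ball|exact: measurableC|].
  by move=> y ye /sub.
apply/seteqP; split=> x /=; rewrite in_itv/=.
  move=> H; apply/andP; split; rewrite leNgt; apply/negP => hx.
    apply: (@out x (- x)); [lra| |apply: H; lra].
    by move=> y; rewrite ball_itv /= !in_itv/= => /andP[y0 _] /andP[_ h]; lra.
  apply: (@out x (x - b)); [lra| |apply: H; lra].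
  by move=> y; rewrite ball_itv /= !in_itv/= => /andP[_ yb] /andP[h _]; lra.
move=> /andP[x0 xb] e e0.
have h1 : Num.max 0 (x - e) < Num.min b (x + e).
  by rewrite lt_min !gt_max; apply/andP; split; apply/andP; split; lra.
have h0 : 0 <= Num.max 0 (x - e) by rewrite le_max lexx.
have hb : Num.min b (x + e) <= b by rewrite ge_min lexx.
apply: (lt_le_trans (pos _ _ h0 h1 hb)).
apply: le_measure; rewrite ?inE; [exact: measurable_itv|exact: measurable_ball|].
by move=> y; rewrite ball_itv /= !in_itv/= gt_max lt_min => /andP[/andP[_ ->] /andP[_ ->]].
Qed.

Theorem theorem1p4 (R : realType) (theta : R) (V V1 V2 : R -> R) :
  1 < theta ->
  (* V is C^2 on [0,+oo): V' = V1, V'' = V2 on (0,+oo), continuous up to 0 *)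
  (forall x : R, 0 < x -> is_derive x 1 V (V1 x)) ->
  (forall x : R, 0 < x -> is_derive x 1 V1 (V2 x)) ->
  {within `[0, +oo[, continuous V} ->
  {within `[0, +oo[, continuous V1} ->
  {within `[0, +oo[, continuous V2} ->
  (V x / ln x @[x --> +oo] --> +oo) ->
  (forall x : R, 0 < x -> 0 < V2 x * x + V1 x) ->
  (forall x : R, 0 < x -> 0 <= V2 x) ->
  forall mu : probability R R, is_equilibrium_measure theta V mu ->
  exists c : R,
    [/\ 0 < c,
        Econtour theta V1 c = (1 + theta)%:C,
        (forall c' : R, 0 < c' -> Econtour theta V1 c' = (1 + theta)%:C -> c' = c),
        measure_support mu = `[0, bc theta c]%classic &
        (forall A : set R, measurable A ->
           mu A = (\int[lebesgue_measure]_(x in A `&` `]0%R, bc theta c[%classic)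
                     (psi theta c V1 V2 x)%:E)%E)].
Proof.
move=> th1 dV dV1 cV cV1 cV2 limV wpos _ mu mueq.
have th0 : 0 < theta by exact: lt_trans th1.
pose w := wf V1 V2; pose U := Uf V1.
have w_ge0 y : 0 <= w y by exact: wf_ge0.
have w_gt0 y : 0 < y -> 0 < w y by exact: wf_gt0.
have mw : measurable_fun [set: R] w by exact: (measurable_wf dV1 cV2).
have w_bd (b : R) : 0 < b -> exists2 W : R, 0 < W & forall x : R, 0 < x <= b -> w x <= W.
  exact: (wf_bounded dV1 cV1 cV2).
have U_ge0 y : 0 <= U y by exact: (Uf_ge0 dV1 cV1 cV2 wpos).
have U_incr (x y : R) : 0 < x -> x < y -> U x < U y by exact: (Uf_incr dV1 wpos).
have mU : measurable_fun [set: R] U by exact: (measurable_Uf dV1).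
have iw := integral_wf dV1 cV1 cV2 wpos.
have U_lip (W b : R) : (forall x : R, 0 < x <= b -> w x <= W) ->
    forall x y : R, 0 < x -> x <= y -> y <= b -> U y - U x <= W * (y - x).
  exact: (Uf_lip dV1).
have U_unb (A : R) : exists2 y : R, 0 < y & A <= U y.
  exact: (Uf_unbounded dV dV1 cV1 cV2 limV wpos).
have iwl := integral_wf_ln dV dV1 cV cV1 cV2 wpos.
(* By [EcE] below, the contour equation at [c'] says that [mfun theta U c'] equals [pi]; existence
   is [mfun_onto], and uniqueness comes from strict monotonicity. *)
have [c c0 mc] := mfun_onto th0 w_ge0 mw U_ge0 U_incr mU iw w_bd U_lip U_unb (pi_gt0 R).
have Mc : Mf theta U c = pi%:E by rewrite (MfE th0 U_ge0 U_incr mU c0) mc.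
have [K K0 HK] := potential_dominates_tau th1 w_ge0 iwl limV.
have munu := equilibrium_unique th1 w_ge0 mw w_bd iw iwl cV K0 HK c0 Mc mueq.
have EcE (c' : R) : 0 < c' -> Econtour theta V1 c' = ((1 + theta) * (mfun theta U c' / pi))%:C.
  move=> c'0; rewrite (Econtour_mint th1 (fun x => @V1_continuous R V1 V2 dV1 x)
    (fun x x0 => ltW (V1_gt0 dV1 cV1 cV2 wpos x0)) c'0).
  by rewrite (mint_mfun th0 c'0 mU U_ge0).
have pin : pi != 0 :> R by rewrite lt0r_neq0// pi_gt0.
have bE := bcE theta c.
exists c; split=> //.
- by rewrite EcE// mc divff// mulr1.
- move=> c' c'0; rewrite EcE// => /(congr1 (@complex.Re R)) /= E.
  have m' : mfun theta U c' = pi.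
    have t0 : 1 + theta != 0 by rewrite lt0r_neq0//; lra.
    have : mfun theta U c' / pi = 1 by apply: (mulfI t0); rewrite mulr1.
    by move/(congr1 (fun z => z * pi)); rewrite divfK// mul1r.
  have incr := mfun_incr th0 U_ge0 U_incr mU.
  by case: (ltgtP c' c) => // [/(incr _ _ c'0)|/(incr _ _ c0)]; rewrite m' mc ltxx.
- rewrite bE; apply: support_of_density; first by rewrite mulr_gt0// Bx_gt0.
    move=> a1 a2 h1 h2 h3; rewrite munu//.
    exact: (nu_oo_gt0 th1 w_ge0 w_gt0 mw iw c0 Mc h1 h2 h3).
  by rewrite munu//; exact: nu_supp.
- move=> A mA; rewrite munu//.
  by apply: nu_psi => // y y0; rewrite /w /wf y0.
Qed.
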